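(* Let $C$ be an irreducible trigonal curve in a Hirzebruch surface $\Sigma_d$ and let $Q$ be an abelian group. If $C$ admits a $\mathbb D(Q)$-covering, then $Q$ is a quotient of $\mathbb Z_3\oplus\mathbb Z_3$, $\mathbb Z_9$, $\mathbb Z_5\oplus\mathbb Z_5$, or $\mathbb Z_7$.
   Context: All varieties are over $\mathbb C$; $\mathbb Z_n=\mathbb Z/n\mathbb Z$. $\Sigma_d$ ($d\ge 0$) is the Hirzebruch surface: the geometrically ruled rational surface $\Sigma_d\to\mathbb P^1$ with an exceptional section $E$, $E^2=-d$. A trigonal curve is a reduced curve $C\subset\Sigma_d$ disjoint from $E$ and intersecting each fiber of the ruling at three points counted with multiplicity (i.e. $C\in|3E+3dF|$, $F$ a fiber). The projective fundamental group of $C$ is $\pi^{\mathrm{proj}}_C:=\pi_1(\Sigma_d\smallsetminus(C\cup E))$. For an abelian group $Q$, $\mathbb D(Q)=Q\rtimes\mathbb Z_2$ is the (generalized) dihedral group, with the generator of $\mathbb Z_2$ acting on $Q$ by $-\mathrm{id}$. A $\mathbb D(Q)$-covering of $C$ is a (connected) Galois covering of $\Sigma_d$ with group $\mathbb D(Q)$ ramified at $C\cup E$ only; equivalently, an epimorphism $\pi^{\mathrm{proj}}_C\to\mathbb D(Q)$. *)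

(* Defs.v *)
(* The complex numbers are R[i] for an arbitrary R : realType. *)
From HB Require Import structures.
From mathcomp Require Import all_boot all_order all_algebra.
From mathcomp Require Import complex ring lra.
From mathcomp Require Import generic_quotient.
From mathcomp Require Import all_classical all_reals topology normedtype homotopy.
(* the notations of mpoly clash with those of topology *)
From mathcomp Require Import -(notations) mpoly.

Set Implicit Arguments.
Unset Strict Implicit.
Unset Printing Implicit Defensive.

Import Order.TTheory GRing.Theory Num.Theory.
Import numFieldNormedType.Exports.
Local Open Scope classical_set_scope.
Local Open Scope ring_scope.
Local Open Scope quotient_scope.

Section UnitInterval.
Context {R : realType}.

Definition unitI (R : realType) : Type := `[0 : R, 1]%classic.
HB.instance Definition _ := Topological.on (unitI R).

Lemma clamp_subproof (r : R) : Order.max 0 (Order.min r 1) \in `[0 : R, 1]%classic.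
Proof.
by rewrite inE /= in_itv /= le_max lexx ge_max ler01 ge_min lexx orbT.
Qed.

(* the retraction of the real line onto [0, 1] *)
Definition clamp (r : R) : unitI R := SigSub (clamp_subproof r).
Definition ival (t : unitI R) : R := \val t.

Lemma ival_clamp r : ival (clamp r) = Order.max 0 (Order.min r 1).
Proof. by []. Qed.

Lemma ival01 (t : unitI R) : 0 <= ival t <= 1.
Proof. by have := valP t; rewrite inE /= in_itv. Qed.

Lemma ival_inj : injective ival.
Proof. exact: val_inj. Qed.

Lemma clampK (t : unitI R) : clamp (ival t) = t.
Proof.
apply: ival_inj; rewrite ival_clamp.
by have /andP[t0 t1] := ival01 t; rewrite min_l // max_r.
Qed.

Lemma clamp_le0 (r : R) : r <= 0 -> clamp r = clamp 0.
Proof.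
move=> r0; apply: ival_inj; rewrite !ival_clamp.
by rewrite [Order.min r 1]min_l ?(le_trans r0) // max_l // min_l // max_l.
Qed.

Lemma clamp_ge1 (r : R) : 1 <= r -> clamp r = clamp 1.
Proof.
by move=> r1; apply: ival_inj; rewrite !ival_clamp [Order.min r 1]min_r // minxx.
Qed.

Lemma unitI_neq : clamp 0 != clamp 1.
Proof.
apply/eqP => /(congr1 ival); rewrite !ival_clamp minxx.
rewrite min_l ?ler01 // maxxx max_r ?ler01 // => /eqP.
by rewrite eq_sym oner_eq0.
Qed.

HB.instance Definition _ := @isBiPointed.Build (unitI R) (clamp 0) (clamp 1) unitI_neq.

Lemma ival0 : ival zero = 0.
Proof. by rewrite ival_clamp min_l ?ler01 // maxxx. Qed.

Lemma ival1 : ival one = 1.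
Proof. by rewrite ival_clamp minxx max_r ?ler01. Qed.

Lemma ival_continuous : continuous ival.
Proof. exact: initial_continuous. Qed.

Lemma clamp_continuous : continuous clamp.
Proof.
apply: continuous_comp_initial => r.
apply: (@continuous_max _ R (cst 0) (fun r => Order.min r 1)).
  exact: cvg_cst.
by apply: (@continuous_min _ R id (cst 1)); [exact: cvg_id|exact: cvg_cst].
Qed.

End UnitInterval.

Section ContinuityTop.
Context {A B C : topologicalType}.

Lemma cont_comp (f : A -> B) (g : B -> C) :
  continuous f -> continuous g -> continuous (fun z => g (f z)).
Proof. by move=> fc gc z; apply: continuous_comp; [exact: fc|exact: gc]. Qed.

Lemma cont_fst : continuous (fun z : A * B => z.1).
Proof. by move=> z; exact: cvg_fst. Qed.

Lemma cont_snd : continuous (fun z : A * B => z.2).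
Proof. by move=> z; exact: cvg_snd. Qed.

Lemma cont_pair (f : A -> B) (g : A -> C) :
  continuous f -> continuous g -> continuous (fun z => (f z, g z)).
Proof. by move=> fc gc z; apply: cvg_pair; [exact: fc|exact: gc]. Qed.

Lemma cont_cst (c : B) : continuous (fun _ : A => c).
Proof. by move=> z; exact: cvg_cst. Qed.

End ContinuityTop.

Section Continuity.
Context {R : realType} {S : topologicalType}.
Implicit Types f g h : S -> R.

Lemma mul2_continuous f : continuous f -> continuous (fun s => 2 * f s).
Proof. by move=> fc s; apply: cvgM; [exact: cvg_cst|exact: fc]. Qed.

Lemma mul2B1_continuous f : continuous f -> continuous (fun s => 2 * f s - 1).
Proof.
by move=> fc s; apply: cvgB; [exact: mul2_continuous|exact: cvg_cst].
Qed.

Lemma oneB_continuous f : continuous f -> continuous (fun s => 1 - f s).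
Proof. by move=> fc s; apply: cvgB; [exact: cvg_cst|exact: fc]. Qed.

Lemma lerp_continuous h f g : continuous h -> continuous f -> continuous g ->
  continuous (fun s => (1 - h s) * f s + h s * g s).
Proof.
move=> hc fc gc s; apply: cvgD; apply: cvgM;
  [exact: oneB_continuous|exact: fc|exact: hc|exact: gc].
Qed.

End Continuity.

Section Pasting.
Context {R : realType} {S T : topologicalType}.

Lemma paste_continuous (h : S -> R) (c : R) (f g : S -> T) :
  continuous h -> continuous f -> continuous g ->
  (forall s, h s = c -> f s = g s) ->
  continuous (fun s => if h s <= c then f s else g s).
Proof.
move=> hc fc gc fg s U /=; rewrite nbhs_simpl /=.
case: (ltgtP (h s) c) => [lt_hc|lt_ch|eq_hc] nU.
- have near_lt : \forall z \near s, h z < c.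
    by apply: (hc s [set y | y < c]); exact: lt_nbhsl.
  apply: filterS2 near_lt (fc s U nU) => z hz Uz.
  by rewrite /= (ltW hz).
- have near_gt : \forall z \near s, c < h z.
    by apply: (hc s [set y | c < y]); apply: open_nbhs_nbhs; split; [exact: open_gt|].
  apply: filterS2 near_gt (gc s U nU) => z hz Uz.
  by rewrite /= leNgt hz.
- have fU : nbhs s (f @^-1` U) := fc s U nU.
  have gU : nbhs s (g @^-1` U) by apply: (gc s U); rewrite -fg.
  by apply: filterS (filterI fU gU) => z [Uz Vz] /=; case: ifP.
Qed.

End Pasting.

Section FundamentalGroup.
Context {R : realType} {X : topologicalType} {x : X}.
Local Notation I := (unitI R).
Local Notation loop := {path I from x to x in X}.
Implicit Types p q r : loop.

(* homotopy of loops, relative to the base point *)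
Definition homotopic p q : Prop :=
  exists H : I * I -> X,
    [/\ continuous H,
        forall t, H (zero, t) = p t,
        forall t, H (one, t) = q t,
        forall s, H (s, zero) = x &
        forall s, H (s, one) = x].

(* the extension of p to the real line, constant outside [0, 1] *)
Definition ext p (r : R) : X := p (clamp r).

Lemma ext_le0 p (r : R) : r <= 0 -> ext p r = x.
Proof. by move=> r0; rewrite /ext clamp_le0 // (@path_zero _ _ _ _ p). Qed.

Lemma ext_ge1 p (r : R) : 1 <= r -> ext p r = x.
Proof. by move=> r1; rewrite /ext clamp_ge1 // (@path_one _ _ _ _ p). Qed.

Lemma ext_continuous p : continuous (ext p).
Proof.
exact: cont_comp clamp_continuous (@cts_fun _ _ p).
Qed.

Lemma ext_comp_continuous (S : topologicalType) p (f : S -> R) :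
  continuous f -> continuous (fun s => ext p (f s)).
Proof.
by move=> fc; exact: cont_comp fc (@ext_continuous p).
Qed.

Definition cat_fun p q (t : I) : X :=
  if ival t <= 2^-1 then p (clamp (2 * ival t)) else q (clamp (2 * ival t - 1)).

Definition rev_fun p (t : I) : X := p (clamp (1 - ival t)).

Lemma cat_fun_continuous p q : continuous (cat_fun p q).
Proof.
apply: (@paste_continuous R I X ival 2^-1 (fun t => ext p (2 * ival t))
  (fun t => ext q (2 * ival t - 1))).
- exact: ival_continuous.
- by apply: ext_comp_continuous; apply: mul2_continuous; exact: ival_continuous.
- by apply: ext_comp_continuous; apply: mul2B1_continuous; exact: ival_continuous.
- by move=> t ->; rewrite ext_ge1 ?ext_le0 //; lra.
Qed.

Lemma cat_fun0 p q : cat_fun p q zero = x.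
Proof. by rewrite /cat_fun ival0 ifT ?mulr0 ?(@path_zero _ _ _ _ p) //; lra. Qed.

Lemma cat_fun1 p q : cat_fun p q one = x.
Proof.
rewrite /cat_fun ival1 ifF; last by apply/negP; lra.
by rewrite -/(ext q _) ext_ge1 //; lra.
Qed.

Lemma rev_fun_continuous p : continuous (rev_fun p).
Proof.
by apply: ext_comp_continuous; apply: oneB_continuous; exact: ival_continuous.
Qed.

Lemma rev_fun0 p : rev_fun p zero = x.
Proof. by rewrite /rev_fun ival0 -/(ext p _) ext_ge1 //; lra. Qed.

Lemma rev_fun1 p : rev_fun p one = x.
Proof. by rewrite /rev_fun ival1 -/(ext p _) ext_le0 //; lra. Qed.

Definition loop_cat p q : loop :=
  mk_path (@cat_fun_continuous p q) (cat_fun0 p q) (cat_fun1 p q).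
Definition loop_rev p : loop :=
  mk_path (@rev_fun_continuous p) (rev_fun0 p) (rev_fun1 p).
Definition loop_one : loop := cst x.

Lemma ext_ival p t : ext p (ival t) = p t.
Proof. by rewrite /ext clampK. Qed.

Lemma ext_cat p q (r : R) :
  ext (loop_cat p q) r = if r <= 2^-1 then ext p (2 * r) else ext q (2 * r - 1).
Proof.
rewrite {1}/ext /= /mk_path /= /cat_fun.
case: (leP r 0) => r0.
  rewrite clamp_le0 // (_ : ival (clamp 0) = 0); last exact: ival0.
  rewrite !ifT; [|lra|lra].
  by rewrite -/(ext p _) !ext_le0 //; lra.
case: (leP 1 r) => r1.
  rewrite clamp_ge1 // (_ : ival (clamp 1) = 1); last exact: ival1.
  rewrite !ifF; [|apply/negP; lra|apply/negP; lra].
  by rewrite -/(ext q _) !ext_ge1 //; lra.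
by rewrite ival_clamp min_l ?(ltW r1) // max_r ?(ltW r0).
Qed.

Lemma ext_rev p (r : R) : ext (loop_rev p) r = ext p (1 - r).
Proof.
rewrite {1}/ext /= /mk_path /= /rev_fun -/(ext p _).
case: (leP r 0) => r0.
  rewrite clamp_le0 // (_ : ival (clamp 0) = 0); last exact: ival0.
  by rewrite !ext_ge1 //; lra.
case: (leP 1 r) => r1.
  rewrite clamp_ge1 // (_ : ival (clamp 1) = 1); last exact: ival1.
  by rewrite !ext_le0 //; lra.
by rewrite ival_clamp min_l ?(ltW r1) // max_r ?(ltW r0).
Qed.

Lemma ext_one (r : R) : ext loop_one r = x.
Proof. by []. Qed.

Lemma fst_continuous : continuous (fun z : I * I => ival z.1).
Proof. exact: (@cont_comp (I * I)%type I R fst ival cont_fst ival_continuous). Qed.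

Lemma snd_continuous : continuous (fun z : I * I => ival z.2).
Proof. exact: (@cont_comp (I * I)%type I R snd ival cont_snd ival_continuous). Qed.

Lemma comp2_continuous (H : I * I -> X) (f g : I * I -> I) :
  continuous H -> continuous f -> continuous g ->
  continuous (fun z => H (f z, g z)).
Proof.
by move=> Hc fc gc; exact: (cont_comp (cont_pair fc gc) Hc).
Qed.

Lemma clamp_comp_continuous (f : I * I -> R) :
  continuous f -> continuous (fun z => clamp (f z)).
Proof.
by move=> fc; exact: cont_comp fc clamp_continuous.
Qed.

Lemma homotopic_refl p : homotopic p p.
Proof.
exists (fun z => p z.2); split => //= *; rewrite ?path_zero ?path_one //.
exact: (@cont_comp (I * I)%type I X snd p cont_snd (@cts_fun _ _ p)).
Qed.

Lemma homotopic_sym p q : homotopic p q -> homotopic q p.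
Proof.
move=> [H [Hc H0 H1 Hl Hr]]; exists (fun z => H (clamp (1 - ival z.1), z.2)).
split => //= [|t|t].
- apply: comp2_continuous => //; last exact: cont_snd.
  by apply: clamp_comp_continuous; apply: oneB_continuous; exact: fst_continuous.
- by rewrite ival0 subr0 H1.
- by rewrite ival1 subrr H0.
Qed.

Lemma homotopic_trans p q r : homotopic p q -> homotopic q r -> homotopic p r.
Proof.
move=> [H [Hc H0 H1 Hl Hr]] [K [Kc K0 K1 Kl Kr]].
exists (fun z => if ival z.1 <= 2^-1 then H (clamp (2 * ival z.1), z.2)
                 else K (clamp (2 * ival z.1 - 1), z.2)).
split => //= [|t|t|s|s].
- apply: (@paste_continuous R (I * I)%type X (fun z => ival z.1) 2^-1
    (fun z => H (clamp (2 * ival z.1), z.2))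
    (fun z => K (clamp (2 * ival z.1 - 1), z.2))).
  + exact: fst_continuous.
  + apply: comp2_continuous => //; last exact: cont_snd.
    by apply: clamp_comp_continuous; apply: mul2_continuous; exact: fst_continuous.
  + apply: comp2_continuous => //; last exact: cont_snd.
    by apply: clamp_comp_continuous; apply: mul2B1_continuous; exact: fst_continuous.
  + move=> z ->; rewrite (_ : 2 * 2^-1 = 1 :> R) ?subrr; last by lra.
    by rewrite H1 K0.
- by rewrite ival0 ifT ?mulr0 ?H0 //; lra.
- rewrite ival1 ifF; last by apply/negP; lra.
  by rewrite (_ : 2 * 1 - 1 = 1 :> R) ?K1 //; lra.
- by case: ifP.
- by case: ifP.
Qed.

Lemma homotopic_cat p p' q q' :
  homotopic p p' -> homotopic q q' ->
  homotopic (loop_cat p q) (loop_cat p' q').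
Proof.
move=> [H [Hc H0 H1 Hl Hr]] [K [Kc K0 K1 Kl Kr]].
exists (fun z => if ival z.2 <= 2^-1 then H (z.1, clamp (2 * ival z.2))
                 else K (z.1, clamp (2 * ival z.2 - 1))).
split => //= [|t|t|s|s].
- apply: (@paste_continuous R (I * I)%type X (fun z => ival z.2) 2^-1
    (fun z => H (z.1, clamp (2 * ival z.2)))
    (fun z => K (z.1, clamp (2 * ival z.2 - 1)))).
  + exact: snd_continuous.
  + apply: comp2_continuous => //; first exact: cont_fst.
    by apply: clamp_comp_continuous; apply: mul2_continuous; exact: snd_continuous.
  + apply: comp2_continuous => //; first exact: cont_fst.
    by apply: clamp_comp_continuous; apply: mul2B1_continuous; exact: snd_continuous.
  + move=> z ->; rewrite (_ : 2 * 2^-1 = 1 :> R) ?subrr; last by lra.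
    by rewrite Hr Kl.
- by rewrite H0 K0.
- by rewrite H1 K1.
- by rewrite ival0 ifT ?mulr0 ?Hl //; lra.
- rewrite ival1 ifF; last by apply/negP; lra.
  by rewrite (_ : 2 * 1 - 1 = 1 :> R) ?Kr //; lra.
Qed.

Lemma homotopic_rev p p' :
  homotopic p p' -> homotopic (loop_rev p) (loop_rev p').
Proof.
move=> [H [Hc H0 H1 Hl Hr]]; exists (fun z => H (z.1, clamp (1 - ival z.2))).
split => //= [|t|t|s|s].
- apply: comp2_continuous => //; first exact: cont_fst.
  by apply: clamp_comp_continuous; apply: oneB_continuous; exact: snd_continuous.
- by rewrite H0.
- by rewrite H1.
- by rewrite ival0 subr0 Hr.
- by rewrite ival1 subrr Hl.
Qed.

Lemma homotopic_reparam p q q' (f g : R -> R) :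
  continuous f -> continuous g -> f 0 = g 0 -> f 1 = g 1 ->
  (forall r : R, 0 <= r <= 1 -> ext q r = ext p (f r)) ->
  (forall r : R, 0 <= r <= 1 -> ext q' r = ext p (g r)) ->
  homotopic q q'.
Proof.
move=> fc gc fg0 fg1 qf qg.
exists (fun z => ext p ((1 - ival z.1) * f (ival z.2) + ival z.1 * g (ival z.2))).
have fE t : ext p (f (ival t)) = q t by rewrite -qf ?ival01 // ext_ival.
have gE t : ext p (g (ival t)) = q' t by rewrite -qg ?ival01 // ext_ival.
split => //= [|t|t|s|s].
- apply: ext_comp_continuous; apply: lerp_continuous.
  + exact: fst_continuous.
  + exact: (@cont_comp _ _ _ (fun z : I * I => ival z.2) f snd_continuous fc).
  + exact: (@cont_comp _ _ _ (fun z : I * I => ival z.2) g snd_continuous gc).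
- by rewrite ival0 subr0 mul1r mul0r addr0 fE.
- by rewrite ival1 subrr mul0r add0r mul1r gE.
- rewrite ival0 -fg0 (_ : _ + _ = f 0); last by ring.
  by rewrite -ival0 fE path_zero.
- rewrite ival1 -fg1 (_ : _ + _ = f 1); last by ring.
  by rewrite -ival1 fE path_one.
Qed.

Lemma affine_continuous (a b : R) : continuous (fun r : R => a * r + b).
Proof.
move=> r; apply: cvgD; last exact: cvg_cst.
by apply: cvgM; [exact: cvg_cst|exact: cvg_id].
Qed.

Lemma homotopic_catA p q r :
  homotopic (loop_cat p (loop_cat q r)) (loop_cat (loop_cat p q) r).
Proof.
apply: (@homotopic_reparam (loop_cat p (loop_cat q r)) _ _ (fun u => 1 * u + 0)
  ((fun u => 2 * u + 0) \min ((fun u => 1 * u + 4^-1) \min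
     (fun u => 2^-1 * u + 2^-1)))).
- exact: affine_continuous.
- move=> u; apply: continuous_min; first exact: affine_continuous.
  by apply: continuous_min; exact: affine_continuous.
- by rewrite /=; rewrite !minElt; repeat case: ifPn; lra.
- by rewrite /=; rewrite !minElt; repeat case: ifPn; lra.
- by move=> u _; rewrite mul1r addr0.
- move=> u /andP[u0 u1]; rewrite !ext_cat /=.
  case: (leP u 2^-1) => u2; last first.
    rewrite [Order.min (1 * u + _) _]min_r; last by lra.
    rewrite min_r; last by lra.
    rewrite ifF; last by apply/negP; lra.
    rewrite ifF; last by apply/negP; lra.
    by congr ext; lra.
  rewrite [Order.min (1 * u + _) _]min_l; last by lra.
  case: (leP u 4^-1) => u4.
    rewrite min_l; last by lra.
    rewrite ifT; last by lra.
    rewrite ifT; last by lra.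
    by congr ext; lra.
  rewrite min_r; last by lra.
  rewrite ifF; last by apply/negP; lra.
  rewrite ifF; last by apply/negP; lra.
  rewrite ifT; last by lra.
  by congr ext; lra.
Qed.

Lemma homotopic_cat1p p : homotopic (loop_cat loop_one p) p.
Proof.
apply: (@homotopic_reparam p _ _ ((fun u => 2 * u + (- 1)) \max (fun=> 0))
  (fun u => 1 * u + 0)).
- move=> u; apply: continuous_max; first exact: affine_continuous.
  exact: cvg_cst.
- exact: affine_continuous.
- by rewrite /= max_r //; lra.
- by rewrite /= max_l //; lra.
- move=> u _; rewrite ext_cat ext_one /=; case: (leP u 2^-1) => u2.
    by rewrite max_r ?ext_le0 //; lra.
  by rewrite max_l //; lra.
- by move=> u _; rewrite mul1r addr0.
Qed.

Lemma homotopic_catp1 p : homotopic (loop_cat p loop_one) p.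
Proof.
apply: (@homotopic_reparam p _ _ ((fun u => 2 * u + 0) \min (fun=> 1))
  (fun u => 1 * u + 0)).
- move=> u; apply: continuous_min; first exact: affine_continuous.
  exact: cvg_cst.
- exact: affine_continuous.
- by rewrite /= min_l //; lra.
- by rewrite /= min_r //; lra.
- move=> u _; rewrite ext_cat ext_one /=; case: (leP u 2^-1) => u2.
    by rewrite min_l ?addr0 //; lra.
  by rewrite min_r ?ext_ge1 //; lra.
- by move=> u _; rewrite mul1r addr0.
Qed.

Lemma homotopic_catVp p : homotopic (loop_cat (loop_rev p) p) loop_one.
Proof.
apply: (@homotopic_reparam p _ _
  ((fun u => - 2 * u + 1) \max (fun u => 2 * u + (- 1))) (fun=> 1)).
- by move=> u; apply: continuous_max; exact: affine_continuous.
- by move=> u; exact: cvg_cst.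
- by rewrite /= max_l //; lra.
- by rewrite /= max_r //; lra.
- move=> u _; rewrite ext_cat ext_rev /=; case: (leP u 2^-1) => u2.
    by rewrite max_l; [congr ext; lra|lra].
  by rewrite max_r //; lra.
- by move=> u _; rewrite ext_one ext_ge1.
Qed.

Lemma homotopic_catpV p : homotopic (loop_cat p (loop_rev p)) loop_one.
Proof.
apply: (@homotopic_reparam p _ _
  ((fun u => 2 * u + 0) \min (fun u => - 2 * u + 2)) (fun=> 0)).
- by move=> u; apply: continuous_min; exact: affine_continuous.
- by move=> u; exact: cvg_cst.
- by rewrite /= min_l //; lra.
- by rewrite /= min_r //; lra.
- move=> u _; rewrite ext_cat ext_rev /=; case: (leP u 2^-1) => u2.
    by rewrite min_l; [congr ext; lra|lra].
  by rewrite min_r; [congr ext; lra|lra].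
- by move=> u _; rewrite ext_one ext_le0.
Qed.

Definition homotopicb : rel loop := fun p q => `[< homotopic p q >].

Lemma homotopicb_refl : reflexive homotopicb.
Proof. by move=> p; apply/asboolP; exact: homotopic_refl. Qed.

Lemma homotopicb_sym : ssrbool.symmetric homotopicb.
Proof. by move=> p q; apply/asboolP/asboolP; exact: homotopic_sym. Qed.

Lemma homotopicb_trans : transitive homotopicb.
Proof.
move=> q p r /asboolP pq /asboolP qr; apply/asboolP.
exact: homotopic_trans pq qr.
Qed.

Canonical homotopic_equiv :=
  EquivRel homotopicb homotopicb_refl homotopicb_sym homotopicb_trans.

End FundamentalGroup.

Definition pi1 (R : realType) (X : topologicalType) (x : X) : Type :=
  {eq_quot @homotopic_equiv R X x}.

Section Pi1Group.
Context {R : realType} {X : topologicalType} {x : X}.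
Local Notation loop := {path unitI R from x to x in X}.
Local Notation G := (pi1 R x).

HB.instance Definition _ := Quotient.on G.
HB.instance Definition _ := Choice.on G.

Definition pi1_class (p : loop) : G := \pi_G p.
Definition pi1_mul (a b : G) : G := pi1_class (loop_cat (repr a) (repr b)).
Definition pi1_one : G := pi1_class loop_one.
Definition pi1_inv (a : G) : G := pi1_class (loop_rev (repr a)).

Lemma pi1_classP p q : pi1_class p = pi1_class q <-> homotopic p q.
Proof. by split => [/eqmodP/asboolP//|h]; apply/eqmodP/asboolP. Qed.

Lemma pi1_reprP p : homotopic (repr (pi1_class p)) p.
Proof. by apply/pi1_classP; rewrite /pi1_class reprK. Qed.

Lemma pi1_mulE p q : pi1_mul (pi1_class p) (pi1_class q) = pi1_class (loop_cat p q).
Proof. by apply/pi1_classP/homotopic_cat; exact: pi1_reprP. Qed.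

Lemma pi1_invE p : pi1_inv (pi1_class p) = pi1_class (loop_rev p).
Proof. by apply/pi1_classP/homotopic_rev; exact: pi1_reprP. Qed.

Lemma pi1_ind (P : G -> Prop) : (forall p, P (pi1_class p)) -> forall a, P a.
Proof. by move=> h a; rewrite -[a]reprK; exact: h. Qed.

Lemma pi1_mulA : associative pi1_mul.
Proof.
elim/pi1_ind => p; elim/pi1_ind => q; elim/pi1_ind => r.
by rewrite !pi1_mulE; apply/pi1_classP; exact: homotopic_catA.
Qed.

Lemma pi1_mul1g : left_id pi1_one pi1_mul.
Proof.
by elim/pi1_ind => p; rewrite pi1_mulE; apply/pi1_classP; exact: homotopic_cat1p.
Qed.

Lemma pi1_mulg1 : right_id pi1_one pi1_mul.
Proof.
by elim/pi1_ind => p; rewrite pi1_mulE; apply/pi1_classP; exact: homotopic_catp1.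
Qed.

Lemma pi1_mulVg : left_inverse pi1_one pi1_inv pi1_mul.
Proof.
elim/pi1_ind => p; rewrite pi1_invE pi1_mulE.
by apply/pi1_classP; exact: homotopic_catVp.
Qed.

Lemma pi1_mulgV : right_inverse pi1_one pi1_inv pi1_mul.
Proof.
elim/pi1_ind => p; rewrite pi1_invE pi1_mulE.
by apply/pi1_classP; exact: homotopic_catpV.
Qed.

HB.instance Definition _ := isGroup.Build G
  pi1_mulA pi1_mul1g pi1_mulg1 pi1_mulVg pi1_mulgV.

End Pi1Group.

(* the pair (a, s) stands for a * t ^ s, where t generates Z_2 *)
Definition dihedral (Q : zmodType) : Type := (Q * bool)%type.

Section Dihedral.
Context {Q : zmodType}.
Local Notation D := (dihedral Q).

HB.instance Definition _ := Choice.on D.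

Definition dih_act (s : bool) (a : Q) : Q := if s then - a else a.
Definition dih_mul (g h : D) : D := (g.1 + dih_act g.2 h.1, g.2 (+) h.2).
Definition dih_one : D := (0, false).
Definition dih_inv (g : D) : D := (- dih_act g.2 g.1, g.2).

Lemma dih_mulA : associative dih_mul.
Proof.
move=> [a [] ] [b [] ] [c [] ]; rewrite /dih_mul /=; congr pair;
  by rewrite ?opprD ?opprK ?addrA.
Qed.

Lemma dih_mul1g : left_id dih_one dih_mul.
Proof. by move=> [a s]; rewrite /dih_mul /= add0r. Qed.

Lemma dih_mulg1 : right_id dih_one dih_mul.
Proof. by move=> [a []]; rewrite /dih_mul /= ?oppr0 addr0. Qed.

Lemma dih_mulVg : left_inverse dih_one dih_inv dih_mul.
Proof. by move=> [a []]; rewrite /dih_mul /= ?opprK ?subrr ?addNr. Qed.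

Lemma dih_mulgV : right_inverse dih_one dih_inv dih_mul.
Proof. by move=> [a []]; rewrite /dih_mul /= ?opprK subrr. Qed.

HB.instance Definition _ := isGroup.Build D
  dih_mulA dih_mul1g dih_mulg1 dih_mulVg dih_mulgV.

End Dihedral.

Definition quotient_of (A Q : zmodType) : Prop :=
  exists f : {additive A -> Q}, forall y, exists x, f x = y.

(* Cox's quotient construction: Sigma_d is the quotient of the pairs
   (x, y) = ((x_0, x_1), (u, v)), x != 0 and y != 0, by the torus action
     (l, m) . (x, u, v) = (l x, m u, l ^ d m v).
   The ruling is (x, y) |-> [x]; the variables x_0, x_1 have class F, u has class
   E and v has class E + d F.  As u and v have no common zero, E (E + d F) = 0,
   so that the section E = {u = 0} satisfies E ^ 2 = - d. *)
Definition cox_space (R : realType) : Type :=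
  [set z : 'rV[R[i]^o]_2 * 'rV[R[i]^o]_2 | z.1 != 0 /\ z.2 != 0].
HB.instance Definition _ (R : realType) := Topological.on (cox_space R).

Section Hirzebruch.
Context {R : realType} {d : nat}.
Implicit Types z w : cox_space R.

Definition base z : 'rV[R[i]]_2 := (\val z).1.
Definition fiber z : 'rV[R[i]]_2 := (\val z).2.

Definition torus_orbit z w : Prop :=
  exists l m : R[i], [/\ l != 0, m != 0, base w = l *: base z,
    fiber w 0 0 = m * fiber z 0 0 & fiber w 0 1 = l ^+ d * m * fiber z 0 1].

Definition torus_orbitb : rel (cox_space R) := fun z w => `[< torus_orbit z w >].

Lemma torus_orbit_refl : reflexive torus_orbitb.
Proof.
move=> z; apply/asboolP; exists 1, 1.
by split; rewrite ?oner_neq0 ?scale1r ?expr1n ?mul1r.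
Qed.

Lemma torus_orbit_symP z w : torus_orbit z w -> torus_orbit w z.
Proof.
move=> [l [m [l0 m0 Ex Eu Ev]]]; exists l^-1, m^-1.
have ld0 : l ^+ d != 0 by rewrite expf_neq0.
split; rewrite ?invr_neq0 //.
- by rewrite Ex scalerA mulVf // scale1r.
- by rewrite Eu mulKf.
- by rewrite Ev exprVn -invfM mulKf // mulf_neq0.
Qed.

Lemma torus_orbit_sym : ssrbool.symmetric torus_orbitb.
Proof. by move=> z w; apply/asboolP/asboolP; exact: torus_orbit_symP. Qed.

Lemma torus_orbit_trans : transitive torus_orbitb.
Proof.
move=> w z t /asboolP[l [m [l0 m0 Ex Eu Ev]]] /asboolP[k [n [k0 n0 Fx Fu Fv]]].
apply/asboolP; exists (k * l), (n * m); split; rewrite ?mulf_neq0 //.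
- by rewrite Fx Ex scalerA.
- by rewrite Fu Eu mulrA.
- by rewrite Fv Ev exprMn; ring.
Qed.

Canonical torus_equiv :=
  EquivRel torus_orbitb torus_orbit_refl torus_orbit_sym torus_orbit_trans.

End Hirzebruch.

Definition hirzebruch (R : realType) (d : nat) : Type :=
  quotient_topology {eq_quot @torus_equiv R d}.
HB.instance Definition _ (R : realType) (d : nat) := Topological.on (hirzebruch R d).
HB.instance Definition _ (R : realType) (d : nat) := Quotient.on (hirzebruch R d).

Section TrigonalCurves.
Context {R : realType} {d : nat}.
Local Notation coxpoly := (mpoly 4 R[i]).
Implicit Types (F G H : coxpoly) (C Z : set (hirzebruch R d)).

(* the variables of index 0, 1, 2, 3 are x_0, x_1, u, v *)
Definition coordinates (z : cox_space R) : 'I_4 -> R[i] :=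
  fun i => row_mx (base z) (fiber z) 0 i.

(* F is a section of the line bundle of class a E + b F *)
Definition has_class (a b : nat) F : Prop := forall m, m \in msupp F ->
  (m 2%R + m 3%R = a)%N /\ (m 0%R + m 1%R + d * m 3%R = b)%N.

(* independent of the representative if F has a class: see zero_locus_pi *)
Definition zero_locus F : set (hirzebruch R d) :=
  [set p | meval (coordinates (repr p)) F = 0].

Lemma zero_locus_pi a b F (z : cox_space R) : has_class a b F ->
  zero_locus F (\pi_(hirzebruch R d) z) <-> meval (coordinates z) F = 0.
Proof.
move=> hF; rewrite /zero_locus /=; case: piP => w /eqmodP/asboolP.
move=> [l [m [l0 m0 Ex Eu Ev]]].
suff -> : meval (coordinates w) F = m ^+ a * l ^+ b * meval (coordinates z) F.
  split=> [/eqP|->]; last by rewrite mulr0.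
  by rewrite !mulf_eq0 !expf_eq0 (negbTE l0) (negbTE m0) !andbF /= => /eqP.
have Ec (i : 'I_4) :
    coordinates w i = [:: l; l; m; l ^+ d * m]`_i * coordinates z i.
  rewrite /coordinates !mxE; case: splitP => -[[|[|//]] j2] /= ->.
  - by rewrite Ex mxE.
  - by rewrite Ex mxE.
  - by have -> : Ordinal j2 = 0 by exact: val_inj.
  - by have -> : Ordinal j2 = 1 by exact: val_inj.
rewrite !mevalE big_distrr /= !big_seq; apply: eq_bigr => n nF.
have [<- <-] := hF n nF.
under eq_bigr do rewrite Ec exprMn.
rewrite big_split /= mulrCA; congr (_ * (_ * _)).
rewrite !big_ord_recl big_ord0 /= mulr1 exprMn -exprM !exprD.
have -> : lift ord0 ord0 = 1 :> 'I_4 by exact: val_inj.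
have -> : lift ord0 (lift ord0 ord0) = 2 :> 'I_4 by exact: val_inj.
have -> : lift ord0 (lift ord0 (lift ord0 ord0)) = 3 :> 'I_4 by exact: val_inj.
have -> : ord0 = 0 :> 'I_4 by exact: val_inj.
by ring.
Qed.

Definition exceptional_section : set (hirzebruch R d) :=
  [set p | fiber (repr p) 0 0 = 0].

Definition zariski_closed Z : Prop := exists S : set coxpoly,
  (forall F, S F -> exists a b, has_class a b F) /\
  Z = \bigcap_(F in S) zero_locus F.

Definition irreducible_set Z : Prop :=
  Z !=set0 /\
  forall A B, zariski_closed A -> zariski_closed B ->
    Z `<=` A `|` B -> Z `<=` A \/ Z `<=` B.

Definition squarefree F : Prop :=
  forall G H, F = G ^+ 2 * H -> G \is a GRing.unit.

(* A reduced curve is identified with its set of points; it belongs to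
   |3 E + 3 d F| if that set has a square-free equation of this class. *)
Definition trigonal_curve C : Prop := exists F,
  [/\ has_class 3 (3 * d) F, squarefree F, C = zero_locus F &
      C `&` exceptional_section = set0].

Definition curve_complement C : Type := ~` (C `|` exceptional_section).
HB.instance Definition _ C := Topological.on (curve_complement C).

Definition pi1_proj C (x : curve_complement C) : groupType := pi1 R x.

(* the complement is path-connected, hence the choice of x is irrelevant *)
Definition admits_dihedral_covering C (Q : zmodType) : Prop :=
  exists (x : curve_complement C) (f : {multiplicative pi1_proj x -> dihedral Q}),
    forall g, exists a, f a = g.

End TrigonalCurves.

(* Main.v *)
Require Import Defs.
From HB Require Import structures.
From mathcomp Require Import all_boot all_order all_algebra.
From mathcomp Require Import complex ring lra zify.
From mathcomp Require Import generic_quotient.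
From mathcomp Require Import all_classical all_reals topology normedtype homotopy.
From mathcomp Require Import -(notations) mpoly.

Set Implicit Arguments.
Unset Strict Implicit.
Unset Printing Implicit Defensive.

Import Order.TTheory GRing.Theory Num.Theory.
Import numFieldNormedType.Exports.
Local Open Scope classical_set_scope.
Local Open Scope ring_scope.

(** The curve is studied through its fibres over the projective line. In an affine chart it is
    [v ^ 3 + P v + q = 0] with [P], [q] polynomials of degrees at most [2 d], [3 d] in [b], and an
    epimorphism of the fundamental group onto the dihedral group [D(Q)] becomes a functor [g] on the
    paths of the complement (predicate [flat]). A point [z] of a fibre from which the three roots
    [e1], [e2], [e3] are all visible has three meridians, small loops around the roots along the
    segments from [z]. They generate the whole group: the loops of a fibre do (a cut of
    the plane), those of a chart follow since every loop can be pushed along the base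
    ([aff_gen]), and two charts cover the complement ([meridians_generate]).

    A character of [D(Q)] with values in [Z_2] colours the roots of each fibre. If the colours differ,
    the root of the minority colour is a continuous section over the complement of a finite set,
    hence a polynomial ([liouville]), and the curve splits: this contradicts irreducibility
    ([no_section]). So the colour is constant ([one_colour]): the meridians are
    reflections, [Q] is generated by the two differences [x], [y] of their translation parts, and
    [Q] has no quotient of order two.

    The pair [(x, y)], defined up to sign, is attached to a fibre together with a parameter [s] of the
    upper half plane with [s ^ 2 = (e3 - e1) / (e2 - e1)], which singles out the base point
    [e1 + s (e2 - e1)]. Relabellings of the roots make [s] move by [- 1 / s] and by
    [s ^ 2 |-> 1 / (1 - s ^ 2)], and the pair by elements of order two and three of the modular group
    ([cm_quarter], [cm_third]). Fix a weight [w] on pairs; the sum [psi] of the weights over the base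
    points whose fibre has shape [s] does not depend on [s], because roots are continuous,
    and it is invariant under the modular group. Let the modular invariant [a / c] have
    degree [D] in [b]. Near the three special values of [s] the roots gather around the [N0] distinct
    zeros of [a], the [N1] zeros of [a - c] and the [N2] zeros of [c], in orbits of a local symmetry
    of the pairs: so [3 N0 <= D], [2 N1 <= D] and [n N2 <= psi], where the weight is
    [n] divided by the order of [y]. If the average of this weight over suitable elements of the
    modular group is at most [n / 6] ([bad]), then [N2 <= D / 6] and [N0 + N1 + N2 <= D], whereas the
    theorem of Mason and Stothers gives [N0 + N1 + N2 >= D + 2]. This excludes as [Q] the cyclic groups
    of prime order at least 11 and of orders 15, 21, 25, 27, 35, 49, and [Z_3 * Z_9], [Z_7 * Z_7].

    The invariant [a / c] is constant only if [P = 0], the other possibilities being excluded by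
    irreducibility ([not_proportional], [q_zero]). If [P = 0], the pairs of the
    three rotations of a fibre [v ^ 3 = - q] differ unless [3 Q = 0], and distinguish again a
    section ([isotrivial]).

    Finally a group with two generators is [Z_d1 + Z_d2] with [d1] dividing [d2] ([smith2]), and a
    covering for [Q] induces one for each quotient of [Q], so that the excluded groups leave only the
    quotients of the four groups of the statement ([classification]). *)

(** * Paths and their homotopies *)

Section Paths.
Context {R : realType} {X : topologicalType}.
Implicit Types (a b c : R -> X) (t s : R).

Let half1 : (1 <= 2^-1 :> R) = false.
Proof. by apply/negP => h; lra. Qed.

Let half0 : (0 <= 2^-1 :> R) = true.
Proof. by lra. Qed.

Let two1 : 2 - 1 = 1 :> R.
Proof. by lra. Qed.

Let twoV : 2 * 2^-1 = 1 :> R.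
Proof. by lra. Qed.

(** Paths are maps on the whole line of which only [0, 1] matters: this keeps the unit interval out of
    concatenations and reparametrizations. *)
Definition pth a (y z : X) := [/\ continuous a, a 0 = y & a 1 = z].

Definition pcat a b t : X := if t <= 2^-1 then a (2 * t) else b (2 * t - 1).

Definition prev a t : X := a (1 - t).

Definition heq a b := exists H : R * R -> X,
  [/\ continuous H,
      forall t, 0 <= t <= 1 -> H (0, t) = a t,
      forall t, 0 <= t <= 1 -> H (1, t) = b t,
      forall s, 0 <= s <= 1 -> H (s, 0) = a 0 &
      forall s, 0 <= s <= 1 -> H (s, 1) = a 1].

Lemma affc (k l : R) : continuous (fun t : R => k * t + l).
Proof.
move=> t; apply: cvgD; last exact: cvg_cst.
by apply: cvgM; [exact: cvg_cst|exact: cvg_id].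
Qed.

Lemma pcat_pth a b x y z : pth a x y -> pth b y z -> pth (pcat a b) x z.
Proof.
move=> [ca a0 a1] [cb b0 b1]; split.
- apply: (@paste_continuous R R X id 2^-1 (fun t => a (2 * t)) (fun t => b (2 * t - 1))).
  + by move=> t; exact: cvg_id.
  + apply: (@cont_comp _ _ _ (fun t : R => 2 * t) a _ ca) => t.
    by apply: cvgM; [exact: cvg_cst|exact: cvg_id].
  + exact: (cont_comp (@affc 2 (-1)) cb).
  + by move=> s ->; rewrite twoV subrr a1 b0.
- by rewrite /pcat half0 mulr0.
- by rewrite /pcat half1 mulr1 two1.
Qed.

Lemma prev_pth a y z : pth a y z -> pth (prev a) z y.
Proof.
move=> [ca a0 a1]; split; rewrite /prev ?subr0 ?subrr //.
apply: (@cont_comp _ _ _ (fun t : R => 1 - t) a _ ca) => t.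
by apply: cvgB; [exact: cvg_cst|exact: cvg_id].
Qed.

Lemma cst_pth y : pth (fun=> y) y y.
Proof. by split=> // t; exact: cvg_cst. Qed.

Lemma fstc : continuous (fun z : R * R => z.1).
Proof. by move=> z; exact: cvg_fst. Qed.

Lemma sndc : continuous (fun z : R * R => z.2).
Proof. by move=> z; exact: cvg_snd. Qed.

Lemma heq_ext a b : continuous a -> (forall t, 0 <= t <= 1 -> a t = b t) -> heq a b.
Proof.
move=> ca ab; exists (fun z => a z.2); split => //.
exact: (cont_comp sndc ca).
Qed.

Lemma heq_refl a : continuous a -> heq a a.
Proof. by move=> ca; apply: heq_ext. Qed.

Lemma in01 t : t = 0 \/ t = 1 -> 0 <= t <= 1.
Proof. by case=> ->; rewrite lexx ler01. Qed.

Lemma heq_end a b : heq a b -> a 0 = b 0 /\ a 1 = b 1.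
Proof.
move=> [H [_ H0 H1 Hl Hr]]; split.
  by rewrite -H1 ?Hl //; apply: in01; auto.
by rewrite -H1 ?Hr //; apply: in01; auto.
Qed.

Lemma heq_trans a b c : heq a b -> heq b c -> heq a c.
Proof.
move=> ab bc; have [ab0 ab1] := heq_end ab.
move: ab bc => [H [Hc H0 H1 Hl Hr]] [K [Kc K0 K1 Kl Kr]].
have i0 : 0 <= (0 : R) <= 1 by apply: in01; left.
have i1 : 0 <= (1 : R) <= 1 by apply: in01; right.
(* both homotopies are only controlled over [0, 1], so their second variable is clamped *)
pose cl (t : R) : R := Order.max 0 (Order.min t 1).
have clc : continuous cl.
  move=> t; apply: (@continuous_max _ R (cst 0) (fun r => Order.min r 1)).
    exact: cvg_cst.
  by apply: (@continuous_min _ R id (cst 1)); [exact: cvg_id|exact: cvg_cst].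
have cl01 t : 0 <= cl t <= 1 by rewrite /cl le_max lexx ge_max ler01 ge_min lexx orbT.
have clE t : 0 <= t <= 1 -> cl t = t.
  by move=> /andP[t0 t1]; rewrite /cl min_l // max_r.
exists (fun z => if z.1 <= 2^-1 then H (2 * z.1, cl z.2) else K (2 * z.1 - 1, cl z.2)).
have pc (k l : R) : continuous (fun z : R * R => (k * z.1 + l, cl z.2)).
  by apply: cont_pair; [exact: (cont_comp fstc (@affc k l))|exact: (cont_comp sndc clc)].
split=> [|t t01|t t01|s s01|s s01].
- apply: (@paste_continuous R _ X (fun z : R * R => z.1) 2^-1
    (fun z => H (2 * z.1, cl z.2)) (fun z => K (2 * z.1 - 1, cl z.2))).
  + exact: fstc.
  + apply: (@cont_comp _ _ _ (fun z : R * R => (2 * z.1, cl z.2)) H _ Hc).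
    have -> : (fun z : R * R => (2 * z.1, cl z.2)) = (fun z => (2 * z.1 + 0, cl z.2)).
      by apply/funext => z; rewrite addr0.
    exact: pc.
  + exact: (cont_comp (pc 2 (-1)) Kc).
  + by move=> z ->; rewrite twoV subrr H1 // K0.
- by rewrite /= half0 mulr0 clE ?H0.
- by rewrite /= half1 mulr1 two1 clE ?K1.
- rewrite /= clE //; case: ifP => h.
    by rewrite Hl //; move: s01 => /andP[? ?]; apply/andP; split; lra.
  rewrite Kl ?ab0 //; move/negbT: h; rewrite -ltNge => h.
  by move: s01 => /andP[? ?]; apply/andP; split; lra.
- rewrite /= clE //; case: ifP => h.
    by rewrite Hr //; move: s01 => /andP[? ?]; apply/andP; split; lra.
  rewrite Kr ?ab1 //; move/negbT: h; rewrite -ltNge => h.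
  by move: s01 => /andP[? ?]; apply/andP; split; lra.
Qed.

Lemma heq_sym a b : heq a b -> heq b a.
Proof.
move=> ab; have [ab0 ab1] := heq_end ab; case: ab => H [Hc H0 H1 Hl Hr].
have f01 s : 0 <= s <= 1 -> 0 <= 1 - s <= 1.
  by move=> /andP[? ?]; apply/andP; split; lra.
exists (fun z => H (1 - z.1, z.2)); split=> [|t t01|t t01|s s01|s s01] /=.
- apply: (@cont_comp _ _ _ (fun z : R * R => (1 - z.1, z.2)) H _ Hc).
  apply: cont_pair; last exact: sndc.
  by move=> z; apply: cvgB; [exact: cvg_cst|exact: cvg_fst].
- by rewrite subr0 H1.
- by rewrite subrr H0.
- by rewrite Hl ?f01.
- by rewrite Hr ?f01.
Qed.

Lemma heq_cat a b a' b' : a 1 = b 0 -> heq a a' -> heq b b' -> heq (pcat a b) (pcat a' b').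
Proof.
move=> ab [H [Hc H0 H1 Hl Hr]] [K [Kc K0 K1 Kl Kr]].
pose cl (t : R) : R := Order.max 0 (Order.min t 1).
have clc : continuous cl.
  move=> t; apply: (@continuous_max _ R (cst 0) (fun r => Order.min r 1)).
    exact: cvg_cst.
  by apply: (@continuous_min _ R id (cst 1)); [exact: cvg_id|exact: cvg_cst].
have cl01 t : 0 <= cl t <= 1 by rewrite /cl le_max lexx ge_max ler01 ge_min lexx orbT.
have clE t : 0 <= t <= 1 -> cl t = t.
  by move=> /andP[t0 t1]; rewrite /cl min_l // max_r.
exists (fun z => if z.2 <= 2^-1 then H (cl z.1, 2 * z.2) else K (cl z.1, 2 * z.2 - 1)).
have i0 : 0 <= (0 : R) <= 1 by apply: in01; left.
have i1 : 0 <= (1 : R) <= 1 by apply: in01; right.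
have pc (k l : R) : continuous (fun z : R * R => (cl z.1, k * z.2 + l)).
  by apply: cont_pair; [exact: (cont_comp fstc clc)|exact: (cont_comp sndc (@affc k l))].
have lo t : 0 <= t <= 1 -> t <= 2^-1 -> 0 <= 2 * t <= 1.
  by move=> /andP[? ?] ?; apply/andP; split; lra.
have hi t : 0 <= t <= 1 -> (t <= 2^-1) = false -> 0 <= 2 * t - 1 <= 1.
  move=> /andP[? ?] /negbT; rewrite -ltNge => ?; apply/andP; split; lra.
split=> [|t t01|t t01|s s01|s s01].
- apply: (@paste_continuous R _ X (fun z : R * R => z.2) 2^-1
    (fun z => H (cl z.1, 2 * z.2)) (fun z => K (cl z.1, 2 * z.2 - 1))).
  + exact: sndc.
  + apply: (@cont_comp _ _ _ (fun z : R * R => (cl z.1, 2 * z.2)) H _ Hc).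
    have -> : (fun z : R * R => (cl z.1, 2 * z.2)) = (fun z => (cl z.1, 2 * z.2 + 0)).
      by apply/funext => z; rewrite addr0.
    exact: pc.
  + exact: (cont_comp (pc 2 (-1)) Kc).
  + by move=> z ->; rewrite twoV subrr Hr // Kl.
- by rewrite /pcat /= clE //; case: ifP => h; [rewrite H0 ?lo|rewrite K0 ?hi].
- by rewrite /pcat /= clE //; case: ifP => h; [rewrite H1 ?lo|rewrite K1 ?hi].
- by rewrite /pcat /= clE // half0 mulr0 Hl.
- by rewrite /pcat /= clE // half1 mulr1 two1 Kr.
Qed.

(** Two paths that factor through a convex domain with the same end points
    are joined by the straight-line homotopy there. *)
Lemma heq_convex (K : R * R -> X) (al be : R -> R * R) a b :
  continuous K -> continuous al -> continuous be -> al 0 = be 0 -> al 1 = be 1 ->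
  (forall t, 0 <= t <= 1 -> a t = K (al t)) ->
  (forall t, 0 <= t <= 1 -> b t = K (be t)) -> heq a b.
Proof.
move=> Kc alc bec e0 e1 aE bE.
exists (fun z => K (((1 - z.1) * (al z.2).1 + z.1 * (be z.2).1),
                    ((1 - z.1) * (al z.2).2 + z.1 * (be z.2).2))).
have i0 : 0 <= (0 : R) <= 1 by apply: in01; left.
have i1 : 0 <= (1 : R) <= 1 by apply: in01; right.
split=> [|t t01|t t01|s s01|s s01] /=.
- apply: (@cont_comp _ _ _ (fun z : R * R => ((1 - z.1) * (al z.2).1 + z.1 * (be z.2).1,
    (1 - z.1) * (al z.2).2 + z.1 * (be z.2).2)) K _ Kc).
  apply: cont_pair; apply: lerp_continuous; try exact: fstc.
  + exact: (cont_comp (cont_comp sndc alc) cont_fst).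
  + exact: (cont_comp (cont_comp sndc bec) cont_fst).
  + exact: (cont_comp (cont_comp sndc alc) cont_snd).
  + exact: (cont_comp (cont_comp sndc bec) cont_snd).
- by rewrite subr0 !mul1r !mul0r !addr0 aE -?surjective_pairing.
- by rewrite subrr !mul1r !mul0r !add0r bE -?surjective_pairing.
- by rewrite -e0 aE // -!mulrDl subrK !mul1r -surjective_pairing.
- by rewrite -e1 aE // -!mulrDl subrK !mul1r -surjective_pairing.
Qed.

Lemma heq_reparam a b c (f g : R -> R) :
  continuous a -> continuous f -> continuous g -> f 0 = g 0 -> f 1 = g 1 ->
  (forall t, 0 <= t <= 1 -> b t = a (f t)) ->
  (forall t, 0 <= t <= 1 -> c t = a (g t)) -> heq b c.
Proof.
move=> ac fc gc e0 e1 bE cE.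
apply: (@heq_convex (fun z => a z.1) (fun t => (f t, 0)) (fun t => (g t, 0))) => //.
- exact: (cont_comp fstc ac).
- by apply: cont_pair => // t; exact: cvg_cst.
- by apply: cont_pair => // t; exact: cvg_cst.
- by rewrite e0.
- by rewrite e1.
Qed.

Lemma idc : continuous (fun t : R => t).
Proof. by move=> t; exact: cvg_id. Qed.

Lemma heq_catA a b c x y z w : pth a x y -> pth b y z -> pth c z w ->
  heq (pcat a (pcat b c)) (pcat (pcat a b) c).
Proof.
move=> pa pb pc; have [abc _ _] := pcat_pth pa (pcat_pth pb pc).
apply: (@heq_reparam (pcat a (pcat b c)) _ _ id ((fun u => 2 * u + 0) \min
  ((fun u => 1 * u + 4^-1) \min (fun u => 2^-1 * u + 2^-1)))) => //.
- exact: idc.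
- move=> u; apply: continuous_min; first exact: affc.
  by apply: continuous_min; exact: affc.
- by rewrite /=; rewrite !minElt; repeat case: ifPn; lra.
- by rewrite /=; rewrite !minElt; repeat case: ifPn; lra.
- move=> u /andP[u0 u1]; rewrite /pcat /=.
  case: (leP u 2^-1) => u2; last first.
    rewrite [Order.min (1 * u + _) _]min_r; last by lra.
    rewrite min_r; last by lra.
    rewrite ifF; last by apply/negP; lra.
    rewrite ifF; last by apply/negP; lra.
    by congr (c _); lra.
  rewrite [Order.min (1 * u + _) _]min_l; last by lra.
  case: (leP u 4^-1) => u4.
    rewrite min_l; last by lra.
    rewrite ifT; last by lra.
    rewrite ifT; last by lra.
    by congr (a _); lra.
  rewrite min_r; last by lra.
  rewrite ifF; last by apply/negP; lra.
  rewrite ifF; last by apply/negP; lra.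
  rewrite ifT; last by lra.
  by congr (b _); lra.
Qed.

Lemma heq_cat1p a x y : pth a x y -> heq (pcat (fun=> x) a) a.
Proof.
move=> [ca a0 a1].
apply: (@heq_reparam a _ _ ((fun u => 2 * u + (- 1)) \max (fun=> 0)) id) => //.
- move=> u; apply: continuous_max; first exact: affc.
  exact: cvg_cst.
- exact: idc.
- by rewrite /= max_r //; lra.
- by rewrite /= max_l //; lra.
- move=> u _; rewrite /pcat /=; case: (leP u 2^-1) => u2.
    by rewrite max_r ?a0 //; lra.
  by rewrite max_l //; lra.
Qed.

Lemma heq_catp1 a x y : pth a x y -> heq (pcat a (fun=> y)) a.
Proof.
move=> [ca a0 a1].
apply: (@heq_reparam a _ _ ((fun u => 2 * u + 0) \min (fun=> 1)) id) => //.
- move=> u; apply: continuous_min; first exact: affc.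
  exact: cvg_cst.
- exact: idc.
- by rewrite /= min_l //; lra.
- by rewrite /= min_r //; lra.
- move=> u _; rewrite /pcat /=; case: (leP u 2^-1) => u2.
    by rewrite min_l ?addr0 //; lra.
  by rewrite min_r ?a1 //; lra.
Qed.

Lemma heq_catpV a x y : pth a x y -> heq (pcat a (prev a)) (fun=> x).
Proof.
move=> [ca a0 a1].
apply: (@heq_reparam a _ _
  ((fun u => 2 * u + 0) \min (fun u => - 2 * u + 2)) (fun=> 0)) => //.
- by move=> u; apply: continuous_min; exact: affc.
- by move=> u; exact: cvg_cst.
- by rewrite /= min_l //; lra.
- by rewrite /= min_r //; lra.
- move=> u _; rewrite /pcat /prev /=; case: (leP u 2^-1) => u2.
    by rewrite min_l; [congr a; lra|lra].
  by rewrite min_r; [congr a; lra|lra].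
Qed.

Lemma heq_catVp a x y : pth a x y -> heq (pcat (prev a) a) (fun=> y).
Proof.
move=> pa; apply: heq_trans (heq_catpV (prev_pth pa)).
have [c1 e1 e2] := pcat_pth (prev_pth pa) pa.
apply: heq_ext => // t _; rewrite /pcat /prev; case: ifP => // _.
by congr (a _); lra.
Qed.

Definition lp_fun a (t : unitI R) : X := a (ival t).

Section Loop.
Variables (x : X) (a : R -> X) (pa : pth a x x).

Lemma lp_cont : continuous (lp_fun a).
Proof. by case: pa => ca _ _; exact: (cont_comp ival_continuous ca). Qed.
Lemma lp0 : lp_fun a zero = x.
Proof. by case: pa => _ a0 _; rewrite /lp_fun ival0. Qed.
Lemma lp1 : lp_fun a one = x.
Proof. by case: pa => _ _ a1; rewrite /lp_fun ival1. Qed.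

Definition lp : {path unitI R from x to x in X} := mk_path lp_cont lp0 lp1.
End Loop.

Lemma homotopic_lp x a b (pa : pth a x x) (pb : pth b x x) :
  heq a b -> homotopic (lp pa) (lp pb).
Proof.
have [_ a0 a1] := pa.
move=> [H [Hc H0 H1 Hl Hr]].
exists (fun z => H (ival z.1, ival z.2)).
split=> [|t|t|s|s] /=.
- exact: (cont_comp (cont_pair fst_continuous snd_continuous) Hc).
- by rewrite ival0 H0 ?ival01.
- by rewrite ival1 H1 ?ival01.
- by rewrite ival0 Hl ?ival01 // a0.
- by rewrite ival1 Hr ?ival01 // a1.
Qed.

Lemma homotopic_eqfun x (p q : {path unitI R from x to x in X}) : p =1 q -> homotopic p q.
Proof.
move=> pq; have [H [Hc H0 H1 Hl Hr]] := homotopic_refl p.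
by exists H; split => // t; rewrite H1 pq.
Qed.

Lemma homotopic_lp_cat x a b (pa : pth a x x) (pb : pth b x x) (pab : pth (pcat a b) x x) :
  homotopic (lp pab) (loop_cat (lp pa) (lp pb)).
Proof.
apply: homotopic_eqfun => t; rewrite /= /mk_path /= /lp_fun /pcat /cat_fun.
have /andP[t0 t1] := ival01 t.
case: ifP => h; rewrite /= /mk_path /= /lp_fun ival_clamp.
  by rewrite min_l ?max_r //; lra.
move/negbT: h; rewrite -ltNge => h.
by rewrite min_l ?max_r //; lra.
Qed.

End Paths.

(** * The path functor of a representation of the fundamental group *)

Section Functor.
Context {R : realType} {X : topologicalType} (x : X) (G : groupType).
Variable f : {multiplicative pi1 R x -> G}.
Hypothesis fsurj : forall g, exists a, f a = g.
Hypothesis conn : forall y, exists a : R -> X, pth a x y.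
Implicit Types (a b : R -> X) (y z : X).

Let pp y : R -> X := projT1 (cid (conn y)).
Let ppP y : pth (pp y) x y := projT2 (cid (conn y)).

Let Lam a : G := if pselect (pth a x x) is left pa then f (pi1_class (lp pa)) else 1%g.

Let LamE a (pa : pth a x x) : Lam a = f (pi1_class (lp pa)).
Proof.
rewrite /Lam; case: pselect => // pa'.
by apply: (congr1 f); apply/pi1_classP; apply: homotopic_lp; apply: heq_refl; case: pa.
Qed.

Let Lam_heq a b : pth a x x -> heq a b -> continuous b -> Lam a = Lam b.
Proof.
move=> pa ab cb; have [e0 e1] := heq_end ab.
have pb : pth b x x by case: (pa) => _ a0 a1; split; rewrite -?e0 -?e1.
by rewrite (LamE pa) (LamE pb); apply: (congr1 f); apply/pi1_classP; exact: homotopic_lp.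
Qed.

Let Lam_cat a b : pth a x x -> pth b x x -> Lam (pcat a b) = (Lam a * Lam b)%g.
Proof.
move=> pa pb; rewrite (LamE pa) (LamE pb) (LamE (pcat_pth pa pb)).
rewrite -gmulfM; apply: (congr1 f); rewrite [RHS]pi1_mulE.
by apply/pi1_classP; exact: homotopic_lp_cat.
Qed.

(** A path is closed up by chosen paths from [x] to its two ends. *)
Definition tau a : G := Lam (pcat (pcat (pp (a 0)) a) (prev (pp (a 1)))).

Let in_pth a : continuous a ->
  pth (pcat (pcat (pp (a 0)) a) (prev (pp (a 1)))) x x.
Proof.
move=> ca; apply: (@pcat_pth _ _ _ _ _ (a 1)); last exact/prev_pth/ppP.
by apply: (@pcat_pth _ _ _ _ _ (a 0)) => //; exact: ppP.
Qed.

Lemma tau_heq a b : continuous a -> continuous b -> heq a b -> tau a = tau b.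
Proof.
move=> ca cb ab; have [e0 e1] := heq_end ab.
apply: Lam_heq; first exact: in_pth.
  rewrite -e0 -e1; have [c1 f0 f1] := ppP (a 0); have [c2 f2 f3] := prev_pth (ppP (a 1)).
  have pa : pth a (a 0) (a 1) by [].
  apply: heq_cat; [|apply: heq_cat => //; exact: heq_refl|exact: heq_refl].
  by have [_ _ ->] := pcat_pth (ppP (a 0)) pa; rewrite f2.
by have [] := in_pth cb.
Qed.

Lemma tau_ext a b : continuous a -> continuous b ->
  (forall t, 0 <= t <= 1 -> a t = b t) -> tau a = tau b.
Proof. by move=> ca cb ab; apply: tau_heq => //; exact: heq_ext. Qed.

Lemma tau_cat a b : continuous a -> continuous b -> a 1 = b 0 ->
  tau (pcat a b) = (tau a * tau b)%g.
Proof.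
move=> ca cb ab.
have pa : pth a (a 0) (a 1) by [].
have pb : pth b (a 1) (b 1) by [].
have [cab ab0 ab1] := pcat_pth pa pb.
rewrite {2 3}/tau -Lam_cat; [|exact: in_pth|exact: in_pth].
apply: Lam_heq; first exact: in_pth; last first.
  by have [] := pcat_pth (in_pth ca) (in_pth cb).
rewrite ab0 ab1 -ab.
set p0 := pp (a 0); set p1 := pp (a 1); set p2 := pp (b 1).
have P0 : pth p0 x (a 0) := ppP _.
have P1 : pth p1 x (a 1) := ppP _.
have R1 := prev_pth P1.
have P2 : pth p2 x (b 1) := ppP _.
have R2 := prev_pth P2.
have P0a := pcat_pth P0 pa.
have Hc (u v u' v' : R -> X) y z w : pth u y z -> pth v z w -> heq u u' -> heq v v' ->
    heq (pcat u v) (pcat u' v').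
  by move=> [_ _ u1] [_ v0 _]; apply: heq_cat; rewrite u1 v0.
have hr (u : R -> X) y z : pth u y z -> heq u u by move=> [cu _ _]; exact: heq_refl.
apply: heq_sym.
apply: heq_trans (heq_sym (heq_catA P0a R1 (pcat_pth (pcat_pth P1 pb) R2))) _.
have h : heq (pcat (prev p1) (pcat (pcat p1 b) (prev p2))) (pcat b (prev p2)).
  apply: heq_trans (heq_catA R1 (pcat_pth P1 pb) R2) _.
  apply: (Hc _ _ _ _ _ _ _ (pcat_pth R1 (pcat_pth P1 pb)) R2 _ (hr _ _ _ R2)).
  apply: heq_trans (heq_catA R1 P1 pb) _.
  apply: heq_trans (heq_cat1p pb).
  exact: (Hc _ _ _ _ _ _ _ (pcat_pth R1 P1) pb (heq_catVp P1) (hr _ _ _ pb)).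
apply: heq_trans (Hc _ _ _ _ _ _ _ P0a (pcat_pth R1 (pcat_pth (pcat_pth P1 pb) R2))
  (hr _ _ _ P0a) h) _.
apply: heq_trans (heq_catA P0a pb R2) _.
apply: (Hc _ _ _ _ _ _ _ (pcat_pth P0a pb) R2 _ (hr _ _ _ R2)).
exact: heq_sym (heq_catA P0 pa pb).
Qed.

Lemma tau_cst y : tau (fun=> y) = 1%g.
Proof.
have [c _ _] := @cst_pth R _ y.
apply: (@mulgI _ (tau (fun=> y))); rewrite mulg1 -tau_cat //.
have p := @cst_pth R _ y; have [c2 _ _] := pcat_pth p p.
by apply: tau_heq => //; exact: heq_cat1p p.
Qed.

(** The value of the functor around a square is trivial: this is the only
    form in which homotopy invariance is used afterwards. *)
Lemma tau_square (K : R * R -> X) : continuous K ->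
  (tau (fun t => K (t, 0%R)) * tau (fun t => K (1%R, t)) =
   tau (fun t => K (0%R, t)) * tau (fun t => K (t, 1%R)))%g.
Proof.
move=> Kc.
have c1 (k : R) : continuous (fun t : R => (t, k)).
  by apply: cont_pair; [exact: idc|exact: cont_cst].
have c2 (k : R) : continuous (fun t : R => (k, t)).
  by apply: cont_pair; [exact: cont_cst|exact: idc].
have k1 k : continuous (fun t : R => K (t, k)) by exact: (cont_comp (c1 k) Kc).
have k2 k : continuous (fun t : R => K (k, t)) by exact: (cont_comp (c2 k) Kc).
rewrite -!tau_cat //.
have A : pth (pcat (fun t : R => (t, 0 : R)) (fun t : R => (1 : R, t))) (0, 0) (1, 1).
  by apply: (@pcat_pth R (R * R)%type _ _ _ (1, 0)); split.
have B : pth (pcat (fun t : R => (0 : R, t)) (fun t : R => (t, 1 : R))) (0, 0) (1, 1).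
  by apply: (@pcat_pth R (R * R)%type _ _ _ (0, 1)); split.
have [cA A0 A1] := A; have [cB B0 B1] := B.
have EA : pcat (fun t => K (t, 0)) (fun t => K (1, t)) =
    K \o pcat (fun t : R => (t, 0 : R)) (fun t : R => (1 : R, t)).
  by apply/funext => t; rewrite /pcat /=; case: ifP.
have EB : pcat (fun t => K (0, t)) (fun t => K (t, 1)) =
    K \o pcat (fun t : R => (0 : R, t)) (fun t : R => (t, 1 : R)).
  by apply/funext => t; rewrite /pcat /=; case: ifP.
rewrite EA EB; apply: tau_heq; [exact: (cont_comp cA Kc)|exact: (cont_comp cB Kc)|].
by apply: (@heq_convex _ _ K _ _ _ _ Kc cA cB) => //; rewrite ?A0 ?B0 ?A1 ?B1.
Qed.

Lemma tau_surj y g : exists a, pth a y y /\ tau a = g.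
Proof.
have [h hg] := fsurj g.
have {hg} <- : f (pi1_class (repr h)) = g by rewrite /pi1_class reprK.
set p := repr h.
pose l : R -> X := ext p.
have pl : pth l x x.
  by split; [exact: ext_continuous|rewrite /l ext_le0|rewrite /l ext_ge1].
have P := ppP y; have R1 := prev_pth P.
have pL := pcat_pth (pcat_pth R1 pl) P.
exists (pcat (pcat (prev (pp y)) l) (pp y)); split => //.
case: (pL) => cL L0 L1.
rewrite /tau L0 L1.
have Hc (u v u' v' : R -> X) y1 z w : pth u y1 z -> pth v z w -> heq u u' -> heq v v' ->
    heq (pcat u v) (pcat u' v').
  by move=> [_ _ u1] [_ v0 _]; apply: heq_cat; rewrite u1 v0.
have hr (u : R -> X) y1 z : pth u y1 z -> heq u u by move=> [cu _ _]; exact: heq_refl.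
have pT := pcat_pth (pcat_pth P pL) R1.
rewrite (@Lam_heq _ l pT); last by case: pl.
  rewrite (LamE pl); apply: (congr1 f); apply/pi1_classP.
  by apply: homotopic_eqfun => t; rewrite /= /mk_path /= /lp_fun /l ext_ival.
apply: heq_trans (heq_sym (heq_catA P pL R1)) _.
apply: heq_trans (Hc _ _ _ _ _ _ _ P (pcat_pth pL R1) (hr _ _ _ P)
  (heq_sym (heq_catA (pcat_pth R1 pl) P R1))) _.
apply: heq_trans (Hc _ _ _ _ _ _ _ P (pcat_pth (pcat_pth R1 pl) (pcat_pth P R1)) (hr _ _ _ P)
  (Hc _ _ _ _ _ _ _ (pcat_pth R1 pl) (pcat_pth P R1) (hr _ _ _ (pcat_pth R1 pl))
     (heq_catpV P))) _.
have px := @cst_pth R _ x.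
apply: heq_trans (Hc _ _ _ _ _ _ _ P (pcat_pth (pcat_pth R1 pl) px) (hr _ _ _ P)
  (heq_catp1 (pcat_pth R1 pl))) _.
apply: heq_trans (heq_catA P R1 pl) _.
apply: heq_trans (Hc _ _ _ _ _ _ _ (pcat_pth P R1) pl (heq_catpV P) (hr _ _ _ pl)) _.
exact: heq_cat1p pl.
Qed.

End Functor.

HB.instance Definition _ (R : realType) := NormedModule.copy (R[i]) (R[i]^o).

(** * Segments and finite exceptional sets *)

Section Segments.
Context {R : realType}.
Local Notation C := R[i].

Definition rc (t : R) : C := (t%:C)%C.

Lemma rc0 : rc 0 = 0. Proof. by []. Qed.
Lemma rc1 : rc 1 = 1. Proof. by []. Qed.
Lemma rcB t u : rc (t - u) = rc t - rc u. Proof. exact: raddfB. Qed.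
Lemma rcD t u : rc (t + u) = rc t + rc u. Proof. exact: raddfD. Qed.
Lemma rcM t u : rc (t * u) = rc t * rc u. Proof. exact: rmorphM. Qed.

Lemma norm_rc t : `|rc t| = rc `|t|.
Proof. by rewrite normc_def /= expr0n /= addr0 sqrtr_sqr. Qed.

Lemma pos_rc (e : C) : 0 < e -> exists2 r : R, 0 < r & e = rc r.
Proof.
rewrite ltcE => /andP[/eqP i0 r0]; exists (complex.Re e) => //.
by case: e i0 r0 => a b /= ->.
Qed.

Lemma rcc : continuous rc.
Proof.
move=> t; apply/cvgrPdist_lt => e /pos_rc[r r0 ->].
have : \forall u \near t, `|t - u| < r by exact: (nbhsx_ballx t r r0).
by apply: filterS => u h; rewrite -rcB norm_rc ltcR.
Qed.

Section ContC.
Variables (T : topologicalType).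
Implicit Types (f h : T -> C).

Lemma contD f h : continuous f -> continuous h -> continuous (fun x => f x + h x).
Proof. by move=> fc hc x; apply: cvgD; [exact: fc|exact: hc]. Qed.
Lemma contN f : continuous f -> continuous (fun x => - f x).
Proof. by move=> fc x; apply: cvgN; exact: fc. Qed.
Lemma contB f h : continuous f -> continuous h -> continuous (fun x => f x - h x).
Proof. by move=> fc hc; exact: (contD fc (contN hc)). Qed.
Lemma contM f h : continuous f -> continuous h -> continuous (fun x => f x * h x).
Proof. by move=> fc hc x; apply: cvgM; [exact: fc|exact: hc]. Qed.
Lemma contX f n : continuous f -> continuous (fun x => f x ^+ n).
Proof.
move=> fc; elim: n => [|n IH]; first by move=> x; exact: cvg_cst.
have -> : (fun x => f x ^+ n.+1) = (fun x => f x * f x ^+ n).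
  by apply/funext => x; rewrite exprS.
exact: (contM fc IH).
Qed.
Lemma cont_horner (p : {poly C}) f : continuous f -> continuous (fun x => p.[f x]).
Proof.
move=> fc; elim/poly_ind: p => [|p c IH].
  by have -> : (fun x => (0 : {poly C}).[f x]) = (fun=> 0);
    [apply/funext => x; rewrite horner0|move=> x; exact: cvg_cst].
have -> : (fun x => (p * 'X + c%:P).[f x]) = (fun x => p.[f x] * f x + c).
  by apply/funext => x; rewrite hornerMXaddC.
exact: (contD (contM IH fc) (fun x => cvg_cst c)).
Qed.
Lemma at_div f h x : continuous f -> continuous h -> h x != 0 ->
  (fun y => f y / h y) @ x --> f x / h x.
Proof. by move=> fc hc h0; apply: cvgM; [exact: fc|apply: cvgV => //; exact: hc]. Qed.
Lemma near_neq0 f x : continuous f -> f x != 0 -> \forall y \near x, f y != 0.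
Proof. by move=> fc fx; apply: (cvgr_neq0 _ (fc x)). Qed.
Lemma near_dist f x (e : C) : continuous f -> 0 < e -> \forall y \near x, `|f x - f y| < e.
Proof. by move=> fc e0; exact: (@cvgrPdist_lt _ _ _ (nbhs x) _ f (f x)).1 (fc x) e e0. Qed.
End ContC.

Lemma idC : continuous (fun x : C => x).
Proof. by move=> x; exact: cvg_id. Qed.

Lemma constc (T U : topologicalType) (c : U) : continuous (fun _ : T => c).
Proof. by move=> x; exact: cvg_cst. Qed.


Lemma nearS (T : topologicalType) (x : T) (P Q : T -> Prop) :
  (forall y, P y -> Q y) -> (\forall y \near x, P y) -> \forall y \near x, Q y.
Proof. exact: filterS. Qed.

Lemma nearI (T : topologicalType) (x : T) (P Q : T -> Prop) :
  (\forall y \near x, P y) -> (\forall y \near x, Q y) -> \forall y \near x, P y /\ Q y.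
Proof. exact: filterI. Qed.

Lemma near_cont (T U : topologicalType) (f : T -> U) (x : T) (P : U -> Prop) :
  {for x, continuous f} -> (\forall y \near f x, P y) -> \forall y \near x, P (f y).
Proof. by move=> fc H; exact: fc _ H. Qed.

Lemma lconst01 (T : Type) (h : R -> T) :
  (forall t : R, 0 <= t <= 1 -> \forall u \near t, 0 <= u <= 1 -> h u = h t) -> h 1 = h 0.
Proof.
move=> lc.
pose A := [set t : R | 0 <= t <= 1].
have AE : `[(0 : R), 1]%classic = A by apply/seteqP; split=> t; rewrite /= in_itv.
pose B := [set t | 0 <= t <= 1 /\ h t = h 0].
suff BA : B = A.
  have : A 1 by rewrite /A /= ler01 lexx.
  by rewrite -BA => -[].
have := @segment_connected R 0 1; rewrite AE; apply.
- by exists 0; split=> //; rewrite lexx ler01.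
- exists [set u | 0 <= u <= 1 -> h u = h 0]°; first exact: open_interior.
  apply/seteqP; split=> t.
    move=> [t01 ht]; split=> //.
    by have := lc t t01; apply: filterS => u hu u01; rewrite hu.
  by move=> [t01 /nbhs_singleton /= ht]; split=> //; exact: ht.
- exists (~` [set u | 0 <= u <= 1 -> h u <> h 0]°).
    by apply: open_closedC; exact: open_interior.
  apply/seteqP; split=> t.
    move=> [t01 ht]; split=> //.
    by move=> /nbhs_singleton /= ht'; exact: ht'.
  move=> [t01 nt]; split=> //.
  apply: contrapT => ht; apply: nt.
  by have := lc t t01; apply: filterS => u hu u01; rewrite hu.
Qed.

(** Compactness of the unit interval, for properties depending on a parameter. *)
Lemma near_seg (T : topologicalType) (y0 : T) (P : R -> T -> Prop) :
  (forall t : R, 0 <= t <= 1 -> \forall z \near (t, y0), P z.1 z.2) ->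
  \forall y \near y0, forall t, 0 <= t <= 1 -> P t y.
Proof.
move=> h.
have := (@compact_near_coveringP R `[0, 1]%classic).1 (@segment_compact R 0 1).
move=> /(_ T (nbhs y0) (fun y t => P t y) _) H.
have {}H : \near y0, `[(0 : R), 1]%classic `<=` (fun t => P t y0).
  apply: H => t; rewrite /= in_itv /= => t01.
  by have := h t t01.
by apply: filterS H => y Hy t t01; apply: Hy; rewrite /= in_itv.
Qed.

Definition lin (a b : C) (t : R) : C := a + rc t * (b - a).

Lemma lin0 a b : lin a b 0 = a. Proof. by rewrite /lin mul0r addr0. Qed.
Lemma lin1 a b : lin a b 1 = b. Proof. by rewrite /lin mul1r addrC subrK. Qed.

Lemma lin_cont (T : topologicalType) (f g : T -> C) (h : T -> R) :
  continuous f -> continuous g -> continuous h -> continuous (fun x => lin (f x) (g x) (h x)).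
Proof.
move=> fc gc hc x; apply: cvgD; first exact: fc.
apply: cvgM; last by apply: cvgB; [exact: gc|exact: fc].
exact: (cont_comp hc rcc).
Qed.

Lemma real_avoid (L : seq R) (e : R) : 0 < e -> exists r, [/\ 0 < r, r < e & r \notin L].
Proof.
elim: L e => [|l L IH] e e0; first by exists (e / 2); split=> //; lra.
have [r [r0 re rL]] := IH e e0.
have [rl|rl] := eqVneq r l; last by exists r; split=> //; rewrite inE negb_or rl.
have [r' [r'0 r're r'L]] := IH r r0.
by exists r'; split=> //; [lra|rewrite inE negb_or -rl lt_eqF].
Qed.

Definition im (z : C) : R := complex.Im z.
Definition re (z : C) : R := complex.Re z.

(** A finite set can be avoided by moving the end point slightly: each point
    of the set lies on at most one of the segments towards [b + i r (b - a)]. *)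
Lemma avoid_segment (L : seq C) (a b : C) (N : set C) : a \notin L -> nbhs b N ->
  exists2 c, N c & forall t, 0 <= t <= 1 -> lin a c t \notin L.
Proof.
move=> aL Nb; have [ab|ab] := eqVneq a b.
  exists b; first exact: nbhs_singleton.
  by move=> t _; rewrite ab /lin subrr mulr0 addr0 -ab.
pose c (r : R) := b + 'i * rc r * (b - a).
have cc : continuous c.
  move=> r; apply: cvgD; first exact: cvg_cst.
  apply: cvgM; last exact: cvg_cst.
  by apply: cvgM; [exact: cvg_cst|exact: rcc].
have c0 : c 0 = b by rewrite /c mulr0 mul0r addr0.
have : \forall r \near 0, N (c r) by apply: (cc 0); rewrite c0.
move=> /nbhs_ballP[e /= e0 he].
pose q (l : C) := im ((l - a) / (b - a)) / re ((l - a) / (b - a)).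
have [r [r0 re' rL]] := real_avoid [seq q l | l <- L] e0.
exists (c r).
  by apply: he; rewrite /ball /= sub0r normrN gtr0_norm.
move=> t t01; apply: contraNN rL => lL; apply/mapP; exists (lin a (c r) t) => //.
have ba : b - a != 0 by rewrite subr_eq0 eq_sym.
have E : (lin a (c r) t - a) / (b - a) = rc t * (1 + 'i * rc r).
  rewrite /lin [a + _]addrC addrK /c.
  by field.
rewrite /q E /re /im.
have -> : rc t * (1 + 'i * rc r) = (t +i* (t * r))%C.
  by apply/eqP; rewrite eq_complex /= /rc /=; apply/andP; split; apply/eqP; rewrite /=; ring.
rewrite /=; have [t0|t0] := eqVneq t 0; last by field.
by move: aL; rewrite -(lin0 a (c r)) -t0 lL.
Qed.

Definition convexC (A : set C) := forall a b t, A a -> A b -> 0 <= t <= 1 -> A (lin a b t).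

(** By [avoid_segment] a convex open set remains connected after the removal of finitely many points. *)
Lemma lconst_avoid (T : Type) (h : C -> T) (A : set C) (L : seq C) :
  convexC A -> open A ->
  (forall s, A s -> s \notin L -> \forall u \near s, h u = h s) ->
  forall a b, A a -> A b -> a \notin L -> b \notin L -> h a = h b.
Proof.
move=> cA oA lc a b Aa Ab aL bL.
have NA : \forall c \near b, A c /\ h c = h b.
  by apply: filterI; [exact: open_nbhs_nbhs|exact: lc].
have [c [Ac <-] cL] := avoid_segment aL NA.
transitivity (h (lin a c 0)); first by rewrite lin0.
transitivity (h (lin a c 1)); last by rewrite lin1.
apply/esym; apply: (@lconst01 _ (fun t => h (lin a c t))) => t t01.
have := lc _ (cA _ _ _ Aa Ac t01) (cL t t01).
have lcont : continuous (lin a c).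
  by apply: lin_cont => // x; [exact: cvg_cst|exact: cvg_cst|exact: cvg_id].
move=> H; have {}H : \forall u \near t, h (lin a c u) = h (lin a c t) := lcont t _ H.
by apply: filterS H => u hu _.
Qed.

End Segments.

(** * Continuity of the roots of a polynomial *)

Section Roots.
Context {R : realType}.
Local Notation C := R[i].

Definition proots (p : {poly C}) : seq C := sval (closed_field_poly_normal p).

Lemma prootsE p : p = lead_coef p *: \prod_(z <- proots p) ('X - z%:P).
Proof. exact: (svalP (closed_field_poly_normal p)). Qed.

Lemma size_proots (p : {poly C}) : p != 0 -> size p = (size (proots p)).+1.
Proof.
move=> p0; rewrite {1}[p]prootsE size_scale ?lead_coef_eq0 //.
by rewrite size_prod_XsubC.
Qed.

Lemma mem_proots (p : {poly C}) (x : C) : p != 0 -> (x \in proots p) = root p x.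
Proof.
move=> p0; rewrite {2}[p]prootsE rootZ ?lead_coef_eq0 //.
by rewrite root_prod_XsubC.
Qed.

Lemma proots_perm (c : C) (s : seq C) (p : {poly C}) : c != 0 ->
  p = c *: \prod_(z <- s) ('X - z%:P) -> perm_eq (proots p) s.
Proof.
move=> c0 pE; apply: prod_XsubC_eq.
have p0 : p != 0.
  by rewrite pE scaler_eq0 negb_or c0 monic_neq0 // monic_prod_XsubC.
have lp : lead_coef p = c.
  by rewrite pE lead_coefZ (monicP (monic_prod_XsubC _ _ _)) mulr1.
by apply: (scalerI c0); rewrite -pE -lp -prootsE.
Qed.

Lemma closest (r : C) (qs : seq C) : qs != [::] ->
  exists2 q, q \in qs & forall q', q' \in qs -> `|r - q| <= `|r - q'|.
Proof.
elim: qs => // q0 [|q1 qs] IH _.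
  by exists q0; rewrite ?inE // => q'; rewrite inE => /eqP ->.
have [//|q qin hq] := IH.
have [h|h] := real_leP (normr_real (r - q0)) (normr_real (r - q)).
  exists q0; first by rewrite inE eqxx.
  by move=> q'; rewrite inE => /orP[/eqP->//|/hq]; exact: le_trans.
exists q; first by rewrite inE qin orbT.
by move=> q'; rewrite inE => /orP[/eqP->|/hq//]; exact: ltW.
Qed.

(** The value at [r] is the product of the distances to the roots, hence at least a power of the
    smallest one. *)
Lemma closest_root (p : {poly C}) (r : C) : p \is monic -> (1 < size p)%N ->
  exists2 q, root p q & `|r - q| ^+ (size p).-1 <= `|p.[r]|.
Proof.
move=> pm sp.
have p0 : p != 0 := monic_neq0 pm.
have s0 : proots p != [::].
  by move: sp; rewrite size_proots // -size_eq0; case: (proots p).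
have [q qin hq] := closest r s0.
exists q; first by rewrite -mem_proots.
rewrite [p in p.[r]]prootsE (monicP pm) scale1r horner_prod normr_prod size_proots //=.
elim: (proots p) hq => [|a l IH] hq; first by rewrite big_nil expr0.
rewrite big_cons exprS; apply: ler_pM => //.
  by rewrite exprn_ge0.
  by rewrite hornerXsubC; apply: hq; rewrite inE eqxx.
by apply: IH => q' q'in; apply: hq; rewrite inE q'in orbT.
Qed.

Lemma cvg_sumr (I : Type) (r : seq I) (T : Type) (F : set_system T) (FF : Filter F)
    (f : I -> T -> C) (l : I -> C) :
  (forall i, f i t @[t --> F] --> l i) ->
  (\sum_(i <- r) f i t) @[t --> F] --> \sum_(i <- r) l i.
Proof.
move=> h; elim: r => [|i r IH].
  rewrite big_nil; under eq_fun do rewrite big_nil; exact: cvg_cst.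
rewrite big_cons; under eq_fun do rewrite big_cons.
by apply: cvgD; [exact: h|exact: IH].
Qed.

(** Divide by the factor of a root close to [r]; the coefficients of the
    quotient are obtained by descending recursion, hence converge as well. *)
Lemma roots_match (T : Type) (F : set_system T) (FF : Filter F) (f : T -> {poly C})
    (rs : seq C) :
  (forall i, (f t)`_i @[t --> F] --> (\prod_(r <- rs) ('X - r%:P))`_i) ->
  (\forall t \near F, f t \is monic /\ size (f t) = (size rs).+1) ->
  forall e : C, 0 < e ->
  \forall t \near F, exists qs, [/\ f t = \prod_(q <- qs) ('X - q%:P), size qs = size rs &
    forall i, (i < size rs)%N -> `|rs`_i - qs`_i| < e].
Proof.
elim: rs f => [|r rs IH] f cf mf e e0.
  apply: filterS mf => t [tm ts]; exists [::]; split=> //.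
  rewrite big_nil.
  have /size_poly1P[c c0 E] : size (f t) == 1%N by rewrite ts.
  by move: tm; rewrite E monicE lead_coefC => /eqP ->.
pose n := (size rs).+1.
pose Q t q := root (f t) q /\ `|r - q| ^+ n <= `|(f t).[r]|.
pose q t := xget 0 (Q t).
have qP : \forall t \near F, Q t (q t).
  apply: filterS mf => t [tm ts].
  have [|x x1 x2] := closest_root r tm; first by rewrite ts.
  by apply: (@xgetPex _ 0 (Q t)); exists x; split=> //; move: x2; rewrite ts.
have cr : (f t).[r] @[t --> F] --> (0 : C).
  have -> : 0 = \sum_(i < n.+1) (\prod_(x <- r :: rs) ('X - x%:P))`_i * r ^+ i.
    rewrite -horner_coef_wide ?size_prod_XsubC //.
    by rewrite big_cons hornerM hornerXsubC subrr mul0r.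
  apply: (@cvg_trans _ ((\sum_(i < n.+1) (f t)`_i * r ^+ i) @[t --> F])).
    apply: near_eq_cvg; apply: filterS mf => t [tm ts].
    by rewrite -horner_coef_wide ?ts.
  apply: cvg_sumr => i; apply: cvgM; [exact: cf|exact: cvg_cst].
have cq : q t @[t --> F] --> r.
  apply/cvgrPdist_lt => d d0.
  have d0' : 0 < d ^+ n by rewrite exprn_gt0.
  have H := cvgr0_norm_lt _ cr _ d0'.
  have {}H := H FF; move: qP H; apply: filterS2 => t [_ h1] h2.
  have : `|r - q t| ^+ n < d ^+ n by exact: le_lt_trans h1 h2.
  by rewrite ltr_pXn2r // nnegrE // ltW.
pose f1 t := f t %/ ('X - (q t)%:P).
have f1E : \forall t \near F, f t = f1 t * ('X - (q t)%:P).
  by apply: filterS qP => t [rt _]; rewrite /f1 divpK // dvdp_XsubCl.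
have mf1 : \forall t \near F, f1 t \is monic /\ size (f1 t) = (size rs).+1.
  move: f1E mf; apply: filterS2 => t E [tm ts]; split.
    by move: tm; rewrite {1}E monicMr // monicXsubC.
  have f10 : f1 t != 0.
    by apply: contraTneq tm => f10; rewrite E f10 mul0r monicE lead_coef0 eq_sym oner_eq0.
  by move: ts; rewrite E size_Mmonic ?monicXsubC // size_XsubC addn2 /= => -[].
have g1E i : (\prod_(x <- rs) ('X - x%:P))`_i =
    (\prod_(x <- r :: rs) ('X - x%:P))`_i.+1 + r * (\prod_(x <- rs) ('X - x%:P))`_i.+1.
  rewrite big_cons mulrBl coefB coefXM /= mul_polyC coefZ subrK //.
have cf1 k i : (n - i < k)%N ->
    (f1 t)`_i @[t --> F] --> (\prod_(x <- rs) ('X - x%:P))`_i.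
  elim: k i => [i|k IHk i ik]; first by rewrite ltn0 => h; case: (notF h).
  have [ni|ni] := leqP n i.
    have -> : (\prod_(x <- rs) ('X - x%:P))`_i = 0.
      by rewrite nth_default // size_prod_XsubC.
    apply: (@cvg_trans _ ((0 : C) @[t --> F])); last exact: cvg_cst.
    by apply: near_eq_cvg; apply: filterS mf1 => t [_ ts]; rewrite nth_default // ts.
  rewrite g1E.
  apply: (@cvg_trans _ (((f t)`_i.+1 + q t * (f1 t)`_i.+1) @[t --> F])).
    apply: near_eq_cvg; apply: filterS f1E => t E.
    by rewrite {1}E mulrBr coefB coefMX /= coefMC mulrC subrK.
  apply: cvgD; first exact: cf.
  apply: cvgM; first exact: cq.
  by apply: IHk; apply: leq_trans (_ : n - i <= k)%N; rewrite ?ltn_sub2l // -ltnS.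
have H := IH f1 (fun i => cf1 _ i (ltnSn _)) mf1 e e0.
have H2 := (@cvgrPdist_lt _ _ _ F FF q r).1 cq e e0.
move: f1E H H2; apply: filterS3 => t E [qs [Eq sq hq]] hr.
exists (q t :: qs); split=> /=; first by rewrite big_cons E Eq mulrC.
  by rewrite sq.
by case=> [|i] //= ; rewrite ltnS; exact: hq.
Qed.

Definition sumroots (V : nmodType) (p : {poly C}) (w : C -> V) := \sum_(b <- proots p) w b.

(** Weighted counts of roots are locally constant as long as no root
    escapes to infinity and the weight of a root is locally constant. *)
Lemma sumroots_near (T : topologicalType) (V : nmodType) (f : T -> {poly C}) (t0 : T)
    (w : T -> C -> V) n :
  (forall i, (f t)`_i @[t --> t0] --> (f t0)`_i) ->
  size (f t0) = n.+1 -> (\forall t \near t0, (size (f t) <= n.+1)%N) ->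
  (forall b0, root (f t0) b0 ->
     \forall z \near (t0, b0), root (f z.1) z.2 -> w z.1 z.2 = w t0 b0) ->
  \forall t \near t0, sumroots (f t) (w t) = sumroots (f t0) (w t0).
Proof.
move=> cf sf sn wn.
have f0 : f t0 != 0 by rewrite -size_poly_gt0 sf.
set rs := proots (f t0).
have srs : size rs = n by move: sf; rewrite size_proots // => -[].
have l0 : (f t0)`_n != 0 by move: f0; rewrite -lead_coef_eq0 /lead_coef sf.
have ln : \forall t \near t0, (f t)`_n != 0.
  by apply: (cvgr_neq0 _ (cf n)).
pose g t := ((f t)`_n)^-1 *: f t.
have sz : \forall t \near t0, size (f t) = n.+1.
  move: sn ln; apply: filterS2 => t h1 h2; apply/eqP; rewrite eqn_leq h1 /= ltnNge.
  by apply: contraNN h2 => h2; rewrite nth_default.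
have mg : \forall t \near t0, g t \is monic /\ size (g t) = (size rs).+1.
  move: sz ln; apply: filterS2 => t h1 h2; split.
    by rewrite monicE lead_coefZ /lead_coef h1 mulVf.
  by rewrite size_scale ?invr_neq0 // srs.
have cg i : (g t)`_i @[t --> t0] --> (\prod_(r <- rs) ('X - r%:P))`_i.
  have -> : (\prod_(r <- rs) ('X - r%:P))`_i = ((f t0)`_n)^-1 * (f t0)`_i.
    have := prootsE (f t0); rewrite -/rs /lead_coef sf /= => {2}->.
    by rewrite coefZ mulKf.
  have -> : (fun t => (g t)`_i) = (fun t => ((f t)`_n)^-1 * (f t)`_i).
    by apply/funext => t; rewrite coefZ.
  by apply: cvgM; [apply: cvgV|].
(* a common radius for the finitely many roots of f t0 *)
have [e e0 he] : exists2 e : C, 0 < e & \forall t \near t0, forall b0 b, b0 \in rs ->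
    `|b0 - b| < e -> root (f t) b -> w t b = w t0 b0.
  have : forall b0, b0 \in rs -> root (f t0) b0 by move=> b0; rewrite mem_proots.
  elim: (rs) => [|b0 l IH] hr; first by exists 1 => //; apply: nearW => t b0 b.
  have [|e1 e10 h1] := IH; first by move=> b bl; apply: hr; rewrite inE bl orbT.
  have := wn b0 (hr b0 (mem_head _ _)).
  case=> -[A B] /= [/= nA nB] AB.
  have /nbhs_ballP[e2 /= e20 hB] := nB.
  exists (Order.min e1 e2); first by rewrite minElt; case: ifP.
  have le1 : Order.min e1 e2 <= e1.
    by rewrite minElt; case: ifP => // h; rewrite real_leNgt ?gtr0_real // h.
  have le2 : Order.min e1 e2 <= e2 by rewrite minElt; case: ifP => // /ltW.
  move: h1 nA; apply: filterS2 => t ht At b b' ; rewrite inE => /orP[/eqP->|bl] lt rt.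
    apply: (AB (t, b')) => //; split=> //=; apply: hB.
    exact: lt_le_trans lt le2.
  apply: ht => //; exact: lt_le_trans lt le1.
have H := @roots_match _ (nbhs t0) (nbhs_filter t0) g rs cg mg e e0.
apply: (filterS _ (filterI (filterI H he) (filterI sz ln))).
move=> t [[[qs [Eg sq hq]] ht] [st lt]].
have fE : f t = (f t)`_n *: \prod_(q <- qs) ('X - q%:P).
  by rewrite -Eg /g scalerA mulfV // scale1r.
rewrite /sumroots -/rs (perm_big _ (proots_perm lt fE)) /=.
have rq b : b \in qs -> root (f t) b.
  by move=> bq; rewrite fE rootZ // root_prod_XsubC.
rewrite (big_nth 0) [RHS](big_nth 0) sq !big_mkord; apply: eq_bigr => i _.
have iq : qs`_i \in qs by rewrite mem_nth // sq.
by apply: ht; rewrite ?mem_nth // ?hq //; exact: rq.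
Qed.

End Roots.
Section ReIm.
Context {R : realType}.
Local Notation C := R[i].
Implicit Types (x y : C) (t : R).

Lemma reD x y : re (x + y) = re x + re y. Proof. by case: x y => [a b] [c d]. Qed.
Lemma imD x y : im (x + y) = im x + im y. Proof. by case: x y => [a b] [c d]. Qed.
Lemma reN x : re (- x) = - re x. Proof. by case: x. Qed.
Lemma imN x : im (- x) = - im x. Proof. by case: x. Qed.
Lemma reM x y : re (x * y) = re x * re y - im x * im y.
Proof. by case: x y => [a b] [c d]. Qed.
Lemma imM x y : im (x * y) = re x * im y + im x * re y.
Proof. by case: x y => [a b] [c d]. Qed.
Lemma re_rc t : re (rc t) = t. Proof. by []. Qed.
Lemma im_rc t : im (rc t) = 0. Proof. by []. Qed.
Lemma re_i : re ('i : C) = 0. Proof. by []. Qed.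
Lemma im_i : im ('i : C) = 1. Proof. by []. Qed.
Lemma re1 : re (1 : C) = 1. Proof. by []. Qed.
Lemma im1 : im (1 : C) = 0. Proof. by []. Qed.
Lemma re0 : re (0 : C) = 0. Proof. by []. Qed.
Lemma im0 : im (0 : C) = 0. Proof. by []. Qed.

Definition reimE := (reD, imD, reN, imN, reM, imM, re_rc, im_rc, re_i, im_i, re1, im1, re0, im0).

Lemma eqC x y : re x = re y -> im x = im y -> x = y.
Proof. by case: x y => [a b] [c d] /= -> ->. Qed.

Lemma reimK x : x = rc (re x) + 'i * rc (im x).
Proof. by apply: eqC; rewrite !reimE; ring. Qed.

Lemma re_cont : continuous (re : C -> R).
Proof.
move=> x; apply/(@cvgrPdist_lt _ _ _ (nbhs x) (nbhs_filter x)) => e e0.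
have H : \forall y \near x, `|x - y| < rc e.
  by apply: (near_dist (f := fun y : C => y)); [exact: idC|rewrite ltcR].
apply: nearS H => y h; rewrite -ltcR -/(rc _) -/(rc e).
by apply: le_lt_trans h; rewrite -reN -reD; exact: normc_ge_Re.
Qed.

Lemma im_cont : continuous (im : C -> R).
Proof.
have -> : im = (fun y => re (- 'i * y)) :> (C -> R).
  by apply/funext => y; rewrite !reimE; ring.
have c : continuous (fun y : C => - 'i * y) by apply: contM; [exact: cont_cst|exact: idC].
exact: (cont_comp c re_cont).
Qed.

End ReIm.

(** * Meridians in a fibre *)

Section Flat.
Context {R : realType} {G : groupType}.
Local Notation C := R[i].
Implicit Types (b z e : C) (y : C * C) (a : R -> C * C).

Definition inside (Om : C * C -> Prop) a := forall t, 0 <= t <= 1 -> Om (a t).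

(** The properties of the parallel transport of a covering of [Om] that are used: triviality around
    squares stands for homotopy invariance, and only the restriction of a path to [0, 1] matters. *)
Definition flat (Om : C * C -> Prop) (g : (R -> C * C) -> G) :=
  [/\ forall K : R * R -> C * C, continuous K ->
        (forall s t, 0 <= s <= 1 -> 0 <= t <= 1 -> Om (K (s, t))) ->
        (g (fun t => K (t, 0%R)) * g (fun t => K (1%R, t)) =
         g (fun t => K (0%R, t)) * g (fun t => K (t, 1%R)))%g,
      forall a a', continuous a -> continuous a' -> a 1 = a' 0 -> inside Om a -> inside Om a' ->
        (g (pcat a a') = g a * g a')%g,
      forall y, Om y -> g (fun=> y) = 1%g &
      forall a a', continuous a -> continuous a' -> inside Om a ->
        (forall t, 0 <= t <= 1 -> a t = a' t) -> g a = g a'].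

Variables (Om : C * C -> Prop) (g : (R -> C * C) -> G).
Hypothesis gflat : flat Om g.

Let g_sq := let: And4 h _ _ _ := gflat in h.
Let g_cst := let: And4 _ _ h _ := gflat in h.

(** [L] joins two points of the total space, [sg] two points of the fibre over [b], by a segment. *)
Definition L y y' t : C * C := (lin y.1 y'.1 t, lin y.2 y'.2 t).

Definition sg b z w t : C * C := (b, lin z w t).
Definition sin b z w := inside Om (sg b z w).

Lemma Lcst y : L y y = (fun=> y).
Proof. by apply/funext => t; rewrite /L /lin !subrr !mulr0 !addr0 -surjective_pairing. Qed.

Lemma lin_c (z w : C) : continuous (lin z w).
Proof. by apply: lin_cont => t; [exact: cvg_cst|exact: cvg_cst|exact: cvg_id]. Qed.

Lemma sq_move b b' z z' w w' :
  (forall s, 0 <= s <= 1 -> sin (lin b b' s) (lin z z' s) (lin w w' s)) ->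
  (g (L (b, z) (b', z')) * g (sg b' z' w') = g (sg b z w) * g (L (b, w) (b', w')))%g.
Proof.
move=> h.
pose K (x : R * R) : C * C := (lin b b' x.1, lin (lin z z' x.1) (lin w w' x.1) x.2).
have Kc : continuous K.
  have lc (p p' : C) : continuous (fun x : R * R => lin p p' x.1).
    by apply: (cont_comp fstc); exact: lin_c.
  apply: cont_pair; first exact: lc.
  by apply: lin_cont; [exact: lc|exact: lc|exact: sndc].
have := g_sq Kc (fun s t s01 t01 => h s s01 t t01).
have -> : (fun t => K (t, 0)) = L (b, z) (b', z').
  by apply/funext => t; rewrite /K /L /= lin0.
have -> : (fun t => K (t, 1)) = L (b, w) (b', w').
  by apply/funext => t; rewrite /K /L /= lin1.
have -> : (fun t => K (0, t)) = sg b z w.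
  by apply/funext => t; rewrite /K /sg /= !lin0.
have -> // : (fun t => K (1, t)) = sg b' z' w'.
by apply/funext => t; rewrite /K /sg /= !lin1.
Qed.

Lemma sg_tri b z w v :
  (forall s t, 0 <= s <= 1 -> 0 <= t <= 1 -> Om (b, lin z (lin w v t) s)) ->
  (g (sg b z w) * g (sg b w v) = g (sg b z v))%g.
Proof.
move=> h.
pose K (x : R * R) : C * C := (b, lin z (lin w v x.2) x.1).
have Kc : continuous K.
  apply: cont_pair; first exact: cont_cst.
  apply: lin_cont; [exact: cont_cst| |exact: fstc].
  by apply: (cont_comp sndc); exact: lin_c.
have := g_sq Kc h.
have -> : (fun t => K (t, 0)) = sg b z w.
  by apply/funext => t; rewrite /K /sg /= lin0.
have -> : (fun t => K (t, 1)) = sg b z v.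
  by apply/funext => t; rewrite /K /sg /= lin1.
have -> : (fun t => K (0, t)) = (fun=> (b, z)).
  by apply/funext => t; rewrite /K /= lin0.
have -> : (fun t => K (1, t)) = sg b w v.
  by apply/funext => t; rewrite /K /= lin1.
rewrite g_cst ?mul1g //.
by have := h 0 0; rewrite lin0 lexx ler01; apply.
Qed.

Lemma mulr01 (s t : R) : 0 <= s <= 1 -> 0 <= t <= 1 -> 0 <= s * t <= 1.
Proof. by move=> /andP[s0 s1] /andP[t0 t1]; rewrite mulr_ge0 // mulr_ile1. Qed.

Lemma sg_split b z v (u : R) : 0 <= u <= 1 -> sin b z v ->
  (g (sg b z v) = g (sg b z (lin z v u)) * g (sg b (lin z v u) v))%g.
Proof.
move=> u01 h; apply/esym/sg_tri => s t s01 t01.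
have -> : lin z (lin (lin z v u) v t) s = lin z v (s * (u + t * (1 - u))).
  by rewrite /lin !(rcM, rcD, rcB, rc1); ring.
apply: h; apply: mulr01 => //.
by move: u01 t01 => /andP[? ?] /andP[? ?]; apply/andP; split; nra.
Qed.

Lemma sg_rev b z w : sin b z w -> (g (sg b z w) * g (sg b w z) = 1)%g.
Proof.
move=> h; rewrite sg_tri.
  have -> : sg b z z = (fun=> (b, z)).
    by apply/funext => t; rewrite /sg /lin subrr mulr0 addr0.
  by rewrite g_cst //; have := h 0; rewrite /sg lin0 lexx ler01; apply.
move=> s t s01 t01.
have -> : lin z (lin w z t) s = lin z w (s * (1 - t)).
  by rewrite /lin !(rcM, rcD, rcB, rc1); ring.
apply: h; apply: mulr01 => //.
by move: t01 => /andP[? ?]; apply/andP; split; lra.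
Qed.

Lemma sin_sym b z w : sin b z w -> sin b w z.
Proof.
move=> h t /andP[t0 t1]; have := h (1 - t).
rewrite /sg (_ : lin w z t = lin z w (1 - t)); first by apply; apply/andP; split; lra.
by rewrite /lin rcB rc1; ring.
Qed.

Definition tin b z w v := [/\ sin b z w, sin b w v & sin b v z].
Definition tri b z w v : G := (g (sg b z w) * g (sg b w v) * g (sg b v z))%g.

Lemma tri_move b b' z z' w w' v v' :
  (forall s, 0 <= s <= 1 -> tin (lin b b' s) (lin z z' s) (lin w w' s) (lin v v' s)) ->
  (tri b' z' w' v' = (g (L (b, z) (b', z')))^-1 * tri b z w v * g (L (b, z) (b', z')))%g.
Proof.
move=> h; rewrite /tri.
have H1 : (g (L (b, z) (b', z')) * g (sg b' z' w') = g (sg b z w) * g (L (b, w) (b', w')))%g.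
  by apply: sq_move => s s01; have [] := h s s01.
have H2 : (g (L (b, w) (b', w')) * g (sg b' w' v') = g (sg b w v) * g (L (b, v) (b', v')))%g.
  by apply: sq_move => s s01; have [] := h s s01.
have H3 : (g (L (b, v) (b', v')) * g (sg b' v' z') = g (sg b v z) * g (L (b, z) (b', z')))%g.
  by apply: sq_move => s s01; have [] := h s s01.
apply: (mulgI (g (L (b, z) (b', z')))); rewrite !mulgA mulgV mul1g H1.
by rewrite -!mulgA; congr (_ * _)%g; rewrite mulgA H2 -mulgA; congr (_ * _)%g.
Qed.

(** Points of the fibre plane in the affine coordinate with origin [z] and
    unit [e]. *)
Definition pt z e (u : C) : C := z + u * (e - z).

Lemma pt0 z e : pt z e 0 = z. Proof. by rewrite /pt mul0r addr0. Qed.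
Lemma pt1 z e : pt z e 1 = e. Proof. by rewrite /pt mul1r addrC subrK. Qed.
Lemma pt_lin z e u v t : lin (pt z e u) (pt z e v) t = pt z e (lin u v t).
Proof. by rewrite /pt /lin; ring. Qed.
Lemma pt_linz z e v t : lin z (pt z e v) t = pt z e (lin 0 v t).
Proof. by rewrite -{1}(pt0 z e) pt_lin. Qed.
Lemma pt_linz' z e v t : lin (pt z e v) z t = pt z e (lin v 0 t).
Proof. by rewrite -{2}(pt0 z e) pt_lin. Qed.
Lemma ptK z e u : z != e -> (pt z e u - z) / (e - z) = u.
Proof. by move=> ze; rewrite /pt [z + _]addrC addrK mulfK // subr_eq0 eq_sym. Qed.

Lemma itp_gt (a x y t : R) : 0 <= t <= 1 -> a < x -> a < y -> a < x + t * (y - x).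
Proof.
move=> /andP[t0 t1] ax ay; have [xy|xy] := leP x y; first by nra.
have : 0 <= (1 - t) * (x - y) by rewrite mulr_ge0; lra.
by move=> h; rewrite (_ : x + t * (y - x) = y + (1 - t) * (x - y)); [lra|ring].
Qed.

Lemma itp_lt (a x y t : R) : 0 <= t <= 1 -> x < a -> y < a -> x + t * (y - x) < a.
Proof.
move=> t01 xa ya; have := @itp_gt (- a) (- x) (- y) t t01; rewrite !ltrN2 => /(_ xa ya).
by rewrite (_ : - x + t * (- y - - x) = - (x + t * (y - x))) ?ltrN2 //; ring.
Qed.

(** In the coordinate with origin [z] and unit [e], the point [e] is the only one of the curve in [K]. *)
Definition lone b z e (K : set C) :=
  forall f, ~ Om (b, f) -> f != e -> ~ K ((f - z) / (e - z)).

Lemma lin01E (u v : C) t : re (lin u v t) = re u + t * (re v - re u) /\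
  im (lin u v t) = im u + t * (im v - im u).
Proof. by rewrite /lin !reimE; split; ring. Qed.

(** The two sides at [z] leave on both sides of the ray through [e], and the third one crosses it beyond [e]. *)
Lemma tin_lone b z e (K : set C) (u v : C) : z != e -> convexC K -> K 0 -> K u -> K v ->
  lone b z e K -> 1 < re u -> im u < 0 -> 1 < re v -> 0 < im v ->
  tin b z (pt z e u) (pt z e v).
Proof.
move=> ze cK K0 Ku Kv lK ru iu rv iv.
have key w : K w -> w <> 1 -> Om (b, pt z e w).
  move=> Kw w1; apply: contrapT => nO.
  have [E|E] := eqVneq (pt z e w) e.
    by apply: w1; rewrite -(ptK w ze) E divff // subr_eq0 eq_sym.
  by have := lK _ nO E; rewrite ptK //; apply.
have z0 (t x : R) : x != 0 -> t * x = 0 -> t = 0.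
  by move=> x0 /eqP; rewrite mulf_eq0 (negbTE x0) orbF => /eqP.
split=> t t01; rewrite /sg ?pt_lin ?pt_linz ?pt_linz'; apply: key; try exact: cK.
- move=> E; have := congr1 re E; have := congr1 im E.
  rewrite /lin !reimE => e2 e1.
  have t0 : t = 0 by apply: (z0 _ (im u)); [rewrite lt_eqF|lra].
  by move: e1; rewrite t0; lra.
- move=> /(congr1 re); have := itp_gt t01 ru rv; have [-> _] := lin01E u v t.
  by rewrite re1; lra.
- move=> E; have := congr1 re E; have := congr1 im E.
  rewrite /lin !reimE => e2 e1.
  have t0 : 1 - t = 0 by apply: (z0 _ (im v)); [rewrite gt_eqF|lra].
  have t1 : t = 1 by lra.
  by move: e1; rewrite t1; lra.
Qed.

(** The vertices are moved inside [K], each on its side of the ray through [e]: no point of the curve is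
    swept. *)
Lemma tri_deform b z e (K : set C) (u v u' v' : C) : z != e -> convexC K -> K 0 ->
  lone b z e K -> K u -> K v -> K u' -> K v' ->
  1 < re u -> im u < 0 -> 1 < re v -> 0 < im v ->
  1 < re u' -> im u' < 0 -> 1 < re v' -> 0 < im v' ->
  tri b z (pt z e u) (pt z e v) = tri b z (pt z e u') (pt z e v').
Proof.
move=> ze cK K0 lK Ku Kv Ku' Kv' ru iu rv iv ru' iu' rv' iv'.
have linc (x : C) s : lin x x s = x by rewrite /lin subrr mulr0 addr0.
have Ozb : Om (b, z).
  have [] := tin_lone ze cK K0 Ku Kv lK ru iu rv iv => /(_ 0).
  by rewrite /sg lin0 lexx ler01 => + _ _; apply.
have := @tri_move b b z z (pt z e u) (pt z e u') (pt z e v) (pt z e v').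
rewrite Lcst g_cst // invg1 mul1g mulg1 => <- // s /andP[s0 s1].
rewrite !linc !pt_lin.
have s01 : 0 <= s <= 1 by rewrite s0.
have [E1 E2] := lin01E u u' s; have [E3 E4] := lin01E v v' s.
by apply: (@tin_lone b z e K) => //; try exact: cK; rewrite ?E1 ?E2 ?E3 ?E4 ?itp_gt ?itp_lt.
Qed.

Definition cone (u v : C) : set C :=
  [set w | exists x y : R, [/\ 0 <= x, 0 <= y & w = rc x * u + rc y * v]].

Lemma cone_convex u v : convexC (cone u v).
Proof.
move=> w w' t [x [y [x0 y0 ->]]] [x' [y' [x'0 y'0 ->]]] /andP[t0 t1].
exists (x + t * (x' - x)), (y + t * (y' - y)); split; [nra|nra|].
by rewrite /lin !(rcD, rcM, rcB); ring.
Qed.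

Lemma cone0 u v : cone u v 0.
Proof. by exists 0, 0; split; rewrite ?lexx // rc0 !mul0r addr0. Qed.

Lemma conel u v : cone u v u.
Proof. by exists 1, 0; split; rewrite ?lexx ?ler01 // rc0 rc1 mul0r mul1r addr0. Qed.

Lemma coner u v : cone u v v.
Proof. by exists 0, 1; split; rewrite ?lexx ?ler01 // rc0 rc1 mul0r mul1r add0r. Qed.

(** The standard triangle: vertices [(1 + h) (1 -+ i h)] in the coordinate
    where the root is [1]. *)
Definition vl (h : R) : C := rc (1 + h) * (1 - 'i * rc h).
Definition vr (h : R) : C := rc (1 + h) * (1 + 'i * rc h).

Lemma vlE h : re (vl h) = 1 + h /\ im (vl h) = - ((1 + h) * h).
Proof. by rewrite /vl !reimE; split; ring. Qed.
Lemma vrE h : re (vr h) = 1 + h /\ im (vr h) = (1 + h) * h.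
Proof. by rewrite /vr !reimE; split; ring. Qed.

(** The triangle with vertices [0], [vl h], [vr h]. *)
Definition wedge (h : R) : set C :=
  [set u | [/\ 0 <= re u, re u <= 1 + h, - (h * re u) <= im u & im u <= h * re u]].

Lemma wedge_convex h : convexC (wedge h).
Proof.
move=> u v t [u1 u2 u3 u4] [v1 v2 v3 v4] /andP[t0 t1].
by have [E1 E2] := lin01E u v t; split; rewrite ?E1 ?E2; nra.
Qed.

Lemma wedge0 h : 0 <= h -> wedge h 0.
Proof. by move=> h0; split; rewrite !reimE; lra. Qed.

Lemma wedge_vl h : 0 <= h -> wedge h (vl h).
Proof. by move=> h0; have [E1 E2] := vlE h; split; rewrite ?E1 ?E2; nra. Qed.

Lemma wedge_vr h : 0 <= h -> wedge h (vr h).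
Proof. by move=> h0; have [E1 E2] := vrE h; split; rewrite ?E1 ?E2; nra. Qed.

Lemma wedgeS h h' u : 0 <= h -> h <= h' -> wedge h u -> wedge h' u.
Proof. by move=> h0 hh [u1 u2 u3 u4]; split; nra. Qed.

Definition good b z e h := [/\ 0 < h, z != e & lone b z e (wedge h)].

Definition stri b z e h := tri b z (pt z e (vl h)) (pt z e (vr h)).

Lemma good_le b z e h h' : 0 < h -> h <= h' -> good b z e h' -> good b z e h.
Proof.
move=> h0 hh [h'0 ze l]; split=> // f nO fe hw; apply: (l f nO fe).
by apply: wedgeS hw => //; exact: ltW.
Qed.

Lemma stri_le b z e h h' : 0 < h -> h <= h' -> good b z e h' -> stri b z e h = stri b z e h'.
Proof.
move=> h0 hh [h'0 ze l]; have [E1 E2] := vlE h; have [E3 E4] := vrE h.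
have [E5 E6] := vlE h'; have [E7 E8] := vrE h'.
have h0' := ltW h0; have h'0' := ltW h'0.
apply: (@tri_deform b z e (wedge h')) => //; rewrite ?E1 ?E2 ?E3 ?E4 ?E5 ?E6 ?E7 ?E8; try nra.
- exact: wedge_convex.
- exact: wedge0.
- by apply: (wedgeS h0' hh); exact: wedge_vl.
- by apply: (wedgeS h0' hh); exact: wedge_vr.
- exact: wedge_vl.
- exact: wedge_vr.
Qed.

Lemma stri_indep b z e h h' : good b z e h -> good b z e h' -> stri b z e h = stri b z e h'.
Proof.
move=> gh gh'; have [hh|hh] := leP h h'; first by apply: stri_le => //; case: gh.
by apply/esym/stri_le => //; [case: gh'|exact: ltW].
Qed.

(** All good [h] give the same value by [stri_indep], so that any of them may be chosen. *)
Definition mer b z e : G := stri b z e (xget 1 [set h | good b z e h]).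

Lemma merE b z e h : good b z e h -> mer b z e = stri b z e h.
Proof.
move=> gh; apply: (fun g1 => stri_indep g1 gh).
by apply: (@xgetPex _ 1 [set h | good b z e h]); exists h.
Qed.

Lemma tin_good b z e h : good b z e h -> tin b z (pt z e (vl h)) (pt z e (vr h)).
Proof.
move=> [h0 ze l]; have h0' := ltW h0; have [E1 E2] := vlE h; have [E3 E4] := vrE h.
apply: (@tin_lone b z e (wedge h)) => //; rewrite ?E1 ?E2 ?E3 ?E4; try nra.
- exact: wedge_convex.
- exact: wedge0.
- exact: wedge_vl.
- exact: wedge_vr.
Qed.

(** Meridians are recognized in this form, by [tri_deform] with the cone as the convex set. *)
Lemma tri_cone b z e (u v : C) : z != e -> lone b z e (cone u v) ->
  1 < re u -> im u < 0 -> 1 < re v -> 0 < im v ->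
  tri b z (pt z e u) (pt z e v) = mer b z e /\ exists h, good b z e h.
Proof.
move=> ze l ru iu rv iv.
pose h := Order.min (- im u / re u) (im v / re v).
have h0 : 0 < h by rewrite /h lt_min !divr_gt0 // ?oppr_gt0 //; lra.
have h1 : h * re u <= - im u by rewrite -ler_pdivlMr ?ge_min ?lexx //; lra.
have h2 : h * re v <= im v by rewrite -ler_pdivlMr ?ge_min ?lexx ?orbT //; lra.
pose dt := re u * im v - im u * re v.
have dt0 : 0 < dt by rewrite /dt; nra.
have sub w : 0 <= re w -> - (h * re w) <= im w -> im w <= h * re w -> cone u v w.
  move=> w0 w1 w2.
  exists ((re w * im v - im w * re v) / dt), ((im w * re u - re w * im u) / dt); split.
  - by rewrite divr_ge0 ?(ltW dt0) //; nra.
  - by rewrite divr_ge0 ?(ltW dt0) //; nra.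
  - have dn : dt != 0 by rewrite gt_eqF.
    by apply: eqC; rewrite !reimE; move: dn; rewrite /dt => dn; field.
have gh : good b z e h.
  split=> // f nO fe [w1 w2 w3 w4]; apply: (l f nO fe); exact: sub.
split; last by exists h.
rewrite (merE gh) /stri.
have [E1 E2] := vlE h; have [E3 E4] := vrE h.
apply: (@tri_deform b z e (cone u v)) => //; rewrite ?E1 ?E2 ?E3 ?E4; try nra.
- exact: cone_convex.
- exact: cone0.
- exact: conel.
- exact: coner.
- by apply: sub; rewrite ?E1 ?E2; nra.
- by apply: sub; rewrite ?E3 ?E4; nra.
Qed.

End Flat.

Section Cubic.
Context {R : realType} {G : groupType}.
Local Notation C := R[i].
Variables (P q : {poly C}).

Definition cub (y : C * C) : C := y.2 ^+ 3 + P.[y.1] * y.2 + q.[y.1].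
Definition Om (y : C * C) : Prop := cub y != 0.
Definition roots3 (b e1 e2 e3 : C) := forall v, cub (b, v) = (v - e1) * (v - e2) * (v - e3).

Variable g : (R -> C * C) -> G.
Hypothesis gflat : flat Om g.

Lemma cub_cont (T : topologicalType) (be v : T -> C) :
  continuous be -> continuous v -> continuous (fun x => cub (be x, v x)).
Proof.
move=> bc vc.
exact: (contD (contD (contX (n := 3) vc) (contM (cont_horner (p := P) bc) vc))
  (cont_horner (p := q) bc)).
Qed.

Lemma rootP b e1 e2 e3 f : roots3 b e1 e2 e3 -> ~ Om (b, f) <-> [\/ f = e1, f = e2 | f = e3].
Proof.
move=> r; rewrite /Om r; split.
  move=> /negP; rewrite negbK !mulf_eq0 !subr_eq0 => /orP[/orP[]|] /eqP ->;
    by [constructor 1|constructor 2|constructor 3].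
by case=> ->; rewrite subrr ?mulr0 ?mul0r eqxx.
Qed.

(** Openness for each point of the segment and compactness of the segment. *)
Lemma near_sin (T : topologicalType) (be z w : T -> C) (x0 : T) :
  continuous be -> continuous z -> continuous w -> sin Om (be x0) (z x0) (w x0) ->
  \forall x \near x0, sin Om (be x) (z x) (w x).
Proof.
move=> bc zc wc h.
apply: (@near_seg R T x0 (fun t x => Om (be x, lin (z x) (w x) t))) => t t01.
pose F (y : R * T) := cub (be y.2, lin (z y.2) (w y.2) y.1).
apply: (@near_neq0 R _ F (t, x0)); last exact: h.
have sc : continuous (fun y : R * T => y.2) by move=> y; exact: cvg_snd.
have fc : continuous (fun y : R * T => y.1) by move=> y; exact: cvg_fst.
apply: cub_cont; first exact: (cont_comp sc bc).
by apply: lin_cont => //; [exact: (cont_comp sc zc)|exact: (cont_comp sc wc)].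
Qed.

Lemma near_sin_lin (T : topologicalType) (be z w : T -> C) (x0 : T) :
  continuous be -> continuous z -> continuous w -> sin Om (be x0) (z x0) (w x0) ->
  \forall x \near x0, forall s, 0 <= s <= 1 ->
    sin Om (lin (be x0) (be x) s) (lin (z x0) (z x) s) (lin (w x0) (w x) s).
Proof.
move=> bc zc wc h.
have lc (f : T -> C) : continuous f -> continuous (fun y : R * T => lin (f x0) (f y.2) y.1).
  move=> fc; apply: lin_cont; [exact: cont_cst| |by move=> y; exact: cvg_fst].
  by apply: cont_comp fc => y; exact: cvg_snd.
apply: (@near_seg R T x0 (fun s x =>
  sin Om (lin (be x0) (be x) s) (lin (z x0) (z x) s) (lin (w x0) (w x) s))) => s s01.
apply: (@near_sin _ (fun y : R * T => lin (be x0) (be y.2) y.1)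
  (fun y => lin (z x0) (z y.2) y.1) (fun y => lin (w x0) (w y.2) y.1) (s, x0)); try exact: lc.
by rewrite /= /lin !subrr !mulr0 !addr0.
Qed.

Lemma tri_near (T : topologicalType) (be z w v : T -> C) (x0 : T) :
  continuous be -> continuous z -> continuous w -> continuous v ->
  tin Om (be x0) (z x0) (w x0) (v x0) ->
  \forall x \near x0, tri g (be x) (z x) (w x) (v x) =
    ((g (L (be x0, z x0) (be x, z x)))^-1 * tri g (be x0) (z x0) (w x0) (v x0) *
      g (L (be x0, z x0) (be x, z x)))%g.
Proof.
move=> bc zc wc vc [h1 h2 h3].
have H := nearI (near_sin_lin bc zc wc h1) (nearI (near_sin_lin bc wc vc h2)
  (near_sin_lin bc vc zc h3)).
apply: nearS H => x [k1 [k2 k3]].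
by apply: (tri_move gflat) => s s01; split; [exact: k1|exact: k2|exact: k3].
Qed.

Lemma near_gt0 (T : topologicalType) (f : T -> R) (x0 : T) :
  {for x0, continuous f} -> 0 < f x0 -> \forall x \near x0, 0 < f x.
Proof. by move=> fc f0; exact: (cvgr_gt _ fc). Qed.

Lemma at_re (T : topologicalType) (f : T -> C) (x0 : T) :
  {for x0, continuous f} -> {for x0, continuous (fun x => re (f x))}.
Proof. by move=> fc; apply: (@continuous_comp _ _ _ f re) => //; exact: re_cont. Qed.

Lemma at_im (T : topologicalType) (f : T -> C) (x0 : T) :
  {for x0, continuous f} -> {for x0, continuous (fun x => im (f x))}.
Proof. by move=> fc; apply: (@continuous_comp _ _ _ f im) => //; exact: im_cont. Qed.

Lemma near_wedge (T : topologicalType) (u : T -> C) (x0 : T) (h : R) :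
  {for x0, continuous u} -> ~ wedge h (u x0) -> \forall x \near x0, ~ wedge h (u x).
Proof.
move=> uc nw.
have rc' := at_re uc; have ic := at_im uc.
have hr : {for x0, continuous (fun x => h * re (u x))} by apply: cvgM rc'; exact: cvg_cst.
have D (f1 f2 : T -> R) : {for x0, continuous f1} -> {for x0, continuous f2} ->
    f1 x0 < f2 x0 -> \forall x \near x0, f1 x < f2 x.
  move=> c1 c2 l.
  have : \forall x \near x0, 0 < f2 x - f1 x.
    by apply: near_gt0; [exact: cvgB|rewrite subr_gt0].
  by apply: nearS => x; rewrite subr_gt0.
have [r0|r0] := ltP (re (u x0)) 0.
  by apply: nearS (D _ (fun=> 0) rc' _ r0) => [x k [w1 _ _ _]|]; [lra|exact: cvg_cst].
have [r1|r1] := ltP (1 + h) (re (u x0)).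
  by apply: nearS (D (fun=> 1 + h) _ _ rc' r1) => [x k [_ w1 _ _]|]; [lra|exact: cvg_cst].
have [r2|r2] := ltP (im (u x0)) (- (h * re (u x0))).
  have nr : {for x0, continuous (fun x => - (h * re (u x)))} by apply: cvgN.
  by apply: nearS (D _ _ ic nr r2) => x k [_ _ w1 _]; lra.
have [r3|r3] := ltP (h * re (u x0)) (im (u x0)).
  by apply: nearS (D _ _ hr ic r3) => x k [_ _ _ w1]; lra.
by case: nw.
Qed.

Lemma at_ratio (T : topologicalType) (f e z : T -> C) (x0 : T) :
  continuous f -> continuous e -> continuous z -> z x0 != e x0 ->
  {for x0, continuous (fun x => (f x - z x) / (e x - z x))}.
Proof.
by move=> fc ec zc ze; apply: at_div; [exact: contB|exact: contB|rewrite subr_eq0 eq_sym].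
Qed.

Lemma vl_c (h : R) (T : topologicalType) (z e : T -> C) :
  continuous z -> continuous e -> continuous (fun x => pt (z x) (e x) (vl h)).
Proof.
move=> zc ec; have k : continuous (fun _ : T => vl h) by exact: cont_cst.
exact: (contD zc (contM k (contB ec zc))).
Qed.

Lemma vr_c (h : R) (T : topologicalType) (z e : T -> C) :
  continuous z -> continuous e -> continuous (fun x => pt (z x) (e x) (vr h)).
Proof.
move=> zc ec; have k : continuous (fun _ : T => vr h) by exact: cont_cst.
exact: (contD zc (contM k (contB ec zc))).
Qed.

(** By [tri_near] for a fixed [h], which remains good nearby. *)
Lemma mer_near (T : topologicalType) (be z e1 e2 e3 : T -> C) (x0 : T) (h : R) :
  continuous be -> continuous z -> continuous e1 -> continuous e2 -> continuous e3 ->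
  roots3 (be x0) (e1 x0) (e2 x0) (e3 x0) -> e2 x0 != e1 x0 -> e3 x0 != e1 x0 ->
  good Om (be x0) (z x0) (e1 x0) h ->
  \forall x \near x0, roots3 (be x) (e1 x) (e2 x) (e3 x) ->
    good Om (be x) (z x) (e1 x) h /\
    mer Om g (be x) (z x) (e1 x) =
      ((g (L (be x0, z x0) (be x, z x)))^-1 * mer Om g (be x0) (z x0) (e1 x0) *
        g (L (be x0, z x0) (be x, z x)))%g.
Proof.
move=> bc zc c1 c2 c3 r3 e21 e31 gh; have [h0 ze l] := gh.
have H1 := tri_near bc zc (vl_c (h := h) zc c1) (vr_c (h := h) zc c1) (tin_good gh).
have H2 : \forall x \near x0, ~ wedge h ((e2 x - z x) / (e1 x - z x)).
  apply: near_wedge; first exact: at_ratio.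
  by apply: l => //; apply/(rootP _ r3); constructor 2.
have H3 : \forall x \near x0, ~ wedge h ((e3 x - z x) / (e1 x - z x)).
  apply: near_wedge; first exact: at_ratio.
  by apply: l => //; apply/(rootP _ r3); constructor 3.
have H4 : \forall x \near x0, e1 x - z x != 0.
  by apply: near_neq0; [exact: contB|rewrite subr_eq0 eq_sym].
apply: nearS (nearI H1 (nearI H2 (nearI H3 H4))) => x [k1 [k2 [k3 k4]]] r.
have gx : good Om (be x) (z x) (e1 x) h.
  split=> //; first by rewrite eq_sym -subr_eq0.
  by move=> f /(rootP _ r)[] -> //; rewrite eqxx.
by split=> //; rewrite (merE gflat gx) (merE gflat gh).
Qed.

(** ** Centres from which all roots are visible *)

(** With origin [z] and unit a root [e], [vis] says that a point is not on the segment from [z] to [e],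
    and [nonray] that it is not on the ray from [z] through [e]. *)
Definition nonray (u : C) := ~ (im u = 0 /\ 0 <= re u).
Definition vis (u : C) := ~ (im u = 0 /\ 0 <= re u <= 1).

Lemma nonray_vis u : nonray u -> vis u.
Proof. by move=> n [i /andP[r _]]; apply: n. Qed.

(** A point outside a segment is outside a thin enough neighbourhood of it. *)
Lemma vis_wedge u : vis u -> exists2 h0 : R, 0 < h0 & forall h, 0 < h -> h <= h0 -> ~ wedge h u.
Proof.
move=> v; have [i0|i0] := eqVneq (im u) 0.
  have [r0|r0] := ltP (re u) 0.
    by exists 1 => // h _ _ [w1 _ _ _]; lra.
  have r1 : 1 < re u by rewrite ltNge; apply/negP => r1; apply: v; rewrite r0.
  by exists ((re u - 1) / 2); [lra|move=> h h0 h1 [_ w _ _]; lra].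
have n0 : 0 < `|im u| by rewrite normr_gt0.
pose m := `|re u| + 1.
have m0 : 0 < m by rewrite /m; have := normr_ge0 (re u); lra.
exists (`|im u| / (2 * m)); first by rewrite divr_gt0 // mulr_gt0.
move=> h h0; rewrite ler_pdivlMr ?mulr_gt0 // => h1 [w1 _ w3 w4].
have : `|im u| <= h * re u by rewrite ler_norml w3 w4.
have : re u <= `|re u| by exact: ler_norm.
by rewrite /m in h1; nra.
Qed.

Lemma vis_good b z e1 e2 e3 : roots3 b e1 e2 e3 -> z != e1 ->
  vis ((e2 - z) / (e1 - z)) -> vis ((e3 - z) / (e1 - z)) -> exists h, good Om b z e1 h.
Proof.
move=> r ze /vis_wedge[h2 h20 k2] /vis_wedge[h3 h30 k3].
exists (Order.min h2 h3); split=> //; first by rewrite lt_min h20.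
move=> f /(rootP _ r)[] -> //; rewrite ?eqxx // => _.
  by apply: k2; rewrite ?lt_min ?h20 // ge_min lexx.
by apply: k3; rewrite ?lt_min ?h20 // ge_min lexx orbT.
Qed.

Lemma nonrayV u : u != 0 -> nonray u -> nonray u^-1.
Proof.
move=> u0 n [i r]; apply: n.
have E : u = rc ((re u^-1)^-1).
  rewrite -[LHS]invrK [in LHS](reimK u^-1) i rc0 mulr0 addr0.
  by rewrite /rc -fmorphV.
by rewrite E im_rc re_rc invr_ge0.
Qed.

(** No two of the three roots are seen from [z] in the same direction. *)
Definition valid z e1 e2 e3 :=
  [/\ z != e1, z != e2, z != e3 & [/\ nonray ((e2 - z) / (e1 - z)),
    nonray ((e3 - z) / (e1 - z)) & nonray ((e3 - z) / (e2 - z))]].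

Lemma roots3_swap b e1 e2 e3 : roots3 b e1 e2 e3 -> roots3 b e2 e1 e3.
Proof. by move=> r v; rewrite r; ring. Qed.

Lemma roots3_rot b e1 e2 e3 : roots3 b e1 e2 e3 -> roots3 b e2 e3 e1.
Proof. by move=> r v; rewrite r; ring. Qed.

Lemma ratioV z e f : z != e -> z != f -> nonray ((f - z) / (e - z)) -> nonray ((e - z) / (f - z)).
Proof.
move=> ze zf n; rewrite -[(e - z) / _]invrK invf_div; apply: nonrayV => //.
by rewrite mulf_neq0 ?invr_neq0 // subr_eq0 eq_sym.
Qed.

Lemma valid_swap z e1 e2 e3 : valid z e1 e2 e3 -> valid z e2 e1 e3.
Proof. by move=> [z1 z2 z3 [n1 n2 n3]]; split=> //; split=> //; exact: ratioV. Qed.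

Lemma valid_rot z e1 e2 e3 : valid z e1 e2 e3 -> valid z e2 e3 e1.
Proof. by move=> [z1 z2 z3 [n1 n2 n3]]; split=> //; split=> //; exact: ratioV. Qed.

Lemma valid_neq z e1 e2 e3 : valid z e1 e2 e3 -> [/\ e1 != e2, e1 != e3 & e2 != e3].
Proof.
move=> [z1 z2 z3 [n1 n2 n3]].
have K (e : C) : z != e -> (e - z) / (e - z) = 1.
  by move=> ze; rewrite divff // subr_eq0 eq_sym.
by split; apply/eqP => E; [move: n1|move: n2|move: n3]; rewrite E K //; apply;
  rewrite !reimE ler01.
Qed.

Lemma valid_good1 b z e1 e2 e3 : roots3 b e1 e2 e3 -> valid z e1 e2 e3 ->
  exists h, good Om b z e1 h.
Proof.
move=> r [z1 z2 z3 [n1 n2 n3]]; apply: (vis_good r) => //; exact: nonray_vis.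
Qed.

Lemma valid_good b z e1 e2 e3 : roots3 b e1 e2 e3 -> valid z e1 e2 e3 ->
  exists h, [/\ good Om b z e1 h, good Om b z e2 h & good Om b z e3 h].
Proof.
move=> r v.
have [h1 g1] := valid_good1 r v.
have [h2 g2] := valid_good1 (roots3_rot r) (valid_rot v).
have [h3 g3] := valid_good1 (roots3_rot (roots3_rot r)) (valid_rot (valid_rot v)).
have [p1 _ _] := g1; have [p2 _ _] := g2; have [p3 _ _] := g3.
exists (Order.min h1 (Order.min h2 h3)).
have p : 0 < Order.min h1 (Order.min h2 h3) by rewrite !lt_min p1 p2.
by split; [apply: good_le g1|apply: good_le g2|apply: good_le g3] => //;
  rewrite !ge_min lexx ?orbT.
Qed.

Lemma near_nonray (T : topologicalType) (u : T -> C) (x0 : T) :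
  {for x0, continuous u} -> nonray (u x0) -> \forall x \near x0, nonray (u x).
Proof.
move=> uc n; have rc' := at_re uc; have ic := at_im uc.
have [i0|i0] := eqVneq (im (u x0)) 0.
  have r0 : re (u x0) < 0 by rewrite ltNge; apply/negP => r0; apply: n.
  have H : \forall x \near x0, 0 < - re (u x) by apply: near_gt0; [exact: cvgN|rewrite oppr_gt0].
  by apply: nearS H => x k [_ ?]; lra.
have H : \forall x \near x0, 0 < im (u x) ^+ 2.
  apply: near_gt0; last by rewrite exprn_even_gt0.
  by apply: cvgM.
by apply: nearS H => x k [i _]; move: k; rewrite i expr0n ltxx.
Qed.

Lemma near_valid (T : topologicalType) (z e1 e2 e3 : T -> C) (x0 : T) :
  continuous z -> continuous e1 -> continuous e2 -> continuous e3 ->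
  valid (z x0) (e1 x0) (e2 x0) (e3 x0) ->
  \forall x \near x0, valid (z x) (e1 x) (e2 x) (e3 x).
Proof.
move=> zc c1 c2 c3 [z1 z2 z3 [n1 n2 n3]].
have N (e : T -> C) : continuous e -> z x0 != e x0 -> \forall x \near x0, z x != e x.
  move=> ec ze; have H : \forall x \near x0, z x - e x != 0.
    by apply: near_neq0; [exact: contB|rewrite subr_eq0].
  by apply: nearS H => x; rewrite subr_eq0.
have := nearI (nearI (N _ c1 z1) (nearI (N _ c2 z2) (N _ c3 z3)))
  (nearI (near_nonray (at_ratio c2 c1 zc z1) n1)
  (nearI (near_nonray (at_ratio c3 c1 zc z1) n2) (near_nonray (at_ratio c3 c2 zc z2) n3))).
by apply: nearS => x [[? [? ?]] [? [? ?]]].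
Qed.

End Cubic.

(** * Triangles around two roots *)

Section Hurwitz.
Context {R : realType} {G : groupType}.
Local Notation C := R[i].
Variables (P q : {poly C}).
Local Notation Om := (Om P q).
Local Notation roots3 := (roots3 P q).
Variable g : (R -> C * C) -> G.
Hypothesis gflat : flat Om g.
Local Notation mer := (mer Om g).

Let g_sq := let: And4 h _ _ _ := gflat in h.
Let g_cat := let: And4 _ h _ _ := gflat in h.
Let g_cst := let: And4 _ _ h _ := gflat in h.
Let g_ext := let: And4 _ _ _ h := gflat in h.

Definition coor (z f w : C) : C := (w - z) / (f - z).

Lemma pt_coor z f w : z != f -> pt z f (coor z f w) = w.
Proof. by move=> zf; rewrite /pt /coor divfK ?subr_eq0 1?eq_sym // addrC subrK. Qed.

Lemma coor_cone z f f' u v (x y : C) : z != f ->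
  (f' - z) / (f - z) = x * coor z f u + y * coor z f v ->
  f' - z = x * (u - z) + y * (v - z).
Proof.
move=> zf E; have fz : f - z != 0 by rewrite subr_eq0 eq_sym.
by rewrite -[LHS](divfK fz) E /coor; field.
Qed.

(** The third vertex [lin al be t] separates the two roots: cutting along the segment from [z] to it
    leaves two triangles around one root each. The order is counterclockwise. *)
Lemma tri_two b z f1 f2 f3 al be t : roots3 b f1 f2 f3 -> z != f1 -> z != f2 ->
  0 <= t <= 1 -> sin Om b al be ->
  1 < re (coor z f1 al) -> im (coor z f1 al) < 0 ->
  1 < re (coor z f1 (lin al be t)) -> 0 < im (coor z f1 (lin al be t)) ->
  1 < re (coor z f2 (lin al be t)) -> im (coor z f2 (lin al be t)) < 0 ->
  1 < re (coor z f2 be) -> 0 < im (coor z f2 be) ->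
  0 < im (coor z f1 be) -> im (coor z f2 al) < 0 ->
  (forall x y : R, 0 <= x -> 0 <= y -> f3 - z <> rc x * (al - z) + rc y * (be - z)) ->
  tri g b z al be = (mer b z f1 * mer b z f2)%g.
Proof.
move=> r z1 z2 t01 sab a1 a2 a3 a4 b1 b2 b3 b4 c1 c2 h3.
have f1z : f1 - z != 0 by rewrite subr_eq0 eq_sym.
have f2z : f2 - z != 0 by rewrite subr_eq0 eq_sym.
set ga := lin al be t.
(* a point of the cone spanned by two vectors on the same strict side of a line is not on it *)
have key (f u v : C) (s : R) : f - z != 0 -> s != 0 -> 0 < s * im (coor z f u) ->
    0 < s * im (coor z f v) -> forall x y : R, 0 <= x -> 0 <= y ->
    f - z <> rc x * (u - z) + rc y * (v - z).
  move=> fz s0 su sv x y x0 y0 E.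
  have E1 : 1 = rc x * coor z f u + rc y * coor z f v.
    by rewrite /coor !mulrA -mulrDl -E divff.
  have Ei : x * im (coor z f u) + y * im (coor z f v) = 0.
    by have := congr1 im E1; rewrite !reimE; lra.
  have : x * (s * im (coor z f u)) + y * (s * im (coor z f v)) = 0.
    by rewrite -[RHS](mulr0 s) -Ei; ring.
  move=> Es.
  have x00 : x = 0.
    apply/eqP; rewrite eq_le x0 andbT leNgt; apply/negP => xp.
    have : 0 < x * (s * im (coor z f u)) by apply: mulr_gt0.
    have : 0 <= y * (s * im (coor z f v)) by rewrite mulr_ge0 // ltW.
    by lra.
  have y00 : y = 0.
    apply/eqP; rewrite eq_le y0 andbT leNgt; apply/negP => yp.
    have : 0 < y * (s * im (coor z f v)) by apply: mulr_gt0.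
    by rewrite x00 in Es; lra.
  by move: E1; rewrite x00 y00 rc0 !mul0r addr0 => /eqP; rewrite oner_eq0.
have l1 : lone Om b z f1 (cone (coor z f1 al) (coor z f1 ga)).
  move=> f /(rootP _ r)[] -> ; rewrite ?eqxx // => _ [x [y [x0 y0 E]]].
    apply: (key f2 al ga (-1) f2z _ _ _ x y x0 y0); rewrite ?mulN1r ?oppr_gt0 //.
      by rewrite oppr_eq0 oner_eq0.
    exact: coor_cone E.
  have /andP[t0 t1] := t01.
  apply: (h3 (x + y * (1 - t)) (y * t)); [nra|nra|].
  rewrite (coor_cone _ E) // /ga /lin !(rcD, rcM, rcB, rc1); ring.
have l2 : lone Om b z f2 (cone (coor z f2 ga) (coor z f2 be)).
  move=> f /(rootP _ r)[] -> ; rewrite ?eqxx // => _ [x [y [x0 y0 E]]].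
    apply: (key f1 ga be 1 f1z _ _ _ x y x0 y0); rewrite ?mul1r ?oner_eq0 //.
    exact: coor_cone E.
  have /andP[t0 t1] := t01.
  apply: (h3 (x * (1 - t)) (y + x * t)); [nra|nra|].
  rewrite (coor_cone _ E) // /ga /lin !(rcD, rcM, rcB, rc1); ring.
have [T1 _] := tri_cone gflat z1 l1 a1 a2 a3 a4.
have [T2 _] := tri_cone gflat z2 l2 b1 b2 b3 b4.
have [s1 s2 s3] := tin_lone z1 (@cone_convex _ _ _) (@cone0 _ _ _) (@conel _ _ _)
  (@coner _ _ _) l1 a1 a2 a3 a4.
rewrite -T1 -T2 !pt_coor // /tri (sg_split gflat t01 sab) -/ga.
have rv : (g (sg b ga z) * g (sg b z ga) = 1)%g.
  by apply: (sg_rev gflat); rewrite -(pt_coor ga z1).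
by rewrite -!mulgA (mulgA (g (sg b ga z))) rv mul1g.
Qed.

Lemma coorM z f f' w : z != f' -> coor z f w = coor z f' w * coor z f f'.
Proof.
by move=> zf; rewrite /coor mulrA divfK // subr_eq0 eq_sym.
Qed.

Lemma coor_pt z f u : z != f -> coor z f (pt z f u) = u.
Proof. exact: ptK. Qed.

(** Near a position where [e1] hides [e3], a thin triangle towards [e3] contains both, and the side of
    the ray on which [e1] lies decides which one comes first. *)
Lemma tri_hidden b z e1 e2 e3 (h : R) : roots3 b e1 e2 e3 -> z != e1 -> z != e3 -> 0 < h ->
  let nu := coor z e1 e3 in
  sin Om b (pt z e3 (vl h)) (pt z e3 (vr h)) ->
  1 < (1 + h) * (re nu - h * `|im nu|) -> `|im nu| < h * re nu ->
  ~ (0 <= re (coor z e3 e2) /\ `|im (coor z e3 e2)| <= h * re (coor z e3 e2)) ->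
  (0 < im nu -> stri g b z e3 h = (mer b z e1 * mer b z e3)%g) /\
  (im nu < 0 -> stri g b z e3 h = (mer b z e3 * mer b z e1)%g).
Proof.
move=> r z1 z3 h0 nu; rewrite /stri.
have [L1 L2] := vlE h; have [R1 R2] := vrE h.
move: (vl h) (vr h) L1 L2 R1 R2 => A B L1 L2 R1 R2 sab n1 n2 n3.
set al := pt z e3 A; set be := pt z e3 B.
have hn0 : h != 0 by rewrite gt_eqF.
have nr0 : 0 < re nu by have := normr_ge0 (im nu); nra.
have rn0 : re nu != 0 by rewrite gt_eqF.
have c3 w : coor z e1 w = coor z e3 w * nu by exact: coorM.
clearbody nu.
have h3 x y : 0 <= x -> 0 <= y -> e2 - z <> rc x * (al - z) + rc y * (be - z).
  move=> x0 y0 E; apply: n3.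
  have -> : coor z e3 e2 = rc x * A + rc y * B.
    have E' : (e2 - z) / (e3 - z) = rc x * coor z e3 al + rc y * coor z e3 be.
      by rewrite E mulrDl -!mulrA.
    by rewrite /coor E' !coor_pt.
  rewrite !reimE L1 L2 R1 R2; split; first by nra.
  by rewrite ler_norml; apply/andP; split; nra.
have gaE t : coor z e3 (lin al be t) = lin A B t.
  by rewrite /al /be pt_lin coor_pt.
split=> s0.
- have an : `|im nu| = im nu by rewrite gtr0_norm.
  rewrite an in n1 n2.
  pose d := im nu / (2 * re nu).
  have dE : d * re nu = im nu / 2 by rewrite /d; field.
  have d0 : 0 < d by rewrite /d divr_gt0 // mulr_gt0.
  have dh : d < h by rewrite /d ltr_pdivrMr ?mulr_gt0 //; nra.
  pose t := (1 - d / h) / 2.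
  have tE : h * (2 * t) = h - d by rewrite /t; field.
  have t01 : 0 <= t <= 1 by apply/andP; split; nra.
  have [g1 g2] := lin01E A B t.
  have G1 : re (lin A B t) = 1 + h by rewrite g1 L1 R1; ring.
  have G2 : im (lin A B t) = - ((1 + h) * d).
    by rewrite g2 L2 R2 -[d](subKr h) -tE; ring.
  have e0 : 0 < 1 + h by lra.
  have p1 : 0 < (1 + h) * im nu by apply: mulr_gt0.
  have p2 : 0 < (1 + h) * h by apply: mulr_gt0.
  have p3 : 0 < (1 + h) * d by apply: mulr_gt0.
  have p4 : (1 + h) * (d * re nu) = (1 + h) * (im nu / 2) by rewrite dE.
  have p5 : 0 < (1 + h) * (h * im nu) by apply: mulr_gt0 => //; apply: mulr_gt0.
  have p6 : 0 < (1 + h) * (d * im nu) by apply: mulr_gt0 => //; apply: mulr_gt0.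
  have p7 : (1 + h) * im nu < (1 + h) * (h * re nu) by rewrite ltr_pM2l.
  have p8 : 0 < (1 + h) * (h * re nu) by apply: mulr_gt0 => //; apply: mulr_gt0.
  apply: (@tri_two b z e1 e3 e2 al be t (roots3_swap (roots3_rot (roots3_rot r))) z1 z3 t01 sab) => //;
    rewrite ?c3 ?gaE ?coor_pt // ?reM ?imM ?G1 ?G2 ?L1 ?L2 ?R1 ?R2; lra.
- have an : `|im nu| = - im nu by rewrite ltr0_norm.
  rewrite an in n1 n2.
  pose d := - im nu / (2 * re nu).
  have dE : d * re nu = - im nu / 2 by rewrite /d; field.
  have d0 : 0 < d by rewrite /d divr_gt0 ?mulr_gt0 // oppr_gt0.
  have dh : d < h by rewrite /d ltr_pdivrMr ?mulr_gt0 //; nra.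
  pose t := (1 + d / h) / 2.
  have tE : h * (2 * t) = h + d by rewrite /t; field.
  have t01 : 0 <= t <= 1 by apply/andP; split; nra.
  have [g1 g2] := lin01E A B t.
  have G1 : re (lin A B t) = 1 + h by rewrite g1 L1 R1; ring.
  have G2 : im (lin A B t) = (1 + h) * d.
    by rewrite g2 L2 R2 (_ : d = h * (2 * t) - h); [ring|lra].
  have mn : 0 < - im nu by rewrite oppr_gt0.
  have e0 : 0 < 1 + h by lra.
  have p1 : 0 < (1 + h) * (- im nu) by apply: mulr_gt0.
  have p2 : 0 < (1 + h) * h by apply: mulr_gt0.
  have p3 : 0 < (1 + h) * d by apply: mulr_gt0.
  have p4 : (1 + h) * (d * re nu) = (1 + h) * ((- im nu) / 2) by rewrite dE.
  have p5 : 0 < (1 + h) * (h * (- im nu)) by apply: mulr_gt0 => //; apply: mulr_gt0.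
  have p6 : 0 < (1 + h) * (d * (- im nu)) by apply: mulr_gt0 => //; apply: mulr_gt0.
  have p7 : (1 + h) * (- im nu) < (1 + h) * (h * re nu) by rewrite ltr_pM2l.
  have p8 : 0 < (1 + h) * (h * re nu) by apply: mulr_gt0 => //; apply: mulr_gt0.
  apply: (@tri_two b z e3 e1 e2 al be t (roots3_rot (roots3_rot r)) z3 z1 t01 sab) => //;
    rewrite ?c3 ?gaE ?coor_pt // ?reM ?imM ?G1 ?G2 ?L1 ?L2 ?R1 ?R2; lra.
Qed.

End Hurwitz.

(** * Generation by the meridians of one fibre *)

Section Generation.
Context {R : realType} {G : groupType}.
Local Notation C := R[i].
Variables (P q : {poly C}).
Local Notation Om := (Om P q).
Local Notation roots3 := (roots3 P q).
Variable g : (R -> C * C) -> G.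
Hypothesis gflat : flat Om g.
Local Notation mer := (mer Om g).

Let g_sq := let: And4 h _ _ _ := gflat in h.
Let g_cat := let: And4 _ h _ _ := gflat in h.
Let g_cst := let: And4 _ _ h _ := gflat in h.
Let g_ext := let: And4 _ _ _ h := gflat in h.

Definition subg (H : G -> Prop) :=
  [/\ H 1%g, forall a b, H a -> H b -> H (a * b)%g & forall a, H a -> H a^-1%g].

Definition pre (y : R -> C * C) (t : R) : R -> C * C := fun u => y (t * u).

Lemma near_Om (T : topologicalType) (F : T -> C * C) (x0 : T) :
  continuous F -> Om (F x0) -> \forall x \near x0, Om (F x).
Proof.
move=> Fc h; apply: (@near_neq0 R _ (fun x => cub P q (F x))) h.
have -> : (fun x => cub P q (F x)) = (fun x => cub P q ((F x).1, (F x).2)).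
  by apply/funext => x; rewrite -surjective_pairing.
by apply: cub_cont; [exact: (cont_comp Fc cont_fst)|exact: (cont_comp Fc cont_snd)].
Qed.

Lemma L_cont2 (T : topologicalType) (y y' : T -> C * C) (h : T -> R) :
  continuous y -> continuous y' -> continuous h -> continuous (fun x => L (y x) (y' x) (h x)).
Proof.
move=> yc y'c hc; apply: cont_pair; apply: lin_cont => //.
- exact: (cont_comp yc cont_fst).
- exact: (cont_comp y'c cont_fst).
- exact: (cont_comp yc cont_snd).
- exact: (cont_comp y'c cont_snd).
Qed.

(** A small square bounded by the added piece of the path and the straight segment lies in [Om]. *)
Lemma advance (y : R -> C * C) (t0 : R) : continuous y -> inside Om y -> 0 <= t0 <= 1 ->
  \forall t \near t0, g (pre y t) = (g (pre y t0) * g (L (y t0) (y t)))%g.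
Proof.
move=> yc iy t01.
have mulc : continuous (fun z : R * R => z.1 * z.2) by exact: mul_continuous.
have H : \forall t \near t0, forall u, 0 <= u <= 1 -> forall s, 0 <= s <= 1 ->
    Om (L (y (t0 * u)) (y (t * u)) s).
  apply: (@near_seg R R t0 (fun u t => forall s, 0 <= s <= 1 ->
    Om (L (y (t0 * u)) (y (t * u)) s))) => u u01.
  apply: (@near_seg R (R * R)%type (u, t0) (fun s x =>
    Om (L (y (t0 * x.1)) (y (x.2 * x.1)) s))) => s s01.
  apply: (@near_Om _ (fun z : R * (R * R) => L (y (t0 * z.2.1)) (y (z.2.2 * z.2.1)) z.1)
    (s, (u, t0))).
    apply: L_cont2; last by move=> z; exact: cvg_fst.
    - apply: (cont_comp _ yc); apply: (@cont_comp _ _ _ (fun z : R * (R * R) => (t0, z.2.1))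
        (fun z : R * R => z.1 * z.2)) => //.
      apply: cont_pair; first exact: cont_cst.
      exact: (cont_comp cont_snd cont_fst).
    - apply: (cont_comp _ yc); apply: (@cont_comp _ _ _ (fun z : R * (R * R) => (z.2.2, z.2.1))
        (fun z : R * R => z.1 * z.2)) => //.
      exact: (cont_pair (cont_comp cont_snd cont_snd) (cont_comp cont_snd cont_fst)).
  by rewrite /= Lcst; apply: iy; exact: mulr01.
apply: nearS H => t H.
pose K (z : R * R) := L (y (t0 * z.1)) (y (t * z.1)) z.2.
have Kc : continuous K.
  have c (k : R) : continuous (fun z : R * R => y (k * z.1)).
    apply: (@cont_comp _ _ _ (fun z : R * R => k * z.1) y _ yc).
    by apply: (@cont_comp _ _ _ (fun z : R * R => (k, z.1)) (fun z : R * R => z.1 * z.2)) => //;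
      apply: cont_pair; [exact: cont_cst|exact: cont_fst].
  by apply: L_cont2; [exact: c|exact: c|exact: cont_snd].
have := g_sq Kc (fun s u s01 u01 => H s s01 u u01).
have -> : (fun s => K (s, 0)) = pre y t0.
  by apply/funext => s; rewrite /K /L /= !lin0 -surjective_pairing.
have -> : (fun s => K (s, 1)) = pre y t.
  by apply/funext => s; rewrite /K /L /= !lin1 -surjective_pairing.
have -> : (fun u => K (0, u)) = (fun=> y 0).
  by apply/funext => u; rewrite /K /= !mulr0 Lcst.
have -> : (fun u => K (1, u)) = L (y t0) (y t).
  by apply/funext => u; rewrite /K /= !mulr1.
by rewrite g_cst ?mul1g // ; apply: iy; rewrite lexx ler01.
Qed.

(** ** Paths in a fibre *)

Definition fp (b : C) (c : R -> C) (t : R) : C * C := (b, c t).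

Definition fpath b z w (c : R -> C) := pth c z w /\ inside Om (fp b c).

Lemma fp_c b (c : R -> C) : continuous c -> continuous (fp b c).
Proof. move=> cc; have bc : continuous (fun _ : R => b) := @constc _ _ b.
exact: (@cont_pair R C C (fun=> b) c bc cc). Qed.

Lemma half01 (t : R) : 0 <= t <= 1 -> t <= 2^-1 -> 0 <= 2 * t <= 1.
Proof. by move=> /andP[? ?] ?; apply/andP; split; lra. Qed.

Lemma half01' (t : R) : 0 <= t <= 1 -> (t <= 2^-1) = false -> 0 <= 2 * t - 1 <= 1.
Proof.
by move=> /andP[? ?] /negbT; rewrite -ltNge => ?; apply/andP; split; lra.
Qed.

Lemma fp_cat b z w v c c' : fpath b z w c -> fpath b w v c' ->
  fpath b z v (pcat c c') /\ g (fp b (pcat c c')) = (g (fp b c) * g (fp b c'))%g.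
Proof.
move=> [p1 i1] [p2 i2]; have E : fp b (pcat c c') = pcat (fp b c) (fp b c').
  by apply/funext => t; rewrite /fp /pcat; case: ifP.
split.
  split; first exact: pcat_pth p1 p2.
  move=> t t01; rewrite E /pcat; case: ifP => h; [apply: i1|apply: i2].
    exact: half01.
  exact: half01'.
have [c1 _ e1] := p1; have [c2 e2 _] := p2.
have e12 : fp b c 1 = fp b c' 0 by rewrite /fp e1 e2.
rewrite E; exact: (g_cat (fp_c (b := b) c1) (fp_c (b := b) c2) e12 i1 i2).
Qed.

Lemma fp_rev b z w c : fpath b z w c ->
  fpath b w z (prev c) /\ g (fp b (prev c)) = (g (fp b c))^-1%g.
Proof.
move=> [p1 i1]; have [cc e0 e1] := p1.
split.
  split; first exact: prev_pth p1.
  move=> t /andP[t0 t1]; apply: i1; apply/andP; split; lra.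
pose K (x : R * R) : C * C := (b, c ((1 - x.2) * x.1)).
have Kc : continuous K.
  have bc : continuous (fun _ : R * R => b) := @constc _ _ b.
  apply: (@cont_pair _ C C (fun=> b) (fun x : R * R => c ((1 - x.2) * x.1)) bc).
  apply: (@cont_comp _ _ _ (fun x : R * R => (1 - x.2) * x.1) c _ cc).
  move=> x; apply: cvgM; last exact: cvg_fst.
  by apply: cvgB; [exact: cvg_cst|exact: cvg_snd].
have KO s t : 0 <= s <= 1 -> 0 <= t <= 1 -> Om (K (s, t)).
  move=> s01 /andP[t0 t1]; rewrite /K /=; apply: i1; apply: mulr01 => //.
  by apply/andP; split; lra.
have := g_sq Kc KO.
have -> : (fun t => K (t, 0)) = fp b c.
  by apply/funext => t; rewrite /K /fp /= subr0 mul1r.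
have -> : (fun t => K (1, t)) = fp b (prev c).
  by apply/funext => t; rewrite /K /fp /prev /= mulr1.
have -> : (fun t => K (0, t)) = (fun=> (b, c 0)).
  by apply/funext => t; rewrite /K /fp /= mulr0.
have -> : (fun t => K (t, 1)) = (fun=> (b, c 0)).
  by apply/funext => t; rewrite /K /fp /= subrr mul0r.
rewrite g_cst ?mulg1; last by apply: i1; rewrite lexx ler01.
by move=> E; apply: (mulgI (g (fp b c))); rewrite E mulgV.
Qed.

Lemma fp_sg b z w : sin Om b z w -> fpath b z w (lin z w).
Proof. by move=> h; split => //; split; [exact: lin_c|exact: lin0|exact: lin1]. Qed.

Lemma disc_convex (z e : C) : 0 < e -> convexC [set w | `|z - w| < e].
Proof.
move=> e0 u v t /= hu hv t01.
have [er er0 E] := pos_rc e0.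
have -> : z - lin u v t = rc (1 - t) * (z - u) + rc t * (z - v).
  by rewrite /lin rcB rc1; ring.
have /andP[t0 t1] := t01.
apply: le_lt_trans (ler_normD _ _) _; rewrite !normrM !norm_rc.
have -> : `|1 - t| = 1 - t by rewrite ger0_norm // subr_ge0.
have -> : `|t| = t by rewrite ger0_norm.
have [nu nuE] : exists r, `|z - u| = rc r by rewrite normc_def; eexists.
have [nv nvE] : exists r, `|z - v| = rc r by rewrite normc_def; eexists.
move: hu hv; rewrite nuE nvE E !ltcR -!rcM -rcD ltcR => hu hv.
by have := @itp_lt _ er nu nv t t01 hu hv; lra.
Qed.

Lemma disc_open (z e : C) : open [set w | `|z - w| < e].
Proof.
rewrite openE => w hw; rewrite /interior /=.
have d0 : 0 < e - `|z - w| by rewrite subr_gt0.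
apply: nearS (near_dist w (@idC R) d0) => x hx /=.
have -> : z - x = (z - w) + (w - x) by ring.
apply: le_lt_trans (ler_normD _ _) _.
by move: hx; rewrite ltrBrDl.
Qed.

Lemma ball_convex (z : C) (N : set C) : nbhs z N ->
  exists B : set C, [/\ open B, convexC B, B z & B `<=` N].
Proof.
move=> /nbhs_ballP[e /= e0 he]; exists [set w | `|z - w| < e]; split.
- exact: disc_open.
- exact: disc_convex.
- by rewrite /= subrr normr0.
- by move=> w /= hw; apply: he.
Qed.

(** ** Loops in a fibre *)

Section FibreLoops.
Variables (b z0 e1 e2 e3 : C) (H : G -> Prop).
Hypothesis (rts : roots3 b e1 e2 e3) (val : valid z0 e1 e2 e3) (Hg : subg H).
Hypothesis (H1 : H (mer b z0 e1)) (H2 : H (mer b z0 e2)) (H3 : H (mer b z0 e3)).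

Definition offray (e w : C) := ~ (im (coor z0 e w) = 0 /\ 1 <= re (coor z0 e w)).
(** The points that no root hides from [z0]. *)
Definition seen (w : C) := [/\ offray e1 w, offray e2 w & offray e3 w].

Lemma seen_sin w : seen w -> sin Om b z0 w.
Proof.
move=> [s1 s2 s3] t /andP[t0 t1]; apply: contrapT => /(rootP _ rts) E.
have [z1 z2 z3 _] := val.
have key e : z0 != e -> offray e w -> lin z0 w t = e -> False.
  move=> ze off Ee; apply: off.
  have E1 : rc t * coor z0 e w = 1.
    have E0 : rc t * (w - z0) = e - z0 by rewrite -Ee /lin; ring.
    by rewrite /coor mulrA E0 divff // subr_eq0 eq_sym.
  move: (coor z0 e w) E1 => u E1.
  have Er : t * re u = 1 by have := congr1 re E1; rewrite reM re_rc im_rc mul0r subr0.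
  have Ei : t * im u = 0 by have := congr1 im E1; rewrite imM re_rc im_rc mul0r addr0.
  have t00 : t != 0 by apply/eqP => t00; move: Er; rewrite t00; lra.
  split.
    move/eqP: Ei.
    by rewrite mulf_eq0 (negbTE t00) => /eqP.
  by nra.
by case: E => E; [exact: (key e1)|exact: (key e2)|exact: (key e3)].
Qed.

Definition wloop w w' := (g (sg b z0 w) * g (sg b w w') * g (sg b w' z0))%g.

Lemma wloop_seen (B : set C) w w' : convexC B -> B w -> B w' -> (forall v, B v -> seen v) ->
  wloop w w' = 1%g.
Proof.
move=> cB Bw Bw' sB; rewrite /wloop (sg_tri gflat).
  by rewrite (sg_rev gflat) //; apply: seen_sin; exact: sB.
move=> s t s01 t01; apply: (seen_sin (sB _ (cB w w' t Bw Bw' t01))) => //.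
Qed.

Lemma wloop_inv w w' : sin Om b z0 w -> sin Om b z0 w' -> sin Om b w w' ->
  wloop w' w = (wloop w w')^-1%g.
Proof.
move=> s1 s2 s3; apply: (mulgI (wloop w w')); rewrite mulgV /wloop.
have r1 := sg_rev gflat s1; have r2 := sg_rev gflat (sin_sym s2); have r3 := sg_rev gflat s3.
rewrite -!mulgA (mulgA (g (sg b w' z0))) r2 mul1g.
by rewrite (mulgA (g (sg b w w'))) r3 mul1g r1.
Qed.

End FibreLoops.

End Generation.

Section Planar.
Context {R : realType} {G : groupType}.
Local Notation C := R[i].
Variables (P q : {poly C}).
Local Notation Om := (Om P q).
Local Notation roots3 := (roots3 P q).
Variable g : (R -> C * C) -> G.
Hypothesis gflat : flat Om g.
Local Notation mer := (mer Om g).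

Lemma coor_c (z0 e : C) : continuous (coor z0 e).
Proof.
exact: (contM (contB (@idC R) (@constc _ _ z0)) (@constc _ _ ((e - z0)^-1))).
Qed.

Lemma nonray_scale (k u : C) : im k = 0 -> 0 < re k -> nonray u -> nonray (k * u).
Proof.
move=> k0 k1 n [i r]; apply: n; move: i r.
rewrite imM reM k0 !mul0r addr0 subr0 => /eqP.
rewrite mulf_eq0 (gt_eqF k1) /= => /eqP -> r; split=> //.
by rewrite -(pmulr_rge0 _ k1).
Qed.

Section Gen.
Variables (b z0 e1 e2 e3 : C) (H : G -> Prop).
Hypothesis (rts : roots3 b e1 e2 e3) (val : valid z0 e1 e2 e3) (Hg : subg H).
Hypothesis (H1 : H (mer b z0 e1)) (H2 : H (mer b z0 e2)) (H3 : H (mer b z0 e3)).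
Local Notation seen := (seen z0 e1 e2 e3).

Lemma near_offray (e w : C) : offray z0 e w -> \forall v \near w, offray z0 e v.
Proof.
move=> o.
have n : nonray (coor z0 e w - 1).
  by move=> [i r]; apply: o; split; move: i r; rewrite !reimE; lra.
have c : continuous (fun v => coor z0 e v - 1).
  exact: (@contB R C (coor z0 e) (fun=> 1) (@coor_c z0 e) (@constc C C 1)).
apply: nearS (near_nonray (c w) n) => v n' [i r]; apply: n'.
by split; move: i r; rewrite ?(imD, imN, im1, reD, reN, re1); lra.
Qed.

Lemma near_seen w : seen w -> \forall v \near w, seen v.
Proof.
move=> [s1 s2 s3]; have := nearI (near_offray s1) (nearI (near_offray s2) (near_offray s3)).
by apply: nearS => v [? [? ?]].
Qed.

(** Crossing the ray behind [e1] changes the loop through [z0] by the meridian of [e1] or its inverse,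
    while on either side of the ray nothing changes. *)
Lemma onray_local z1 : Om (b, z1) -> ~ offray z0 e1 z1 ->
  (forall N, nbhs z1 N -> exists w, N w /\ seen w) /\
  (exists N, nbhs z1 N /\ forall B : set C, convexC B -> B `<=` N ->
    forall w w', B w -> B w' -> seen w -> seen w' -> H (wloop g b z0 w w')).
Proof.
move=> O1 /contrapT [i1 r1].
have [z1' z2' z3' [n1 n2 n3]] := val.
have e1z : e1 - z0 != 0 by rewrite subr_eq0 eq_sym.
have kne : coor z0 e1 z1 != 1.
  apply: contraPneq O1 => k1; have -> : z1 = e1 by rewrite -(pt_coor z1 z1') k1 pt1.
  by apply/(rootP _ rts); constructor 1.
have k1 : 1 < re (coor z0 e1 z1).
  rewrite lt_neqAle r1 andbT; apply: contra_neq kne => k.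
  by apply: eqC; rewrite ?i1 ?im1 // re1.
have N1 : \forall w \near z1, 1 < re (coor z0 e1 w).
  have c : continuous (fun w => coor z0 e1 w - 1).
    exact: (@contB R C (coor z0 e1) (fun=> 1) (@coor_c z0 e1) (@constc C C 1)).
  have : \forall w \near z1, 0 < re (coor z0 e1 w - 1).
    by apply: near_gt0; [exact: at_re (c z1)|rewrite reD reN re1; lra].
  by apply: nearS => w; rewrite reD reN re1; lra.
have N2 f : z0 != f -> nonray (coor z0 f e1) -> \forall w \near z1, nonray (coor z0 f w).
  move=> zf nf; apply: near_nonray; first exact: coor_c.
  by rewrite (coorM _ _ (f' := e1)) //; apply: nonray_scale => //; lra.
have nf2 : nonray (coor z0 e2 e1) by apply: ratioV.
have nf3 : nonray (coor z0 e3 e1) by apply: ratioV.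
have off f w : nonray (coor z0 f w) -> offray z0 f w.
  by move=> n [i r]; apply: n; split=> //; apply: le_trans r.
have NN := nearI N1 (nearI (N2 _ z2' nf2) (N2 _ z3' nf3)).
split.
- move=> N Nz.
  pose w (r : R) := z1 + rc r * ('i * (e1 - z0)).
  have wc : continuous w.
    exact: (contD (@constc _ _ z1) (contM rcc (@constc _ _ ('i * (e1 - z0))))).
  have w0 : w 0 = z1 by rewrite /w rc0 mul0r addr0.
  have : \forall r \near (0 : R), N (w r) /\ (1 < re (coor z0 e1 (w r)) /\
      nonray (coor z0 e2 (w r)) /\ nonray (coor z0 e3 (w r))).
    apply: (@near_cont _ _ w 0 (fun w => N w /\ (1 < re (coor z0 e1 w) /\
      nonray (coor z0 e2 w) /\ nonray (coor z0 e3 w)))); first exact: wc.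
    by rewrite w0; apply: nearI NN.
  move=> /nbhs_ballP[d /= d0 hd].
  have [|Nw [r' [m2 m3]]] := hd (d / 2); first rewrite /ball /=.
    by rewrite sub0r normrN gtr0_norm; lra.
  exists (w (d / 2)); split=> //; split; [|exact: off|exact: off].
  move=> [i _]; move: i.
  have -> : coor z0 e1 (w (d / 2)) = coor z0 e1 z1 + rc (d / 2) * 'i.
    by rewrite /coor /w; field.
  by rewrite imD i1 imM re_rc im_rc im_i re_i; lra.
- exists (fun w => 1 < re (coor z0 e1 w) /\
      nonray (coor z0 e2 w) /\ nonray (coor z0 e3 w)); split; first exact: NN.
  move=> B cB BN w w' Bw Bw' sw sw'.
  have im0 v : B v -> seen v -> im (coor z0 e1 v) != 0.
    move=> Bv [o _ _]; apply/eqP => i; apply: o; split=> //.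
    by have [k _] := BN v Bv; apply: ltW.
  have iw := im0 w Bw sw; have iw' := im0 w' Bw' sw'.
  have lE u v t : coor z0 e1 (lin u v t) = lin (coor z0 e1 u) (coor z0 e1 v) t.
    by rewrite /coor /lin; field.
  (* on the same side of the ray the whole segment is visible *)
  have same (s : R) u v : s != 0 -> B u -> B v -> 0 < s * im (coor z0 e1 u) ->
      0 < s * im (coor z0 e1 v) -> wloop g b z0 u v = 1%g.
    move=> s0 Bu Bv iu iv.
    apply: (@wloop_seen _ _ _ _ _ gflat _ _ _ _ _ rts val
      (B `&` [set x | 0 < s * im (coor z0 e1 x)])).
    + move=> x y t [Bx ix] [By iy] t01; split; first exact: cB.
      rewrite /= lE; have [_ ->] := lin01E (coor z0 e1 x) (coor z0 e1 y) t.
      have := @itp_gt _ 0 (s * im (coor z0 e1 x)) (s * im (coor z0 e1 y)) t t01 ix iy.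
      by move=> h; apply: (lt_le_trans h); rewrite le_eqVlt; apply/orP; left; apply/eqP; ring.
    + by [].
    + by [].
    + move=> x [Bx ix]; have [k1' [k2 k3]] := BN x Bx; split; [|exact: off|exact: off].
      by move=> [i _]; move: ix; rewrite /= i mulr0 ltxx.
  have opp u v : B u -> B v -> im (coor z0 e1 u) < 0 -> 0 < im (coor z0 e1 v) ->
      H (wloop g b z0 u v) /\ sin Om b u v.
    move=> Bu Bv iu iv.
    have [ru _] := BN u Bu; have [rv _] := BN v Bv.
    have l : lone Om b z0 e1 (cone (coor z0 e1 u) (coor z0 e1 v)).
      have key f : z0 != f -> (forall x, B x -> nonray (coor z0 f x)) ->
          ~ cone (coor z0 e1 u) (coor z0 e1 v) ((f - z0) / (e1 - z0)).
        move=> zf nf [x [y [x0 y0 E]]].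
        have E' := coor_cone z1' E.
        have xy : x + y != 0.
          apply: contraNneq zf => xy.
          have x00 : x = 0 by lra.
          have y00 : y = 0 by lra.
          by rewrite eq_sym -subr_eq0 E' x00 y00 rc0 !mul0r addr0.
        have xy0 : 0 < x + y by rewrite lt_neqAle eq_sym xy addr_ge0.
        have t01 : 0 <= y / (x + y) <= 1.
          by rewrite divr_ge0 ?(ltW xy0) //= ler_pdivrMr // mul1r; lra.
        apply: (nf _ (cB u v _ Bu Bv t01)).
        have xyn : rc (x + y) != 0.
          by apply: contraNneq xy => /(congr1 re) /= ->.
        have -> : coor z0 f (lin u v (y / (x + y))) = rc ((x + y)^-1).
          have fz : f - z0 != 0 by rewrite subr_eq0 eq_sym.
          rewrite /coor; apply: (mulIf fz); rewrite divfK // E'.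
          apply: (mulfI xyn); rewrite mulrA -rcM divff // rc1 mul1r.
          rewrite /lin rcM /rc [in LHS]fmorphV -/(rc _) -/(rc _).
          by move: xyn; rewrite rcD => xyn; field.
        by rewrite im_rc re_rc invr_ge0 ltW.
      move=> f /(rootP _ rts)[] -> ; rewrite ?eqxx // => _; apply: key => // x Bx.
        by have [_ []] := BN x Bx.
      by have [_ []] := BN x Bx.
    have [T _] := tri_cone gflat z1' l ru iu rv iv.
    have [_ s2 _] := tin_lone z1' (@cone_convex _ _ _) (@cone0 _ _ _) (@conel _ _ _)
      (@coner _ _ _) l ru iu rv iv.
    move: T s2; rewrite !pt_coor // => T s2; split=> //.
    by rewrite /wloop -/(tri g b z0 u v) T.
  have [Hone Hmul Hinv] := Hg.
  move: iw iw'; rewrite !neq_lt => /orP[l1|l1] /orP[l2|l2].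
  + rewrite (same (-1) w w') // ?mulN1r ?oppr_gt0 //.
    by rewrite oppr_eq0 oner_eq0.
  + by have [] := opp w w' Bw Bw' l1 l2.
  + have [h s] := opp w' w Bw' Bw l2 l1.
    rewrite (wloop_inv gflat _ _ s); first exact: Hinv.
      exact: (seen_sin rts val sw').
    exact: (seen_sin rts val sw).
  + by rewrite (same 1 w w') // ?mul1r ?oner_eq0.
Qed.

End Gen.

Lemma seen_rot (z0 e1 e2 e3 w : C) : seen z0 e2 e3 e1 w -> seen z0 e1 e2 e3 w.
Proof. by case. Qed.

Section Gen2.
Variables (b z0 e1 e2 e3 : C) (H : G -> Prop).
Hypothesis (rts : roots3 b e1 e2 e3) (val : valid z0 e1 e2 e3) (Hg : subg H).
Hypothesis (H1 : H (mer b z0 e1)) (H2 : H (mer b z0 e2)) (H3 : H (mer b z0 e3)).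
Local Notation seen := (seen z0 e1 e2 e3).

Lemma local_loops z1 : Om (b, z1) ->
  (forall N, nbhs z1 N -> exists w, N w /\ seen w) /\
  (exists N, nbhs z1 N /\ forall B : set C, convexC B -> B `<=` N ->
    forall w w', B w -> B w' -> seen w -> seen w' -> H (wloop g b z0 w w')).
Proof.
move=> O1.
have [s1|s1] := pselect (offray z0 e1 z1); last exact: onray_local H1 _ O1 s1.
have [s2|s2] := pselect (offray z0 e2 z1); last first.
  have [h1 [N [h2 h3]]] := onray_local (roots3_rot rts) (valid_rot val) Hg H2 O1 s2.
  split; first by move=> M /h1[w [? ?]]; exists w; split=> //; exact: seen_rot.
  by exists N; split=> // B cB BN w w' Bw Bw' [? ? ?] [? ? ?]; apply: (h3 B).
have [s3|s3] := pselect (offray z0 e3 z1); last first.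
  have [h1 [N [h2 h3]]] := onray_local (roots3_rot (roots3_rot rts))
    (valid_rot (valid_rot val)) Hg H3 O1 s3.
  split; first by move=> M /h1[w [? ?]]; exists w; split=> //; do 2 apply: seen_rot.
  by exists N; split=> // B cB BN w w' Bw Bw' [? ? ?] [? ? ?]; apply: (h3 B).
have sz : seen z1 by split.
split; first by move=> N Nz; exists z1; split=> //; exact: nbhs_singleton.
exists seen; split; first exact: near_seen.
move=> B cB BN w w' Bw Bw' _ _.
by have [Hone _ _] := Hg; rewrite (wloop_seen gflat rts val cB Bw Bw' BN).
Qed.

(** Cut the plane along the rays hidden by the roots: a loop is a product of loops from [z0] through two
    close points of the cut plane, each of which crosses at most one ray. *)
Lemma gen_loop (c : R -> C) : fpath P q b z0 z0 c -> H (g (fp b c)).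
Proof.
move=> [[cc c0 c1] ic].
have [Hone Hmul Hinv] := Hg.
have yc := fp_c (b := b) cc.
pose A t w := (g (pre (fp b c) t) * g (sg b (c t) w) * g (sg b w z0))%g.
pose Sg t := exists N : set C, nbhs (c t) N /\ forall w, N w -> seen w -> H (A t w).
have z0i : 0 <= (0 : R) <= 1 by apply: in01; left.
have [z1' z2' z3' _] := val.
have cz (e : C) : coor z0 e z0 = 0 by rewrite /coor subrr mul0r.
have sz0 : seen z0 by split=> -[_]; rewrite cz re0 ler10.
have Om0 : Om (b, z0) by have := ic 0 z0i; rewrite /fp c0.
have sgz : sg b z0 z0 = (fun=> (b, z0)).
  by apply/funext => t; rewrite /sg /lin subrr mulr0 addr0.
have [_ _ g_cst _] := gflat.
suff E : Sg 1 = Sg 0.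
  have S0 : Sg 0.
    exists seen; split; first by rewrite c0; exact: near_seen.
    move=> w _ sw; rewrite /A c0.
    have -> : pre (fp b c) 0 = (fun=> (b, z0)).
      by apply/funext => t; rewrite /pre /fp mul0r c0.
    by rewrite g_cst // mul1g (sg_rev gflat) //; exact: (seen_sin rts val sw).
  move: S0; rewrite -E => -[N [Nz hN]].
  have := hN z0; rewrite c1 in Nz.
  move=> /(_ (nbhs_singleton Nz) sz0); rewrite /A c1 sgz g_cst // !mulg1.
  have -> // : pre (fp b c) 1 = fp b c.
  by apply/funext => t; rewrite /pre mul1r.
apply: lconst01 => t t01.
have Ot : Om (b, c t) := ic t t01.
have [dn [N [Nz hN]]] := local_loops Ot.
have NO : \forall w \near c t, N w /\ Om (b, w).
  apply: nearI Nz _; apply: (@near_Om _ _ _ _ (fun w => (b, w))); last exact: Ot.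
  exact: (@cont_pair C C C (fun=> b) (fun w => w) (@constc _ _ b) (@idC R)).
have [B [oB cB Bz BN]] := ball_convex NO.
have nB : nbhs (c t) B := open_nbhs_nbhs (conj oB Bz).
have NB : \forall u \near t, B (c u) by exact: near_cont (cc t) nB.
have adv := advance gflat yc ic t01.
apply: nearS (nearI NB adv) => u [Bu au] u01.
have AE w : B w -> A u w = A t w.
  move=> Bw; rewrite /A au -!mulgA; congr (_ * _)%g.
  have -> : L (fp b c t) (fp b c u) = sg b (c t) (c u).
    by apply/funext => s; rewrite /L /sg /fp /= /lin subrr mulr0 addr0.
  rewrite mulgA (sg_tri gflat) // => s r s01 r01.
  by have [] := BN _ (cB _ _ s Bz (cB _ _ r Bu Bw r01) s01).
have SE s : B (c s) -> Om (b, c s) -> (forall w, B w -> A s w = A t w) ->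
    Sg s <-> (forall w, B w -> seen w -> H (A t w)).
  move=> Bs Os As; split; last first.
    move=> h; exists B; split; first exact: (open_nbhs_nbhs (conj oB Bs)).
    by move=> w Bw sw; rewrite As //; exact: h.
  move=> [M [nM hM]].
  have [dns _] := local_loops Os.
  have [|w0 [[Mw0 Bw0] sw0]] := dns (M `&` B).
    by apply: filterI; [exact: nM|exact: (open_nbhs_nbhs (conj oB Bs))].
  move=> w Bw sw.
  have -> : A t w = (A t w0 * wloop g b z0 w0 w)%g.
    have s0 := sin_sym (seen_sin rts val sw0).
    rewrite /A /wloop -!mulgA; congr (_ * _)%g.
    have T : (g (sg b (c t) w0) * g (sg b w0 w) = g (sg b (c t) w))%g.
      apply: (sg_tri gflat) => r r' r01 r'01.
      by have [] := BN _ (cB _ _ r Bz (cB _ _ r' Bw0 Bw r'01) r01).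
    by rewrite (mulgA (g (sg b w0 z0))) (sg_rev gflat s0) mul1g mulgA T.
  apply: Hmul; first by rewrite -As //; exact: hM.
  by apply: (hN B) => // x /BN[].
apply/propext; rewrite SE //; last exact: ic.
by rewrite SE.
Qed.

End Gen2.

End Planar.

Section Center.
Context {R : realType}.
Local Notation C := R[i].

Lemma nonray_im (u : C) : im u != 0 -> nonray u.
Proof. by move=> i [i0 _]; rewrite i0 eqxx in i. Qed.

Lemma im_inv (s : C) : im s != 0 -> im s^-1 != 0.
Proof.
move=> i; have s0 : s != 0 by apply: contraNneq i => ->.
apply: contraNneq i => i0.
have E : s * s^-1 = 1 by rewrite divff.
have := congr1 im E; have := congr1 re E; rewrite imM reM i0 !mulr0 subr0 add0r re1 im1.
move=> e1 /eqP; rewrite mulf_eq0 => /orP[//|/eqP r0].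
by move: e1; rewrite r0; lra.
Qed.

(** In the coordinate with origin [e1] and unit [e2], the quotients of the directions from [s] to [0], [1],
    [s ^ 2] are [1 - 1 / s], [1 - s] and [- s], none of which is real. *)
Lemma center_valid (e1 e2 s : C) : e1 != e2 -> im s != 0 ->
  valid (pt e1 e2 s) e1 e2 (pt e1 e2 (s ^+ 2)).
Proof.
move=> e12 i.
have d0 : e2 - e1 != 0 by rewrite subr_eq0 eq_sym.
have s0 : s != 0 by apply: contraNneq i => ->.
have s1 : 1 - s != 0 by apply: contraNneq i => /eqP; rewrite subr_eq0 => /eqP <-.
have D (u v : C) : pt e1 e2 u - pt e1 e2 v = (u - v) * (e2 - e1) by rewrite /pt; ring.
have E1 : e1 = pt e1 e2 0 by rewrite pt0.
have E2 : e2 = pt e1 e2 1 by rewrite pt1.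
have ne (u v : C) : u - v != 0 -> pt e1 e2 u != pt e1 e2 v.
  by move=> uv; rewrite -subr_eq0 D mulf_neq0.
have iV := im_inv i.
have z1 : pt e1 e2 s != e1 by rewrite {2}E1 ne // subr0.
have z2 : pt e1 e2 s != e2 by rewrite {2}E2 ne // -oppr_eq0 opprB.
split=> //.
  by apply: ne; rewrite (_ : s - s ^+ 2 = s * (1 - s)) ?mulf_neq0 //; ring.
have N1 : e1 - pt e1 e2 s = - s * (e2 - e1) by rewrite /pt; ring.
have N2 : e2 - pt e1 e2 s = (1 - s) * (e2 - e1) by rewrite /pt; ring.
have N3 : pt e1 e2 (s ^+ 2) - pt e1 e2 s = (s ^+ 2 - s) * (e2 - e1) by rewrite D.
split; rewrite ?N1 ?N2 ?N3; apply: nonray_im.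
- have -> : (1 - s) * (e2 - e1) / (- s * (e2 - e1)) = 1 - s^-1 by (field; rewrite ?d0 ?s0 ?s1 ?mulf_neq0 ?oppr_eq0 ?invr_neq0).
  by rewrite imD imN im1 add0r oppr_eq0.
- have -> : (s ^+ 2 - s) * (e2 - e1) / (- s * (e2 - e1)) = 1 - s by (field; rewrite ?d0 ?s0 ?s1 ?mulf_neq0 ?oppr_eq0 ?invr_neq0).
  by rewrite imD imN im1 add0r oppr_eq0.
- have -> : (s ^+ 2 - s) * (e2 - e1) / ((1 - s) * (e2 - e1)) = - s by (field; rewrite ?d0 ?s0 ?s1 ?mulf_neq0 ?oppr_eq0 ?invr_neq0).
  by rewrite imN oppr_eq0.
Qed.

End Center.

Lemma poly_ext (R : realType) (p p' : {poly R[i]}) : (forall v, p.[v] = p'.[v]) -> p = p'.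
Proof.
move=> h; apply/eqP; rewrite -subr_eq0; apply/eqP; apply: contrapT => /eqP n0.
have := @max_poly_roots _ (p - p') [seq i%:R | i <- iota 0 (size (p - p'))] n0.
rewrite size_map size_iota ltnn => H; apply/notF/H.
  by apply/allP => x _; rewrite rootE hornerD hornerN h subrr.
by rewrite map_inj_uniq ?iota_uniq // => i j /eqP; rewrite eqr_nat => /eqP.
Qed.

Section Affine.
Context {R : realType} {G : groupType}.
Local Notation C := R[i].
Variables (P q : {poly C}).
Local Notation Om := (Om P q).
Local Notation roots3 := (roots3 P q).
Variable g : (R -> C * C) -> G.
Hypothesis gflat : flat Om g.
Local Notation mer := (mer Om g).

Let g_sq := let: And4 h _ _ _ := gflat in h.
Let g_cst := let: And4 _ _ h _ := gflat in h.
Let g_ext := let: And4 _ _ _ h := gflat in h.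

Definition fibpoly (b : C) : {poly C} := 'X^3 + P.[b] *: 'X + q.[b]%:P.

Lemma fibpolyE b v : (fibpoly b).[v] = cub P q (b, v).
Proof. by rewrite /fibpoly /cub !hornerE. Qed.

Lemma fibpoly_monic b : fibpoly b \is monic /\ size (fibpoly b) = 4.
Proof.
have s : (size (P.[b] *: 'X + q.[b]%:P)%R < 4)%N.
  rewrite (leq_ltn_trans (size_polyD _ _)) // gtn_max.
  by rewrite (leq_ltn_trans (size_scale_leq _ _)) ?size_polyX // (leq_ltn_trans (size_polyC_leq1 _)).
rewrite /fibpoly -addrA; split; last by rewrite size_polyDl ?size_polyXn.
by rewrite monicE lead_coefDl ?size_polyXn // lead_coefXn.
Qed.

Lemma fib_roots b : exists Lb : seq C, forall v, ~ Om (b, v) -> v \in Lb.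
Proof.
have [m _] := fibpoly_monic b.
exists (proots (fibpoly b)) => v /negP; rewrite negbK => /eqP h.
by rewrite mem_proots ?monic_neq0 // rootE fibpolyE h.
Qed.

(** Continuity of the roots of a monic polynomial, as a lifting property of the three roots. *)
Lemma roots3_near (b e1 e2 e3 : C) (N : C * (C * (C * C)) -> Prop) : roots3 b e1 e2 e3 ->
  (\forall x \near (b, (e1, (e2, e3))), N x) ->
  \forall c \near b, exists f1 f2 f3, N (c, (f1, (f2, f3))) /\ roots3 c f1 f2 f3.
Proof.
move=> r nN.
have E : fibpoly b = \prod_(x <- [:: e1; e2; e3]) ('X - x%:P).
  apply: poly_ext => v; rewrite fibpolyE r !big_cons big_nil !hornerM !hornerXsubC hornerC.
  by rewrite mulr1 !mulrA.
have [[A1 A2] /= [nA1 nA2] A12] := nN.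
have [[B1 B2] /= [nB1 nB2] B12] := nA2.
have [[D1 D2] /= [nD1 nD2] D12] := nB2.
have /nbhs_ballP[x1 /= x10 h1] := nB1.
have /nbhs_ballP[x2 /= x20 h2] := nD1.
have /nbhs_ballP[x3 /= x30 h3] := nD2.
have [r1 r10 E1] := pos_rc x10; have [r2 r20 E2] := pos_rc x20; have [r3 r30 E3] := pos_rc x30.
pose d := Order.min r1 (Order.min r2 r3).
have d0 : 0 < d by rewrite /d !lt_min r10 r20.
have rd : 0 < rc d by rewrite ltcR.
have M := @roots_match R C (nbhs b) (nbhs_filter b) fibpoly [:: e1; e2; e3] _ _ (rc d) rd.
have {}M := M _ _.
have H : \forall c \near b, exists qs, [/\ fibpoly c = \prod_(x <- qs) ('X - x%:P),
    size qs = 3 & forall i, (i < 3)%N -> `|[:: e1; e2; e3]`_i - qs`_i| < rc d].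
  apply: M; last by apply: nearW => c; exact: fibpoly_monic.
  move=> i; rewrite -E.
  have -> : (fun t => (fibpoly t)`_i) =
      (fun t => (i == 3)%:R + P.[t] * (i == 1)%:R + (if i == 0 then q.[t] else 0)).
    by apply/funext => t; rewrite /fibpoly !coefD coefXn coefZ coefX coefC.
  have -> : (fibpoly b)`_i = (i == 3)%:R + P.[b] * (i == 1)%:R + (if i == 0 then q.[b] else 0).
    by rewrite /fibpoly !coefD coefXn coefZ coefX coefC.
  have c : continuous (fun t : C => (i == 3)%:R + P.[t] * (i == 1)%:R +
      (if i == 0 then q.[t] else 0)).
    apply: (contD (contD (@constc _ _ _) (contM (cont_horner (p := P) (@idC R)) (@constc _ _ _)))).
    by case: (i == 0); [exact: (cont_horner (p := q) (@idC R))|exact: constc].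
  exact: c.
apply: nearS (nearI nA1 H) => c [Ac [qs [Eq sq hq]]].
case: qs sq Eq hq => [|f1 [|f2 [|f3 [|//]]]] // _ Eq hq.
have le1 : d <= r1 by rewrite /d ge_min lexx.
have le2 : d <= r2 by rewrite /d !ge_min lexx orbT.
have le3 : d <= r3 by rewrite /d !ge_min lexx !orbT.
exists f1, f2, f3; split.
  apply: (A12 (c, (f1, (f2, f3)))); split=> //=.
  apply: (B12 (f1, (f2, f3))); split=> /=.
    by apply: h1; rewrite /ball /= E1; apply: lt_le_trans (hq 0%N isT) _; rewrite lecR.
  apply: (D12 (f2, f3)); split=> /=.
    by apply: h2; rewrite /ball /= E2; apply: lt_le_trans (hq 1%N isT) _; rewrite lecR.
  by apply: h3; rewrite /ball /= E3; apply: lt_le_trans (hq 2%N isT) _; rewrite lecR.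
move=> v; rewrite -fibpolyE Eq !big_cons big_nil !hornerM !hornerXsubC hornerC.
by rewrite mulr1 !mulrA.
Qed.

(** The fibre is a plane minus at most three points, which a broken line avoids. *)
Lemma fib_conn b z w : Om (b, z) -> Om (b, w) -> exists c, fpath P q b z w c.
Proof.
move=> Oz Ow.
have [Lb hLb] := fib_roots b.
pose L' := [seq x <- Lb | `[< ~ Om (b, x) >]].
have LE x : x \notin L' <-> Om (b, x).
  rewrite mem_filter; split.
    by move=> h; apply: contrapT => nO; move: h; rewrite (asboolT nO) /= hLb.
  by move=> O; rewrite asboolF.
have Nw : \forall v \near w, Om (b, v).
  apply: (@near_Om _ _ _ _ (fun v => (b, v))); last exact: Ow.
  exact: (@cont_pair C C C (fun=> b) (fun v => v) (@constc _ _ b) (@idC R)).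
have [B [oB cB Bw BN]] := ball_convex Nw.
have [v Bv hv] := avoid_segment ((LE z).2 Oz) (open_nbhs_nbhs (conj oB Bw)).
have s1 : sin Om b z v by move=> t t01; apply/LE; exact: hv.
have s2 : sin Om b v w by move=> t t01; apply: BN; exact: cB.
by have [h _] := fp_cat gflat (fp_sg s1) (fp_sg s2); exists (pcat (lin z v) (lin v w)).
Qed.

Lemma poly_bound (p : {poly C}) (r : C) : 0 <= r ->
  exists2 M : C, 0 <= M & forall b, `|b| <= r -> `|p.[b]| <= M.
Proof.
move=> r0; elim/poly_ind: p => [|p c [M M0 hM]].
  by exists 0 => // b _; rewrite horner0 normr0.
exists (M * r + `|c|); first by rewrite addr_ge0 ?mulr_ge0.
move=> b br; rewrite hornerMXaddC; apply: le_trans (ler_normD _ _) _.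
by rewrite lerD2r normrM ler_pM // hM.
Qed.

(** A cubic polynomial does not vanish at a large real [M]: this provides a section over each disc. *)
Lemma far_Om b (M : C) : `|P.[b]| + `|q.[b]| + 1 <= M -> Om (b, M).
Proof.
move=> h; apply/negP => /eqP E.
have M1 : 1 <= M by apply: le_trans h; rewrite lerDr addr_ge0.
have M0 : 0 <= M by apply: le_trans M1.
have nM : `|M| = M by rewrite ger0_norm.
have : M ^+ 3 = - (P.[b] * M + q.[b]).
  by apply/eqP; rewrite -subr_eq0 opprK addrA; apply/eqP; exact: E.
move/(congr1 (fun x => `|x|)); rewrite normrX nM normrN => E3.
have : M ^+ 3 <= `|P.[b]| * M + `|q.[b]|.
  by rewrite E3; apply: le_trans (ler_normD _ _) _; rewrite normrM nM.
have k1 : M <= M ^+ 2 by rewrite -{1}[M]expr1 ler_weXn2l.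
have k2 : `|P.[b]| * M <= `|P.[b]| * M ^+ 2 by rewrite ler_wpM2l.
have k3 : `|q.[b]| <= `|q.[b]| * M ^+ 2.
  by rewrite ler_peMr // (le_trans M1).
have k4 : (`|P.[b]| + `|q.[b]| + 1) * M ^+ 2 <= M ^+ 3.
  by rewrite [M ^+ 3]exprS ler_wpM2r // exprn_ge0.
have k5 : 0 < M ^+ 2 by rewrite exprn_gt0 // (lt_le_trans ltr01).
move=> k6.
have : (`|P.[b]| + `|q.[b]| + 1) * M ^+ 2 <= (`|P.[b]| + `|q.[b]|) * M ^+ 2.
  apply: le_trans k4 (le_trans k6 _); rewrite mulrDl; exact: lerD.
by rewrite ler_pM2r // gerDl real_leNgt ?real1 ?real0 // ltr01.
Qed.

Lemma base_tri (b b' b'' v : C) :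
  (forall s t, 0 <= s <= 1 -> 0 <= t <= 1 -> Om (lin b (lin b' b'' t) s, v)) ->
  (g (L (b, v) (b', v)) * g (L (b', v) (b'', v)) = g (L (b, v) (b'', v)))%g.
Proof.
move=> h.
pose K (x : R * R) : C * C := (lin b (lin b' b'' x.2) x.1, v).
have Kc : continuous K.
  have k1 : continuous (fun x : R * R => lin b (lin b' b'' x.2) x.1).
    apply: lin_cont; [exact: constc| |exact: fstc].
    by apply: (cont_comp sndc); exact: lin_c.
  exact: (@cont_pair _ C C _ (fun=> v) k1 (@constc _ _ v)).
have lc (x : C) t : lin x x t = x by rewrite /lin subrr mulr0 addr0.
have := g_sq Kc h.
have -> : (fun t => K (t, 0)) = L (b, v) (b', v).
  by apply/funext => t; rewrite /K /L /= lin0 lc.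
have -> : (fun t => K (t, 1)) = L (b, v) (b'', v).
  by apply/funext => t; rewrite /K /L /= lin1 lc.
have -> : (fun t => K (0, t)) = (fun=> (b, v)).
  by apply/funext => t; rewrite /K /= lin0.
have -> : (fun t => K (1, t)) = L (b', v) (b'', v).
  by apply/funext => t; rewrite /K /L /= lin1 lc.
rewrite g_cst ?mul1g //.
by have := h 0 0; rewrite lin0 lexx ler01; apply.
Qed.

(** A path of a fibre is compact, hence survives in the neighbouring fibres, and the square between the
    two copies is filled. *)
Lemma fibre_transport b z w c : fpath P q b z w c ->
  \forall b' \near b, fpath P q b' z w c /\
    (g (L (b, z) (b', z)) * g (fp b' c) = g (fp b c) * g (L (b, w) (b', w)))%g.
Proof.
move=> [[cc c0 c1] ic].
have H : \forall b' \near b, forall t, 0 <= t <= 1 -> forall s, 0 <= s <= 1 ->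
    Om (lin b b' s, c t).
  apply: (@near_seg R C b (fun t b' => forall s, 0 <= s <= 1 -> Om (lin b b' s, c t))) => t t01.
  apply: (@near_seg R (R * C)%type (t, b) (fun s x => Om (lin b x.2 s, c x.1))) => s s01.
  apply: (@near_Om _ _ _ _ (fun x : R * (R * C) => (lin b x.2.2 x.1, c x.2.1)) (s, (t, b))).
    have k1 : continuous (fun x : R * (R * C) => lin b x.2.2 x.1).
      by apply: lin_cont; [exact: constc|exact: (cont_comp cont_snd cont_snd)|exact: cont_fst].
    have k2 : continuous (fun x : R * (R * C) => c x.2.1).
      exact: (cont_comp (cont_comp cont_snd cont_fst) cc).
    exact: (@cont_pair _ C C _ _ k1 k2).
  by rewrite /= /lin subrr mulr0 addr0; exact: ic.
apply: nearS H => b' H; split.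
  split; first by split.
  by move=> t t01; have := H t t01 1; rewrite lin1 ler01 lexx; apply.
pose K (x : R * R) : C * C := (lin b b' x.1, c x.2).
have Kc : continuous K.
  have k1 : continuous (fun x : R * R => lin b b' x.1) by apply: (cont_comp fstc); exact: lin_c.
  exact: (@cont_pair _ C C _ _ k1 (cont_comp sndc cc)).
have lc (x : C) t : lin x x t = x by rewrite /lin subrr mulr0 addr0.
have := g_sq Kc (fun s t s01 t01 => H t t01 s s01).
have -> : (fun t => K (t, 0)) = L (b, z) (b', z).
  by apply/funext => t; rewrite /K /L /= c0 lc.
have -> : (fun t => K (t, 1)) = L (b, w) (b', w).
  by apply/funext => t; rewrite /K /L /= c1 lc.
have -> : (fun t => K (0, t)) = fp b c.
  by apply/funext => t; rewrite /K /fp /= lin0.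
have -> // : (fun t => K (1, t)) = fp b' c.
by apply/funext => t; rewrite /K /fp /= lin1.
Qed.

(* the triangular loop around a root as a single path *)
Lemma mer_loop b z e1 e2 e3 : roots3 b e1 e2 e3 -> valid z e1 e2 e3 ->
  exists2 c, fpath P q b z z c & g (fp b c) = mer b z e1.
Proof.
move=> r v; have [h gh] := valid_good1 r v.
have [s1 s2 s3] := tin_good gh.
have [p1 E1] := fp_cat gflat (fp_sg s1) (fp_sg s2).
have [p2 E2] := fp_cat gflat p1 (fp_sg s3).
exists (pcat (pcat (lin z (pt z e1 (vl h))) (lin (pt z e1 (vl h)) (pt z e1 (vr h))))
  (lin (pt z e1 (vr h)) z)) => //.
by rewrite E2 E1 (merE gflat gh).
Qed.

End Affine.

Section AffineGen.
Context {R : realType} {G : groupType}.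
Local Notation C := R[i].
Variables (P q : {poly C}).
Local Notation Om := (Om P q).
Local Notation roots3 := (roots3 P q).
Variable g : (R -> C * C) -> G.
Hypothesis gflat : flat Om g.
Local Notation mer := (mer Om g).

Let g_sq := let: And4 h _ _ _ := gflat in h.
Let g_cst := let: And4 _ _ h _ := gflat in h.
Let g_ext := let: And4 _ _ _ h := gflat in h.

Lemma subg_conj (H : G -> Prop) (k : G) : subg H -> subg (fun h => H (k * h * k^-1)%g).
Proof.
move=> [H1 HM HV]; split; first by rewrite mulg1 mulgV.
- by move=> a b ha hb; have := HM _ _ ha hb; rewrite !mulgA mulgVK.
- by move=> a /HV; rewrite !invgM invgK mulgA.
Qed.

(** [gen_loop] and [mer_loop], transported along [c1]. *)
Lemma loops_mer b z m e1 e2 e3 (c1 : R -> C) (H : G -> Prop) :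
  roots3 b e1 e2 e3 -> valid z e1 e2 e3 -> subg H -> fpath P q b z m c1 ->
  let k := g (fp b c1) in
  (forall c, fpath P q b m m c -> H (g (fp b c))) <->
  [/\ H (k^-1 * mer b z e1 * k)%g, H (k^-1 * mer b z e2 * k)%g & H (k^-1 * mer b z e3 * k)%g].
Proof.
move=> r v sH p1 k; have [p2 E2] := fp_rev gflat p1; split.
  move=> h.
  have key f1 f2 f3 : roots3 b f1 f2 f3 -> valid z f1 f2 f3 -> H (k^-1 * mer b z f1 * k)%g.
    move=> r' v'; have [c pc <-] := mer_loop gflat r' v'.
    have [p3 E3] := fp_cat gflat p2 pc; have [p4 E4] := fp_cat gflat p3 p1.
    by have := h _ p4; rewrite E4 E3 E2.
  split; first exact: key r v.
    exact: key (roots3_rot r) (valid_rot v).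
  exact: key (roots3_rot (roots3_rot r)) (valid_rot (valid_rot v)).
move=> [h1 h2 h3] c pc.
have [p3 E3] := fp_cat gflat p1 pc; have [p4 E4] := fp_cat gflat p3 p2.
have sH' := subg_conj k^-1%g sH.
have := gen_loop gflat r v sH' _ _ _ p4.
rewrite invgK => /(_ h1 h2 h3); rewrite E4 E3 E2 -/k.
by rewrite !mulgA mulVg mul1g mulgVK.
Qed.

Lemma path_bounded (y : R -> C) : continuous y ->
  exists2 M : C, 0 < M & forall t : R, 0 <= t <= 1 -> `|y 0 - y t| < M.
Proof.
move=> yc.
have H : \forall e \near (0 : R), forall t, 0 <= t <= 1 -> `|rc e * (y 0 - y t)| < 1.
  apply: (@near_seg R R 0 (fun t e => `|rc e * (y 0 - y t)| < 1)) => t t01.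
  have c : continuous (fun x : R * R => rc x.2 * (y 0 - y x.1)).
    exact: (contM (cont_comp sndc rcc) (contB (@constc _ _ (y 0)) (cont_comp fstc yc))).
  have := near_dist (t, 0 : R) c (@ltr01 C).
  by apply: nearS => x; rewrite rc0 mul0r sub0r normrN.
move: H => /nbhs_ballP[d /= d0 hd].
have d20 : 0 < d / 2 by lra.
have := hd (d / 2); rewrite /ball /= sub0r normrN gtr0_norm // => /(_ ltac:(lra)) h.
have r0 : 0 < rc (d / 2) by rewrite ltcR.
exists (rc (d / 2))^-1; first by rewrite invr_gt0.
move=> t t01; have := h t t01.
by rewrite normrM (gtr0_norm r0) -[(rc _)^-1]mulr1 ltr_pdivlMl.
Qed.

(** The loop is pushed to the constant section [m] over a disc containing its projection, and the set of
    the base points over which the loops at [m] land in the conjugate of [H] is locally constant; by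
    connectedness it is everything, even over the exceptional set, where a loop can be moved to a
    neighbouring fibre. *)
Lemma aff_gen (Ls : seq C) (b0 z0 e1 e2 e3 : C) (y : R -> C * C) (H : G -> Prop) :
  (forall b : C, b \notin Ls -> exists e1 e2 e3 z : C, roots3 b e1 e2 e3 /\ valid z e1 e2 e3) ->
  b0 \notin Ls -> roots3 b0 e1 e2 e3 -> valid z0 e1 e2 e3 -> subg H ->
  H (mer b0 z0 e1) -> H (mer b0 z0 e2) -> H (mer b0 z0 e3) ->
  pth y (b0, z0) (b0, z0) -> inside Om y -> H (g y).
Proof.
move=> nsing b0L r0 v0 sH h1 h2 h3 [yc y0 y1] iy.
have [Hone HM HV] := sH.
have bc : continuous (fun t => (y t).1) := cont_comp yc cont_fst.
have vc : continuous (fun t => (y t).2) := cont_comp yc cont_snd.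
have [rho rho0 hrho] := path_bounded bc; rewrite y0 /= in hrho.
pose D : set C := [set b | `|b0 - b| < rho].
have cD : convexC D := @disc_convex R b0 rho rho0.
have oD : open D := @disc_open R b0 rho.
have Db0 : D b0 by rewrite /D /= subrr normr0.
have [r r0' hr] : exists2 r, 0 <= r & forall b, D b -> `|b| <= r.
  exists (rho + `|b0|); first by rewrite addr_ge0 // ltW.
  move=> b Db; have -> : b = - (b0 - b) + b0 by ring.
  by apply: le_trans (ler_normD _ _) _; rewrite lerD2r normrN ltW.
have [m1 m10 hP] := poly_bound P r0'; have [m2 m20 hq] := poly_bound q r0'.
pose m := m1 + m2 + 1.
have Om_m b : D b -> Om (b, m).
  by move=> /hr Db; apply: far_Om; rewrite /m lerD2r lerD ?hP ?hq.
have O0 : Om (b0, z0) by have := iy 0; rewrite y0 lexx ler01; apply.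
have [c0 pc0] := fib_conn gflat O0 (Om_m _ Db0).
set ga := g (fp b0 c0).
pose K b := g (L (b0, m) (b, m)).
(* the loops at the constant section, transported to the base point, land in [H] *)
pose Good b := forall c, fpath P q b m m c -> H (ga * K b * g (fp b c) * (K b)^-1 * ga^-1)%g.
have KL b b' : D b -> D b' -> (K b * g (L (b, m) (b', m)) = K b')%g.
  move=> Db Db'; apply: (base_tri gflat) => s t s01 t01; apply: Om_m.
  by apply: (cD) => //; exact: (cD).
have K0 : K b0 = 1%g by rewrite /K Lcst g_cst //; exact: Om_m.
have sHk b : subg (fun h => H (ga * K b * h * (K b)^-1 * ga^-1)%g).
  have := subg_conj (ga * K b)%g sH; rewrite invgM.
  by move=> [k1 k2 k3]; split=> [|u v|u]; rewrite -?mulgA; [move: k1|move: (k2 u v)|move: (k3 u)];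
    rewrite -?mulgA.
have good0 : Good b0.
  move=> c pc; rewrite K0 invg1 !mulg1.
  have [p1 E1] := fp_cat gflat pc0 pc; have [p2 E2] := fp_rev gflat pc0.
  have [p3 E3] := fp_cat gflat p1 p2.
  by have := gen_loop gflat r0 v0 sH h1 h2 h3 p3; rewrite E3 E1 E2.
have lconst : forall b, D b -> b \notin Ls -> \forall b' \near b, Good b' = Good b.
  move=> b Db bL; have [f1 [f2 [f3 [z [rb vb]]]]] := nsing b bL.
  have Oz : Om (b, z).
    have [zf1 zf2 zf3 _] := vb.
    apply: contrapT => /(rootP _ rb)[] E; [move: zf1|move: zf2|move: zf3]; by rewrite E eqxx.
  have [c1 pc1] := fib_conn gflat Oz (Om_m _ Db).
  have ND : \forall b' \near b, D b' by apply: open_nbhs_nbhs; split.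
  have H1 := fibre_transport gflat pc1.
  have near3 : \forall x \near (b, (f1, (f2, f3))), valid z x.2.1 x.2.2.1 x.2.2.2 /\
     (roots3 x.1 x.2.1 x.2.2.1 x.2.2.2 ->
       let A := g (L (b, z) (x.1, z)) in
       [/\ mer x.1 z x.2.1 = A^-1 * mer b z f1 * A,
           mer x.1 z x.2.2.1 = A^-1 * mer b z f2 * A &
           mer x.1 z x.2.2.2 = A^-1 * mer b z f3 * A])%g.
    have [h [gh1 gh2 gh3]] := valid_good rb vb.
    have [n12 n13 n23] := valid_neq vb.
    pose x0 := (b, (f1, (f2, f3))).
    have q1 : continuous (fun x : C * (C * (C * C)) => x.1) by exact: cont_fst.
    have q2 : continuous (fun x : C * (C * (C * C)) => x.2.1).
      exact: (cont_comp cont_snd cont_fst).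
    have q3 : continuous (fun x : C * (C * (C * C)) => x.2.2.1).
      exact: (cont_comp (cont_comp cont_snd cont_snd) cont_fst).
    have q4 : continuous (fun x : C * (C * (C * C)) => x.2.2.2).
      exact: (cont_comp (cont_comp cont_snd cont_snd) cont_snd).
    have qz := @constc (C * (C * (C * C)))%type C z.
    have n21 : f2 != f1 by rewrite eq_sym.
    have n31 : f3 != f1 by rewrite eq_sym.
    have n32 : f3 != f2 by rewrite eq_sym.
    have M1 := @mer_near _ _ _ _ _ gflat _ _ _ _ _ _ x0 h q1 qz q2 q3 q4 rb n21 n31 gh1.
    have M2 := @mer_near _ _ _ _ _ gflat _ _ _ _ _ _ x0 h q1 qz q3 q4 q2 (roots3_rot rb) n32 n12 gh2.
    have M3 := @mer_near _ _ _ _ _ gflat _ _ _ _ _ _ x0 h q1 qz q4 q2 q3 (roots3_rot (roots3_rot rb)) n13 n23 gh3.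
    have NV := @near_valid _ _ _ _ _ _ x0 qz q2 q3 q4 vb.
    apply: nearS (nearI NV (nearI M1 (nearI M2 M3))) => x [nv [k1 [k2 k3]]].
    split=> // rx A; have [_ E1] := k1 rx; have [_ E2] := k2 (roots3_rot rx).
    by have [_ E3] := k3 (roots3_rot (roots3_rot rx)); split.
  have H2 := roots3_near rb near3.
  apply: nearS (nearI ND (nearI H1 H2)) => b' [Db' [[pc' E] [f1' [f2' [f3' [[/= vb' mE] rb']]]]]].
  have [{mE}m1E m2E m3E] := mE rb'.
  have KB := KL b b' Db Db'.
  have conjE (x : G) : (ga * K b' * ((g (fp b' c1))^-1 * ((g (L (b, z) (b', z)))^-1 * x *
      g (L (b, z) (b', z))) * g (fp b' c1)) * (K b')^-1 * ga^-1 =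
      ga * K b * ((g (fp b c1))^-1 * x * g (fp b c1)) * (K b)^-1 * ga^-1)%g.
    have F : (g (L (b, z) (b', z)) * g (fp b' c1) * (K b')^-1 * ga^-1 =
       g (fp b c1) * (K b)^-1 * ga^-1)%g.
      by rewrite E -KB invgM !mulgA mulgK.
    have F' : (ga * K b' * (g (fp b' c1))^-1 * (g (L (b, z) (b', z)))^-1 =
       ga * K b * (g (fp b c1))^-1)%g.
      apply: invg_inj; rewrite !invgM !invgK !mulgA.
      exact: F.
    transitivity ((ga * K b' * (g (fp b' c1))^-1 * (g (L (b, z) (b', z)))^-1) * x *
      (g (L (b, z) (b', z)) * g (fp b' c1) * (K b')^-1 * ga^-1))%g.
      by rewrite -!mulgA.
    by rewrite F F' -!mulgA.
  apply/propext; rewrite /Good.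
  rewrite (loops_mer rb' vb' (sHk b') pc') (loops_mer rb vb (sHk b) pc1).
  by rewrite m1E m2E m3E !conjE.
have good b : D b -> Good b.
  move=> Db c pc.
  have ND : \forall b' \near b, D b' by apply: open_nbhs_nbhs; split.
  have [b' [Db' [pc' E]] avoid] := avoid_segment b0L (nearI ND (fibre_transport gflat pc)).
  have b'L : b' \notin Ls by have := avoid 1; rewrite lin1 ler01 lexx; apply.
  have GE := lconst_avoid cD oD lconst Db' Db0 b'L b0L.
  have : Good b' by rewrite GE.
  move=> /(_ c pc'); rewrite -(KL b b' Db Db') invgM !mulgA.
  rewrite -(mulgA _ (g (L (b, m) (b', m)))) E !mulgA mulgK.
  by [].
(* the initial part of the path, closed up by the fibre and the constant section *)
pose E t c := (g (pre y t) * g (fp (y t).1 c) * (K (y t).1)^-1 * ga^-1)%g.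
pose Sg t := forall c, fpath P q (y t).1 (y t).2 m c -> H (E t c).
have Dy t : 0 <= t <= 1 -> D (y t).1 by exact: hrho.
have Oy t : 0 <= t <= 1 -> Om ((y t).1, (y t).2) by rewrite -surjective_pairing; exact: iy.
have SE t c : 0 <= t <= 1 -> fpath P q (y t).1 (y t).2 m c -> Sg t <-> H (E t c).
  move=> t01 pc; split=> [|h]; first exact.
  move=> c' pc'; have [p1 E1] := fp_rev gflat pc; have [p2 E2] := fp_cat gflat p1 pc'.
  have := HM _ _ h (good _ (Dy t t01) _ p2).
  by rewrite E2 E1 /E !mulgA !mulgVK mulgK.
suff S1 : Sg 1.
  have := S1 c0; rewrite /E y1 /= K0 invg1 mulg1 mulgK => /(_ pc0).
  by have -> : pre y 1 = y by apply/funext => t; rewrite /pre mul1r.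
have -> : Sg 1 = Sg 0; last first.
  move=> c; rewrite /E y0 /= K0 invg1 mulg1 => pc.
  have -> : pre y 0 = (fun=> (b0, z0)) by apply/funext => t; rewrite /pre mul0r y0.
  rewrite g_cst // mul1g.
  have [p2 E2] := fp_rev gflat pc0; have [p3 E3] := fp_cat gflat pc p2.
  by have := gen_loop gflat r0 v0 sH h1 h2 h3 p3; rewrite E3 E2.
apply: lconst01 => t t01.
have [c pc] := fib_conn gflat (Oy t t01) (Om_m _ (Dy t t01)).
have N1 : \forall u \near t, fpath P q (y u).1 (y t).2 m c /\
    (g (L ((y t).1, (y t).2) ((y u).1, (y t).2)) * g (fp (y u).1 c) =
     g (fp (y t).1 c) * g (L ((y t).1, m) ((y u).1, m)))%g.
  exact: (near_cont (bc t) (fibre_transport gflat pc)).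
have N2 := @near_sin_lin _ P q _ (fun u => (y u).1) (fun u => (y u).2) (fun=> (y t).2) t bc vc
  (@constc _ _ (y t).2).
have {}N2 := N2 _.
have s0 : sin Om (y t).1 (y t).2 (y t).2.
  by move=> s s01; rewrite /sg /lin subrr mulr0 addr0; exact: Oy.
have N3 := advance gflat yc iy t01.
apply: nearS (nearI N1 (nearI (N2 s0) N3)) => u [[p1 E1] [k2 k3]] u01.
have su : sin Om (y u).1 (y u).2 (y t).2.
  by have := k2 1; rewrite !lin1 ler01 lexx; apply.
have [p2 E2] := fp_cat gflat (fp_sg su) p1.
have M := sq_move gflat k2.
have c1 : g (sg (y t).1 (y t).2 (y t).2) = 1%g.
  have -> : sg (y t).1 (y t).2 (y t).2 = (fun=> ((y t).1, (y t).2)).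
    by apply/funext => s; rewrite /sg /lin subrr mulr0 addr0.
  by rewrite g_cst //; exact: Oy.
rewrite c1 mul1g in M.
apply/propext; rewrite (SE u _ u01 p2) (SE t c t01 pc) /E k3 E2.
have -> : fp (y u).1 (lin (y u).2 (y t).2) = sg (y u).1 (y u).2 (y t).2 by [].
rewrite -(KL (y t).1 (y u).1 (Dy t t01) (Dy u u01)) invgM !mulgA.
move: M; rewrite -!surjective_pairing => M.
rewrite -(mulgA (g (pre y t))) M -(mulgA _ _ (g (fp (y u).1 c))).
move: E1; rewrite -surjective_pairing => ->.
by rewrite !mulgA mulgK.
Qed.

End AffineGen.

(** * Moving the centre inside one fibre *)

Lemma rcN (R : realType) (x : R) : rc (- x) = - rc x. Proof. exact: raddfN. Qed.

Lemma im_invE (R : realType) (u : R[i]) : u != 0 -> exists2 k : R, 0 < k & im u^-1 = - (k * im u).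
Proof.
move=> u0; have E : u * u^-1 = 1 by rewrite divff.
have n0 : 0 < re u ^+ 2 + im u ^+ 2.
  rewrite lt_neqAle addr_ge0 ?sqr_ge0 // andbT eq_sym paddr_eq0 ?sqr_ge0 // !sqrf_eq0.
  by apply: contraNN u0 => /andP[/eqP a /eqP b]; apply/eqP/eqC.
exists (re u ^+ 2 + im u ^+ 2)^-1; first by rewrite invr_gt0.
apply: (mulfI (lt0r_neq0 n0)); rewrite mulrN mulrA divff ?lt0r_neq0 // mul1r.
have := congr1 im E; have := congr1 re E; rewrite imM reM re1 im1.
move: (u^-1) => v e1 e2.
have e1' : im u * (re u * re v - im u * im v) = im u by rewrite e1 mulr1.
have e2' : re u * (re u * im v + im u * re v) = 0 by rewrite e2 mulr0.
lra.
Qed.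

Section Barycentric.
Context {R : realType}.
Local Notation C := R[i].
Implicit Types (e : C) (l : R).

(* the point with real barycentric coordinates [1 - l2 - l3], [l2], [l3] *)
Definition bc (e1 e2 e3 : C) (l2 l3 : R) : C := e1 + rc l2 * (e2 - e1) + rc l3 * (e3 - e1).

Definition apart (e1 e2 e3 : C) := e1 != e2 /\ im ((e3 - e1) / (e2 - e1)) != 0.

Definition free (l1 l2 l3 : R) :=
  [/\ l3 != 0 \/ 0 < l1 * l2, l2 != 0 \/ 0 < l1 * l3 & l1 != 0 \/ 0 < l2 * l3].

Lemma indep (t : C) (x y : R) : im t != 0 -> rc x + rc y * t = 0 -> x = 0 /\ y = 0.
Proof.
move=> t0 E; have := congr1 im E; have := congr1 re E; rewrite !reimE.
move=> E1 E2; have y0 : y = 0.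
  have /eqP : y * im t = 0 by move: E2; lra.
  by rewrite mulf_eq0 (negbTE t0) orbF => /eqP.
by split=> //; move: E1; rewrite y0; lra.
Qed.

Lemma bc_lin e1 e2 e3 (l2 l3 l2' l3' t : R) :
  lin (bc e1 e2 e3 l2 l3) (bc e1 e2 e3 l2' l3') t =
  bc e1 e2 e3 (l2 + t * (l2' - l2)) (l3 + t * (l3' - l3)).
Proof. by rewrite /lin /bc !(rcD, rcM, rcB); ring. Qed.

Lemma apart_neq e1 e2 e3 : apart e1 e2 e3 ->
  [/\ e2 - e1 != 0, im ((e3 - e1) / (e2 - e1)) != 0 &
      e3 = e1 + (e3 - e1) / (e2 - e1) * (e2 - e1)].
Proof.
move=> [e12 i]; have d0 : e2 - e1 != 0 by rewrite subr_eq0 eq_sym.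
by split=> //; rewrite divfK // addrC subrK.
Qed.

(** A root hides another one exactly when the centre is on the line through them, outside the segment: one
    coordinate vanishes and the two other ones have opposite signs. *)
Lemma valid_bc e1 e2 e3 l2 l3 : apart e1 e2 e3 -> free (1 - l2 - l3) l2 l3 ->
  valid (bc e1 e2 e3 l2 l3) e1 e2 e3.
Proof.
move=> /apart_neq[d0 + +] [f3 f2 f1]; move: (_ / _) => t i E3.
have E1 : e1 - bc e1 e2 e3 l2 l3 = (rc (- l2) + rc (- l3) * t) * (e2 - e1).
  by rewrite /bc E3 !rcN; ring.
have E2 : e2 - bc e1 e2 e3 l2 l3 = (rc (1 - l2) + rc (- l3) * t) * (e2 - e1).
  by rewrite /bc E3 rcN rcB rc1; ring.
have E4 : e3 - bc e1 e2 e3 l2 l3 = (rc (- l2) + rc (1 - l3) * t) * (e2 - e1).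
  by rewrite /bc E3 rcN rcB rc1; ring.
have nz (x y : R) : (x = 0 -> y = 0 -> False) -> (rc x + rc y * t) * (e2 - e1) != 0.
  by move=> h; rewrite mulf_neq0 //; apply/eqP => /(indep i)[]; exact: h.
have pos (x y : R) : x = 0 -> (0 < x * y) = false /\ (0 < y * x) = false.
  by move=> ->; rewrite mulr0 mul0r ltxx.
have z1 : e1 - bc e1 e2 e3 l2 l3 != 0.
  rewrite E1; apply: nz => a b; case: f3 => [/eqP|]; first by lra.
  by have -> : l2 = 0 by [lra|]; rewrite mulr0 ltxx.
have z2 : e2 - bc e1 e2 e3 l2 l3 != 0.
  rewrite E2; apply: nz => a b; case: f3 => [/eqP|]; first by lra.
  by have -> : 1 - l2 - l3 = 0 by [lra|]; rewrite mul0r ltxx.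
have z3 : e3 - bc e1 e2 e3 l2 l3 != 0.
  rewrite E4; apply: nz => a b; case: f2 => [/eqP|]; first by lra.
  by have -> : 1 - l2 - l3 = 0 by [lra|]; rewrite mul0r ltxx.
have ray (x y x' y' : R) : (rc x + rc y * t) * (e2 - e1) != 0 ->
   (forall k, 0 <= k -> x' = k * x -> y' = k * y -> False) ->
   nonray ((rc x' + rc y' * t) * (e2 - e1) / ((rc x + rc y * t) * (e2 - e1))).
  move=> n h; set u := _ / _ => -[i0 r0].
  have uE : u = rc (re u) by rewrite [LHS]reimK i0 rc0 mulr0 addr0.
  have uM : (rc x' + rc y' * t) * (e2 - e1) = u * ((rc x + rc y * t) * (e2 - e1)).
    by rewrite /u divfK.
  move: r0 uM; rewrite uE; move: (re u) => k k0 uM.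
  have : (rc (x' - k * x) + rc (y' - k * y) * t) = 0.
    apply: (mulIf d0); rewrite mul0r !(rcB, rcM) -[RHS](subrr (rc k * ((rc x + rc y * t) * (e2 - e1)))).
    by rewrite -{1}uM; ring.
  by move=> /(indep i)[? ?]; apply: (h k) => //; lra.
have S (x y : C) : y - x != 0 -> x != y by rewrite subr_eq0 eq_sym.
split; [exact: S|exact: S|exact: S|split].
- rewrite E1 E2; apply: ray; first by rewrite -E1.
  move=> k k0 a b; case: f3 => [/eqP f|f].
    have k1 : k = 1 by apply: (mulIf (x := l3)); [apply/eqP|lra].
    by move: a; rewrite k1; lra.
  have [l30|l30] := eqVneq l3 0; last first.
    have k1 : k = 1 by apply: (mulIf (x := l3)) => //; lra.
    by move: a; rewrite k1; lra.
  by move: f; rewrite l30 subr0 a; nra.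
- rewrite E1 E4; apply: ray; first by rewrite -E1.
  move=> k k0 a b; case: f2 => [/eqP f|f].
    have k1 : k = 1 by apply: (mulIf (x := l2)); [apply/eqP|lra].
    by move: b; rewrite k1; lra.
  have [l20|l20] := eqVneq l2 0; last first.
    have k1 : k = 1 by apply: (mulIf (x := l2)) => //; lra.
    by move: b; rewrite k1; lra.
  by move: f; rewrite l20 subr0 b; nra.
- rewrite E2 E4; apply: ray; first by rewrite -E2.
  move=> k k0 a b; have K : (1 - l2 - l3) * (1 - k) = 0 by lra.
  have [l10|l10] := eqVneq (1 - l2 - l3) 0; last first.
    have k1 : 1 - k = 0 by apply: (mulfI l10); rewrite K mulr0.
    by move: a; rewrite (_ : k = 1); lra.
  case: f1 => [/eqP//|f].
  by move: f; have -> : l2 = - (k * l3) by [lra|]; nra.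
Qed.

End Barycentric.

Section Centre.
Context {R : realType} {G : groupType}.
Local Notation C := R[i].
Variables (P q : {poly C}).
Local Notation Om := (Om P q).
Local Notation roots3 := (roots3 P q).
Variable g : (R -> C * C) -> G.
Hypothesis gflat : flat Om g.
Local Notation mer := (mer Om g).

Definition cj (k a : G) := (k^-1 * a * k)%g.

Definition mers b z e1 e2 e3 : G * G * G := (mer b z e1, mer b z e2, mer b z e3).

(* simultaneous conjugation *)
Definition csim (a a' : G * G * G) :=
  exists k, a' = (cj k a.1.1, cj k a.1.2, cj k a.2).

Lemma cjM k l a : cj k (cj l a) = cj (l * k)%g a.
Proof. by rewrite /cj invgM !mulgA. Qed.

Lemma cj1 a : cj 1%g a = a.
Proof. by rewrite /cj invg1 mul1g mulg1. Qed.

Lemma csim_refl a : csim a a.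
Proof. by exists 1%g; rewrite !cj1; case: a => [[]]. Qed.

Lemma csim_sym a a' : csim a a' -> csim a' a.
Proof. by move=> [k ->]; exists k^-1%g; rewrite /= !cjM !mulgV !cj1; case: a => [[]]. Qed.

Lemma csim_trans a a' a'' : csim a a' -> csim a' a'' -> csim a a''.
Proof. by move=> [k ->] [l ->]; exists (k * l)%g; rewrite /= !cjM. Qed.

Lemma mers_near (T : topologicalType) (be z e1 e2 e3 : T -> C) (x0 : T) :
  continuous be -> continuous z -> continuous e1 -> continuous e2 -> continuous e3 ->
  roots3 (be x0) (e1 x0) (e2 x0) (e3 x0) -> valid (z x0) (e1 x0) (e2 x0) (e3 x0) ->
  \forall x \near x0, roots3 (be x) (e1 x) (e2 x) (e3 x) ->
    csim (mers (be x0) (z x0) (e1 x0) (e2 x0) (e3 x0)) (mers (be x) (z x) (e1 x) (e2 x) (e3 x)).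
Proof.
move=> bc zc c1 c2 c3 r v; have [h [g1 g2 g3]] := valid_good r v.
have [n12 n13 n23] := valid_neq v.
have n21 : e2 x0 != e1 x0 by rewrite eq_sym.
have n31 : e3 x0 != e1 x0 by rewrite eq_sym.
have n32 : e3 x0 != e2 x0 by rewrite eq_sym.
have M1 := mer_near gflat bc zc c1 c2 c3 r n21 n31 g1.
have M2 := mer_near gflat bc zc c2 c3 c1 (roots3_rot r) n32 n12 g2.
have M3 := mer_near gflat bc zc c3 c1 c2 (roots3_rot (roots3_rot r)) n13 n23 g3.
apply: nearS (nearI M1 (nearI M2 M3)) => x [k1 [k2 k3]] rx.
have [_ E1] := k1 rx; have [_ E2] := k2 (roots3_rot rx).
have [_ E3] := k3 (roots3_rot (roots3_rot rx)).
by exists (g (L (be x0, z x0) (be x, z x))); rewrite /mers E1 E2 E3.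
Qed.

Lemma mers_seg b z z' e1 e2 e3 : roots3 b e1 e2 e3 ->
  (forall t, 0 <= t <= 1 -> valid (lin z z' t) e1 e2 e3) ->
  csim (mers b z e1 e2 e3) (mers b z' e1 e2 e3).
Proof.
move=> r v.
have H := @lconst01 R _ (fun t => csim (mers b (lin z z' t) e1 e2 e3)).
rewrite /= lin0 lin1 in H; rewrite -H; first exact: csim_refl.
move=> t t01.
have := @mers_near R (fun=> b) (lin z z') (fun=> e1) (fun=> e2) (fun=> e3) t (@constc _ _ b)
  (@lin_c R z z') (@constc _ _ e1) (@constc _ _ e2) (@constc _ _ e3) r (v t t01).
apply: nearS => u /(_ r) S _; apply/funext => a; apply/propext; split=> k.
  exact: csim_trans S k.
by apply: csim_trans (csim_sym S) k.
Qed.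

Section Triangle.
Variables (b e1 e2 e3 : C).
Hypothesis (r : roots3 b e1 e2 e3) (ap : apart e1 e2 e3).
Local Notation bc := (bc e1 e2 e3).
Local Notation ms l2 l3 := (mers b (bc l2 l3) e1 e2 e3).

(** This region and the two following ones are convex and avoid the positions excluded by [free]. *)
Lemma ms_pp l2 l3 l2' l3' : 0 < l2 -> 0 < l3 -> 0 < l2' -> 0 < l3' ->
  csim (ms l2 l3) (ms l2' l3').
Proof.
move=> a a' c c'; apply: mers_seg => // t t01; rewrite bc_lin; apply: valid_bc => //.
have p2 := itp_gt t01 a c; have p3 := itp_gt t01 a' c'.
split; [left|left|right]; rewrite ?gt_eqF //; exact: mulr_gt0.
Qed.

Lemma ms_np l2 l3 l2' l3' : 0 < l2 -> 0 < 1 - l2 - l3 -> 0 < l2' -> 0 < 1 - l2' - l3' ->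
  csim (ms l2 l3) (ms l2' l3').
Proof.
move=> a a' c c'; apply: mers_seg => // t t01; rewrite bc_lin; apply: valid_bc => //.
have p2 := itp_gt t01 a c; have p3 := itp_gt t01 a' c'.
have p1 : 0 < 1 - (l2 + t * (l2' - l2)) - (l3 + t * (l3' - l3)) by lra.
by split; [right|left|left]; rewrite ?gt_eqF ?mulr_gt0.
Qed.

Lemma ms_nn l2 l3 l2' l3' : l2 < 0 -> l3 < 0 -> l2' < 0 -> l3' < 0 ->
  csim (ms l2 l3) (ms l2' l3').
Proof.
move=> a a' c c'; apply: mers_seg => // t t01; rewrite bc_lin; apply: valid_bc => //.
have p2 := itp_lt t01 a c; have p3 := itp_lt t01 a' c'.
by split; left; apply/eqP; lra.
Qed.

(** The two signs of the elementary braid, up to simultaneous conjugation. *)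
Definition hurwitz (a a' : G * G * G) := exists k, a' = (cj k a.1.1, cj k a.1.2, cj k (cj a.1.1 a.2))
  \/ a' = (cj k a.1.1, cj k a.1.2, cj k (cj a.1.1^-1%g a.2)).

(** At the centre with coordinates [2, 0, -1] the root [e1] hides [e3]. A thin triangle around both has a
    constant value during the crossing, and by [tri_hidden] it is the product of the meridians of
    [e1] and [e3] in one order before and in the other order after. *)
Lemma ms_cross : exists2 ep : R, 0 < ep < 1 & hurwitz (ms ep (-1)) (ms (- ep) (-1)).
Proof.
have [d0 + +] := apart_neq ap; move: (_ / _) => t ti E3.
pose z (x : R) := bc x (-1).
have zE x : z x = e1 + (rc x - t) * (e2 - e1).
  by rewrite /z /bc {1}E3 rcN rc1; ring.
have n (x y : R) : (x != 0) || (y != 0) -> rc x + rc y * t != 0.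
  by move=> xy; apply: contraTneq xy => /(indep ti)[-> ->]; rewrite eqxx.
have n1 x : rc x - t != 0.
  have := n x (-1); rewrite rcN rc1 mulN1r; apply.
  by rewrite oppr_eq0 oner_eq0 orbT.
have n2 x : 2 * t - rc x != 0.
  have := n (- x) 2; rewrite rcN (_ : rc 2 = 2); last by rewrite /rc rmorph_nat.
  by rewrite addrC; apply; rewrite pnatr_eq0 orbT.
have z1 x : e1 - z x = (t - rc x) * (e2 - e1) by rewrite zE; ring.
have z3 x : e3 - z x = (2 * t - rc x) * (e2 - e1) by rewrite zE E3; ring.
have z2 x : e2 - z x = (1 + t - rc x) * (e2 - e1) by rewrite zE; ring.
have z1n x : z x != e1 by rewrite eq_sym -subr_eq0 z1 mulf_neq0 // -oppr_eq0 opprB.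
have z3n x : z x != e3 by rewrite eq_sym -subr_eq0 z3 mulf_neq0.
have z2n x : z x != e2.
  rewrite eq_sym -subr_eq0 z2 mulf_neq0 //.
  have := n (1 - x) 1; rewrite rc1 mul1r rcB rc1 (_ : 1 - rc x + t = 1 + t - rc x); last by ring.
  by apply; rewrite oner_eq0 orbT.
have iV (u : C) : im u != 0 -> im u^-1 != 0 := @im_inv R u.
(* at [x = 0] the root [e1] is the midpoint of the centre and [e3] *)
have nu0 : coor (z 0) e1 e3 = 2.
  by rewrite /coor z1 z3 rc0 !subr0; field; rewrite d0 -oppr_eq0 -sub0r -rc0 n1.
have c2 : im (coor (z 0) e3 e2) != 0.
  have -> : coor (z 0) e3 e2 = (1 + t^-1) * rc 2^-1.
    have t0 : t != 0 by rewrite -oppr_eq0 -sub0r -rc0 n1.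
    rewrite /coor z2 z3 rc0 !subr0 (_ : rc 2^-1 = 2^-1) ?/rc ?fmorphV ?rmorph_nat //.
    by field; rewrite t0 d0.
  have tv : im t^-1 != 0 by exact: iV.
  rewrite imM re_rc im_rc mulr0 add0r imD im1 add0r mulf_neq0 //.
  by rewrite invr_eq0 pnatr_eq0.
clear n2.
set c0 := coor (z 0) e3 e2 in c2.
(* a width for which the triangle around [e1] and [e3] leaves [e2] outside *)
pose h := Order.min (`|im c0| / (2 * (`|re c0| + 1))) 1.
have ab := normr_ge0 (re c0).
have ip : 0 < `|im c0| by rewrite normr_gt0.
have hp : 0 < h by rewrite /h lt_min ltr01 andbT divr_gt0 // mulr_gt0 //; lra.
have h1 : h <= 1 by rewrite /h ge_min lexx orbT.
have hc : h * re c0 < `|im c0|.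
  have : h <= `|im c0| / (2 * (`|re c0| + 1)) by rewrite /h ge_min lexx.
  rewrite ler_pdivlMr ?mulr_gt0 //; last by lra.
  by have := ler_norm (re c0); nra.
have nw : ~ wedge h c0.
  move=> [_ _ w3 w4]; have : `|im c0| <= h * re c0 by rewrite ler_norml w3 w4.
  by lra.
have T0 : tin Om b (z 0) (pt (z 0) e3 (vl h)) (pt (z 0) e3 (vr h)).
  have [L1 L2] := vlE h; have [R1 R2] := vrE h.
  have w0 := wedge0 (ltW hp); have wl := wedge_vl (ltW hp); have wr := wedge_vr (ltW hp).
  move: (vl h) (vr h) L1 L2 R1 R2 wl wr => A B L1 L2 R1 R2 wl wr.
  have e1E : e1 = pt (z 0) e3 (rc 2^-1).
    rewrite /pt z3 zE rc0 subr0 sub0r (_ : rc 2^-1 = 2^-1) ?/rc ?fmorphV ?rmorph_nat //.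
    by field.
  have e3E : e3 = pt (z 0) e3 1 by rewrite pt1.
  have inj u v : pt (z 0) e3 u = pt (z 0) e3 v -> u = v.
    by move=> E; rewrite -(ptK u (z3n 0)) E ptK.
  have key u : wedge h u -> u <> rc 2^-1 -> u <> 1 -> Om (b, pt (z 0) e3 u).
    move=> Ku u1 u2; apply: contrapT => /(rootP _ r)[] E.
    - by apply: u1; apply: inj; rewrite E e1E.
    - by apply: nw; rewrite /c0 /coor -E ptK.
    - by apply: u2; apply: inj; rewrite E -e3E.
  have cw := @wedge_convex R h.
  have hp2 : 0 < (1 + h) * h by rewrite mulr_gt0 //; lra.
  have nl (s c : R) (u : C) : s != 0 -> im u = s * ((1 + h) * h) ->
      forall t, 0 < c -> lin 0 u t <> rc c.
    move=> s0 iu t' cp E; have := congr1 im E; have := congr1 re E.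
    have [-> ->] := lin01E 0 u t'; rewrite re0 im0 re_rc im_rc iu !subr0 !add0r.
    move=> E1 /eqP; rewrite mulf_eq0 (mulf_eq0 s) (negbTE s0) (gt_eqF hp2) !orbF => /eqP t0.
    by move: E1; rewrite t0; lra.
  have lsym u t' : lin u 0 t' = lin 0 u (1 - t') by rewrite /lin rcB rc1; ring.
  have half0 : (0 : R) < 2^-1 by rewrite invr_gt0.
  split=> t' t01; rewrite /sg ?pt_lin ?pt_linz ?pt_linz'; apply: key; try exact: cw.
  - by apply: (nl (-1)); rewrite ?oppr_eq0 ?oner_eq0 // L2; ring.
  - by rewrite -rc1; apply: (nl (-1)); rewrite ?oppr_eq0 ?oner_eq0 // L2; ring.
  - move=> /(congr1 re); have [-> _] := lin01E A B t'; rewrite L1 R1 re_rc subrr mulr0; lra.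
  - move=> /(congr1 re); have [-> _] := lin01E A B t'; rewrite L1 R1 re1 subrr mulr0; lra.
  - by rewrite lsym; apply: (nl 1); rewrite ?oner_eq0 // R2; ring.
  - by rewrite lsym -rc1; apply: (nl 1); rewrite ?oner_eq0 // R2; ring.
have zc : continuous z.
  have -> : z = (fun x => e1 + (rc x - t) * (e2 - e1)) by apply/funext => x; rewrite zE.
  exact: (contD (@constc _ _ e1) (contM (contB rcc (@constc _ _ t)) (@constc _ _ (e2 - e1)))).
have kb := @constc R C b; have k1 := @constc R C e1; have k2 := @constc R C e2.
have k3 := @constc R C e3.
have NT := tri_near gflat kb zc (vl_c (h := h) zc k3) (vr_c (h := h) zc k3) T0.
have c2' : im (coor (z 0) e3 e2) != 0 := c2.
have ne12 : e2 != e1 by rewrite -subr_eq0.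
have ne13 : e3 != e1.
  by rewrite -subr_eq0 E3 addrC addKr mulf_neq0 // -oppr_eq0 -sub0r -rc0 n1.
have c21 : im (coor (z 0) e1 e2) != 0.
  rewrite /coor z2 z1 rc0 !subr0 (_ : (1 + t) * (e2 - e1) / (t * (e2 - e1)) = 1 + t^-1).
    by rewrite imD im1 add0r iV.
  by field; rewrite d0 -oppr_eq0 -sub0r -rc0 n1.
have [ha ga] : exists h, good Om b (z 0) e1 h.
  apply: (vis_good r) => //; first by move=> [i _]; move: c21; rewrite /coor i eqxx.
  by rewrite -/(coor _ _ _) nu0 => -[_ /andP[_]]; rewrite (_ : re 2 = 2) //; lra.
have [hb gb] : exists h, good Om b (z 0) e2 h.
  apply: (vis_good (roots3_rot r)) => //.
    move=> [i _]; move: c2'; have -> : coor (z 0) e3 e2 = ((e3 - z 0) / (e2 - z 0))^-1.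
      by rewrite invf_div.
    by move=> /iV; rewrite invrK i eqxx.
  move=> [i _]; move: c21; have -> : coor (z 0) e1 e2 = ((e1 - z 0) / (e2 - z 0))^-1.
    by rewrite invf_div.
  by move=> /iV; rewrite invrK i eqxx.
have ne21 : e1 != e2 by rewrite eq_sym.
have ne23 : e3 != e2.
  by apply: contraTneq c2' => <-; rewrite /coor divff ?im1 ?eqxx // subr_eq0 eq_sym.
have N1 := @mer_near _ _ _ _ _ gflat _ _ _ _ _ _ 0 ha kb zc k1 k2 k3 r ne12 ne13 ga.
have N2 := @mer_near _ _ _ _ _ gflat _ _ _ _ _ _ 0 hb kb zc k2 k3 k1 (roots3_rot r) ne23 ne21 gb.
have nuc := @at_ratio R R (fun=> e3) (fun=> e1) z 0 k3 k1 zc (z1n 0).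
have e2c := @at_ratio R R (fun=> e2) (fun=> e3) z 0 k2 k3 zc (z3n 0).
have N3 : \forall x \near (0 : R), sin Om b (pt (z x) e3 (vl h)) (pt (z x) e3 (vr h)).
  apply: (near_sin kb (vl_c (h := h) zc k3) (vr_c (h := h) zc k3)).
  by have [_ ? _] := T0.
pose nu x := coor (z x) e1 e3; pose c x := coor (z x) e3 e2.
have nuc' : {for 0, continuous nu} := nuc.
have cc : {for 0, continuous c} := e2c.
have K (f : R -> R) (k : R) : {for 0, continuous f} -> {for 0, continuous (fun x => f x + k)}.
  by move=> fc; apply: cvgD; [exact: fc|exact: cvg_cst].
have KM (f : R -> R) (k : R) : {for 0, continuous f} -> {for 0, continuous (fun x => k * f x)}.
  by move=> fc; apply: cvgM; [exact: cvg_cst|exact: fc].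
have KD (f f' : R -> R) : {for 0, continuous f} -> {for 0, continuous f'} ->
    {for 0, continuous (fun x => f x + f' x)}.
  by move=> fc fc'; apply: cvgD; [exact: fc|exact: fc'].
have re2 : re (2 : C) = 2 by rewrite -[2 in LHS]/((1 + 1) : C) reD re1; ring.
have im2 : im (2 : C) = 0 by rewrite -[2 in LHS]/((1 + 1) : C) imD im1; ring.
have N4 : \forall x \near (0 : R), 0 < im c0 * im (c x) + - (`|im c0| * h) * re (c x).
  apply: near_gt0; first exact: (KD _ _ (KM _ _ (at_im cc)) (KM _ _ (at_re cc))).
  rewrite -/(c 0) -[c 0]/c0 -(expr2 (im c0)) -real_normK ?num_real // expr2 mulNr -mulrA -mulrBr.
  by rewrite mulr_gt0 // subr_gt0.
have N5 : \forall x \near (0 : R), 0 < re (nu x) + - (3 / 2).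
  by apply: near_gt0; [exact: (K _ _ (at_re nuc'))|rewrite /nu nu0 re2; lra].
have N6 : \forall x \near (0 : R), 0 < im (nu x) + h / 2.
  by apply: near_gt0; [exact: (K _ _ (at_im nuc'))|rewrite /nu nu0 im2; lra].
have N7 : \forall x \near (0 : R), 0 < -1 * im (nu x) + h / 2.
  by apply: near_gt0; [exact: (K _ _ (KM _ _ (at_im nuc')))|rewrite /nu nu0 im2; lra].
have inuE x : exists2 k : R, 0 < k & im (nu x) = - (k * (x * im t)).
  have [k k0 kE] := im_invE (n1 x).
  exists k => //; have -> : nu x = 2 - rc x * (rc x - t)^-1.
    by rewrite /nu /coor z1 z3; field; rewrite d0 n1 -oppr_eq0 opprB n1.
  by rewrite imD im2 imN imM re_rc im_rc kE imD imN im_rc; ring.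
(* the value of the triangle, conjugated back to [x = 0], on the two sides *)
have H : \forall x \near (0 : R), let A := g (L (b, z 0) (b, z x)) in
    exists2 s, mers b (z x) e1 e2 e3 = (cj A (mer b (z 0) e1), cj A (mer b (z 0) e2), s) &
      let T := cj A (tri g b (z 0) (pt (z 0) e3 (vl h)) (pt (z 0) e3 (vr h))) in
      (0 < im (nu x) -> T = (cj A (mer b (z 0) e1) * s)%g) /\
      (im (nu x) < 0 -> T = (s * cj A (mer b (z 0) e1))%g).
  apply: nearS (nearI NT (nearI N1 (nearI N2 (nearI N3 (nearI N4 (nearI N5 (nearI N6 N7)))))))
    => x [kT [/(_ r)[_ M1] [/(_ (roots3_rot r))[_ M2] [s3 [k4 [k5 [k6 k7]]]]]]] A.
  exists (mer b (z x) e3); first by rewrite /mers M1 M2.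
  have ai : `|im (nu x)| < h / 2 by rewrite ltr_norml; apply/andP; split; lra.
  have an := normr_ge0 (im (nu x)).
  have hh : h * `|im (nu x)| <= 1 / 2 by nra.
  have hn : 0 <= h * (re (nu x) - 1) by apply: mulr_ge0; lra.
  have [] := @tri_hidden _ _ _ _ _ gflat b (z x) e1 e2 e3 h r (z1n x) (z3n x) hp s3; rewrite -/(nu x).
  - nra.
  - lra.
  - rewrite -/(c x) => -[r0 i0].
    have : im c0 * im (c x) <= `|im c0| * `|im (c x)| by rewrite -normrM ler_norm.
    have : `|im c0| * `|im (c x)| <= `|im c0| * (h * re (c x)) by rewrite ler_wpM2l.
    by lra.
  move=> T1 T2; rewrite {1}/cj -kT -/(stri g b (z x) e3 h) /cj -M1.
  by split; [exact: T1|exact: T2].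
move: H => /nbhs_ballP[d /= d00 hd].
pose ep := Order.min d 1 / 2.
have m0 : 0 < Order.min d 1 by rewrite lt_min d00 ltr01.
have md : Order.min d 1 <= d by rewrite ge_min lexx.
have m1 : Order.min d 1 <= 1 by rewrite ge_min lexx orbT.
have ep0 : 0 < ep by rewrite /ep; lra.
exists ep; first by rewrite /ep; apply/andP; split; lra.
have [|s1 M1 [T1 T1']] := hd ep; first by rewrite /ball /= sub0r normrN gtr0_norm // /ep; lra.
have [|s2 M2 [T2 T2']] := hd (- ep); first by rewrite /ball /= sub0r opprK gtr0_norm // /ep; lra.
move: T1 T1' T2 T2' M1 M2; set A := g _; set B := g _.
move=> T1 T1' T2 T2' M1 M2.
have [k k0 kE] := inuE ep; have [k' k'0 k'E] := inuE (- ep).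
have sE (T m1' s : G) : (T = m1' * s)%g -> s = (m1'^-1 * T)%g by move=> ->; rewrite mulKg.
have sE' (T m1' s : G) : (T = s * m1')%g -> s = (T * m1'^-1)%g by move=> ->; rewrite mulgK.
exists (A^-1 * B)%g; rewrite -/(z ep) -/(z (- ep)) M1 M2 /=.
have cjE x : cj (A^-1 * B)%g (cj A x) = cj B x by rewrite cjM mulgA mulgV mul1g.
rewrite !cjE.
have pos (k0' y : R) : 0 < k0' -> 0 < y -> 0 < k0' * (ep * y).
  by move=> ? ?; apply: mulr_gt0 => //; apply: mulr_gt0.
have [tp|tn] := ltP 0 (im t).
  have i1 : im (nu ep) < 0 by rewrite kE oppr_lt0; apply: pos.
  have i2 : 0 < im (nu (- ep)) by rewrite k'E mulNr mulrN opprK; apply: pos.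
  left; congr (_, _); rewrite (sE _ _ _ (T2 i2)) (sE' _ _ _ (T1' i1)).
  move: (mer b (z 0) e1) (tri g b _ _ _) => u v.
  by rewrite /cj !(invgM, invgK, mulgA) !(mulgK, mulgVK, mulVg, mulgV, mul1g).
have tn' : 0 < - im t by rewrite oppr_gt0 lt_neqAle ti.
have i1 : 0 < im (nu ep) by rewrite kE -!mulrN; apply: pos.
have i2 : im (nu (- ep)) < 0.
  by rewrite k'E mulNr mulrN opprK -oppr_gt0 -!mulrN; apply: pos.
right; congr (_, _); rewrite (sE' _ _ _ (T2' i2)) (sE _ _ _ (T1 i1)).
move: (mer b (z 0) e1) (tri g b _ _ _) => u v.
by rewrite /cj !(invgM, invgK, mulgA) !(mulgK, mulgVK, mulVg, mulgV, mul1g).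
Qed.

End Triangle.

End Centre.

(** * The dihedral invariant of a labelled fibre *)

Section Invariant.
Context {R : realType} {Q : zmodType}.
Local Notation C := R[i].
Local Notation G := (dihedral Q).
Variables (P q : {poly C}).
Local Notation Om := (Om P q).
Local Notation roots3 := (roots3 P q).
Variable g : (R -> C * C) -> G.
Hypothesis gflat : flat Om g.
Local Notation mers := (mers P q g).

Definition refl3 (a : G * G * G) := [/\ a.1.1.2, a.1.2.2 & a.2.2].

(** The dihedral data of three reflections: simultaneous conjugation changes it by a sign at most. *)
Definition dat (a : G * G * G) : Q * Q := (a.1.1.1 - a.1.2.1, a.1.1.1 - a.2.1).

Definition pm (d d' : Q * Q) := d' = d \/ d' = - d.

(** The changes of the data under a cyclic permutation of the meridians and under a Hurwitz move
    followed by a transposition. *)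
Definition rotd (d : Q * Q) : Q * Q := (d.2 - d.1, - d.1).
Definition quard (d : Q * Q) : Q * Q := (- d.2, d.1).

Lemma pm_sym d d' : pm d d' -> pm d' d.
Proof. by move=> [->|->]; [left|right; rewrite opprK]. Qed.

Lemma pm_trans d d' d'' : pm d d' -> pm d' d'' -> pm d d''.
Proof. by move=> [->|->] [->|->]; rewrite ?opprK; [left|right|right|left]. Qed.

Lemma rotdN d : rotd (- d) = - rotd d.
Proof. by case: d => x y; rewrite /rotd /=; congr (_, _); rewrite opprB opprK addrC. Qed.

Lemma quardN d : quard (- d) = - quard d.
Proof. by case: d. Qed.

Lemma pm_rotd d d' : pm d d' -> pm (rotd d) (rotd d').
Proof. by move=> [->|->]; [left|right; rewrite rotdN]. Qed.

Lemma pm_quard d d' : pm d d' -> pm (quard d) (quard d').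
Proof. by move=> [->|->]; [left|right; rewrite quardN]. Qed.

(** Conjugation acts on the translation parts of reflections by a common isometry. *)
Lemma cj_refl (k : G) : exists (v : Q) (t : bool), forall m : G, m.2 = true ->
  cj k m = (v + (if t then - m.1 else m.1), true).
Proof.
case: k => u []; [exists (u + u), true|exists (- u - u), false] => -[a s] /= ->; rewrite /cj.
  rewrite -[((_ * _) * _)%g]/(dih_mul (dih_mul (dih_inv (u, true)) (a, true)) (u, true)).
  by rewrite /dih_mul /dih_inv /= opprK; congr (_, _); rewrite addrAC.
rewrite -[((_ * _) * _)%g]/(dih_mul (dih_mul (dih_inv (u, false)) (a, true)) (u, false)).
by rewrite /dih_mul /dih_inv /=; congr (_, _); rewrite addrAC.
Qed.

Lemma csim_dat a a' : refl3 a -> csim a a' -> refl3 a' /\ pm (dat a) (dat a').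
Proof.
move=> [r1 r2 r3] [k ->]; have [v [t H]] := cj_refl k; rewrite !H //; split=> //.
rewrite /dat /=; clear H; case: t; [right|left]; rewrite /=.
  by congr (_, _); rewrite opprD addrACA subrr add0r opprB opprK addrC.
by congr (_, _); rewrite opprD addrACA subrr add0r.
Qed.

(** The conjugate of the reflection [a3] by [a1] is [2 a1 - a3]. *)
Lemma hurwitz_dat a a' : refl3 a -> hurwitz a a' ->
  refl3 a' /\ pm ((dat a).1, - (dat a).2) (dat a').
Proof.
move: a => [[[a1 []] [a2 []]] [a3 []]] [] // _ _ _.
pose n1 : G := (a1, true); pose n2 : G := (a2, true); pose n3 : G := (a3, true).
pose n4 : G := (a1 + a1 - a3, true).
have E (m : G) : m = n1 \/ m = n1^-1%g -> cj m n3 = n4.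
  by move=> [->|->]; rewrite /cj;
    [rewrite -[((_ * _) * _)%g]/(dih_mul (dih_mul (dih_inv n1) n3) n1)
    |rewrite -[((_ * _) * _)%g]/(dih_mul (dih_mul (dih_inv (dih_inv n1)) n3) (dih_inv n1))];
    rewrite /dih_mul /dih_inv /= ?opprK; congr (_, _); rewrite addrAC.
have key (k m : G) : m = n1 \/ m = n1^-1%g ->
    csim (n1, n2, n4) (cj k n1, cj k n2, cj k (cj m n3)).
  by move=> hm; exists k; rewrite (E m hm).
have dE : dat (n1, n2, n4) = ((dat ((n1, n2, n3) : G * G * G)).1, - (dat ((n1, n2, n3) : G * G * G)).2).
  by rewrite /dat /=; congr (_, _); rewrite !opprB opprD addrCA (addrA a1) subrr sub0r.
rewrite -dE -[(a1, true, _, _)]/(n1, n2, n3) => -[k [->|->]] /=.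
  have r4 : refl3 (n1, n2, n4) by [].
  exact: (csim_dat r4 (key k n1 (or_introl erefl))).
have r4 : refl3 (n1, n2, n4) by [].
exact: (csim_dat r4 (key k n1^-1%g (or_intror erefl))).
Qed.

Lemma dat_rot m1 m2 m3 : dat (m2, m3, m1) = rotd (dat (m1, m2, m3)).
Proof.
rewrite /dat /rotd /=; congr (_, _); last by rewrite opprB.
by rewrite opprB [RHS]addrC addrA subrK.
Qed.

(** ** Fibres labelled by a scale [dl] and a shape [s] *)

(** The roots with [e2 - e1 = dl], [e3 - e1 = s ^ 2 dl] and sum zero, and the centre [e1 + s dl]: all are
    polynomial in [dl] and [s], so that continuity is immediate. *)
Definition ce1 (dl s : C) : C := - ((1 + s ^+ 2) / 3) * dl.
Definition ce2 (dl s : C) : C := ce1 dl s + dl.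
Definition ce3 (dl s : C) : C := ce1 dl s + s ^+ 2 * dl.
Definition cz (dl s : C) : C := ce1 dl s + s * dl.

Definition lab b (dl s : C) := [/\ dl != 0,
  P.[b] = - (dl ^+ 2 / 3) * (s ^+ 4 - s ^+ 2 + 1) &
  q.[b] = dl ^+ 3 * ((1 + s ^+ 2) * (2 - s ^+ 2) * (2 * s ^+ 2 - 1)) / 27].

Lemma lab_roots3 b dl s : lab b dl s -> roots3 b (ce1 dl s) (ce2 dl s) (ce3 dl s).
Proof.
by move=> [_ EP Eq] v; rewrite /cub /= EP Eq /ce2 /ce3 /ce1; field.
Qed.

Lemma lab_valid dl s : dl != 0 -> im s != 0 ->
  valid (cz dl s) (ce1 dl s) (ce2 dl s) (ce3 dl s).
Proof.
move=> d0 i; have e12 : ce1 dl s != ce2 dl s.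
  by rewrite eq_sym -subr_eq0 /ce2 addrC addKr.
have := center_valid e12 i; rewrite /pt (_ : ce2 dl s - ce1 dl s = dl) //.
by rewrite /ce2 addrC addKr.
Qed.

Definition cm b (dl s : C) := mers b (cz dl s) (ce1 dl s) (ce2 dl s) (ce3 dl s).

Hypothesis allrefl : forall b z e1 e2 e3, roots3 b e1 e2 e3 -> valid z e1 e2 e3 ->
  refl3 (mers b z e1 e2 e3).

Lemma ce_c : [/\ continuous (fun x : C * (C * C) => ce1 x.2.1 x.2.2),
  continuous (fun x : C * (C * C) => ce2 x.2.1 x.2.2),
  continuous (fun x : C * (C * C) => ce3 x.2.1 x.2.2) &
  continuous (fun x : C * (C * C) => cz x.2.1 x.2.2)].
Proof.
have dc : continuous (fun x : C * (C * C) => x.2.1) := cont_comp cont_snd cont_fst.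
have sc : continuous (fun x : C * (C * C) => x.2.2) := cont_comp cont_snd cont_snd.
have s2 := contX (n := 2) sc.
have k (c : C) : continuous (fun _ : C * (C * C) => c) := @constc _ _ c.
have c1 : continuous (fun x : C * (C * C) => ce1 x.2.1 x.2.2).
  rewrite /ce1; exact: (contM (contN (contM (contD (k 1) s2) (k 3^-1))) dc).
by split; [exact: c1|exact: (contD c1 dc)|exact: (contD c1 (contM s2 dc))|exact: (contD c1 (contM sc dc))].
Qed.

Lemma dat_near b0 dl0 s0 : lab b0 dl0 s0 -> im s0 != 0 ->
  \forall x \near (b0, (dl0, s0)), lab x.1 x.2.1 x.2.2 ->
    pm (dat (cm b0 dl0 s0)) (dat (cm x.1 x.2.1 x.2.2)).
Proof.
move=> lb i; have [c1 c2 c3 c4] := ce_c.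
have r := lab_roots3 lb; have v := lab_valid (let: And3 d _ _ := lb in d) i.
have := @mers_near _ _ _ _ _ gflat _ _ _ _ _ _ (b0, (dl0, s0)) (@cont_fst C (C * C)%type) c4 c1 c2 c3 r v.
apply: nearS => x H lx; have [_ h] := csim_dat (allrefl r v) (H (lab_roots3 lx)).
exact: h.
Qed.

Section FirstQuadrant.
Variables (b dl s : C).
Hypothesis (lb : lab b dl s) (pr : 0 < re s) (pi : 0 < im s).
Local Notation e1 := (ce1 dl s).
Local Notation e2 := (ce2 dl s).
Local Notation e3 := (ce3 dl s).

Let d0 : dl != 0 := let: And3 d _ _ := lb in d.

Lemma im_sqr : im (s ^+ 2) = 2 * (re s * im s).
Proof. by rewrite expr2 imM; ring. Qed.

Lemma ce_apart : apart e1 e2 e3.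
Proof.
split; first by rewrite eq_sym -subr_eq0 /ce2 addrC addKr.
have -> : (e3 - e1) / (e2 - e1) = s ^+ 2 by rewrite /ce3 /ce2 ![e1 + _ - _]addrC !addKr mulfK.
by rewrite im_sqr gt_eqF // !mulr_gt0.
Qed.

Let l2 := (re s ^+ 2 + im s ^+ 2) / (2 * re s).
Let l3 := (2 * re s)^-1.

Lemma bc_s (k : R) : bc e1 e2 e3 (k * l2) (k * l3) = e1 + rc k * s * dl.
Proof.
have r0 : 2 * re s != 0 by rewrite mulf_neq0 ?pnatr_eq0 // gt_eqF.
have E (x y : R) : x + y * (re s ^+ 2 - im s ^+ 2) = re s -> y * (2 * (re s * im s)) = im s ->
    rc x + rc y * s ^+ 2 = s.
  by move=> h1 h2; apply: eqC; [rewrite -{}[RHS]h1|rewrite -{}[RHS]h2]; rewrite expr2 !reimE; ring.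
have r00 : re s != 0 by rewrite gt_eqF.
have {E} El : rc l2 + rc l3 * s ^+ 2 = s by apply: E; rewrite /l2 /l3; field.
transitivity (e1 + rc k * (rc l2 + rc l3 * s ^+ 2) * dl); last by rewrite El.
by rewrite /bc /ce3 /ce2 (rcM k l2) (rcM k l3); ring.
Qed.

Let l20 : 0 < l2.
Proof. by rewrite divr_gt0 ?mulr_gt0 // addr_gt0 // exprn_gt0. Qed.
Let l30 : 0 < l3.
Proof. by rewrite invr_gt0 mulr_gt0. Qed.

Let third : 0 < 3^-1 :> R.
Proof. by rewrite invr_gt0. Qed.

(** Inside the angle at [e1] both centres are in the convex region of [ms_pp]. *)
Lemma cm_centroid : csim (cm b dl s) (mers b (bc e1 e2 e3 3^-1 3^-1) e1 e2 e3).
Proof.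
have := ms_pp gflat (lab_roots3 lb) ce_apart l20 l30 third third.
by have := bc_s 1; rewrite !mul1r => ->.
Qed.

(** Beyond the vertex [e1] the line through [e1] and [e3] has been crossed once. *)
Lemma cm_opposite : exists2 a, hurwitz a (mers b (e1 - s * dl) e1 e2 e3) & csim (cm b dl s) a.
Proof.
have r := lab_roots3 lb; have ap := ce_apart.
have [ep /andP[ep0 ep1] [k hk]] := ms_cross gflat r ap.
exists (mers b (bc e1 e2 e3 ep (-1)) e1 e2 e3); last first.
  apply: csim_trans cm_centroid _; apply: (ms_np gflat r ap) => //; lra.
have nl2 : -1 * l2 < 0 by rewrite mulN1r oppr_lt0.
have nl3 : -1 * l3 < 0 by rewrite mulN1r oppr_lt0.
have nep : - ep < 0 by rewrite oppr_lt0.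
have n1 : (-1 : R) < 0 by rewrite oppr_lt0.
have [l kl] := ms_nn gflat r ap nep n1 nl2 nl3.
have E : bc e1 e2 e3 (-1 * l2) (-1 * l3) = e1 - s * dl by rewrite bc_s rcN rc1 !mulN1r mulNr.
move: kl; rewrite E => ->.
by exists (k * l)%g; case: hk => -> /=; [left|right]; rewrite !cjM.
Qed.

(** For [- 1 / s] the roots [e2] and [e3] are exchanged and the centre is opposite with respect to [e1]. *)
Lemma cm_quarter : lab b (s ^+ 2 * dl) (- s^-1) /\
  pm (quard (dat (cm b dl s))) (dat (cm b (s ^+ 2 * dl) (- s^-1))).
Proof.
have s0 : s != 0 by apply: contraTneq pi => ->; rewrite im0 ltxx.
have [_ EP Eq] := lb.
have lb' : lab b (s ^+ 2 * dl) (- s^-1).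
  split; first by rewrite mulf_neq0 // expf_neq0.
    by rewrite EP; field.
  by rewrite Eq; field.
split=> //; rewrite /cm.
have -> : ce1 (s ^+ 2 * dl) (- s^-1) = e1 by rewrite /ce1; field.
have -> : ce2 (s ^+ 2 * dl) (- s^-1) = e3 by rewrite /ce2 /ce3 /ce1; field.
have -> : ce3 (s ^+ 2 * dl) (- s^-1) = e2 by rewrite /ce2 /ce3 /ce1; field.
have -> : cz (s ^+ 2 * dl) (- s^-1) = e1 - s * dl by rewrite /cz /ce1; field.
have r := lab_roots3 lb; have v := lab_valid d0 (lt0r_neq0 pi).
have [a ha ca] := cm_opposite.
have [ra pa] := csim_dat (allrefl r v) ca; have [_ pa'] := hurwitz_dat ra ha.
have -> : dat (mers b (e1 - s * dl) e1 e3 e2) =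
  ((dat (mers b (e1 - s * dl) e1 e2 e3)).2, (dat (mers b (e1 - s * dl) e1 e2 e3)).1) by [].
move: pa pa'; move: (dat (mers b (cz dl s) e1 e2 e3)) (dat a) (dat (mers b (e1 - s * dl) e1 e2 e3)).
move=> [x y] [x' y'] [u w] /= [[-> ->]|[-> ->]] [[-> ->]|[-> ->]]; rewrite /quard /= ?opprK.
- by left.
- by right; congr (_, _); rewrite ?opprK.
- by right; congr (_, _); rewrite ?opprK.
- by left.
Qed.

End FirstQuadrant.

(** For [s1] the roots are permuted cyclically, and both centres can be moved to the barycentre. *)
Lemma cm_third b dl s (s1 : C) : lab b dl s -> 0 < re s -> 0 < im s ->
  0 < re s1 -> 0 < im s1 -> s1 ^+ 2 = (1 - s ^+ 2)^-1 ->
  lab b ((s ^+ 2 - 1) * dl) s1 /\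
  pm (rotd (dat (cm b dl s))) (dat (cm b ((s ^+ 2 - 1) * dl) s1)).
Proof.
move=> lb pr pi rs1 is1 s1E; have [d0 EP Eq] := lb.
have k0 : 1 - s ^+ 2 != 0.
  apply: contraTneq is1 => k0; move: s1E; rewrite k0 invr0 => /eqP.
  by rewrite sqrf_eq0 => /eqP ->; rewrite im0 ltxx.
have k0' : s ^+ 2 - 1 != 0 by rewrite -oppr_eq0 opprB.
have s4 : s1 ^+ 4 = (1 - s ^+ 2)^-1 ^+ 2 by rewrite -s1E -exprM.
have lb' : lab b ((s ^+ 2 - 1) * dl) s1.
  split; first by rewrite mulf_neq0.
    by rewrite EP s4 s1E; field.
  by rewrite Eq s1E; field.
split=> //.
have E1 : ce1 ((s ^+ 2 - 1) * dl) s1 = (ce2 dl s) by rewrite /ce2 /ce1 s1E; field.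
have E2 : ce2 ((s ^+ 2 - 1) * dl) s1 = (ce3 dl s) by rewrite /ce2 E1 /ce3 /ce2; ring.
have E3 : ce3 ((s ^+ 2 - 1) * dl) s1 = (ce1 dl s) by rewrite /ce3 E1 s1E /ce2; field.
have r := lab_roots3 lb; have v := lab_valid d0 (lt0r_neq0 pi).
have r' := lab_roots3 lb'; have v' := lab_valid (let: And3 d _ _ := lb' in d) (lt0r_neq0 is1).
have [rc1 p1] := csim_dat (allrefl r v) (cm_centroid lb pr pi).
have h2 := cm_centroid lb' rs1 is1.
have [_ p2] := csim_dat (allrefl r' v') h2.
apply: pm_trans (pm_rotd p1) (pm_trans _ (pm_sym p2)).
rewrite E1 E2 E3; left.
have -> : bc (ce2 dl s) (ce3 dl s) (ce1 dl s) 3^-1 3^-1 = bc (ce1 dl s) (ce2 dl s) (ce3 dl s) 3^-1 3^-1.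
  by rewrite /bc (_ : rc 3^-1 = 3^-1) ?/rc ?fmorphV ?rmorph_nat //; field.
by rewrite /mers dat_rot.
Qed.


End Invariant.

(** * The theorem of Mason and Stothers *)

Section Mason.
Context {R : realType}.
Local Notation C := R[i].
Implicit Types (p a c : {poly C}) (l : seq C).

Local Notation lins l := (\prod_(z <- l) ('X - z%:P)).

(** A root of multiplicity [m] is a root of multiplicity [m - 1] of the derivative. *)
Lemma dvdp_deriv_rad (l : seq C) : lins l %| (lins l)^`() * lins (undup l).
Proof.
elim: l => [|z l IH]; first by rewrite big_nil dvd1p.
have -> : lins (z :: l) = ('X - z%:P) * lins l by rewrite big_cons.
rewrite derivM derivB derivX derivC subr0 mul1r [X in _ %| X]mulrDl; apply: dvdp_add.
  rewrite /=; case: ifP => zl.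
    have /dvdpP[k ->] : ('X - z%:P) %| lins (undup l).
      by rewrite dvdp_XsubCl root_prod_XsubC mem_undup.
    by rewrite mulrCA [X in X %| _]mulrC dvdp_mull.
  by rewrite big_cons mulrA [lins l * _]mulrC dvdp_mulr.
rewrite -mulrA dvdp_mul2l ?polyXsubC_eq0 //.
rewrite /=; case: ifP => // zl.
by rewrite big_cons mulrCA dvdp_mull.
Qed.

Definition rad p := lins (undup (proots p)).

Lemma rad_dvd p : p %| p^`() * rad p.
Proof.
have [->|p0] := eqVneq p 0; first by rewrite deriv0 mul0r.
rewrite {1}[p]prootsE [in p^`()](prootsE p) derivZ -scalerAl.
by rewrite dvdpZl ?lead_coef_eq0 // dvdpZr ?lead_coef_eq0 // dvdp_deriv_rad.
Qed.

Lemma size_rad p : size (rad p) = (size (undup (proots p))).+1.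
Proof. by rewrite /rad size_prod_XsubC. Qed.

Lemma rad_neq0 p : rad p != 0.
Proof. by rewrite -size_poly_gt0 size_rad. Qed.

(** Outside the radicals, the product [a c (a - c)] divides the Wronskian of [a] and [c], whose
    degree is at most [2 D - 2] because the leading terms cancel. *)
Lemma mason a c (D : nat) : (0 < D)%N -> size a = D.+1 -> size c = D.+1 ->
  size (a - c) = D.+1 -> coprimep a c ->
  (D + 2 <= size (undup (proots a)) + size (undup (proots c)) + size (undup (proots (a - c))%R))%N.
Proof.
move=> D0 sa sc se ac.
have key (w x y z : nat) : (w <= D.-1 + D)%N ->
    (((D.+1 + D.+1).-1 + D.+1).-1 <= (w + ((x.+1 + y.+1).-1 + z.+1).-1).-1)%N ->
    (D + 2 <= x + y + z)%N by move: D0; clear; lia.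
have key1 (j : nat) : (D.-1 + D < j)%N -> (D + D <= j)%N by move: D0; clear; lia.
have ae : coprimep a (a - c).
  apply/coprimepP => k ka ke; apply: (coprimepP _ _ ac) => //.
  by rewrite -(dvdp_subr _ ka).
have ce : coprimep c (a - c).
  apply/coprimepP => k kc ke; apply: (coprimepP _ _ ac) => //.
  by rewrite -(dvdp_subl _ kc).
pose W := a^`() * c - a * c^`().
have WE : W = (a - c)^`() * c - (a - c) * c^`() by rewrite /W derivB; ring.
have da : a %| W * rad a.
  rewrite /W mulrBl; apply: dvdp_sub; last by rewrite -mulrA dvdp_mulr.
  by rewrite mulrAC dvdp_mulr // rad_dvd.
have dc : c %| W * rad c.
  rewrite /W mulrBl; apply: dvdp_sub; first by rewrite mulrAC dvdp_mull.
  by rewrite -mulrA dvdp_mull // rad_dvd.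
have de : (a - c) %| W * rad (a - c).
  rewrite WE mulrBl; apply: dvdp_sub; last by rewrite -mulrA dvdp_mulr.
  by rewrite mulrAC dvdp_mulr // rad_dvd.
have a0 : a != 0 by rewrite -size_poly_gt0 sa.
have c0 : c != 0 by rewrite -size_poly_gt0 sc.
have e0 : a - c != 0 by rewrite -size_poly_gt0 se.
have sd p : size p = D.+1 -> size p^`() = D.
  move=> sp; apply/eqP; rewrite eqn_leq; apply/andP; split.
    by rewrite -ltnS -sp lt_size_deriv // -size_poly_gt0 sp.
  have l0 : p^`()`_D.-1 != 0.
    rewrite coef_deriv prednK // mulrn_eq0 negb_or -lt0n D0 /=.
    by have : lead_coef p != 0; [rewrite lead_coef_eq0 -size_poly_gt0 sp|rewrite /lead_coef sp].
  by rewrite -(prednK D0) ltnNge; apply: contraNN l0 => h; rewrite nth_default.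
have W0 : W != 0.
  apply/eqP => W0.
  have : a %| a^`() * c by rewrite -(subrK (a * c^`()) (a^`() * c)) -/W W0 add0r dvdp_mulr.
  rewrite Gauss_dvdpl // => /dvdp_leq.
  by rewrite -size_poly_gt0 sd // D0 => /(_ isT); rewrite sa ltnn.
have sW : (size W <= D.-1 + D)%N.
  apply/leq_sizeP => j hj; rewrite /W coefB.
  have [hj'|hj'] := ltnP (D.-1 + D) j.
    have n1 : (size (a^`() * c)%R <= j)%N.
      by apply: leq_trans (size_polyMleq _ _) _; rewrite sd // sc addnS /= key1.
    have n2 : (size (a * c^`())%R <= j)%N.
      by apply: leq_trans (size_polyMleq _ _) _; rewrite sd // sa addSn /= key1.
    by rewrite !nth_default ?subrr.
  have jE : j = (D.-1 + D)%N by apply/eqP; rewrite eqn_leq hj hj'.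
  have la p : size p = D.+1 -> lead_coef p = p`_D by rewrite /lead_coef => ->.
  have lda p : size p = D.+1 -> lead_coef p^`() = p`_D *+ D.
    by move=> sp; rewrite /lead_coef sd // coef_deriv prednK.
  have -> : (a^`() * c)`_j = lead_coef a^`() * lead_coef c.
    by rewrite -lead_coefM /lead_coef size_mul ?sd ?sc ?addnS //= ?jE;
      [congr nth; move: D0; clear; lia|rewrite -size_poly_gt0 sd].
  have -> : (a * c^`())`_j = lead_coef a * lead_coef c^`().
    by rewrite -lead_coefM /lead_coef size_mul ?sd ?sa ?addSn //= ?jE;
      [congr nth; move: D0; clear; lia|rewrite -size_poly_gt0 sd].
  by rewrite !lda // !la // mulrnAl mulrnAr subrr.
have dv : a * c * (a - c) %| W * (rad a * rad c * rad (a - c)).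
  rewrite Gauss_dvdp; last by rewrite coprimepMl ae ce.
  rewrite Gauss_dvdp //; apply/andP; split; first apply/andP; first split.
  - have -> : W * (rad a * rad c * rad (a - c)) = (W * rad a) * (rad c * rad (a - c)) by ring.
    by rewrite dvdp_mulr.
  - have -> : W * (rad a * rad c * rad (a - c)) = (W * rad c) * (rad a * rad (a - c)) by ring.
    by rewrite dvdp_mulr.
  - by rewrite mulrCA dvdp_mull.
have := dvdp_leq _ dv; rewrite !mulf_neq0 ?rad_neq0 // => /(_ isT).
rewrite !size_mul ?mulf_neq0 ?rad_neq0 // sa sc se !size_rad.
exact: key.
Qed.

End Mason.

(** * Counting the fibres of a given shape *)

Section Modulus.
Context {R : realType}.
Local Notation C := R[i].
Implicit Types (x y : C).

Definition nm x : R := re `|x|.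

Lemma nmE x : `|x| = rc (nm x).
Proof. by rewrite /nm normc_def. Qed.

Lemma nm_ge0 x : 0 <= nm x.
Proof.
have h : rc 0 <= rc (nm x) by rewrite -nmE rc0 normr_ge0.
by rewrite lecR in h.
Qed.

Lemma nmD x y : nm (x + y) <= nm x + nm y.
Proof. by rewrite -lecR -!/(rc _) rcD -!nmE ler_normD. Qed.

Lemma nmM x y : nm (x * y) = nm x * nm y.
Proof. by apply: (@complexI R); rewrite -!/(rc _) rcM -!nmE normrM. Qed.

Lemma nmN x : nm (- x) = nm x.
Proof. by apply: (@complexI R); rewrite -!/(rc _) -!nmE normrN. Qed.

Lemma nm_eq0 x : (nm x == 0) = (x == 0).
Proof.
apply/eqP/eqP => [h|->]; last by rewrite /nm normr0 re0.
by apply: normr0_eq0; rewrite nmE h rc0.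
Qed.

Lemma nm_rc (t : R) : nm (rc t) = `|t|.
Proof. by rewrite /nm norm_rc. Qed.

Lemma re_le_nm x : re x <= nm x.
Proof.
rewrite -lecR -/(rc (nm x)) -nmE -/(rc _); apply: le_trans (normc_ge_Re x).
by rewrite -/(re x) -/(rc `|_|) lecR ler_norm.
Qed.

Lemma nm_ltP x (e : R) : (`|x| < rc e) = (nm x < e).
Proof. by rewrite nmE ltcR. Qed.

Lemma near_nm (T : topologicalType) (f : T -> C) (x : T) (e : R) : {for x, continuous f} ->
  0 < e -> \forall y \near x, nm (f x - f y) < e.
Proof.
move=> fc e0; have e0' : 0 < rc e by rewrite ltcR.
have := (@cvgrPdist_lt _ _ _ (nbhs x) (nbhs_filter x) f (f x)).1 fc (rc e) e0'.
by apply: nearS => y; rewrite nm_ltP.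
Qed.

Lemma nm_open x (e : R) : open [set y | nm (x - y) < e].
Proof.
have -> : [set y | nm (x - y) < e] = [set y | `|x - y| < rc e].
  by apply/seteqP; split=> y /=; rewrite nm_ltP.
exact: disc_open.
Qed.

Lemma nm_convex x (e : R) : 0 < e -> convexC [set y | nm (x - y) < e].
Proof.
move=> e0; have e0' : 0 < rc e by rewrite ltcR.
have -> : [set y | nm (x - y) < e] = [set y | `|x - y| < rc e].
  by apply/seteqP; split=> y /=; rewrite nm_ltP.
exact: (@disc_convex R x (rc e) e0').
Qed.

Lemma near_ball (x : C) (N : C -> Prop) : (\forall y \near x, N y) ->
  exists2 e : R, 0 < e & forall y, nm (x - y) < e -> N y.
Proof.
move=> /nbhs_ballP[e /= e0 he]; have [r r0 E] := pos_rc e0.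
by exists r => // y h; apply: he; rewrite /ball /= E nm_ltP.
Qed.

Lemma sqrt_upper (u : C) : 0 < im u -> exists y, [/\ y ^+ 2 = u, 0 < re y & 0 < im y].
Proof.
move=> iu.
pose y := sqrtC u; have y2 : y ^+ 2 = u by exact: sqrtCK.
have E : im u = 2 * (re y * im y) by rewrite -y2 expr2 imM; ring.
have p : 0 < re y * im y by lra.
have [r0|r0] := ltP 0 (re y).
  by exists y; split=> //; rewrite -(pmulr_rgt0 _ r0).
have r1 : re y < 0.
  rewrite lt_neqAle r0 andbT; apply: contraTneq p => ->; by rewrite mul0r ltxx.
exists (- y); rewrite sqrrN reN imN oppr_gt0; split=> //.
by rewrite -(nmulr_rlt0 _ r1) mulrN oppr_lt0.
Qed.

Lemma upper_open : open [set s : C | 0 < im s].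
Proof.
rewrite openE => s hs; rewrite /interior /=.
exact: (near_gt0 (@im_cont R s) hs).
Qed.

Lemma upper_convex : convexC [set s : C | 0 < im s].
Proof. by move=> a b t ha hb t01 /=; have [_ ->] := lin01E a b t; exact: itp_gt. Qed.

Lemma right_open : open [set s : C | 0 < re s].
Proof.
rewrite openE => s hs; rewrite /interior /=.
exact: (near_gt0 (@re_cont R s) hs).
Qed.

End Modulus.

Section Sums.

Lemma sum_excl (I : eqType) (l : seq I) (f : I -> bool) (v : nat) : uniq l ->
  (forall i j, i \in l -> j \in l -> f i -> f j -> i = j) ->
  (\sum_(i <- l) (if f i then v else 0) <= v)%N.
Proof.
elim: l => [|i l IH] /=; first by rewrite big_nil.
move=> /andP[il ul] h; rewrite big_cons.
case: ifP => fi; last by rewrite add0n; apply: IH => // x y xl yl; apply: h; rewrite inE ?xl ?yl orbT.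
rewrite big_seq big1 ?addn0 // => j jl; case: ifP => // fj.
have E : i = j by apply: h; rewrite ?inE ?eqxx ?jl ?orbT.
by move: il; rewrite E jl.
Qed.

Lemma min_pos (R : realType) (l : seq R) : (forall x, x \in l -> 0 < x) ->
  exists2 r, 0 < r & forall x, x \in l -> r <= x.
Proof.
elim: l => [|x l IH] h; first by exists 1.
have [|r r0 hr] := IH; first by move=> y yl; apply: h; rewrite inE yl orbT.
exists (Order.min r x); first by rewrite lt_min r0 h // mem_head.
move=> y; rewrite inE => /orP[/eqP->|yl]; first by rewrite ge_min lexx orbT.
by rewrite ge_min hr.
Qed.

End Sums.

Lemma near_all (T : topologicalType) (x : T) (S : T -> Prop) : (forall y, S y) -> \forall y \near x, S y.
Proof. by move=> h; apply: filterE. Qed.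

Lemma at_pair (T U V : topologicalType) (f : T -> U) (f' : T -> V) (x : T) :
  {for x, continuous f} -> {for x, continuous f'} -> {for x, continuous (fun z => (f z, f' z))}.
Proof. by move=> fc fc'; apply: cvg_pair. Qed.

Lemma constC (R : realType) (T : topologicalType) (c : R[i]) : continuous (fun _ : T => c).
Proof. exact: constc. Qed.

Section Shapes.
Context {R : realType}.
Local Notation C := R[i].
Implicit Types (s : C).

Definition Ash s : C := s ^+ 4 - s ^+ 2 + 1.
Definition Bsh s : C := (1 + s ^+ 2) * (2 - s ^+ 2) * (2 * s ^+ 2 - 1).
(** The modular invariant of the cubic with roots [0], [1], [s ^ 2] is [Jn s / Jd s]; the numerator
    vanishes for equilateral triangles, the denominator for coinciding roots, and the difference is
    the square of [Bsh s], which vanishes when a root is the midpoint of the two other ones. *)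
Definition Jn s : C := 4 * Ash s ^+ 3.
Definition Jd s : C := 27 * (s ^+ 2 * (s ^+ 2 - 1)) ^+ 2.

Lemma JnB s : Jn s - Jd s = Bsh s ^+ 2.
Proof. by rewrite /Jn /Jd /Ash /Bsh; ring. Qed.

Definition cof (S : C -> Prop) := exists L : seq C, forall s, s \notin L -> S s.

Lemma cof_and S S' : cof S -> cof S' -> cof (fun s => S s /\ S' s).
Proof.
move=> [L h] [L' h']; exists (L ++ L') => s; rewrite mem_cat negb_or => /andP[sL sL'].
by split; [exact: h|exact: h'].
Qed.

Lemma cof_poly (p : {poly C}) : p != 0 -> cof (fun s => p.[s] != 0).
Proof. by move=> p0; exists (proots p) => s; rewrite mem_proots. Qed.

Lemma cof_all (I : eqType) (l : seq I) (S : I -> C -> Prop) :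
  (forall i, i \in l -> cof (S i)) -> cof (fun s => forall i, i \in l -> S i s).
Proof.
elim: l => [|i l IH] h; first by exists [::].
have [|L1 h1] := IH; first by move=> j jl; apply: h; rewrite inE jl orbT.
have [L2 h2] := h i (mem_head _ _); exists (L2 ++ L1) => s.
rewrite mem_cat negb_or => /andP[s2 s1] j; rewrite inE => /orP[/eqP->|jl]; first exact: h2.
exact: h1.
Qed.

Lemma cofS (S S' : C -> Prop) : (forall s, S s -> S' s) -> cof S -> cof S'.
Proof. by move=> h [L hL]; exists L => s /hL/h. Qed.

Lemma neq_poly (p : {poly C}) (x : C) : p.[x] != 0 -> p != 0.
Proof. by apply: contraNneq => ->; rewrite horner0. Qed.

Lemma cof_open (S : C -> Prop) (O : set C) (p : C) : cof S -> nbhs p O -> exists2 s, O s & S s.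
Proof.
move=> [L hL] nO.
have [x xL] : exists x : C, x \notin L.
  have := max_poly_roots (monic_neq0 (monic_prod_XsubC L xpredT id))
    (rs := [seq i%:R | i <- iota 0 (size L).+1]).
  rewrite size_prod_XsubC size_map size_iota ltnn => H.
  apply: contrapT => nx; have {}nx x : x \in L.
    by apply: contrapT => /negP xL; apply: nx; exists x.
  apply/notF/H; last by rewrite map_inj_uniq ?iota_uniq // => i j /eqP; rewrite eqr_nat => /eqP.
  by apply/allP => y _; rewrite root_prod_XsubC.
have [s Os hs] := avoid_segment xL nO.
by exists s => //; apply: hL; have := hs 1; rewrite lin1 ler01 lexx; apply.
Qed.

End Shapes.

Section Count.
Context {R : realType} {Q : zmodType}.
Local Notation C := R[i].
Local Notation G := (dihedral Q).
Variables (P q : {poly C}).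
Local Notation Om := (Om P q).
Variable g : (R -> C * C) -> G.
Hypothesis gflat : flat Om g.
Hypothesis allrefl : forall b z e1 e2 e3, roots3 P q b e1 e2 e3 -> valid z e1 e2 e3 ->
  refl3 (mers P q g b z e1 e2 e3).
Local Notation lab := (lab P q).
Local Notation cm := (cm P q g).

Variables (a c k : {poly C}) (D : nat).
Hypothesis (aE : - 4%:P * P ^+ 3 = k * a) (cE : - 4%:P * P ^+ 3 - 27%:P * q ^+ 2 = k * c).
Hypothesis (sa : size a = D.+1) (sc : size c = D.+1) (cop : coprimep a c).
Hypothesis (P0 : P != 0) (q0 : q != 0).

(** For all but finitely many [s], the roots of [fs s] are the base points whose fibre has shape [s]. *)
Definition fs s : {poly C} := Jd s *: a - Jn s *: c.

(** Outside finitely many shapes, none of the roots goes to infinity or hits a zero of [P] or [q]. *)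
Definition nonbad s := [/\ Ash s != 0, s ^+ 2 * (s ^+ 2 - 1) != 0, Bsh s != 0, (fs s)`_D != 0 &
  forall x, P.[x] = 0 \/ q.[x] = 0 -> (fs s).[x] != 0].

Lemma cof_nonbad : cof nonbad.
Proof.
pose JnX : {poly C} := 4%:P * ('X^4 - 'X^2 + 1) ^+ 3.
pose JdX : {poly C} := 27%:P * ('X^2 * ('X^2 - 1)) ^+ 2.
have JnE s : JnX.[s] = Jn s by rewrite /JnX /Jn /Ash !hornerE.
have JdE s : JdX.[s] = Jd s by rewrite /JdX /Jd !hornerE.
clearbody JnX JdX.
have pair (u v : C) : (u != 0) || (v != 0) -> cof (fun s => Jd s * u - Jn s * v != 0).
  move=> uv; have p0 : JdX * u%:P - JnX * v%:P != 0.
    have [v0|v0] := eqVneq v 0.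
      apply: (@neq_poly _ _ 2); rewrite hornerD hornerN !hornerM !hornerC JdE v0 mulr0 subr0.
      move: uv; rewrite v0 eqxx orbF => u0; rewrite mulf_neq0 // /Jd.
      have -> : 27 * ((2 : C) ^+ 2 * (2 ^+ 2 - 1)) ^+ 2 = 3888 by ring.
      by rewrite pnatr_eq0.
    apply: (@neq_poly _ _ 0); rewrite hornerD hornerN !hornerM !hornerC JdE JnE.
    have -> : Jd (0 : C) * u - Jn 0 * v = - 4 * v by rewrite /Jd /Jn /Ash; ring.
    by rewrite mulf_neq0 // oppr_eq0 pnatr_eq0.
  apply: cofS (cof_poly p0) => s; rewrite hornerD hornerN !hornerM !hornerC JdE JnE.
  by [].
have cA : cof (fun s : C => Ash s != 0).
  have : ('X^4 - 'X^2 + 1 : {poly C}) != 0.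
    by apply: (@neq_poly _ _ 0); rewrite !hornerE !expr0n /= subr0 add0r oner_neq0.
  by move=> /cof_poly; apply: cofS => s; rewrite !hornerE.
have cB : cof (fun s : C => Bsh s != 0).
  have : ((1 + 'X^2) * (2%:P - 'X^2) * (2%:P * 'X^2 - 1) : {poly C}) != 0.
    apply: (@neq_poly _ _ 0); rewrite !hornerE !expr0n /= addr0 subr0 mulr0 sub0r mul1r mulrN1.
    by rewrite oppr_eq0 pnatr_eq0.
  move=> /cof_poly; apply: cofS => s.
  have -> // : ((1 + 'X^2) * (2%:P - 'X^2) * (2%:P * 'X^2 - 1) : {poly C}).[s] = Bsh s.
  by rewrite /Bsh !hornerE; ring.
have cD : cof (fun s : C => s ^+ 2 * (s ^+ 2 - 1) != 0).
  have : ('X^2 * ('X^2 - 1) : {poly C}) != 0.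
    apply: (@neq_poly _ _ 2); rewrite !hornerE.
    have -> : (2 : C) ^+ 2 * (2 ^+ 2 - 1) = 12 by ring.
    by rewrite pnatr_eq0.
  by move=> /cof_poly; apply: cofS => s; rewrite !hornerE.
have la : a`_D != 0.
  by have : lead_coef a != 0; [rewrite lead_coef_eq0 -size_poly_gt0 sa|rewrite /lead_coef sa].
have cl : cof (fun s => (fs s)`_D != 0).
  have := pair a`_D c`_D; rewrite la => /(_ isT); apply: cofS => s.
  by rewrite /fs coefB !coefZ.
have cS : cof (fun s => forall x, x \in proots (P * q) -> (fs s).[x] != 0).
  apply: cof_all => x _; have := pair a.[x] c.[x].
  have -> : (a.[x] != 0) || (c.[x] != 0).
    have [ax|//] := eqVneq a.[x] 0; rewrite (coprimep_root cop) //.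
    by rewrite rootE ax.
  by move=> /(_ isT); apply: cofS => s; rewrite /fs hornerD hornerN !hornerZ.
apply: cofS (cof_and cA (cof_and cB (cof_and cD (cof_and cl cS)))) => s [h1 [h2 [h3 [h4 h5]]]].
split=> // x hx; apply: h5; rewrite mem_proots ?mulf_neq0 // rootM !rootE.
by case: hx => ->; rewrite eqxx ?orbT.
Qed.

(** Solved from the two equations of [lab]: the scale [dl] of the fibre over [b], if its shape is [s]. *)
Definition dlt s b : C := - 9 * q.[b] * Ash s / (P.[b] * Bsh s).

Lemma nonbad_root s b : nonbad s -> root (fs s) b -> P.[b] != 0 /\ q.[b] != 0.
Proof.
move=> [_ _ _ _ sing] rb.
by split; apply/eqP => h; [move: (sing b (or_introl h))|move: (sing b (or_intror h))];
  rewrite -rootE rb.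
Qed.

Lemma fs_lab s b : Ash s != 0 -> Bsh s != 0 -> P.[b] != 0 -> q.[b] != 0 -> root (fs s) b ->
  lab b (dlt s b) s.
Proof.
move=> A0 B0 Pb qb rb.
have E : Jd s * a.[b] = Jn s * c.[b].
  by move: rb; rewrite rootE /fs hornerD hornerN !hornerZ subr_eq0 => /eqP.
have EN := congr1 (fun p => p.[b]) aE; have EM := congr1 (fun p => p.[b]) cE.
rewrite /= !(hornerD, hornerN, hornerM, hornerC, horner_exp) in EN EM.
have rel : Bsh s ^+ 2 * P.[b] ^+ 3 = - 27 * Ash s ^+ 3 * q.[b] ^+ 2.
  have E' : Jd s * (- 4 * P.[b] ^+ 3) = Jn s * (- 4 * P.[b] ^+ 3 - 27 * q.[b] ^+ 2).
    have -> : - 4 * P.[b] ^+ 3 = k.[b] * a.[b] by rewrite -EN; ring.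
    have -> : k.[b] * a.[b] - 27 * q.[b] ^+ 2 = k.[b] * c.[b] by rewrite -EM -EN; ring.
    by rewrite mulrCA E mulrCA.
  have n4 : (4 : C) != 0 by rewrite pnatr_eq0.
  apply: (mulfI n4); rewrite -JnB.
  have -> : 4 * ((Jn s - Jd s) * P.[b] ^+ 3) = Jd s * (- 4 * P.[b] ^+ 3) + 4 * (Jn s * P.[b] ^+ 3) by ring.
  by rewrite E' /Jn; ring.
have n3 : (3 : C) != 0 by rewrite pnatr_eq0.
have n9 : (9 : C) != 0 by rewrite pnatr_eq0.
have d2 : dlt s b ^+ 2 = - 3 * P.[b] / Ash s.
  have -> : dlt s b ^+ 2 = 81 * q.[b] ^+ 2 * Ash s ^+ 2 * P.[b] / (Bsh s ^+ 2 * P.[b] ^+ 3).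
    by rewrite /dlt; field; rewrite Pb B0.
  by rewrite rel; field; rewrite A0 qb.
split.
- have n9' : (- 9 : C) != 0 by rewrite oppr_eq0.
  exact: (mulf_neq0 (mulf_neq0 (mulf_neq0 n9' qb) A0) (invr_neq0 (mulf_neq0 Pb B0))).
- by rewrite d2 -/(Ash s); field.
- rewrite exprS d2 -/(Bsh s) /dlt; field.
  by rewrite A0 B0 Pb.
Qed.

Definition dat_at s b := dat (cm b (dlt s b) s).

(** The weighted number of the base points in [U] whose fibre has shape [s]. *)
Definition psi (U : C -> bool) (w : Q * Q -> nat) s : nat :=
  sumroots (fs s) (fun b => if U b then w (dat_at s b) else 0%N).

Definition even (w : Q * Q -> nat) := forall d, w (- d) = w d.

Lemma even_pm w d d' : even w -> pm d d' -> w d' = w d.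
Proof. by move=> we [->|->]. Qed.

Lemma Ash_c (T : topologicalType) (f : T -> C) : continuous f -> continuous (fun x => Ash (f x)).
Proof.
move=> fc; exact: (contD (contB (contX (n := 4) fc) (contX (n := 2) fc)) (@constC _ _ 1)).
Qed.

Lemma Bsh_c (T : topologicalType) (f : T -> C) : continuous f -> continuous (fun x => Bsh (f x)).
Proof.
move=> fc; have f2 := contX (n := 2) fc.
exact: (contM (contM (contD (@constC _ _ 1) f2) (contB (@constC _ _ 2) f2))
  (contB (contM (@constC _ _ 2) f2) (@constC _ _ 1))).
Qed.

Lemma fs_c i : continuous (fun s => (fs s)`_i).
Proof.
have -> : (fun s => (fs s)`_i) = (fun s => Jd s * a`_i - Jn s * c`_i).
  by apply/funext => s; rewrite /fs coefB !coefZ.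
have f2 := contX (n := 2) (@idC R).
have dc : continuous (fun s : C => Jd s).
  exact: (contM (@constC _ _ 27) (contX (n := 2) (contM f2 (contB f2 (@constC _ _ 1))))).
have nc : continuous (fun s : C => Jn s).
  exact: (contM (@constC _ _ 4) (contX (n := 3) (Ash_c (@idC R)))).
exact: (contB (contM dc (@constC _ _ a`_i)) (contM nc (@constC _ _ c`_i))).
Qed.

Lemma size_fs s : (size (fs s) <= D.+1)%N.
Proof.
rewrite /fs (leq_trans (size_polyD _ _)) // geq_max size_polyN.
by rewrite -{1}sa -sc !size_scale_leq.
Qed.

Lemma size_fsE s : (fs s)`_D != 0 -> size (fs s) = D.+1.
Proof.
move=> h; apply/eqP; rewrite eqn_leq size_fs /= ltnNge.
by apply: contraNN h => h; rewrite nth_default.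
Qed.

(** The roots and their labels are continuous, and [w] ignores the sign ambiguity of the data. *)
Lemma psi_near (U : C -> bool) w s0 : nonbad s0 -> im s0 != 0 -> even w ->
  (forall b, root (fs s0) b -> \forall b' \near b, U b' = U b) ->
  \forall s \near s0, psi U w s = psi U w s0.
Proof.
move=> nb i we hU; have [A0 D0 B0 l0 sing] := nb.
apply: (@sumroots_near _ _ _ fs s0 (fun s b => if U b then w (dat_at s b) else 0%N) D).
- by move=> j; exact: (@fs_c j s0).
- exact: size_fsE.
- by apply: near_all => s; exact: size_fs.
move=> b0 rb0; have [Pb qb] := nonbad_root nb rb0.
have lb := fs_lab A0 B0 Pb qb rb0.
have NU : \forall z \near (s0, b0), U z.2 = U b0.
  exact: (@near_cont _ _ (fun z : C * C => z.2) (s0, b0) (fun b => U b = U b0) (@cont_snd C C (s0, b0)) (hU b0 rb0)).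
have sc' : continuous (fun z : C * C => z.1) := cont_fst.
have bc' : continuous (fun z : C * C => z.2) := cont_snd.
have qc := cont_horner (p := q) bc'; have pc := cont_horner (p := P) bc'.
have numc : continuous (fun z : C * C => - 9 * q.[z.2] * Ash z.1).
  exact: (contM (contM (@constC _ _ (- 9)) qc) (Ash_c sc')).
have denc : continuous (fun z : C * C => P.[z.2] * Bsh z.1) := contM pc (Bsh_c sc').
have den0 : P.[b0] * Bsh s0 != 0 by rewrite mulf_neq0.
have dc : {for (s0, b0), continuous (fun z : C * C => dlt z.1 z.2)}.
  exact: (@at_div _ _ _ _ (s0, b0) numc denc den0).
have Fc : {for (s0, b0), continuous (fun z : C * C => (z.2, (dlt z.1 z.2, z.1)))}.
  exact: (@at_pair _ _ _ _ _ (s0, b0) (bc' (s0, b0)) (at_pair dc (sc' (s0, b0)))).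
have H := near_cont Fc (dat_near gflat allrefl lb i).
have N1 := near_neq0 (x := (s0, b0)) (Ash_c sc') A0.
have N2 := near_neq0 (x := (s0, b0)) (Bsh_c sc') B0.
have N3 := near_neq0 (x := (s0, b0)) pc Pb.
have N4 := near_neq0 (x := (s0, b0)) qc qb.
apply: nearS (nearI NU (nearI H (nearI (nearI N1 N2) (nearI N3 N4)))) => z [-> [hz [[z1 z2] [z3 z4]]]] rz.
case: (U b0) => //; apply: even_pm => //.
exact: (hz (fs_lab z1 z2 z3 z4 rz)).
Qed.

Lemma psi_const (U : C -> bool) w (A : set C) : convexC A -> open A -> even w ->
  (forall s, A s -> im s != 0) ->
  (forall s, A s -> nonbad s -> forall b, root (fs s) b -> \forall b' \near b, U b' = U b) ->
  forall s s', A s -> A s' -> nonbad s -> nonbad s' -> psi U w s = psi U w s'.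
Proof.
move=> cA oA we hA hU.
have [L hL] := cof_nonbad.
(* the exceptional values avoided are exactly the bad ones *)
pose L' := [seq s <- L | `[< ~ nonbad s >]].
have LE s : s \notin L' <-> nonbad s.
  rewrite mem_filter; split.
    by move=> h; apply: contrapT => nb; move: h; rewrite (asboolT nb) /= => /hL.
  by move=> nb; rewrite asboolF.
move=> s s' As As' /LE ns /LE ns'.
apply: (lconst_avoid cA oA _ As As' ns ns') => u Au /LE nu.
by apply: psi_near => //; [exact: hA|exact: hU].
Qed.

(** ** The action of the modular group *)

Lemma sumroots_scale (u : C) (p : {poly C}) (w : C -> nat) : u != 0 -> p != 0 ->
  sumroots (u *: p) w = sumroots p w.
Proof.
move=> u0 p0; rewrite /sumroots.
have E : u *: p = (u * lead_coef p) *: \prod_(z <- proots p) ('X - z%:P).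
  by rewrite {1}[p]prootsE scalerA.
by rewrite (perm_big _ (proots_perm _ E)) // mulf_neq0 // lead_coef_eq0.
Qed.

Lemma eq_sumroots (p : {poly C}) (w w' : C -> nat) : p != 0 ->
  (forall b, root p b -> w b = w' b) -> sumroots p w = sumroots p w'.
Proof.
move=> p0 h; rewrite /sumroots !big_seq; apply: eq_bigr => b; rewrite mem_proots //.
exact: h.
Qed.

Lemma nonbad_scale s s1 (u v : C) : u != 0 -> v != 0 -> fs s1 = u *: fs s ->
  Ash s1 = v ^+ 2 * Ash s -> s1 ^+ 2 * (s1 ^+ 2 - 1) != 0 -> Bsh s1 = v ^+ 3 * Bsh s \/ Bsh s1 = - v ^+ 3 * Bsh s ->
  nonbad s -> nonbad s1.
Proof.
move=> u0 v0 E EA D1 EB [A0 D0 B0 l0 sing]; split=> //.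
- by rewrite EA mulf_neq0 // expf_neq0.
- by case: EB => ->; rewrite mulf_neq0 ?oppr_eq0 ?expf_neq0.
- by rewrite E coefZ mulf_neq0.
- by move=> x /sing; rewrite E hornerZ => ?; rewrite mulf_neq0.
Qed.

Lemma nonbad_fs0 s : nonbad s -> fs s != 0.
Proof. by move=> [_ _ _ l0 _]; apply: contraNneq l0 => ->; rewrite coef0. Qed.

Lemma third_shape s s1 : nonbad s -> s1 ^+ 2 = (1 - s ^+ 2)^-1 ->
  [/\ nonbad s1, fs s1 = (1 - s ^+ 2)^-1 ^+ 6 *: fs s &
      forall b, P.[b] != 0 -> dlt s1 b = (s ^+ 2 - 1) * dlt s b].
Proof.
move=> nb E; have [A0 + B0 _ _] := nb; rewrite mulf_eq0 negb_or => /andP[t0 t1].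
have t1' : 1 - s ^+ 2 != 0 by rewrite -oppr_eq0 opprB.
have E4 : s1 ^+ 4 = (1 - s ^+ 2)^-1 ^+ 2 by rewrite -E -exprM.
have EA : Ash s1 = (1 - s ^+ 2)^-1 ^+ 2 * Ash s by rewrite /Ash E4 E; field.
have EB : Bsh s1 = - (1 - s ^+ 2)^-1 ^+ 3 * Bsh s by rewrite /Bsh E; field.
have EF : fs s1 = (1 - s ^+ 2)^-1 ^+ 6 *: fs s.
  have En : Jn s1 = (1 - s ^+ 2)^-1 ^+ 6 * Jn s by rewrite /Jn EA; field.
  have Ed : Jd s1 = (1 - s ^+ 2)^-1 ^+ 6 * Jd s by rewrite /Jd E; field.
  by rewrite /fs En Ed scalerBr !scalerA.
split=> //.
  apply: (nonbad_scale _ _ EF EA _ (or_intror EB) nb); rewrite ?expf_neq0 ?invr_neq0 //.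
  rewrite E (_ : (1 - s ^+ 2)^-1 * ((1 - s ^+ 2)^-1 - 1) = (1 - s ^+ 2)^-1 ^+ 2 * s ^+ 2).
    by rewrite mulf_neq0 // expf_neq0 // invr_neq0.
  by field.
by move=> b Pb; rewrite /dlt EA EB; field; rewrite B0 t1' Pb.
Qed.

Lemma quarter_shape s : nonbad s ->
  [/\ nonbad (- s^-1), fs (- s^-1) = (s ^+ 2)^-1 ^+ 6 *: fs s &
      forall b, P.[b] != 0 -> dlt (- s^-1) b = s ^+ 2 * dlt s b].
Proof.
move=> nb; have [A0 + B0 _ _] := nb; rewrite mulf_eq0 negb_or => /andP[t0 t1].
have s0 : s != 0 by apply: contraNneq t0 => ->; rewrite expr0n.
have EA : Ash (- s^-1) = (s ^+ 2)^-1 ^+ 2 * Ash s by rewrite /Ash; field.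
have EB : Bsh (- s^-1) = (s ^+ 2)^-1 ^+ 3 * Bsh s by rewrite /Bsh; field.
have EF : fs (- s^-1) = (s ^+ 2)^-1 ^+ 6 *: fs s.
  have En : Jn (- s^-1) = (s ^+ 2)^-1 ^+ 6 * Jn s by rewrite /Jn EA; field.
  have Ed : Jd (- s^-1) = (s ^+ 2)^-1 ^+ 6 * Jd s by rewrite /Jd; field.
  by rewrite /fs En Ed scalerBr !scalerA.
split=> //.
  apply: (nonbad_scale _ _ EF EA _ (or_introl EB) nb); rewrite ?expf_neq0 ?invr_neq0 //.
  rewrite (_ : (- s^-1) ^+ 2 * ((- s^-1) ^+ 2 - 1) = - (s ^+ 2)^-1 ^+ 2 * (s ^+ 2 - 1)).
    by rewrite mulf_neq0 // oppr_eq0 expf_neq0 // invr_neq0.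
  by field.
by move=> b Pb; rewrite /dlt EA EB; field; rewrite B0 s0 Pb.
Qed.

Lemma psi_third (U : C -> bool) w s s1 : nonbad s -> 0 < re s -> 0 < im s -> 0 < re s1 -> 0 < im s1 ->
  s1 ^+ 2 = (1 - s ^+ 2)^-1 -> even w -> psi U w s1 = psi U (fun d => w (rotd d)) s.
Proof.
move=> nb r i r1 i1 E we; have [nb1 EF Ed] := third_shape nb E.
have F0 := nonbad_fs0 nb; have [A0 D0 B0 _ _] := nb.
have t1' : 1 - s ^+ 2 != 0.
  by move: D0; rewrite mulf_eq0 negb_or => /andP[_]; rewrite -oppr_eq0 opprB.
rewrite /psi EF sumroots_scale ?expf_neq0 ?invr_neq0 //.
apply: eq_sumroots => // b rb; case: (U b) => //.
have [Pb qb] := nonbad_root nb rb; have lb := fs_lab A0 B0 Pb qb rb.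
have [_ h] := cm_third gflat allrefl lb r i r1 i1 E.
by apply: even_pm => //; rewrite /dat_at Ed.
Qed.

Lemma psi_quarter (U : C -> bool) w s : nonbad s -> 0 < re s -> 0 < im s ->
  even w -> psi U w (- s^-1) = psi U (fun d => w (quard d)) s.
Proof.
move=> nb r i we; have [nb1 EF Ed] := quarter_shape nb.
have F0 := nonbad_fs0 nb; have [A0 D0 B0 _ _] := nb.
have t0 : s ^+ 2 != 0 by move: D0; rewrite mulf_eq0 negb_or => /andP[].
rewrite /psi EF sumroots_scale ?expf_neq0 ?invr_neq0 //.
apply: eq_sumroots => // b rb; case: (U b) => //.
have [Pb qb] := nonbad_root nb rb; have lb := fs_lab A0 B0 Pb qb rb.
have [_ h] := cm_quarter gflat allrefl lb r i.
by apply: even_pm => //; rewrite /dat_at Ed.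
Qed.

(** ** Clusters of roots *)

Lemma fs_match s0 (e : R) : (fs s0)`_D != 0 -> 0 < e -> \forall s \near s0,
  (forall b, root (fs s) b -> exists2 r, root (fs s0) r & nm (r - b) < e) /\
  (forall r, root (fs s0) r -> exists2 b, root (fs s) b & nm (r - b) < e).
Proof.
move=> l0 e0; set rs := proots (fs s0).
have f0 : fs s0 != 0 by rewrite -size_poly_gt0 size_fsE.
have srs : size rs = D by have := size_proots f0; rewrite size_fsE // => -[].
have ln := near_neq0 (x := s0) (@fs_c D) l0.
pose h s := ((fs s)`_D)^-1 *: fs s.
have mg : \forall s \near s0, h s \is monic /\ size (h s) = (size rs).+1.
  apply: nearS ln => s ls; split; last by rewrite size_scale ?invr_neq0 // srs size_fsE.
  by rewrite monicE lead_coefZ /lead_coef size_fsE // mulVf.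
have cg i : (h s)`_i @[s --> s0] --> (\prod_(r <- rs) ('X - r%:P))`_i.
  have -> : (\prod_(r <- rs) ('X - r%:P))`_i = (fs s0)`_i / (fs s0)`_D.
    have := prootsE (fs s0); rewrite -/rs /lead_coef size_fsE //= => {1}->.
    by rewrite coefZ mulrC mulKf.
  have -> : (fun s => (h s)`_i) = (fun s => (fs s)`_i / (fs s)`_D).
    by apply/funext => s; rewrite coefZ mulrC.
  exact: (@at_div _ _ _ _ s0 (@fs_c i) (@fs_c D) l0).
have e0' : 0 < rc e by rewrite ltcR.
have H := @roots_match _ C (nbhs s0) (nbhs_filter s0) h rs cg mg (rc e) e0'.
apply: nearS (nearI ln H) => s [ls [qs [Eg sq hq]]].
have rE b : root (fs s) b = (b \in qs).
  by rewrite -(rootZ _ _ (invr_neq0 ls)) -/(h s) Eg root_prod_XsubC.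
split=> [b|r].
  rewrite rE => bq; have iq : (index b qs < size rs)%N by rewrite -sq index_mem.
  exists rs`_(index b qs); first by rewrite -mem_proots // mem_nth.
  by rewrite -nm_ltP -{2}(nth_index 0 bq); exact: hq.
rewrite -mem_proots // -/rs => rr; have ir : (index r rs < size rs)%N by rewrite index_mem.
exists qs`_(index r rs); first by rewrite rE mem_nth // sq.
by rewrite -nm_ltP -{1}(nth_index 0 rr); exact: hq.
Qed.

Lemma sep (l : seq C) : exists2 r : R, 0 < r &
  forall x y, x \in l -> y \in l -> x != y -> 2 * r <= nm (x - y).
Proof.
have [|r r0 hr] := @min_pos R [seq (if x == y then 1 else nm (x - y)) | x <- l, y <- l].
  move=> z /allpairsP[[x y] /= [_ _ ->]]; case: eqVneq => xy; first exact: ltr01.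
  by rewrite lt_neqAle nm_ge0 eq_sym nm_eq0 subr_eq0 xy.
exists (r / 2); first by lra.
move=> x y xl yl xy; have := hr (if x == y then 1 else nm (x - y)).
rewrite (negbTE xy) => h; have := h _; rewrite (_ : 2 * (r / 2) = r); last by lra.
by apply; apply/allpairsP; exists (x, y); rewrite /= (negbTE xy).
Qed.

Definition around (r : R) (x b : C) : bool := nm (x - b) < r.

(** [fs_match] with half the distance between distinct roots at [s0]. *)
Lemma clusters s0 : (fs s0)`_D != 0 -> exists2 r : R, 0 < r & exists2 e : R, 0 < e &
  [/\ forall x y b, root (fs s0) x -> root (fs s0) y -> around r x b -> around r y b -> x = y,
      forall s, nm (s0 - s) < e -> forall x, root (fs s0) x -> forall b, root (fs s) b ->
        \forall b' \near b, around r x b' = around r x b &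
      forall s, nm (s0 - s) < e -> forall x, root (fs s0) x ->
        exists2 b, root (fs s) b & around r x b].
Proof.
move=> l0; have f0 : fs s0 != 0 by rewrite -size_poly_gt0 size_fsE.
have [r r0 hr] := sep (proots (fs s0)).
have r20 : 0 < r / 2 by lra.
have [e e0 he] := near_ball (fs_match l0 r20).
exists r => //; exists e => //; split.
- move=> x y b xr yr; rewrite /around => hx hy; apply/eqP; apply: contraT => xy.
  have := hr x y; rewrite !mem_proots // => /(_ xr yr xy).
  have := nmD (x - b) (- (y - b)); rewrite nmN (_ : x - b - (y - b) = x - y); last by ring.
  lra.
- move=> s /he[h _] x xr b rb; have [y yr hy] := h b rb.
  have N := near_nm (@idC R b) r20.
  apply: nearS N => b' hb'; rewrite /around.
  have T1 := nmD (x - b) (b - b'); rewrite (_ : x - b + (b - b') = x - b') in T1; last by ring.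
  have T2 := nmD (x - b') (b' - y); rewrite (_ : x - b' + (b' - y) = x - y) in T2; last by ring.
  have T3 := nmD (b' - b) (b - y); rewrite (_ : b' - b + (b - y) = b' - y) in T3; last by ring.
  have T4 := nmD (x - b) (b - y); rewrite (_ : x - b + (b - y) = x - y) in T4; last by ring.
  have E1 : nm (b - y) = nm (y - b) by rewrite -nmN opprB.
  have E2 : nm (b' - b) = nm (b - b') by rewrite -nmN opprB.
  have [xy|xy] := eqVneq x y.
    subst y; apply/idP/idP => _; lra.
  have := hr x y; rewrite !mem_proots // => /(_ xr yr xy) h2.
  by apply/idP/idP => ?; lra.
- move=> s /he[_ h] x xr; have [b rb hb] := h x xr.
  by exists b => //; rewrite /around; lra.
Qed.

(** ** Elementary properties of the weighted counts *)

Lemma psi_ge1 (U : C -> bool) w s b : fs s != 0 -> root (fs s) b -> U b ->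
  (0 < w (dat_at s b))%N -> (0 < psi U w s)%N.
Proof.
move=> f0 rb Ub wb; rewrite /psi /sumroots (big_rem b) ?mem_proots //= Ub.
by rewrite addn_gt0 wb.
Qed.

Lemma psi_le (U : C -> bool) (I : Type) (l : seq I) (w : I -> Q * Q -> nat) w' s : fs s != 0 ->
  (forall b, root (fs s) b -> U b -> (\sum_(i <- l) w i (dat_at s b) <= w' (dat_at s b))%N) ->
  (\sum_(i <- l) psi U (w i) s <= psi U w' s)%N.
Proof.
move=> f0 h; rewrite /psi /sumroots exchange_big /= !big_seq.
apply: leq_sum => b; rewrite mem_proots // => rb.
by case: ifP => Ub; [exact: h|rewrite big1].
Qed.

Lemma psi_total s : nonbad s -> psi xpredT (fun=> 1%N) s = D.
Proof.
move=> nb; have f0 := nonbad_fs0 nb; have [_ _ _ l0 _] := nb.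
rewrite /psi /sumroots sum1_size; have := size_proots f0.
by rewrite size_fsE // => -[].
Qed.

Lemma cluster_sum (l : seq C) (r : R) w s : uniq l ->
  (forall x y b, x \in l -> y \in l -> around r x b -> around r y b -> x = y) ->
  (\sum_(x <- l) psi (around r x) w s <= psi xpredT w s)%N.
Proof.
move=> ul h; rewrite /psi /sumroots exchange_big /=.
apply: leq_sum => b _; apply: sum_excl => // x y xl yl; exact: h.
Qed.

(** ** Invariance *)

Definition okU (A : set C) (U : C -> bool) := forall s, A s -> nonbad s ->
  forall b, root (fs s) b -> \forall b' \near b, U b' = U b.

Definition region (A : set C) := [/\ convexC A, open A & forall s, A s -> 0 < im s].

Lemma region_const A U w s s' : region A -> okU A U -> even w -> A s -> A s' -> nonbad s ->
  nonbad s' -> psi U w s = psi U w s'.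
Proof.
move=> [cA oA hA] hU we As As'; apply: (psi_const cA oA we _ hU As As') => u Au.
exact: (lt0r_neq0 (hA u Au)).
Qed.

(** For [s] near a fixed point of a symmetry, the count in a cluster is constant on the region, so
    comparing a point with its image turns the symmetry into an invariance of the count. *)
Definition invar (A : set C) (f : Q * Q -> Q * Q) := forall U w s, okU A U -> even w ->
  A s -> nonbad s -> psi U (fun d => w (f d)) s = psi U w s.

Definition eveq (f : Q * Q -> Q * Q) := forall d, f (- d) = - f d.

Lemma even_comp w f : even w -> eveq f -> even (fun d => w (f d)).
Proof. by move=> we fe d; rewrite fe we. Qed.

Lemma invar_third A s s1 : region A -> A s -> A s1 -> nonbad s -> 0 < re s -> 0 < re s1 ->
  s1 ^+ 2 = (1 - s ^+ 2)^-1 -> invar A rotd.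
Proof.
move=> rA As As1 nb r r1 E U w s0 hU we As0 nb0; have [_ _ hA] := rA.
have [nb1 _ _] := third_shape nb E.
rewrite (region_const rA hU (even_comp we (@rotdN Q)) As0 As nb0 nb).
rewrite -(psi_third U nb r (hA _ As) r1 (hA _ As1) E we).
exact: (region_const rA hU we As1 As0 nb1 nb0).
Qed.

Lemma invar_quarter A s : region A -> A s -> A (- s^-1) -> nonbad s -> 0 < re s -> invar A quard.
Proof.
move=> rA As As1 nb r U w s0 hU we As0 nb0; have [_ _ hA] := rA.
have [nb1 _ _] := quarter_shape nb.
rewrite (region_const rA hU (even_comp we (@quardN Q)) As0 As nb0 nb).
rewrite -(psi_quarter U nb r (hA _ As) we).
exact: (region_const rA hU we As1 As0 nb1 nb0).
Qed.

Lemma sqr_im (s : C) : im (s ^+ 2) = 2 * (re s * im s).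
Proof. by rewrite expr2 imM; ring. Qed.

Lemma third_im (s : C) : 0 < re s -> 0 < im s -> 0 < im (1 - s ^+ 2)^-1.
Proof.
move=> r i; have k0 : im (1 - s ^+ 2) < 0.
  by rewrite imD imN im1 sqr_im add0r oppr_lt0 !mulr_gt0.
have n0 : 1 - s ^+ 2 != 0 by apply: contraTneq k0 => ->; rewrite im0 ltxx.
by have [kk kp ->] := im_invE n0; rewrite -mulrN mulr_gt0 // oppr_gt0.
Qed.

(** The shear around a cusp is the composition of the other two symmetries. *)
Definition shear (d : Q * Q) := quard (rotd (rotd d)).

Lemma invar_shear A s s1 s2 : region A -> A s -> A (- s2^-1) -> nonbad s -> 0 < re s ->
  0 < re s1 -> 0 < im s1 -> 0 < re s2 -> 0 < im s2 ->
  s1 ^+ 2 = (1 - s ^+ 2)^-1 -> s2 ^+ 2 = (1 - s1 ^+ 2)^-1 -> invar A shear.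
Proof.
move=> rA As As2 nb r r1 i1 r2 i2 E1 E2 U w s0 hU we As0 nb0; have [_ _ hA] := rA.
have [nb1 _ _] := third_shape nb E1; have [nb2 _ _] := third_shape nb1 E2.
have [nb3 _ _] := quarter_shape nb2.
have e1 := even_comp we (@quardN Q); have e2 := even_comp e1 (@rotdN Q).
have e3 := even_comp e2 (@rotdN Q).
rewrite (region_const rA hU e3 As0 As nb0 nb).
rewrite -(psi_third U nb r (hA _ As) r1 i1 E1 e2) -(psi_third U nb1 r1 i1 r2 i2 E2 e1).
rewrite -(psi_quarter U nb2 r2 i2 we).
exact: (region_const rA hU we As2 As0 nb3 nb0).
Qed.

(** ** Existence of shapes related by the symmetries *)

Lemma upper_region : region [set s : C | 0 < im s].
Proof. by split; [exact: upper_convex|exact: upper_open|]. Qed.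

Definition disk (s0 : C) (e : R) : set C := [set s | 0 < im s /\ nm (s0 - s) < e].

Lemma disk_region s0 e : 0 < e -> region (disk s0 e).
Proof.
move=> e0; split; last by move=> s [].
- move=> x y t [x1 x2] [y1 y2] t01; split; first exact: upper_convex.
  exact: (nm_convex e0 x2 y2 t01).
- have -> : disk s0 e = [set s | 0 < im s] `&` [set s | nm (s0 - s) < e] by [].
  by apply: openI; [exact: upper_open|exact: nm_open].
Qed.

(** This shape is an equilateral triangle, fixed by the rotation of order three. *)
Lemma third_point : exists s : C, [/\ 0 < re s, 0 < im s & Ash s = 0].
Proof.
pose p : {poly C} := 'X^2 - 'X + 1.
have pE t : p.[t] = t ^+ 2 - t + 1 by rewrite /p !hornerE expr2.
have sp : size p = 3.
  rewrite /p -addrA size_polyDl size_polyXn // (leq_ltn_trans (size_polyD _ _)) //.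
  by rewrite size_polyN size_polyX size_poly1.
have [t] : exists t, root p t by apply/closed_rootP; rewrite sp.
rewrite rootE pE => /eqP ht.
have [u [iu hu]] : exists u : C, 0 < im u /\ u ^+ 2 - u + 1 = 0.
  have h2 : (1 - t) ^+ 2 - (1 - t) + 1 = 0 by rewrite -ht; ring.
  have [it|it] := ltP 0 (im t); first by exists t.
  exists (1 - t); split=> //; rewrite imD imN im1 add0r oppr_gt0 lt_neqAle it andbT.
  apply/eqP => i0; have := congr1 re ht.
  rewrite expr2 reD reD reM reN re1 i0 mul0r subr0 re0 => E.
  have : 0 <= (re t - 1 / 2) ^+ 2 by rewrite sqr_ge0.
  rewrite expr2; lra.
have [s [Es r i]] := sqrt_upper iu; exists s; split=> //.
by rewrite /Ash -hu -Es -exprM.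
Qed.

Lemma third_pair (s0 : C) (e : R) : 0 < re s0 -> 0 < im s0 -> Ash s0 = 0 -> 0 < e ->
  invar (disk s0 e) rotd.
Proof.
move=> r0 i0 A0 e0.
have t0 : 1 - s0 ^+ 2 != 0.
  apply: contraTneq i0 => /eqP; rewrite subr_eq0 => /eqP E.
  by have := sqr_im s0; rewrite -E im1 => E2; rewrite -leNgt; nra.
have V : (1 - s0 ^+ 2)^-1 = s0 ^+ 2.
  apply: (mulfI t0); rewrite divff //; apply/eqP; rewrite -subr_eq0; apply/eqP.
  by rewrite -A0 /Ash; ring.
have cc : {for s0, continuous (fun s : C => (1 - s ^+ 2)^-1)}.
  have c1 := contB (@constC R C 1) (contX (n := 2) (@idC R)).
  by have := @at_div R C (fun=> 1) (fun s => 1 - s ^+ 2) s0 (@constC R C 1) c1 t0;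
    under eq_fun do rewrite mul1r; rewrite mul1r.
have er : 0 < e * re s0 by rewrite mulr_gt0.
have N1 := near_nm cc er.
have N2 := near_nm (@idC R s0) e0.
have N3 : \forall s \near s0, 0 < re s by exact: (near_gt0 (@re_cont R s0) r0).
have N4 : \forall s \near s0, 0 < im s by exact: (near_gt0 (@im_cont R s0) i0).
have [s [[h1 h2] [h3 h4]] nb] := cof_open cof_nonbad (nearI (nearI N1 N2) (nearI N3 N4)).
have [s1 [E r1 i1]] := sqrt_upper (third_im h3 h4).
apply: (@invar_third _ s s1) => //; first exact: disk_region.
split=> //; rewrite V -E in h1.
have F : nm (s0 ^+ 2 - s1 ^+ 2) = nm (s0 - s1) * nm (s0 + s1) by rewrite -nmM; congr nm; ring.
have := re_le_nm (s0 + s1); rewrite reD => h5.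
rewrite F in h1; rewrite ltNge; apply/negP => h6.
have := nm_ge0 (s0 - s1); nra.
Qed.

Lemma quarter_pair (e : R) : 0 < e -> invar (disk 'i e) quard.
Proof.
move=> e0.
have i0 : ('i : C) != 0 by rewrite neq0Ci.
have V : - ('i : C)^-1 = 'i.
  by apply: (mulfI i0); rewrite mulrN divff // -expr2 sqrCi.
have cc : {for ('i : C), continuous (fun s : C => - s^-1)}.
  have := @at_div R C (fun=> -1) (fun s => s) 'i (@constC R C (-1)) (@idC R) i0.
  by under eq_fun do rewrite mulN1r; rewrite mulN1r.
have N1 := near_nm cc e0; have N2 := near_nm (@idC R ('i : C)) e0.
have N4 : \forall s \near ('i : C), 0 < im s.
  by apply: (near_gt0 (@im_cont R 'i)); rewrite im_i.
have [r r0 hr] := near_ball (nearI (nearI N1 N2) N4).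
pose p : C := 'i + rc (r / 2).
have pp : nm ('i - p) < r by rewrite /p opprD addNKr nmN nm_rc ger0_norm; lra.
have rp : 0 < re p by rewrite /p reD re_i re_rc; lra.
have NO : nbhs p ([set s | nm ('i - s) < r] `&` [set s | 0 < re s]).
  apply: open_nbhs_nbhs; split; last by split.
  by apply: openI; [exact: nm_open|exact: right_open].
have [s [/hr[[h1 h2] h4] h3] nb] := cof_open cof_nonbad NO.
apply: (@invar_quarter _ s) => //; first exact: disk_region.
have s0 : s != 0 by apply: contraTneq h4 => ->; rewrite im0 ltxx.
have [kk kp kE] := im_invE s0.
split; first by rewrite imN kE opprK mulr_gt0.
by rewrite V in h1.
Qed.

(** Two successive rotations take a small [s] to a large [s2] with [(1 / s2) ^ 2] close to [- s ^ 2], so that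
    [- 1 / s2] is again close to the cusp. *)
Lemma shear_pair (e : R) : 0 < e -> invar (disk 0 e) shear.
Proof.
move=> e0.
pose m := Order.min (e / 2) (1 / 2).
have m0 : 0 < m by rewrite /m lt_min; apply/andP; split; lra.
have m1 : m <= e / 2 by rewrite /m ge_min lexx.
have m2 : m <= 1 / 2 by rewrite /m ge_min lexx orbT.
pose p : C := rc (m / 4) + 'i * rc (m / 4).
have pr : re p = m / 4 by rewrite /p !reimE; ring.
have pi : im p = m / 4 by rewrite /p !reimE; ring.
have NO : nbhs p ([set s | nm (0 - s) < m] `&` ([set s | 0 < re s] `&` [set s | 0 < im s])).
  apply: open_nbhs_nbhs; split.
    by apply: openI; [exact: nm_open|apply: openI; [exact: right_open|exact: upper_open]].
  split; last by split; rewrite /= ?pr ?pi; lra.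
  rewrite /= sub0r nmN; apply: le_lt_trans (nmD _ _) _.
  have ni : nm ('i : C) = 1 by rewrite /nm normCi re1.
  by rewrite nmM ni mul1r nm_rc ger0_norm; lra.
have [s [h1 [h2 h3]] nb] := cof_open cof_nonbad NO.
rewrite /= sub0r nmN in h1.
have [s1 [E1 r1 i1]] := sqrt_upper (third_im h2 h3).
have [s2 [E2 r2 i2]] := sqrt_upper (third_im r1 i1).
have s0 : s != 0 by apply: contraTneq h3 => ->; rewrite im0 ltxx.
have s20 : s2 != 0 by apply: contraTneq i2 => ->; rewrite im0 ltxx.
apply: (@invar_shear _ s s1 s2) => //; first exact: disk_region.
- by split=> //; rewrite sub0r nmN; lra.
have [kk kp kE] := im_invE s20.
split; first by rewrite imN kE opprK mulr_gt0.
rewrite sub0r nmN nmN.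
have [_ D0 _ _ _] := nb; move: D0; rewrite mulf_eq0 negb_or => /andP[t0 t1].
have t1' : 1 - s ^+ 2 != 0 by rewrite -oppr_eq0 opprB.
have E : s2^-1 ^+ 2 * (1 - s ^+ 2) = - s ^+ 2.
  have -> : s2^-1 ^+ 2 = 1 - s1 ^+ 2 by rewrite exprVn E2 invrK.
  by rewrite E1; field.
have := congr1 nm E; rewrite nmN !expr2 !nmM => F.
have G1 : nm (1 : C) <= nm (1 - s ^+ 2) + nm (s ^+ 2).
  by have := nmD (1 - s ^+ 2) (s ^+ 2); rewrite subrK.
have n1 : nm (1 : C) = 1 by rewrite -[1 in LHS]rc1 nm_rc normr1.
rewrite n1 expr2 nmM in G1.
have p1 := nm_ge0 s; have p2 := nm_ge0 s2^-1; have p3 := nm_ge0 (1 - s * s).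
have b1 : nm s * nm s <= 1 / 4 by nra.
have b2 : 3 / 4 <= nm (1 - s * s) by lra.
rewrite ltNge; apply/negP => b3.
have b4 : 2 * nm s < e by lra.
have b5 : 4 * (nm s * nm s) < nm s2^-1 * nm s2^-1 by nra.
have b6 : 0 <= nm s2^-1 * nm s2^-1 by rewrite mulr_ge0.
by nra.
Qed.

(** ** The three kinds of special fibres *)

Definition same (d0 d : Q * Q) : bool := (d == d0) || (d == - d0).

Lemma sameP d0 d : reflect (pm d0 d) (same d0 d).
Proof. by apply: (iffP orP) => -[/eqP|/eqP]; [left|right|move=> ->; left|move=> ->; right]. Qed.

Definition isd (d0 d : Q * Q) : nat := if same d0 d then 1 else 0.

Lemma isd_even d0 : even (isd d0).
Proof. by move=> d; rewrite /isd /same eqr_oppLR eqr_opp orbC. Qed.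

Lemma same_pm d0 d d' : same d0 d -> same d0 d' -> pm d d'.
Proof. by move=> /sameP h /sameP h'; exact: pm_trans (pm_sym h) h'. Qed.

Lemma eveq_iter f i : eveq f -> eveq (iter i f).
Proof. by move=> fe; elim: i => // i IH d; rewrite !iterS IH fe. Qed.

Variable genp : Q * Q -> Prop.
Hypothesis allgen : forall b dl s, lab b dl s -> im s != 0 -> genp (dat (cm b dl s)).

Lemma gen_at s b : nonbad s -> 0 < im s -> root (fs s) b -> genp (dat_at s b).
Proof.
move=> nb i rb; have [Pb qb] := nonbad_root nb rb; have [A0 _ B0 _ _] := nb.
by apply: allgen (fs_lab A0 B0 Pb qb rb) (lt0r_neq0 i).
Qed.

(** A cluster contains some pair [d0], hence by invariance the whole orbit of [d0] under [f]. The orbit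
    has at least [m] elements that are distinct up to sign, of weight [v] each. *)
Lemma special_count (s0 u : C) (h : {poly C}) f (n : nat) w' : fs s0 = u *: h -> u != 0 ->
  size h = D.+1 -> 0 <= im s0 -> (forall e, 0 < e -> invar (disk s0 e) f) -> eveq f ->
  (forall d0, genp d0 -> exists m v, (n <= m * v)%N /\
     forall d, genp d -> (\sum_(i <- iota 0 m) (if same d0 (iter i f d) then v else 0) <= w' d)%N) ->
  exists s, [/\ nonbad s, 0 < im s & (n * size (undup (proots h)) <= psi xpredT w' s)%N].
Proof.
move=> F0 u0 sh i0 finv fe bound.
have l0 : (fs s0)`_D != 0.
  rewrite F0 coefZ mulf_neq0 //.
  by have : lead_coef h != 0; [rewrite lead_coef_eq0 -size_poly_gt0 sh|rewrite /lead_coef sh].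
have [r rp [e e0 [c1 c2 c3]]] := clusters l0.
have rE x : root (fs s0) x = root h x by rewrite F0 rootZ.
have h0 : h != 0 by rewrite -size_poly_gt0 sh.
have inv := finv e e0.
have [s [hs1 hs2] nb] : exists2 s, disk s0 e s & nonbad s.
  have NO : nbhs (s0 + 'i * rc (e / 2)) (disk s0 e).
    apply: open_nbhs_nbhs; split; first by have [] := disk_region s0 e0.
    split; first by rewrite !reimE; lra.
    rewrite opprD addNKr nmN nmM nm_rc ger0_norm; last by lra.
    by rewrite (_ : nm 'i = 1) ?mul1r; [lra|rewrite /nm normCi re1].
  by have [s h1 h2] := cof_open cof_nonbad NO; exists s.
exists s; split=> //; have f0 := nonbad_fs0 nb.
apply: leq_trans (@cluster_sum (undup (proots h)) r w' s (undup_uniq _) _); last first.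
  by move=> x y b; rewrite !mem_undup !mem_proots // -!rE; exact: c1.
have -> : (n * size (undup (proots h)) = \sum_(x <- undup (proots h)) n)%N.
  by rewrite big_const_seq count_predT iter_addn_0.
rewrite !big_seq; apply: leq_sum => x.
rewrite mem_undup mem_proots // -rE => rx.
have [b rb ub] := c3 s hs2 x rx.
have oU : okU (disk s0 e) (around r x) by move=> t [_ ht] nt b' rb'; exact: (c2 t ht x rx).
pose d0 := dat_at s b.
have [m [v [nmv hv]]] := bound d0 (gen_at nb hs1 rb).
pose w (i : nat) d := isd d0 (iter i f d).
have we i : even (w i) := even_comp (isd_even d0) (eveq_iter i fe).
have ge1 i : (0 < psi (around r x) (w i) s)%N.
  elim: i => [|i IH]; first by apply: (psi_ge1 f0 rb ub); rewrite /w /isd /same eqxx.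
  have -> : w i.+1 = (fun d => w i (f d)) by apply/funext => d; rewrite /w iterSr.
  by rewrite (inv _ _ _ oU (we i) (conj hs1 hs2) nb).
apply: leq_trans nmv _.
have -> : (m * v = \sum_(i <- iota 0 m) v)%N.
  by rewrite big_const_seq count_predT size_iota iter_addn_0 mulnC.
apply: leq_trans (_ : (\sum_(i <- iota 0 m) psi (around r x)
    (fun d => if same d0 (iter i f d) then v else 0) s <= _)%N); last first.
  by apply: psi_le => // b' rb' _; apply: hv; exact: (gen_at nb hs1 rb').
apply: leq_sum => i _; have := ge1 i.
have -> : psi (around r x) (fun d => if same d0 (iter i f d) then v else 0%N) s =
    (v * psi (around r x) (w i) s)%N.
  rewrite /psi /sumroots big_distrr /=; apply: eq_bigr => b' _.
  by case: ifP => _; rewrite ?muln0 // /w /isd; case: ifP => _; rewrite ?muln0 ?muln1.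
by move=> h1; rewrite leq_pmulr.
Qed.

Definition nofix (f : Q * Q -> Q * Q) := forall d, genp d -> ~ pm d (f d).

Lemma rotd3 (d : Q * Q) : rotd (rotd (rotd d)) = d.
Proof.
case: d => x y; rewrite /rotd /=.
have E : - x - (y - x) = - y by rewrite opprB addKr.
by rewrite E !opprK opprB subrK.
Qed.

Lemma third_count : nofix rotd ->
  exists s, [/\ nonbad s, 0 < im s & (3 * size (undup (proots a)) <= psi xpredT (fun=> 1%N) s)%N].
Proof.
move=> nf; have [s0 [r0 i0 A0]] := third_point.
apply: (@special_count s0 (Jd s0) a rotd).
- by rewrite /fs /Jn A0 expr0n mulr0 scale0r subr0.
- rewrite /Jd mulf_neq0 ?pnatr_eq0 // expf_neq0 //.
  have -> : s0 ^+ 2 * (s0 ^+ 2 - 1) = Ash s0 - 1 by rewrite /Ash; ring.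
  by rewrite A0 sub0r oppr_eq0 oner_eq0.
- exact: sa.
- exact: ltW.
- by move=> e e0; exact: third_pair.
- exact: rotdN.
move=> d0 g0; exists 3, 1%N; split=> // d gd; apply: sum_excl; first exact: iota_uniq.
have h01 : ~ pm d (rotd d) by exact: nf.
have h12 : ~ pm (rotd d) (rotd (rotd d)).
  by move=> /pm_rotd/pm_rotd; rewrite !rotd3.
have h02 : ~ pm d (rotd (rotd d)).
  by move=> /pm_rotd; rewrite rotd3 => /pm_sym.
move=> i j; rewrite !mem_iota /=.
by case: i => [|[|[|//]]] _; case: j => [|[|[|//]]] _ //= si sj; have E := same_pm si sj;
  have E' := pm_sym E.
Qed.

Lemma quarter_count : size (a - c) = D.+1 -> nofix quard ->
  exists s, [/\ nonbad s, 0 < im s & (2 * size (undup (proots (a - c)%R)) <= psi xpredT (fun=> 1%N) s)%N].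
Proof.
move=> se nf.
have i2 : ('i : C) ^+ 2 = -1 by rewrite sqrCi.
have i4 : ('i : C) ^+ 4 = 1 by rewrite -[4%N]/(2 * 2)%N exprM i2 sqrrN expr1n.
have JE : Jn ('i : C) = Jd 'i by rewrite /Jn /Jd /Ash i4 i2; ring.
apply: (@special_count 'i (Jd 'i) (a - c) quard).
- by rewrite /fs JE scalerBr.
- by rewrite /Jd i2 (_ : _ * _ = 108) ?pnatr_eq0 //; ring.
- exact: se.
- by rewrite im_i ler01.
- by move=> e e0; exact: quarter_pair.
- exact: quardN.
move=> d0 g0; exists 2, 1%N; split=> // d gd; apply: sum_excl; first exact: iota_uniq.
have h01 : ~ pm d (quard d) by exact: nf.
move=> i j; rewrite !mem_iota /=.
by case: i => [|[|//]] _; case: j => [|[|//]] _ //= si sj; have E := same_pm si sj;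
  have E' := pm_sym E.
Qed.

Variables (n : nat) (wt : Q -> nat).
Hypothesis wtN : forall y, wt (- y) = wt y.
Hypothesis cusp : forall y, exists2 m, (n <= m * wt y)%N & forall j, (0 < j < m)%N -> y *+ j != 0.
Hypothesis no2 : forall y : Q, y + y = 0 -> y = 0.

Lemma shearN : eveq shear.
Proof. by move=> d; rewrite /shear !rotdN quardN. Qed.

Lemma shearE (d : Q * Q) : shear d = (d.2 - d.1, - d.2).
Proof. by case: d => x y; rewrite /shear /quard /rotd /= opprK opprB addKr. Qed.

Lemma shear_iter i (d : Q * Q) : pm (d.1 - d.2 *+ i, d.2) (iter i shear d).
Proof.
have E (j : nat) (x y : Q) : shear (x - y *+ j, y) = - (x - y *+ j.+1, y).
  rewrite shearE /=; apply: (congr1 (fun z => (z, - y))).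
  by rewrite !opprB mulrS addrA.
elim: i => [|i IH]; first by left; rewrite mulr0n subr0; case: d.
rewrite iterS; case: IH => ->; [right|left]; first exact: E.
by rewrite shearN E opprK.
Qed.

(** The orbit of [(x, y)] under the shear consists of the [(x - i y, y)]; its length is
    bounded below by [cusp], as a coincidence up to sign would make [y] an element of order two. *)
Lemma cusp_count :
  exists s, [/\ nonbad s, 0 < im s & (n * size (undup (proots c)) <= psi xpredT (fun d => wt d.2) s)%N].
Proof.
apply: (@special_count 0 (- 4) c shear).
- have A0 : Ash (0 : C) = 1 by rewrite /Ash !expr0n /= subr0 add0r.
  have J0 : Jd (0 : C) = 0 by rewrite /Jd expr0n /= mul0r expr0n /= mulr0.
  by rewrite /fs J0 /Jn A0 expr1n mulr1 scale0r sub0r scaleNr.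
- by rewrite oppr_eq0 pnatr_eq0.
- exact: sc.
- by rewrite im0.
- by move=> e e0; exact: shear_pair.
- exact: shearN.
move=> [x0 y0] g0; have [m hm hj] := cusp y0; exists m, (wt y0); split=> // -[x y] gd.
have key i : same (x0, y0) (iter i shear (x, y)) -> pm (x0, y0) (x - y *+ i, y).
  by move=> /sameP h; apply: pm_trans h (pm_sym (shear_iter i (x, y))).
apply: leq_trans (_ : (_ <= \sum_(i <- iota 0 m) (if same (x0, y0) (iter i shear (x, y))
    then wt y else 0))%N) _.
  apply: leq_sum => i _; case: ifP => // /key[[_ ->]|[_ ->]] //=; by rewrite wtN.
apply: sum_excl; first exact: iota_uniq.
move=> i j; rewrite !mem_iota !add0n => /andP[_ im'] /andP[_ jm].
wlog ij : i j im' jm / (i <= j)%N.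
  by move=> H; case: (leqP i j) => [|/ltnW] h si sj; [exact: H|apply/esym; exact: H].
move=> /key h1 /key h2; apply/eqP; rewrite eqn_leq ij leqNgt; apply/negP => lij.
have h3 := pm_trans (pm_sym h1) h2.
have yy : y0 = y \/ y0 = - y by case: h1 => -[_ ->]; [left|right; rewrite opprK].
have D0 : y *+ (j - i) = 0.
  case: h3 => E; have E1 := congr1 fst E; have E2 := congr1 snd E; rewrite /= in E1 E2.
    have : x - y *+ j = x - y *+ i by rewrite E1.
    by move=> /addrI/oppr_inj E3; rewrite mulrnBr ?E3 ?subrr // ltnW.
  have y00 : y = 0 by apply: no2; rewrite {1}E2 addNr.
  by rewrite y00 mul0rn.
have := hj (j - i)%N; rewrite subn_gt0 lij (leq_ltn_trans (leq_subr _ _) jm) => /(_ isT).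
by case: yy => ->; rewrite ?mulNrn D0 ?oppr0 eqxx.
Qed.

(** ** Conclusion *)

(** A word stands for an element of the modular group. *)
Definition act (l : seq bool) (d : Q * Q) : Q * Q :=
  foldr (fun (t : bool) d => if t then rotd d else quard d) d l.

(** The symmetries [rotd] and [quard] are available at their fixed points, and [psi] is constant. *)
Lemma act_psi l w s : even w -> nonbad s -> 0 < im s ->
  psi xpredT (fun d => w (act l d)) s = psi xpredT w s.
Proof.
move=> we nb i.
have oU : okU [set s : C | 0 < im s] xpredT by move=> u _ _ b _; exact: near_all.
have sub (s0 : C) e : disk s0 e `<=` [set s : C | 0 < im s] by move=> u [].
have inv f s0 : invar (disk s0 1) f -> eveq f -> (exists2 u, disk s0 1 u & nonbad u) ->
    forall w s, even w -> nonbad s -> 0 < im s -> psi xpredT (fun d => w (f d)) s = psi xpredT w s.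
  move=> hf fe [u du nu] w1 s1 we1 nb1 i1.
  have oU' : okU (disk s0 1) xpredT by move=> u' _ _ b _; exact: near_all.
  rewrite (region_const upper_region oU (even_comp we1 fe) i1 (sub _ _ _ du) nb1 nu).
  by rewrite (hf _ _ _ oU' we1 du nu); exact: (region_const upper_region oU we1 (sub _ _ _ du) i1 nu nb1).
have ex (s0 : C) : 0 < im s0 -> exists2 u, disk s0 1 u & nonbad u.
  move=> i0; have NO : nbhs s0 (disk s0 1).
    apply: open_nbhs_nbhs; split; first by have [] := disk_region s0 (@ltr01 R).
    have n0 : nm (0 : C) = 0 by apply/eqP; rewrite nm_eq0.
    by split=> //; rewrite subrr n0.
  by have [u h1 h2] := cof_open cof_nonbad NO; exists u.
have [s0 [r0 i0 A0]] := third_point.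
have i1 : 0 < im ('i : C) by rewrite im_i.
have iR := inv _ _ (third_pair r0 i0 A0 ltr01) (@rotdN Q) (ex _ i0).
have iS := inv _ _ (quarter_pair ltr01) (@quardN Q) (ex _ i1).
elim: l w we => // -[] l IH w we /=.
  by rewrite (IH (fun d => w (rotd d))) ?iR //; exact: even_comp we (@rotdN Q).
by rewrite (IH (fun d => w (quard d))) ?iS //; exact: even_comp we (@quardN Q).
Qed.

(** By invariance the weighted count is the average over the words, at most [n D / 6]; the three special
    counts add up to [D / 3 + D / 2 + D / 6 = D], less than the bound of Mason and Stothers. *)
Lemma contradiction (words : seq (seq bool)) : (0 < D)%N -> size (a - c) = D.+1 ->
  (0 < n)%N -> (0 < size words)%N -> nofix rotd -> nofix quard ->
  (forall d, genp d -> (6 * \sum_(l <- words) wt (act l d).2 <= n * size words)%N) -> False.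
Proof.
move=> D0 se n0 w0 nR nS ineq.
have [s1 [nb1 i1 h1]] := third_count nR.
have [s2 [nb2 i2 h2]] := quarter_count se nS.
have [s [nb i h3]] := cusp_count.
rewrite psi_total // in h1; rewrite psi_total // in h2.
have m := mason D0 sa sc se cop.
have we : even (fun d => wt d.2) by move=> d /=; rewrite wtN.
set X := psi xpredT (fun d => wt d.2) s in h3.
have f0 := nonbad_fs0 nb.
have : (6 * (size words * X) <= n * size words * D)%N.
  have -> : (size words * X = \sum_(l <- words) psi xpredT (fun d => wt (act l d).2) s)%N.
    under eq_bigr do rewrite (act_psi _ we nb i).
    by rewrite big_const_seq count_predT iter_addn_0 mulnC.
  rewrite -(psi_total nb) /psi /sumroots exchange_big /= !big_distrr /= !big_seq.
  apply: leq_sum => b; rewrite mem_proots // => rb; rewrite muln1.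
  exact: ineq (gen_at nb i rb).
rewrite -mulnA (mulnCA n) (mulnCA 6) leq_pmul2l // => h4.
have h5 : (n * (6 * size (undup (proots c))) <= n * D)%N.
  by apply: leq_trans h4; rewrite mulnCA leq_pmul2l.
rewrite leq_pmul2l // in h5.
move: (size (undup (proots a))) (size (undup (proots c))) (size (undup (proots (a - c)%R))) h1 h2 h5 m D0.
clear; move=> x y z; lia.
Qed.

End Count.

(** * Roots that are distinguished by the covering *)

Section At.
Context {R : realType} {T : topologicalType}.
Local Notation C := R[i].
Implicit Types (f h : T -> C) (x : T).

Lemma atD f h x : {for x, continuous f} -> {for x, continuous h} ->
  {for x, continuous (fun y => f y + h y)}.
Proof. by move=> fc hc; exact: cvgD fc hc. Qed.

Lemma atN f x : {for x, continuous f} -> {for x, continuous (fun y => - f y)}.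
Proof. by move=> fc; exact: cvgN fc. Qed.

Lemma atM f h x : {for x, continuous f} -> {for x, continuous h} ->
  {for x, continuous (fun y => f y * h y)}.
Proof. by move=> fc hc; exact: cvgM fc hc. Qed.

Lemma at_neq0 f x : {for x, continuous f} -> f x != 0 -> \forall y \near x, f y != 0.
Proof. by move=> fc fx; apply: (cvgr_neq0 _ fc). Qed.

Lemma at_comp (U V : topologicalType) (k : U -> V) (l : T -> U) x : {for x, continuous l} ->
  {for l x, continuous k} -> {for x, continuous (fun y => k (l y))}.
Proof. by move=> lc kc; apply: continuous_comp. Qed.

End At.

Section Simple.
Context {R : realType}.
Local Notation C := R[i].
Variables (P q : {poly C}).
Local Notation roots3 := (roots3 P q).
Local Notation cub := (cub P q).

Lemma vieta (b e1 e2 e3 : C) : roots3 b e1 e2 e3 ->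
  [/\ e3 = - (e1 + e2), P.[b] = e1 * e2 + e1 * e3 + e2 * e3 & q.[b] = - (e1 * e2 * e3)].
Proof.
move=> r; have := r 0; have := r 1; have := r (-1); rewrite /cub /=.
move: (P.[b]) (q.[b]) => p c h1 h2 h3.
have n2 : (2 : C) != 0 by rewrite pnatr_eq0.
have E0 : 0 ^+ 3 + p * 0 + c = c by ring.
have cE : c = - (e1 * e2 * e3) by rewrite -E0 h3; ring.
have sE : e3 = - (e1 + e2).
  apply: (mulfI n2).
  have -> : 2 * e3 = ((1 ^+ 3 + p * 1 + c) + ((-1) ^+ 3 + p * (-1) + c)) - 2 * c + 2 * e3 by ring.
  by rewrite h1 h2 cE; ring.
split=> //; apply: (mulfI n2).
have -> : 2 * p = (1 ^+ 3 + p * 1 + c) - ((-1) ^+ 3 + p * (-1) + c) - 2 by ring.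
by rewrite h1 h2; ring.
Qed.

Lemma simple_root (b e1 e2 e3 : C) : roots3 b e1 e2 e3 -> e1 != e2 -> e1 != e3 ->
  3 * e1 ^+ 2 + P.[b] != 0.
Proof.
move=> /vieta[s p _] n12 n13.
have -> : 3 * e1 ^+ 2 + P.[b] = (e1 - e2) * (e1 - e3) by rewrite p s; ring.
by rewrite mulf_neq0 // subr_eq0.
Qed.

Definition dist3 (e1 e2 e3 : C) := [/\ e1 != e2, e1 != e3 & e2 != e3].

(** If the roots are not collinear, [center_valid] provides a centre; otherwise one off the line works. *)
Lemma valid_exists (e1 e2 e3 : C) : dist3 e1 e2 e3 -> exists z, valid z e1 e2 e3.
Proof.
move=> [n12 n13 n23].
have d0 : e2 - e1 != 0 by rewrite subr_eq0 eq_sym.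
pose t := (e3 - e1) / (e2 - e1).
have E3 : e3 = pt e1 e2 t by rewrite /pt /t divfK // addrC subrK.
pose s : C := sqrtC t; have s2 : s ^+ 2 = t by exact: sqrtCK.
have [i0|i0] := eqVneq (im s) 0; last first.
  by exists (pt e1 e2 s); rewrite E3 -s2; exact: center_valid.
(* three collinear points *)
have tE : t = rc (re s ^+ 2).
  by rewrite -s2 [s in LHS]reimK i0 rc0 mulr0 addr0 !expr2 rcM.
move: tE; set r := re s ^+ 2; clearbody r => tE.
have r0 : r != 0.
  apply: contra_neq n13 => r0; by rewrite E3 tE r0 rc0 pt0.
have r1 : 1 - r != 0.
  rewrite subr_eq0; apply: contra_neq n23 => r1; by rewrite E3 tE -r1 rc1 pt1.
have i1 : ('i : C) != 0 by rewrite neq0Ci.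
have k1 : (1 - 'i : C) != 0.
  by apply/eqP => /(congr1 im); rewrite imD imN im1 im_i im0; lra.
exists (pt e1 e2 'i).
have D1 : e1 - pt e1 e2 'i = - 'i * (e2 - e1) by rewrite /pt; ring.
have D2 : e2 - pt e1 e2 'i = (1 - 'i) * (e2 - e1) by rewrite /pt; ring.
have D3 : e3 - pt e1 e2 'i = (rc r - 'i) * (e2 - e1) by rewrite E3 tE /pt; ring.
have k2 : (rc r - 'i : C) != 0.
  by apply/eqP => /(congr1 im); rewrite imD imN im_rc im_i im0; lra.
have ne (x y : C) : y - x != 0 -> x != y by rewrite subr_eq0 eq_sym.
have ii : ('i : C) * 'i = -1 by rewrite -expr2 sqrCi.
split; [apply: ne|apply: ne|apply: ne|]; rewrite ?D1 ?D2 ?D3 ?mulf_neq0 ?oppr_eq0 //.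
split; apply: nonray_im.
- have -> : (1 - 'i) * (e2 - e1) / (- 'i * (e2 - e1)) = 1 + 'i.
    apply: (canLR (mulfK _)); first by rewrite mulf_neq0 ?oppr_eq0.
    have -> : (1 + 'i) * (- 'i * (e2 - e1)) = (- 'i - 'i * 'i) * (e2 - e1) by ring.
    by rewrite ii; ring.
  by rewrite imD im1 im_i add0r oner_eq0.
- have -> : (rc r - 'i) * (e2 - e1) / (- 'i * (e2 - e1)) = 1 + 'i * rc r.
    apply: (canLR (mulfK _)); first by rewrite mulf_neq0 ?oppr_eq0.
    have -> : (1 + 'i * rc r) * (- 'i * (e2 - e1)) = (- 'i - ('i * 'i) * rc r) * (e2 - e1) by ring.
    by rewrite ii; ring.
  by rewrite imD im1 imM im_i re_i re_rc im_rc mul0r mul1r !add0r.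
- have n2 : (2 : C) != 0 by rewrite pnatr_eq0.
  have -> : (rc r - 'i) * (e2 - e1) / ((1 - 'i) * (e2 - e1)) = 2^-1 * ((1 + rc r) - 'i * (1 - rc r)).
    apply: (canLR (mulfK _)); first by rewrite mulf_neq0.
    have -> : 2^-1 * ((1 + rc r) - 'i * (1 - rc r)) * ((1 - 'i) * (e2 - e1)) =
      2^-1 * ((1 + rc r) - 2 * 'i + ('i * 'i) * (1 - rc r)) * (e2 - e1) by ring.
    rewrite ii (_ : 1 + rc r - 2 * 'i + -1 * (1 - rc r) = 2 * (rc r - 'i)); last by ring.
    by rewrite mulKf.
  have h2 : (2^-1 : C) = rc 2^-1 by rewrite /rc fmorphV rmorph_nat.
  rewrite h2 !reimE; apply/eqP; move/eqP: r1; lra.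
Qed.

(** ** Continuous roots are polynomials *)

Lemma interpolate (l : seq C) (f : C -> C) : uniq l ->
  exists E : {poly C}, (size E <= size l)%N /\ forall b, b \in l -> E.[b] = f b.
Proof.
elim: l => [|x l IH] /=; first by exists 0; rewrite size_poly0.
move=> /andP[xl ul]; have [E [sE hE]] := IH ul.
pose La := \prod_(z <- l) ('X - z%:P).
have L0 : La.[x] != 0.
  by rewrite -rootE root_prod_XsubC.
exists (E + ((f x - E.[x]) / La.[x]) *: La); split.
  rewrite (leq_trans (size_polyD _ _)) // geq_max (leq_trans sE) //=.
  by rewrite (leq_trans (size_scale_leq _ _)) // size_prod_XsubC.
move=> b; rewrite hornerD hornerZ inE => /orP[/eqP->|bl].
  by rewrite divfK // addrC subrK.
have -> : La.[b] = 0 by apply/eqP; rewrite -rootE root_prod_XsubC.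
by rewrite mulr0 addr0 hE.
Qed.

Lemma many_points (Ls : seq C) n : exists l : seq C, [/\ uniq l, size l = n & forall b, b \in l -> b \notin Ls].
Proof.
elim: n => [|n [l [ul sl hl]]]; first by exists [::].
have [x _ /andP[xl xL]] : exists2 x : C, True & (x \notin l) && (x \notin Ls).
  have c : cof (fun x : C => (x \notin l) && (x \notin Ls)).
    by exists (l ++ Ls) => x; rewrite mem_cat negb_or.
  have N : nbhs (0 : C) (fun=> True) by exact: (@near_all C 0 (fun=> True) (fun=> I)).
  by have [x _ h] := cof_open c N; exists x.
exists (x :: l); split=> /=; rewrite ?xl ?sl //.
by move=> b; rewrite inE => /orP[/eqP->|/hl].
Qed.

Lemma eq_cof_poly (p : {poly C}) (Ls : seq C) : (forall b, b \notin Ls -> p.[b] = 0) -> p = 0.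
Proof.
move=> h; apply/eqP; apply: contraT => p0.
have c := cof_poly p0; have [L hL] := c.
have cc : cof (fun b : C => p.[b] != 0 /\ b \notin Ls) by apply: cof_and c _; exists Ls.
have N : nbhs (0 : C) (fun=> True) by exact: (@near_all C 0 (fun=> True) (fun=> I)).
by have [b _ [h1 h2]] := cof_open cc N; move: h1; rewrite h ?eqxx.
Qed.

Variables (d : nat) (Ls : seq C) (e : C -> C).
Hypothesis (sP : (size P <= (2 * d).+1)%N) (sq : (size q <= (3 * d).+1)%N).
Hypothesis he : forall b : C, b \notin Ls -> exists e2 e3, roots3 b (e b) e2 e3 /\ dist3 (e b) e2 e3.
Hypothesis ec : forall b : C, b \notin Ls -> {for b, continuous e}.

Definition cubp (E : {poly C}) : {poly C} := E ^+ 3 + P * E + q.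

Lemma cubpE E b : (cubp E).[b] = cub (b, E.[b]).
Proof. by rewrite /cubp /cub /= !(hornerD, hornerM, horner_exp). Qed.

Lemma e_root b : b \notin Ls -> cub (b, e b) = 0.
Proof. by move=> /he[e2 [e3 [r _]]]; rewrite (r (e b)) subrr !mul0r. Qed.

Lemma poly_root_size E : cubp E = 0 -> (size E <= d.+1)%N.
Proof.
move=> E0; rewrite leqNgt; apply/negP => sE.
have Ep : E != 0 by rewrite -size_poly_gt0 (leq_ltn_trans _ sE).
have : E ^+ 3 = - (P * E + q) by apply/eqP; rewrite -subr_eq0 opprK addrA; apply/eqP; exact: E0.
have s3 : size (E ^+ 3) = ((size E).-1 * 3).+1.
  by rewrite -size_exp prednK // size_poly_gt0 expf_neq0.
move=> /(congr1 (fun p : {poly C} => size p)); rewrite size_polyN s3; apply/eqP.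
rewrite gtn_eqF // ltnS (leq_trans (size_polyD _ _)) // geq_max.
have s1 : (0 < size E)%N by rewrite size_poly_gt0.
have key1 (n : nat) : (d.+1 < n)%N -> ((3 * d).+1 <= n.-1 * 3)%N by clear; lia.
have key2 (m n : nat) : (m <= (2 * d).+1)%N -> (d.+1 < n)%N -> ((m + n).-1 <= n.-1 * 3)%N by clear; lia.
by rewrite (leq_trans (size_polyMleq _ _)) ?key2 // (leq_trans sq) // key1.
Qed.

(** Let [E] interpolate [e] at [d + 1] points and let [La] vanish there. For [u != 0] the points where
    [E + La / u] meets the curve are the [d + 1] points and the [2 d + 2] roots of [K u]. The number of
    these roots on the branch [e] does not depend on [u], and it is zero for [u = 0], since
    [(e - E) / La] is bounded near the interpolation points. Hence [(e - E) / La] takes only exceptional values,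
    finitely many, and [e] is a combination of [E] and [La]. *)
Theorem liouville : exists E : {poly C}, [/\ (size E <= d.+1)%N, cubp E = 0 & 3%:P * E ^+ 2 + P != 0].
Proof.
have [l [ul sl hl]] := many_points Ls d.+1.
have [E [sE hE]] := interpolate e ul; rewrite sl in sE.
pose La := \prod_(z <- l) ('X - z%:P).
have sLa : size La = d.+2 by rewrite /La size_prod_XsubC sl.
have mLa : La \is monic by exact: monic_prod_XsubC.
have rLa b : (La.[b] == 0) = (b \in l) by rewrite -rootE root_prod_XsubC.
have [k0 k0E] : exists k0, cubp E = k0 * La.
  apply/dvdpP; apply: uniq_roots_dvdp; last by rewrite uniq_rootsE.
  by apply/allP => b bl; rewrite rootE cubpE hE // e_root ?hl.
have sk : (size k0 <= (2 * d).+1)%N.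
  have [->|k00] := eqVneq k0 0; first by rewrite size_poly0.
  have : (size (cubp E) <= (3 * d).+1)%N.
    rewrite /cubp (leq_trans (size_polyD _ _)) // geq_max sq andbT.
    rewrite (leq_trans (size_polyD _ _)) // geq_max; apply/andP; split.
      rewrite (leq_trans (size_poly_exp_leq _ _)) //.
      by move: sE; case: (size E) => [|n] /=; clear; lia.
    by rewrite (leq_trans (size_polyMleq _ _)) //; move: sE sP; clear; lia.
  have key (n : nat) : ((n + d.+2).-1 <= (3 * d).+1)%N -> (n <= (2 * d).+1)%N by clear; lia.
  by rewrite k0E size_Mmonic // sLa; exact: key.
pose K (u : C) : {poly C} := La ^+ 2 + (3 * u) *: (E * La) + u ^+ 2 *: (3%:P * E ^+ 2 + P) + u ^+ 3 *: k0.
have KE u b : (K u).[b] = La.[b] ^+ 2 + 3 * u * (E.[b] * La.[b]) + u ^+ 2 * (3 * E.[b] ^+ 2 + P.[b])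
    + u ^+ 3 * k0.[b].
  by rewrite /K !(hornerD, hornerZ, hornerM, horner_exp, hornerC).
have kb b : k0.[b] * La.[b] = E.[b] ^+ 3 + P.[b] * E.[b] + q.[b].
  by rewrite -hornerM -k0E cubpE.
have cubK u b : u != 0 -> cub (b, E.[b] + La.[b] / u) = La.[b] / u ^+ 3 * (K u).[b].
  move=> u0; rewrite KE /cub /=.
  have -> : q.[b] = k0.[b] * La.[b] - E.[b] ^+ 3 - P.[b] * E.[b] by rewrite kb; ring.
  by field.
have sK2 : size (La ^+ 2) = (2 * d).+3.
  rewrite expr2 size_Mmonic ?monic_neq0 // sLa; clear; lia.
have sKr u : (size ((3 * u) *: (E * La) + u ^+ 2 *: (3%:P * E ^+ 2 + P) + u ^+ 3 *: k0)%R < (2 * d).+3)%N.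
  rewrite ltnS (leq_trans (size_polyD _ _)) // geq_max; apply/andP; split; last first.
    by rewrite (leq_trans (size_scale_leq _ _)) // (leq_trans sk).
  rewrite (leq_trans (size_polyD _ _)) // geq_max; apply/andP; split.
    rewrite (leq_trans (size_scale_leq _ _)) // (leq_trans (size_polyMleq _ _)) // sLa.
    by move: sE; clear; lia.
  rewrite (leq_trans (size_scale_leq _ _)) // (leq_trans (size_polyD _ _)) // geq_max (leq_trans sP) // andbT.
  rewrite -alg_polyC -scalerAl mul1r (leq_trans (size_scale_leq _ _)) // (leq_trans (size_poly_exp_leq _ _)) //.
  by move: sE; case: (size E) => [|n] /=; clear; lia.
have sK u : size (K u) = (2 * d).+3.
  by rewrite /K -!addrA size_polyDl sK2 // addrA sKr.
pose good u := forall x, x \in Ls -> (K u).[x] != 0.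
have LaLs x : x \in Ls -> La.[x] != 0.
  by move=> xL; rewrite rLa; apply/negP => /hl; rewrite xL.
have good0 : good 0.
  by move=> x xL; rewrite KE mulr0 !expr0n /= !mul0r !addr0 expf_neq0 // LaLs.
have cgood : cof good.
  have H (x : C) : x \in Ls -> cof (fun u => (K u).[x] != 0); last by apply: cof_all => x; exact: H.
  move=> xL.
  pose p : {poly C} := (La.[x] ^+ 2)%:P + 3%:P * 'X * (E.[x] * La.[x])%:P +
    'X^2 * (3 * E.[x] ^+ 2 + P.[x])%:P + 'X^3 * k0.[x]%:P.
  have pE u : p.[u] = (K u).[x] by rewrite KE /p !(hornerD, hornerM, hornerC, hornerX, hornerXn).
  have p0 : p != 0 by apply: (@neq_poly _ _ 0); rewrite pE good0.
  by apply: cofS (cof_poly p0) => u; rewrite pE.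
pose on u b := [/\ b \notin Ls, u != 0 & u * (e b - E.[b]) = La.[b]].
pose W u b : nat := if `[< on u b >] then 1%N else 0%N.
have Kc i : continuous (fun u => (K u)`_i).
  have -> : (fun u => (K u)`_i) = (fun u => (La ^+ 2)`_i + 3 * u * (E * La)`_i +
      u ^+ 2 * (3%:P * E ^+ 2 + P)`_i + u ^+ 3 * k0`_i).
    by apply/funext => u; rewrite /K !(coefD, coefZ).
  have kc c := @constC R C c; have ic := @idC R.
  exact: (contD (contD (contD (kc _) (contM (contM (kc 3) ic) (kc _)))
    (contM (contX (n := 2) ic) (kc _))) (contM (contX (n := 3) ic) (kc _))).
have lc u0 : good u0 -> \forall u \near u0, sumroots (K u) (W u) = sumroots (K u0) (W u0).
  move=> g0; apply: (@sumroots_near _ _ _ K u0 W (2 * d).+2).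
  - by move=> i; exact: (@Kc i u0).
  - exact: sK.
  - by apply: near_all => u; rewrite sK.
  move=> b0 rb0.
  have bL : b0 \notin Ls by apply/negP => /g0; rewrite -rootE rb0.
  have [e2 [e3 [r3 [n12 n13 n23]]]] := he bL.
  have uc := @cont_fst C C; have bc := @cont_snd C C.
  have Ec := cont_horner (p := E) bc; have Lc' := cont_horner (p := La) bc.
  have Pc := cont_horner (p := P) bc; have k0c := cont_horner (p := k0) bc.
  have ec0 : {for (u0, b0), continuous (fun z : C * C => e z.2)} :=
    at_comp (bc (u0, b0)) (ec bL).
  have etac := atD ec0 (atN (Ec (u0, b0))).
  have [u00|u00] := eqVneq u0 0.
    (* near an interpolation point [(e - E) / La] is bounded, the root [e b0] being simple *)
    have b0l : b0 \in l.
      by move: rb0; rewrite rootE KE u00 mulr0 !expr0n /= !mul0r !addr0 expf_eq0 /= rLa.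
    have eb0 : e b0 = E.[b0] by rewrite hE.
    pose Dl (z : C * C) := (e z.2 - E.[z.2]) * (e z.2 - E.[z.2]) +
      (3 * E.[z.2] * (e z.2 - E.[z.2]) + (3 * (E.[z.2] * E.[z.2]) + P.[z.2] + k0.[z.2] * z.1)).
    have kc3 := @constC R (C * C)%type 3.
    have Dc : {for (u0, b0), continuous Dl}.
      have c1' := contM kc3 Ec; have c1 := c1' (u0, b0).
      have c2' := contD (contD (contM kc3 (contM Ec Ec)) Pc) (contM k0c uc); have c2 := c2' (u0, b0).
      exact: (atD (atM etac etac) (atD (atM c1 etac) c2)).
    have D0 : Dl (u0, b0) != 0.
      rewrite /Dl /= eb0 subrr !mulr0 u00 mulr0 addr0 !add0r -eb0 -expr2.
      exact: simple_root r3 n12 n13.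
    apply: nearS (at_neq0 Dc D0) => -[u b]; rewrite /Dl /= => Dn rb.
    have -> : W u0 b0 = 0%N by rewrite /W asboolF // u00 => -[_ /eqP].
    rewrite /W asboolF // => -[bL' un0 Eu].
    have cb := e_root bL'.
    have kb' := kb b; move: rb cb; rewrite rootE KE /cub /= -Eu => /eqP rb cb.
    rewrite -Eu in kb'.
    have [eta0|eta0] := eqVneq (e b - E.[b]) 0.
      move: rb Dn; rewrite eta0 !mulr0 expr0n /= !add0r.
      have -> : u ^+ 2 * (3 * E.[b] ^+ 2 + P.[b]) + u ^+ 3 * k0.[b] =
        u ^+ 2 * (3 * (E.[b] * E.[b]) + P.[b] + k0.[b] * u) by ring.
      by move=> /eqP; rewrite mulf_eq0 expf_eq0 (negbTE un0) /= => /eqP ->; rewrite eqxx.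
    move/eqP: Dn; apply; apply: (mulfI eta0); rewrite mulr0 -[RHS]cb.
    have -> : q.[b] = k0.[b] * (u * (e b - E.[b])) - E.[b] ^+ 3 - P.[b] * E.[b] by rewrite kb'; ring.
    ring.
  (* elsewhere the branch [e] is isolated *)
  pose v (z : C * C) := E.[z.2] + La.[z.2] / z.1.
  have vc : {for (u0, b0), continuous v}.
    apply: (atD (Ec (u0, b0))).
    exact: (@at_div R _ _ _ (u0, b0) Lc' uc u00).
  have Nu : \forall z \near (u0, b0), z.1 != 0 by exact: (at_neq0 (uc (u0, b0)) u00).
  have vroot u b : u != 0 -> root (K u) b -> cub (b, v (u, b)) = 0.
    by move=> un0 /eqP rb; rewrite /v /= cubK // rb mulr0.
  have onE u b : u != 0 -> b \notin Ls -> on u b <-> e b = v (u, b).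
    move=> un0 bL'; rewrite /on /v /=; split=> [[_ _ h]|h].
      by rewrite -h [u * _]mulrC mulfK // addrC subrK.
    by split=> //; rewrite h [E.[b] + _]addrC addrK mulrC divfK.
  have NL : \forall z \near (u0, b0), z.2 \notin Ls.
    have : \forall b \near b0, b \notin Ls.
      have LE : b0 \notin Ls by [].
      have := @near_neq0 R C (fun b => (\prod_(x <- Ls) ('X - x%:P)).[b]) b0 (cont_horner (@idC R)).
      rewrite -rootE root_prod_XsubC => /(_ LE); apply: nearS => b.
      by rewrite -rootE root_prod_XsubC.
    exact: (near_cont (bc (u0, b0))).
  have [E0|E0] := eqVneq (e b0) (v (u0, b0)).
    pose S (z : C * C) := v z * v z + (v z * e z.2 + (e z.2 * e z.2 + P.[z.2])).
    have Sc : {for (u0, b0), continuous S}.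
      apply: (atD (atM vc vc)); apply: (atD (atM vc ec0)).
      exact: (atD (atM ec0 ec0) (Pc (u0, b0))).
    have S0 : S (u0, b0) != 0.
      have -> : S (u0, b0) = 3 * e b0 ^+ 2 + P.[b0] by rewrite /S -E0 /=; ring.
      exact: simple_root r3 n12 n13.
    apply: nearS (nearI Nu (nearI NL (at_neq0 Sc S0))) => -[u b] [/= un0 [bL' Sn]] rb.
    have cv := vroot u b un0 rb; have ce := e_root bL'.
    have vE : e b = v (u, b).
      apply/eqP; rewrite -subr_eq0; apply/eqP; apply: (mulIf Sn); rewrite mul0r.
      rewrite -[RHS](subrr (cub (b, e b))) {2}ce -cv /S /cub /=; ring.
    by rewrite /W !asboolT //; apply/onE.
  have Nn := at_neq0 (atD ec0 (atN vc)).
  have {}Nn : \forall z \near (u0, b0), e z.2 - v z != 0 by apply: Nn; rewrite subr_eq0.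
  apply: nearS (nearI Nu (nearI NL Nn)) => -[u b] [/= un0 [bL' Sn]] rb.
  rewrite /W !asboolF //.
    by move=> /(onE _ _ u00 bL) h; rewrite h eqxx in E0.
  by move=> /(onE _ _ un0 bL') h; rewrite h subrr eqxx in Sn.
have [L hL] := cgood.
pose L' := [seq u <- L | `[< ~ good u >]].
have LE u : u \notin L' <-> good u.
  rewrite mem_filter; split.
    by move=> h; apply: contrapT => nb; move: h; rewrite (asboolT nb) /= => /hL.
  by move=> nb; rewrite asboolF.
have n0 u : good u -> sumroots (K u) (W u) = 0%N.
  move=> gu; have cT : convexC ([set: C]) by [].
  have -> : sumroots (K u) (W u) = sumroots (K 0) (W 0).
    apply: (@lconst_avoid R _ (fun u => sumroots (K u) (W u)) setT L' cT openT _ u 0) => //.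
    - by move=> s _ /LE; exact: lc.
    - exact/LE.
    - exact/LE.
  by rewrite /sumroots big1 // => b _; rewrite /W asboolF // => -[_ /eqP].
(* only finitely many slopes are left *)
pose ws := 0 :: [seq u^-1 | u <- L'].
have slope b : b \notin Ls ++ l -> exists2 w, w \in ws & e b = E.[b] + w * La.[b].
  rewrite mem_cat negb_or => /andP[bL bl].
  have [eta0|eta0] := eqVneq (e b - E.[b]) 0.
    by exists 0; rewrite ?mem_head // mul0r addr0; apply/eqP; rewrite -subr_eq0 eta0.
  have La0 : La.[b] != 0 by rewrite rLa.
  pose u := La.[b] / (e b - E.[b]).
  have u0 : u != 0 by rewrite mulf_neq0 // invr_neq0.
  have Eu : E.[b] + La.[b] / u = e b by rewrite /u invf_div mulrC divfK // addrC subrK.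
  exists u^-1; last by rewrite -Eu [_^-1 * _]mulrC.
  rewrite inE; apply/orP; right; apply: map_f; apply: contraT => /LE gu.
  have rb : root (K u) b.
    have := cubK u b u0; rewrite Eu e_root // => /esym/eqP.
    by rewrite mulf_eq0 mulf_eq0 (negbTE La0) invr_eq0 expf_eq0 (negbTE u0).
  have K0 : K u != 0 by rewrite -size_poly_gt0 sK.
  have := n0 u gu; rewrite /sumroots (big_rem b) ?mem_proots //= /W asboolT //.
  by split=> //; rewrite /u divfK.
have [w ww hw] : exists2 w, w \in ws & cubp (E + w *: La) = 0.
  apply: contrapT => nex.
  have : \prod_(w <- ws) cubp (E + w *: La) = 0.
    apply: (@eq_cof_poly _ (Ls ++ l)) => b hb; have [w ww hw] := slope b hb.
    rewrite horner_prod; apply/eqP; rewrite prodf_seq_eq0; apply/hasP; exists w => //=.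
    rewrite cubpE hornerD hornerZ -hw e_root //.
    by move: hb; rewrite mem_cat negb_or => /andP[].
  move/eqP; rewrite prodf_seq_eq0 => /hasP[w ww /= /eqP hw].
  by apply: nex; exists w.
have [b0 [_ _ hb0]] := many_points Ls 1.
exists (E + w *: La); split=> //; first exact: poly_root_size.
have [l1 [_ sl1 hl1]] := many_points Ls 1.
case: l1 sl1 hl1 => // b [|//] _ hl1; have bL := hl1 b (mem_head _ _).
apply: (@neq_poly _ _ b); rewrite hornerD hornerM horner_exp hornerC.
have [e2 [e3 [r [n12 n13 n23]]]] := he bL.
have : ~ Om P q (b, (E + w *: La).[b]) by rewrite /Om -cubpE hw horner0 eqxx.
have n21 : e2 != e b by rewrite eq_sym.
have n31 : e3 != e b by rewrite eq_sym.
have n32 : e3 != e2 by rewrite eq_sym.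
move=> /(rootP _ r)[] ->.
- exact: simple_root r n12 n13.
- exact: simple_root (roots3_rot r) n23 n21.
- exact: simple_root (roots3_rot (roots3_rot r)) n31 n32.
Qed.

End Simple.

(** ** Colours *)

Section Colour.
Context {R : realType} {G : groupType}.
Local Notation C := R[i].
Variables (P q : {poly C}).
Local Notation Om := (Om P q).
Local Notation roots3 := (roots3 P q).
Variable g : (R -> C * C) -> G.
Hypothesis gflat : flat Om g.
Local Notation mer := (mer Om g).
Variable chi : G -> bool.
Hypothesis chiM : forall x y, chi (x * y)%g = chi x (+) chi y.

Lemma chi1 : chi 1%g = false.
Proof. by have := chiM 1%g 1%g; rewrite mulg1; case: (chi 1%g). Qed.

Lemma chi_cj k x : chi (cj k x) = chi x.
Proof.
have := chiM k^-1%g k; rewrite mulVg chi1 /cj !chiM.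
by case: (chi k^-1%g); case: (chi k); case: (chi x).
Qed.

Definition sees (z e1 e2 e3 : C) := [/\ z != e1, vis ((e2 - z) / (e1 - z)) & vis ((e3 - z) / (e1 - z))].

Lemma valid_sees z e1 e2 e3 : valid z e1 e2 e3 -> sees z e1 e2 e3.
Proof. by move=> [z1 z2 z3 [n1 n2 n3]]; split=> //; exact: nonray_vis. Qed.

Lemma chi_near b z0 e1 e2 e3 : roots3 b e1 e2 e3 -> dist3 e1 e2 e3 -> sees z0 e1 e2 e3 ->
  \forall z \near z0, chi (mer b z e1) = chi (mer b z0 e1).
Proof.
move=> r [n12 n13 _] [z1 v2 v3]; have [h gh] := vis_good r z1 v2 v3.
have n21 : e2 != e1 by rewrite eq_sym.
have n31 : e3 != e1 by rewrite eq_sym.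
have := @mer_near _ _ _ _ _ gflat _ _ _ _ _ _ z0 h (@constc C C b) (@idC R) (@constc C C e1)
  (@constc C C e2) (@constc C C e3) r n21 n31 gh.
by apply: nearS => z /(_ r)[_ ->]; exact: chi_cj.
Qed.

(** The points from which a root is visible form a star around it, so that two of them are joined by way
    of points close to the root. *)
Lemma chi_indep b z z' e1 e2 e3 : roots3 b e1 e2 e3 -> dist3 e1 e2 e3 -> sees z e1 e2 e3 ->
  sees z' e1 e2 e3 -> chi (mer b z e1) = chi (mer b z' e1).
Proof.
move=> r ds; have [n12 n13 n23] := ds.
pose h z := chi (mer b z e1).
have shrink w (t0 : R) : sees w e1 e2 e3 -> 0 <= t0 < 1 ->
    sees (lin w e1 t0) e1 e2 e3 /\ h (lin w e1 t0) = h w.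
  move=> sw t01.
  have st (t : R) : 0 <= t < 1 -> sees (lin w e1 t) e1 e2 e3.
    move=> /andP[p0 p1]; have [w1 v2 v3] := sw.
    have e1w : e1 - w != 0 by rewrite subr_eq0 eq_sym.
    have t1 : rc (1 - t) != 0 by apply/eqP => /(congr1 re); rewrite re_rc re0; lra.
    have D1 : e1 - lin w e1 t = rc (1 - t) * (e1 - w) by rewrite /lin rcB rc1; ring.
    have D f : (f - lin w e1 t) / (e1 - lin w e1 t) = (rc (1 - t))^-1 * ((f - w) / (e1 - w) - rc t).
      have -> : f - lin w e1 t = (f - w) - rc t * (e1 - w) by rewrite /lin; ring.
      rewrite D1; move: t1; move: (rc (1 - t)) (rc t) (f - w) => x y a x0.
      by field; rewrite x0 e1w.
    have V f : vis ((f - w) / (e1 - w)) -> vis ((f - lin w e1 t) / (e1 - lin w e1 t)).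
      rewrite D; set u := _ / _; clearbody u => vu; rewrite (_ : (rc (1 - t))^-1 = rc (1 - t)^-1); last first.
        by rewrite /rc fmorphV.
      have q0 : 0 < (1 - t)^-1 by rewrite invr_gt0; lra.
      have q1 : (1 - t)^-1 * (1 - t) = 1 by rewrite mulVf // gt_eqF; lra.
      move: ((1 - t)^-1) q0 q1 => k q0 q1.
      rewrite /vis !reimE !mul0r subr0 addr0 => -[i /andP[r0 r1]]; apply: vu.
      have i0 : im u = 0.
        by move/eqP: i; rewrite mulf_eq0 (gt_eqF q0) /= => /eqP; lra.
      split=> //; apply/andP; split; nra.
    split; [|exact: V|exact: V].
    by rewrite eq_sym -subr_eq0 D1 mulf_neq0.
  split; first exact: st.
  have := @lconst01 R _ (fun t => h (lin w e1 (t * t0))); rewrite mul1r mul0r lin0; apply.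
  move=> t /andP[p0 p1]; have [q0 q1] := andP t01.
  have tt : 0 <= t * t0 < 1 by apply/andP; split; nra.
  have c : continuous (fun t : R => lin w e1 (t * t0)).
    move=> u; apply: (@continuous_comp _ _ _ (fun t : R => t * t0) (lin w e1)); last exact: lin_c.
    by apply: cvgM; [exact: cvg_id|exact: cvg_cst].
  by have := near_cont (c t) (chi_near r ds (st _ tt)); apply: nearS.
pose m := Order.min (nm (e2 - e1)) (nm (e3 - e1)).
have m0 : 0 < m by rewrite /m lt_min !lt_neqAle !nm_ge0 ![0 == _]eq_sym !nm_eq0 !subr_eq0 ![_ == e1]eq_sym n12 n13.
have inball w : nm (e1 - w) < m -> w \notin [:: e1] -> sees w e1 e2 e3.
  rewrite inE => hw w1.
  have V f : m <= nm (f - e1) -> vis ((f - w) / (e1 - w)).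
    move=> mf [i /andP[r0 r1]].
    have e1w : e1 - w != 0 by rewrite subr_eq0 eq_sym.
    have E : f - e1 = rc (re ((f - w) / (e1 - w)) - 1) * (e1 - w).
      rewrite rcB rc1 mulrBl mul1r.
      have -> : rc (re ((f - w) / (e1 - w))) = (f - w) / (e1 - w).
        by rewrite [RHS]reimK i rc0 mulr0 addr0.
      by rewrite divfK //; ring.
    have := congr1 nm E; rewrite nmM nm_rc ler0_norm; last by lra.
    have := nm_ge0 (e1 - w); nra.
  split=> //; apply: V; by rewrite /m ge_min lexx ?orbT.
move=> s s'.
have near1 w : sees w e1 e2 e3 -> exists v, [/\ nm (e1 - v) < m, v \notin [:: e1] & h v = h w].
  move=> sw; have c := @lin_c R w e1.
  have := near_nm (c 1) m0; rewrite lin1 => /nbhs_ballP[d /= d0 hd].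
  pose t := 1 - Order.min d 1 / 2.
  have k0 : 0 < Order.min d 1 by rewrite lt_min d0 ltr01.
  have k1 : Order.min d 1 <= d by rewrite ge_min lexx.
  have k2 : Order.min d 1 <= 1 by rewrite ge_min lexx orbT.
  have t01 : 0 <= t < 1 by rewrite /t; apply/andP; split; lra.
  have [st ht] := shrink w t sw t01.
  exists (lin w e1 t); split=> //; last by rewrite inE; have [] := st.
  by apply: hd; rewrite /ball /= /t opprB addrC subrK ger0_norm; lra.
have [v [v1 v2 v3]] := near1 z s; have [v' [v1' v2' v3']] := near1 z' s'.
rewrite -/(h z) -/(h z') -v3 -v3'.
apply: (@lconst_avoid R _ h [set w | nm (e1 - w) < m] [:: e1]) => //.
- exact: nm_convex.
- exact: nm_open.
- by move=> w hw wl; exact: (chi_near r ds (inball w hw wl)).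
Qed.

Lemma valid_dist (z e1 e2 e3 : C) : valid z e1 e2 e3 -> dist3 e1 e2 e3.
Proof. exact: valid_neq. Qed.

(** The colour of a root depends neither on the centre nor on the numbering of the two other roots. *)
Lemma colours_agree b z z' e1 e2 e3 f1 f2 f3 : roots3 b e1 e2 e3 -> valid z e1 e2 e3 ->
  roots3 b f1 f2 f3 -> valid z' f1 f2 f3 -> f1 = e1 -> chi (mer b z e1) = chi (mer b z' e1).
Proof.
move=> r v r' v' E; subst f1.
have ds := valid_dist v; have [n12 n13 n23] := ds; have [m12 m13 m23] := valid_dist v'.
have key h2 h3 : roots3 b e1 h2 h3 -> valid z' e1 h2 h3 -> h2 = e2 -> h3 = e3 ->
    chi (mer b z e1) = chi (mer b z' e1).
  by move=> _ w E2 E3; subst h2 h3; exact: chi_indep r ds (valid_sees v) (valid_sees w).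
have isr f : ~ Om (b, f) -> f = e1 \/ f = e2 \/ f = e3.
  by move=> /(rootP _ r)[->|->|->]; auto.
have [] := isr f2; first by apply/(rootP _ r'); constructor 2.
  by move=> E; rewrite E eqxx in m12.
have [] := isr f3; first by apply/(rootP _ r'); constructor 3.
  by move=> E _; rewrite E eqxx in m13.
move=> [E3|E3] [E2|E2]; first by rewrite E2 E3 eqxx in m23.
- by apply: (key f3 f2) => //; [exact: roots3_swap (roots3_rot (roots3_rot r'))|exact: valid_swap (valid_rot (valid_rot v'))].
- exact: (key f2 f3).
- by rewrite E2 E3 eqxx in m23.
Qed.

Definition colour b e (c : bool) := exists e2 e3 z : C,
  [/\ roots3 b e e2 e3, valid z e e2 e3 & chi (mer b z e) = c].

Lemma colour_fun b e c c' : colour b e c -> colour b e c' -> c = c'.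
Proof.
move=> [e2 [e3 [z [r v <-]]]] [f2 [f3 [z' [r' v' <-]]]].
exact: colours_agree r v r' v' _.
Qed.

Definition minority b e := exists e2 e3 z : C, [/\ roots3 b e e2 e3, valid z e e2 e3,
  chi (mer b z e2) = ~~ chi (mer b z e) & chi (mer b z e3) = ~~ chi (mer b z e)].

Lemma colours b z e1 e2 e3 : roots3 b e1 e2 e3 -> valid z e1 e2 e3 ->
  [/\ colour b e1 (chi (mer b z e1)), colour b e2 (chi (mer b z e2)) & colour b e3 (chi (mer b z e3))].
Proof.
move=> r v; split.
- by exists e2, e3, z.
- by exists e3, e1, z; split=> //; [exact: roots3_rot|exact: valid_rot].
- exists e1, e2, z; split=> //; [exact: roots3_rot (roots3_rot r)|exact: valid_rot (valid_rot v)].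
Qed.

Lemma minority_uniq b e e' : minority b e -> minority b e' -> e = e'.
Proof.
move=> [e2 [e3 [z [r v c2 c3]]]] [f2 [f3 [z' [r' v' d2 d3]]]].
have [C1 C2 C3] := colours r v; have [D1 D2 D3] := colours r' v'.
have isr f : ~ Om (b, f) -> colour b f (~~ chi (mer b z e)) \/ f = e.
  by move=> /(rootP _ r)[->|->|->]; [right|left; rewrite -c2|left; rewrite -c3].
have r0 : ~ Om (b, e') by apply/(rootP _ r'); constructor 1.
have r2 : ~ Om (b, f2) by apply/(rootP _ r'); constructor 2.
have r3 : ~ Om (b, f3) by apply/(rootP _ r'); constructor 3.
have [n2 n3 n23] := valid_dist v'.
have [k0|//] := isr e' r0.
have E1 := colour_fun k0 D1.
have two f : ~ Om (b, f) -> colour b f (~~ chi (mer b z' e')) -> f = e.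
  move=> /isr[k1|//] k2; have := colour_fun k1 k2; rewrite E1; by case: (chi _).
have F2 := two f2 r2; have F3 := two f3 r3; rewrite d2 in D2; rewrite d3 in D3.
by move: n23; rewrite (F2 D2) (F3 D3) eqxx.
Qed.

Lemma colours_near b z e1 e2 e3 (N : C -> Prop) : roots3 b e1 e2 e3 -> valid z e1 e2 e3 ->
  (\forall f \near e1, N f) ->
  \forall b' \near b, exists f1 f2 f3, [/\ N f1, roots3 b' f1 f2 f3, valid z f1 f2 f3 &
    [/\ chi (mer b' z f1) = chi (mer b z e1), chi (mer b' z f2) = chi (mer b z e2) &
    chi (mer b' z f3) = chi (mer b z e3)]].
Proof.
move=> r v nN; pose T : topologicalType := (C * (C * (C * C)))%type.
have c0 : continuous (fun x : T => x.1) by exact: cont_fst.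
have c1 : continuous (fun x : T => x.2.1) by exact: cont_comp (@cont_snd _ _) (@cont_fst _ _).
have c22 : continuous (fun x : T => x.2.2) by exact: cont_comp (@cont_snd _ _) (@cont_snd _ _).
have c2 : continuous (fun x : T => x.2.2.1) by exact: cont_comp c22 (@cont_fst _ _).
have c3 : continuous (fun x : T => x.2.2.2) by exact: cont_comp c22 (@cont_snd _ _).
pose x0 : T := (b, (e1, (e2, e3))).
have zc := @constC R T z.
have H1 := @near_valid R T _ _ _ _ x0 zc c1 c2 c3 v.
have H2 := @mers_near _ _ _ _ _ gflat T _ _ _ _ _ x0 c0 zc c1 c2 c3 r v.
have H3 := near_cont (c1 x0) nN.
have H := roots3_near r (nearI H3 (nearI H1 H2)).
apply: nearS H => b' [f1 [f2 [f3 [[h3 [h1 h2]] r']]]].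
exists f1, f2, f3; split=> //.
have /= [k [-> -> ->]] := h2 r'; by rewrite !chi_cj.
Qed.

(** If the three meridians of some fibre do not have the same colour, neither do those of any other one by
    connectedness, and the root of the minority colour is a continuous function of the base point. *)
Theorem colour_split (d : nat) (Ls : seq C) : (size P <= (2 * d).+1)%N -> (size q <= (3 * d).+1)%N ->
  (forall b : C, b \notin Ls -> exists e1 e2 e3 z : C, roots3 b e1 e2 e3 /\ valid z e1 e2 e3) ->
  (exists E : {poly C}, [/\ (size E <= d.+1)%N, cubp P q E = 0 & 3%:P * E ^+ 2 + P != 0]) \/
  (forall b z e1 e2 e3 : C, b \notin Ls -> roots3 b e1 e2 e3 -> valid z e1 e2 e3 ->
    chi (mer b z e2) = chi (mer b z e1) /\ chi (mer b z e3) = chi (mer b z e1)).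
Proof.
move=> sP sq nsing.
pose h b := `[< exists e, minority b e >].
have dich (b z e1 e2 e3 : C) : roots3 b e1 e2 e3 -> valid z e1 e2 e3 -> ~ h b ->
    chi (mer b z e2) = chi (mer b z e1) /\ chi (mer b z e3) = chi (mer b z e1).
  move=> r v nh; have n1 : ~ minority b e1 by move=> m; apply/nh/asboolP; exists e1.
  have n2 : ~ minority b e2 by move=> m; apply/nh/asboolP; exists e2.
  have n3 : ~ minority b e3 by move=> m; apply/nh/asboolP; exists e3.
  have r2 := roots3_rot r; have v2 := valid_rot v.
  have r3 := roots3_rot r2; have v3 := valid_rot v2.
  case E1 : (chi (mer b z e1)); case E2 : (chi (mer b z e2)); case E3 : (chi (mer b z e3)); split=> //; exfalso;
  first [by apply: n3; exists e1, e2, z; rewrite E1 E2 E3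
    | by apply: n2; exists e3, e1, z; rewrite E1 E2 E3
    | by apply: n1; exists e2, e3, z; rewrite E1 E2 E3].
have mnear b e (N : C -> Prop) : minority b e -> (\forall f \near e, N f) ->
    \forall b' \near b, exists2 f, N f & minority b' f.
  move=> [e2 [e3 [z [r v m2 m3]]]] nN; apply: nearS (colours_near r v nN) => b'.
  move=> [f1 [f2 [f3 [n r' v' [k1 k2 k3]]]]]; exists f1 => //.
  by exists f2, f3, z; rewrite k1 k2 k3.
have lc b : b \notin Ls -> \forall b' \near b, h b' = h b.
  move=> bL; case: (asboolP (exists e, minority b e)) => [[e m]|nm].
    have hb : h b by apply/asboolP; exists e.
    apply: nearS (mnear b e (fun=> True) m (@near_all C _ _ (fun=> I))) => b' [f _ m'].
    by rewrite hb; apply/asboolP; exists f.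
  have nh : ~ h b by move/asboolP.
  have [e1 [e2 [e3 [z [r v]]]]] := nsing b bL.
  have [k2 k3] := dich b z _ _ _ r v nh.
  apply: nearS (colours_near r v (@near_all C _ (fun=> True) (fun=> I))) => b'.
  move=> [f1 [f2 [f3 [_ r' v' [l1 l2 l3]]]]].
  rewrite (_ : h b = false); last exact/negP.
  apply/asboolP => -[f [g2 [g3 [z' [r'' v'' m2 m3]]]]].
  have [C1 C2 C3] := colours r' v'; have [D1 D2 D3] := colours r'' v''.
  rewrite l1 in C1; rewrite l2 k2 in C2; rewrite l3 k3 in C3.
  have isc x : ~ Om (b', x) -> colour b' x (chi (mer b z e1)).
    by move=> /(rootP _ r')[] ->.
  have r0 : ~ Om (b', f) by apply/(rootP _ r''); constructor 1.
  have r2 : ~ Om (b', g2) by apply/(rootP _ r''); constructor 2.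
  have := colour_fun D1 (isc _ r0); have := colour_fun D2 (isc _ r2).
  by rewrite m2; case: (chi (mer b' z' f)); case: (chi (mer b z e1)).
have cst b b' : b \notin Ls -> b' \notin Ls -> h b = h b'.
  have cT : convexC ([set: C]) by [].
  apply: (@lconst_avoid R _ h setT Ls cT openT _ b b') => //.
  by move=> s _ sL; exact: lc.
have [l0 [_ sl0 hl0]] := many_points Ls 1.
case: l0 sl0 hl0 => // b0 [|//] _ hl0; have b0L := hl0 b0 (mem_head _ _).
have [hb0|hb0] := boolP (h b0); last first.
  right=> b z e1 e2 e3 bL r v; apply: dich => //; rewrite (cst b b0) //; exact/negP.
left; pose e b := xget 0 [set e | minority b e].
have eP b : b \notin Ls -> minority b (e b).
  move=> bL; have : h b by rewrite (cst b b0).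
  move=> /asboolP[x m]; exact: (@xgetPex _ 0 [set e | minority b e] (ex_intro _ x m)).
apply: (@liouville R P q d Ls e sP sq).
  move=> b /eP[e2 [e3 [z [r v _ _]]]]; exists e2, e3; split=> //; exact: valid_dist v.
move=> b bL N /= nN.
have nL : \forall b' \near b, b' \notin Ls.
  have := @near_neq0 R C (fun b => (\prod_(x <- Ls) ('X - x%:P)).[b]) b (cont_horner (@idC R)).
  rewrite -rootE root_prod_XsubC => /(_ bL); apply: nearS => b'.
  by rewrite -rootE root_prod_XsubC.
apply: nearS (nearI nL (mnear b (e b) N (eP b bL) nN)) => b' [bL' [f Nf m]].
by rewrite /= (minority_uniq (eP b' bL') m).
Qed.

End Colour.

(** * Equations of a trigonal curve in affine charts *)

Section Equation.
Context {R : realType} {d : nat}.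
Local Notation C := R[i].
Local Notation coxpoly := (mpoly 4 R[i]).
Implicit Types (p r x : C * C) (u v b w : C).

Definition vec4 x u v : 'I_4 -> C := fun i => [:: x.1; x.2; u; v]`_i.

Definition ev (F : coxpoly) x u v : C := meval (vec4 x u v) F.

Definition sc (k : C) x : C * C := (k * x.1, k * x.2).

(** The base is parametrized by the line joining [p] and [r]: the frame is kept arbitrary so that the
    fibre at infinity can be chosen generic, and exchanging [p] and [r] gives the second chart. *)
Definition xb p r b : C * C := (p.1 + b * r.1, p.2 + b * r.2).

Variable F : coxpoly.
Hypothesis hF : @has_class R d 3 (3 * d) F.

(** The coefficient of [u ^ (3 - j) v ^ j], as a form of degree [(3 - j) d] ([Ah]) and in the affine
    coordinate of the frame ([Ap]). *)
Definition Ah (j : nat) x : C :=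
  \sum_(m <- msupp F | m (inord 3) == j) mcoeff m F * (x.1 ^+ m (inord 0) * x.2 ^+ m (inord 1)).

Definition Ap p r (j : nat) : {poly C} :=
  \sum_(m <- msupp F | m (inord 3) == j)
    mcoeff m F *: ((p.1%:P + r.1 *: 'X) ^+ m (inord 0) * (p.2%:P + r.2 *: 'X) ^+ m (inord 1)).

Lemma Ap_horner p r j b : (Ap p r j).[b] = Ah j (xb p r b).
Proof.
rewrite /Ap /Ah horner_sum; apply: eq_bigr => m _.
rewrite hornerZ hornerM !horner_exp !hornerD !hornerC !hornerZ !hornerX /=.
by rewrite ![_ * b]mulrC.
Qed.

Lemma class_deg m : m \in msupp F -> (m (inord 2) + m (inord 3) = 3)%N /\
  (m (inord 0) + m (inord 1) = (3 - m (inord 3)) * d)%N.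
Proof.
move=> /hF.
have -> : (3 : 'I_4) = inord 3 by apply: val_inj; rewrite /= inordK.
have -> : (2 : 'I_4) = inord 2 by apply: val_inj; rewrite /= inordK.
have -> : (1 : 'I_4) = inord 1 by apply: val_inj; rewrite /= inordK.
have -> : (0 : 'I_4) = inord 0 by apply: val_inj; rewrite /= inordK.
move: (m (inord 0)) (m (inord 1)) (m (inord 2)) (m (inord 3)) => a b c e [h1 h2]; split=> //.
rewrite mulnBl [(e * d)%N]mulnC -h2 addnK //.
Qed.

Lemma size_Ap p r j : (size (Ap p r j) <= ((3 - j) * d).+1)%N.
Proof.
rewrite /Ap big_seq_cond; apply: (leq_trans (size_sum _ _ _)).
apply/bigmax_leqP_seq => m mF /andP[_ /eqP mj].
have [_ h] := class_deg mF; rewrite mj in h.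
apply: (leq_trans (size_scale_leq _ _)); apply: (leq_trans (size_polyMleq _ _)).
have s1 (k : C) (l : C) : (size (k%:P + l *: 'X)%R <= 2)%N.
  rewrite (leq_trans (size_polyD _ _)) // geq_max (leq_trans (size_polyC_leq1 _)) //=.
  by rewrite (leq_trans (size_scale_leq _ _)) // size_polyX.
have sX (k l : C) n : (size ((k%:P + l *: 'X) ^+ n)%R <= n.+1)%N.
  rewrite (leq_trans (size_poly_exp_leq _ _)) // ltnS.
  by have := s1 k l; case: (size _) => [|[|[|k']]] //= _; rewrite ?mul0n ?mul1n.
have key (a b c e : nat) : (a <= c.+1)%N -> (b <= e.+1)%N -> ((a + b).-1 <= (c + e).+1)%N by clear; lia.
by rewrite -h; apply: key; exact: sX.
Qed.

Lemma Ah_sc j k x : k != 0 -> Ah j (sc k x) = k ^+ ((3 - j) * d) * Ah j x.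
Proof.
move=> k0; rewrite /Ah big_distrr /= big_seq_cond [RHS]big_seq_cond; apply: eq_bigr => m /andP[mF /eqP mj].
have [_ h] := class_deg mF; rewrite mj in h; rewrite -h exprD !exprMn; ring.
Qed.

Lemma ev_expand x u v : ev F x u v =
  Ah 0 x * u ^+ 3 + Ah 1 x * u ^+ 2 * v + Ah 2 x * u * v ^+ 2 + Ah 3 x * v ^+ 3.
Proof.
have -> : Ah 0 x * u ^+ 3 + Ah 1 x * u ^+ 2 * v + Ah 2 x * u * v ^+ 2 + Ah 3 x * v ^+ 3 =
    \sum_(j < 4) Ah j x * (u ^+ (3 - j) * v ^+ j).
  by rewrite !big_ord_recl big_ord0 /= /bump /= expr0 expr1; ring.
rewrite /ev mevalE /Ah.
under [RHS]eq_bigr do rewrite big_distrl /=.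
rewrite (exchange_big_dep xpredT) //= !big_seq; apply: eq_bigr => m mF.
have [h _] := class_deg mF.
have le3 (a b : nat) : (a + b = 3)%N -> (b < 4)%N by clear; lia.
have m3 := le3 _ _ h.
rewrite [RHS](bigD1 (Ordinal m3)) //= [X in _ = _ + X]big1 ?addr0; last first.
  move=> i /andP[/eqP hi /negP ni]; exfalso; apply: ni; apply/eqP; apply: val_inj; exact: esym.
rewrite -mulrA; congr (_ * _).
rewrite !big_ord_recl big_ord0 mulr1 /vec4 /=.
have -> : ord0 = inord 0 :> 'I_4 by apply: val_inj; rewrite /= inordK.
have -> : lift (inord 0) ord0 = inord 1 :> 'I_4 by apply: val_inj; rewrite /= !inordK.
have -> : lift (inord 0) (lift ord0 ord0) = inord 2 :> 'I_4 by apply: val_inj; rewrite /= !inordK.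
have -> : lift (inord 0) (lift ord0 (lift ord0 ord0)) = inord 3 :> 'I_4 by apply: val_inj; rewrite /= !inordK.
have -> : (3 - m (inord 3))%N = m (inord 2) by rewrite -[X in (X - _)%N]h addnK.
by rewrite !mulrA.
Qed.

Lemma Ah3_cst x y : Ah 3 x = Ah 3 y.
Proof.
rewrite /Ah big_seq_cond [RHS]big_seq_cond; apply: eq_bigr => m /andP[mF /eqP mj].
have [_] := class_deg mF; rewrite mj subnn mul0n => /eqP; rewrite addn_eq0 => /andP[/eqP -> /eqP ->].
by rewrite !expr0.
Qed.

Definition c3 : C := Ah 3 (0, 0).
Hypothesis c30 : c3 != 0.

(** ** The depressed cubic *)

(** The shift [shh] kills the quadratic term; [Phh] and [qhh] are the coefficients of the depressed cubic.
    They are forms in [x]; the polynomials [shp], [Pp], [qp] are their expressions in a frame. *)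
Definition shh x : C := Ah 2 x / (3 * c3).
Definition Phh x : C := Ah 1 x / c3 - 3 * shh x ^+ 2.
Definition qhh x : C := Ah 0 x / c3 - Ah 1 x / c3 * shh x + 2 * shh x ^+ 3.

Definition shp p r : {poly C} := (3 * c3)^-1 *: Ap p r 2.
Definition Pp p r : {poly C} := c3^-1 *: Ap p r 1 - 3 *: shp p r ^+ 2.
Definition qp p r : {poly C} := c3^-1 *: Ap p r 0 - c3^-1 *: (Ap p r 1 * shp p r) + 2 *: shp p r ^+ 3.

Lemma shp_horner p r b : (shp p r).[b] = shh (xb p r b).
Proof. by rewrite /shp /shh hornerZ Ap_horner mulrC. Qed.

Lemma Pp_horner p r b : (Pp p r).[b] = Phh (xb p r b).
Proof. rewrite /Pp /Phh; move: (shp_horner p r b); move: (shp p r) => s hs.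
by rewrite !(hornerD, hornerN, hornerZ, horner_exp) Ap_horner hs [c3^-1 * _]mulrC. Qed.

Lemma qp_horner p r b : (qp p r).[b] = qhh (xb p r b).
Proof.
rewrite /qp /qhh; move: (shp_horner p r b); move: (shp p r) => s hs.
rewrite !(hornerD, hornerN, hornerZ, horner_exp, hornerM) !Ap_horner hs.
by rewrite ![c3^-1 * _]mulrC mulrAC.
Qed.

Lemma ev_cub x w : ev F x 1 (w - shh x) = c3 * (w ^+ 3 + Phh x * w + qhh x).
Proof.
rewrite ev_expand (Ah3_cst x (0, 0)) -/c3 /qhh /Phh !expr1n !mulr1.
have n3 : (3 : C) != 0 by rewrite pnatr_eq0.
have -> : Ah 2 x = 3 * c3 * shh x by rewrite /shh mulrC divfK // mulf_neq0.
by field.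
Qed.

Lemma size_shp p r : (size (shp p r) <= d.+1)%N.
Proof. by rewrite (leq_trans (size_scale_leq _ _)) // (leq_trans (size_Ap _ _ _)) // mul1n. Qed.

Lemma size_pow (f : {poly C}) n k : (size f <= n.+1)%N -> (size (f ^+ k) <= (n * k).+1)%N.
Proof.
move=> sf; rewrite (leq_trans (size_poly_exp_leq _ _)) // ltnS leq_mul2r.
by apply/orP; right; case: (size f) sf => [|m] //=.
Qed.

Lemma size_Pp p r : (size (Pp p r) <= (2 * d).+1)%N.
Proof.
rewrite (leq_trans (size_polyD _ _)) // geq_max size_polyN; apply/andP; split.
  by rewrite (leq_trans (size_scale_leq _ _)) // (leq_trans (size_Ap _ _ _)).
by rewrite (leq_trans (size_scale_leq _ _)) // mulnC size_pow // size_shp.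
Qed.

Lemma size_qp p r : (size (qp p r) <= (3 * d).+1)%N.
Proof.
rewrite (leq_trans (size_polyD _ _)) // geq_max; apply/andP; split; last first.
  by rewrite (leq_trans (size_scale_leq _ _)) // mulnC size_pow // size_shp.
rewrite (leq_trans (size_polyD _ _)) // geq_max size_polyN; apply/andP; split.
  by rewrite (leq_trans (size_scale_leq _ _)) // (leq_trans (size_Ap _ _ _)).
rewrite (leq_trans (size_scale_leq _ _)) // (leq_trans (size_polyMleq _ _)) //.
have := size_Ap p r 1; have := size_shp p r; rewrite subSS subn0.
move: (size _) (size _) => a b; clear; lia.
Qed.

Lemma shh_sc k x : k != 0 -> shh (sc k x) = k ^+ d * shh x.
Proof. by move=> k0; rewrite /shh Ah_sc // mul1n mulrA. Qed.

Lemma Phh_sc k x : k != 0 -> Phh (sc k x) = k ^+ (2 * d) * Phh x.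
Proof.
move=> k0; rewrite /Phh Ah_sc // shh_sc // subSS subn0 exprMn -exprM [(d * 2)%N]mulnC; ring.
Qed.

Lemma qhh_sc k x : k != 0 -> qhh (sc k x) = k ^+ (3 * d) * qhh x.
Proof.
move=> k0; rewrite /qhh !Ah_sc // shh_sc // subSS !subn0 exprMn -exprM [(d * 3)%N]mulnC.
have -> : (3 * d = 2 * d + d)%N by rewrite -mulSnr.
rewrite exprD; ring.
Qed.

Lemma xb_swap p r b : b != 0 -> xb r p b^-1 = sc b^-1 (xb p r b).
Proof. by move=> b0; rewrite /xb /sc /= !mulrDr !mulKf // ![b^-1 * _ + _]addrC. Qed.

(** The coefficient in degree [n] is the value at infinity. *)
Lemma reversed_lead (f g : {poly C}) n : (size f <= n.+1)%N ->
  (forall b, b != 0 -> g.[b^-1] = b^-1 ^+ n * f.[b]) -> f`_n = g.[0].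
Proof.
move=> sf h.
pose f' := \poly_(i < n.+1) f`_(n - i).
have -> : g = f'.
  apply/eqP; rewrite -subr_eq0; apply/eqP; apply: (@eq_cof_poly _ _ [:: 0]) => b.
  rewrite inE => b0; apply/eqP; rewrite hornerD hornerN subr_eq0; apply/eqP.
  have bi0 : b^-1 != 0 by rewrite invr_eq0.
  have := h b^-1 bi0; rewrite invrK => ->.
  rewrite (horner_coef_wide _ sf) horner_poly big_distrr /= (reindex_inj rev_ord_inj) /=.
  apply: eq_bigr => i _; rewrite !subSS.
  have le : (i <= n)%N by rewrite -ltnS.
  rewrite mulrCA; congr (_ * _); move: (i : nat) le => k le.
  by rewrite exprVn -{1}(subnK le) exprD mulrAC mulfV ?mul1r // expf_neq0.
by rewrite horner_coef0 coef_poly /= subn0.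
Qed.

Lemma Pp_lead p r : (Pp p r)`_(2 * d) = Phh r.
Proof.
rewrite (@reversed_lead _ (Pp r p) _ (size_Pp p r)).
  by rewrite Pp_horner /xb !mul0r !addr0 -surjective_pairing.
by move=> b b0; rewrite !Pp_horner xb_swap // Phh_sc // invr_eq0.
Qed.

Lemma qp_lead p r : (qp p r)`_(3 * d) = qhh r.
Proof.
rewrite (@reversed_lead _ (qp r p) _ (size_qp p r)).
  by rewrite qp_horner /xb !mul0r !addr0 -surjective_pairing.
by move=> b b0; rewrite !qp_horner xb_swap // qhh_sc // invr_eq0.
Qed.

Lemma Ah_coef (m : multinom 4) j : m \in msupp F -> m (inord 3) = j ->
  (Ap (1, 0) (0, 1) j)`_(m (inord 1)) = mcoeff m F.
Proof.
move=> mF mj; rewrite /Ap coef_sum big_mkcond (bigD1_seq m) ?msupp_uniq //= mj eqxx.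
have E (m' : multinom 4) : (1%:P + 0 *: 'X) ^+ m' (inord 0) * (0%:P + 1 *: 'X) ^+ m' (inord 1) =
    'X^(m' (inord 1)) :> {poly C}.
  by rewrite scale0r addr0 expr1n mul1r add0r scale1r.
rewrite E coefZ coefXn eqxx mulr1 big_seq_cond big1 ?addr0 // => m' /andP[m'F nm].
case: eqP => // m'j.
rewrite E coefZ coefXn; case: eqP => [h1|_]; last by rewrite mulr0.
case/negP: nm; apply/eqP/mnmP => i.
have [a1 a2] := class_deg mF; have [b1 b2] := class_deg m'F.
rewrite mj in a1 a2; rewrite m'j -h1 in b1 b2.
rewrite -(inord_val i); case: i => -[|[|[|[|//]]]] /= _.
- by apply: (@addIn (m (inord 1))); rewrite a2 b2.
- by rewrite -h1.
- by apply: (@addIn j); rewrite a1 b1.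
- by rewrite mj m'j.
Qed.

End Equation.

(** * The affine charts of the complement *)

Section Rows.
Context {R : realType}.
Local Notation C := R[i].
Local Notation row2 := ('rV[R[i]^o]_2).

Definition rowv (x : C * C) : row2 := \row_j [:: x.1; x.2]`_j.
Definition rowc (v : 'rV[C]_2) : C * C := (v 0 0, v 0 1).

Lemma rowvK x : rowc (rowv x) = x.
Proof. by rewrite /rowc !mxE; case: x. Qed.

Lemma rowcK v : rowv (rowc v) = v.
Proof.
apply/rowP => j; rewrite !mxE; case: j => -[|[|//]] lt /=.
  by congr (v _ _); apply: val_inj.
by congr (v _ _); apply: val_inj.
Qed.

Lemma rowv_neq0 x : (rowv x == 0) = (x == 0).
Proof.
apply/eqP/eqP => [h|->]; first by rewrite -[x]rowvK h /rowc !mxE.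
by apply/rowP => j; rewrite !mxE; case: j => -[|[|//]] lt.
Qed.

Lemma rowv_c (T : topologicalType) (f : T -> C * C) t : {for t, continuous f} ->
  {for t, continuous (fun s => rowv (f s))}.
Proof.
move=> fc A [P nP PA].
have c1 := at_comp fc (@cont_fst C C (f t)); have c2 := at_comp fc (@cont_snd C C (f t)).
have n1 : \forall s \near t, P 0 0 (f s).1.
  by apply: c1; have := nP 0 0; rewrite mxE.
have n2 : \forall s \near t, P 0 1 (f s).2.
  by apply: c2; have := nP 0 1; rewrite mxE.
apply: nearS (nearI n1 n2) => s [p1 p2]; apply: PA => i j.
rewrite mxE ord1; case: j => -[|[|//]] lt /=.
  by have -> : Ordinal lt = 0 by exact: val_inj.
by have -> : Ordinal lt = 1 by exact: val_inj.
Qed.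

Lemma entry_c (j : 'I_2) : continuous (fun v : row2 => (v 0 j : C)).
Proof.
move=> v A nA; exists (fun i k => if k == j then A else setT).
  move=> i k; case: eqP => [->|_]; first by rewrite ord1.
  exact: filterT.
by move=> w /(_ 0 j); rewrite eqxx.
Qed.

End Rows.

Section Cox.
Local Open Scope quotient_scope.
Context {R : realType} {d : nat}.
Local Notation C := R[i].
Local Notation cox := (cox_space R).
Local Notation hirz := (hirzebruch R d).
Implicit Types (x y p r : C * C).

Definition bs (z : cox) : C * C := rowc (base z).
Definition fb (z : cox) : C * C := rowc (fiber z).

Lemma bs_neq0 z : bs z != 0.
Proof.
have := valP z; rewrite inE /= => -[h _].
by rewrite -rowv_neq0 rowcK.
Qed.

Lemma fb_neq0 z : fb z != 0.
Proof.
have := valP z; rewrite inE /= => -[_ h].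
by rewrite -rowv_neq0 rowcK.
Qed.

Lemma mkcox_subproof x y : x != 0 -> y != 0 ->
  (rowv x, rowv y) \in [set z : 'rV[R[i]^o]_2 * 'rV[R[i]^o]_2 | z.1 != 0 /\ z.2 != 0]%classic.
Proof. by move=> x0 y0; rewrite inE /= !rowv_neq0. Qed.

Definition mkcox x y (x0 : x != 0) (y0 : y != 0) : cox := SigSub (mkcox_subproof x0 y0).

Lemma bs_mk x y (x0 : x != 0) (y0 : y != 0) : bs (mkcox x0 y0) = x.
Proof. exact: rowvK. Qed.

Lemma fb_mk x y (x0 : x != 0) (y0 : y != 0) : fb (mkcox x0 y0) = y.
Proof. exact: rowvK. Qed.

Lemma bs_c : continuous bs.
Proof.
move=> z; have vc : continuous (fun z : cox => \val z) by exact: initial_continuous.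
have c1 := cont_comp vc (@cont_fst _ _).
exact: (cont_pair (cont_comp c1 (@entry_c R 0)) (cont_comp c1 (@entry_c R 1))).
Qed.

Lemma fb_c : continuous fb.
Proof.
move=> z; have vc : continuous (fun z : cox => \val z) by exact: initial_continuous.
have c1 := cont_comp vc (@cont_snd _ _).
exact: (cont_pair (cont_comp c1 (@entry_c R 0)) (cont_comp c1 (@entry_c R 1))).
Qed.

Lemma orbitE (z w : cox) : @torus_orbit R d z w <-> exists l m : C, [/\ l != 0, m != 0, bs w = sc l (bs z),
  (fb w).1 = m * (fb z).1 & (fb w).2 = l ^+ d * m * (fb z).2].
Proof.
split=> -[l [m [l0 m0 E1 E2 E3]]]; exists l, m; split=> //.
  by rewrite /bs E1 /rowc !mxE.
rewrite -[base w]rowcK -/(bs w) E1; apply/rowP => j; rewrite !mxE.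
by case: j => -[|[|//]] lt /=; congr (_ * base z _ _); exact: val_inj.
Qed.

Definition prh (z : cox) : hirz := (\pi_(hirz) z)%qT.

Lemma prh_c : continuous prh.
Proof. exact: pi_continuous. Qed.

Lemma pi_orbit (z w : cox) : prh z = prh w <-> @torus_orbit R d z w.
Proof. by split=> [/eqmodP/asboolP|h] //; apply/eqmodP/asboolP. Qed.

Lemma repr_orbit (z : cox) : @torus_orbit R d (repr (prh z)) z.
Proof. by apply/pi_orbit; rewrite /prh reprK. Qed.

Lemma evE (F : mpoly 4 C) (z : cox) : meval (coordinates z) F = ev F (bs z) (fb z).1 (fb z).2.
Proof.
apply: meval_eq => i; rewrite /coordinates /vec4 !mxE; case: splitP => -[[|[|//]] lt] /= ->;
  by rewrite /=; congr (_ _ _ _); exact: val_inj.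
Qed.

Lemma prh_repr (y : hirz) : prh (repr y) = y.
Proof. exact: reprK. Qed.

Lemma open_prh (W : set hirz) : (forall z, W (prh z) -> \forall w \near z, W (prh w)) -> open W.
Proof. by move=> h; change (open (prh @^-1` W)); rewrite openE => z; exact: h. Qed.

Definition cplx (F : mpoly 4 C) : set hirz := ~` (@zero_locus R d F `|` @exceptional_section R d).

Lemma exceptionalE z : @exceptional_section R d (prh z) <-> (fb z).1 = 0.
Proof.
have [l [m [l0 m0 _ E _]]] : exists l m : C, [/\ l != 0, m != 0, bs z = sc l (bs (repr (prh z))),
    (fb z).1 = m * (fb (repr (prh z))).1 & (fb z).2 = l ^+ d * m * (fb (repr (prh z))).2].
  exact/orbitE/repr_orbit.
rewrite E /exceptional_section /= -[fiber _ _ _]/((fb (repr (prh z))).1).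
by split=> [->|/eqP]; rewrite ?mulr0 // mulf_eq0 (negbTE m0) /= => /eqP.
Qed.

Lemma cplxE F z : @has_class R d 3 (3 * d) F ->
  cplx F (prh z) <-> ev F (bs z) (fb z).1 (fb z).2 != 0 /\ (fb z).1 != 0.
Proof.
move=> hF; have Z := @zero_locus_pi R d _ _ F z hF; rewrite evE in Z.
split.
  by move=> /not_orP[h1 h2]; split; apply/eqP; [move=> /Z|move=> /exceptionalE].
by move=> [/eqP h1 /eqP h2] [/Z|/exceptionalE].
Qed.

End Cox.

Section Chart.
Context {R : realType} {d : nat}.
Local Notation C := R[i].
Local Notation cox := (cox_space R).
Local Notation hirz := (hirzebruch R d).
Variable F : mpoly 4 C.
Hypothesis hF : @has_class R d 3 (3 * d) F.
Hypothesis c30 : c3 F != 0.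
Variables (p r : C * C).

Definition dt (x y : C * C) : C := x.1 * y.2 - x.2 * y.1.
Hypothesis dt0 : dt p r != 0.

Local Notation P := (Pp F p r).
Local Notation q := (qp F p r).
Local Notation Om := (Om P q).

(** The coordinates of [x] in the basis [p], [r]. *)
Definition al (x : C * C) : C := dt x r / dt p r.
Definition be (x : C * C) : C := dt p x / dt p r.

Lemma al_be x : x = (al x * p.1 + be x * r.1, al x * p.2 + be x * r.2).
Proof.
case: x => x1 x2; move: dt0; rewrite /al /be /dt /=; case: p => a b; case: r => e f /= h.
by congr (_, _); field.
Qed.

Lemma al_sc k x : al (sc k x) = k * al x.
Proof. by rewrite /al /dt /sc /=; ring. Qed.

Lemma be_sc k x : be (sc k x) = k * be x.
Proof. by rewrite /be /dt /sc /=; ring. Qed.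

Lemma al_xb b : al (xb p r b) = 1.
Proof. by rewrite /al -[RHS](mulfV dt0); congr (_ / _); rewrite /dt /xb /=; ring. Qed.

Lemma be_xb b : be (xb p r b) = b.
Proof. by rewrite /be -[RHS](mulfK dt0); congr (_ / _); rewrite /dt /xb /=; ring. Qed.

Lemma xb_al x : al x != 0 -> x = sc (al x) (xb p r (be x / al x)).
Proof.
move=> a0; rewrite {1}[x]al_be /sc /xb /=; move: (al x) (be x) a0 => k l k0.
by congr (_, _); field.
Qed.

Lemma xb_neq0 b : xb p r b != 0.
Proof.
apply/eqP => h; have := al_xb b; rewrite h /al /dt /= !mul0r subrr mul0r => /esym/eqP.
by rewrite oner_eq0.
Qed.

(** The affine coordinates [(b, v)] of a point of the chart [inch], where the curve has its depressed
    equation. *)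
Definition fco (z : cox) : C * C :=
  let a := al (bs z) in let b := be (bs z) / a in
  (b, (fb z).2 / ((fb z).1 * a ^+ d) + shh F (xb p r b)).

Definition inch (z : cox) : Prop := al (bs z) != 0 /\ (fb z).1 != 0.

Lemma inch_orbit z w : @torus_orbit R d z w -> inch z -> inch w.
Proof.
move=> /orbitE[l [m [l0 m0 E1 E2 _]]] [h1 h2]; rewrite /inch E1 E2 al_sc.
by split; rewrite mulf_neq0.
Qed.

Lemma fco_orbit z w : @torus_orbit R d z w -> inch z -> fco w = fco z.
Proof.
move=> /orbitE[l [m [l0 m0 E1 E2 E3]]] [h1 h2]; rewrite /fco E1 E2 E3 al_sc be_sc.
have -> : l * be (bs z) / (l * al (bs z)) = be (bs z) / al (bs z).
  by rewrite -mulf_div mulfV // mul1r.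
congr (_, _ + _); rewrite exprMn.
have ld : l ^+ d != 0 by rewrite expf_neq0.
have ad : al (bs z) ^+ d != 0 by rewrite expf_neq0.
by field; rewrite ld m0 ad h2.
Qed.

Lemma nz1 (v : C) : (1, v) != 0 :> C * C.
Proof. by apply/eqP => -[/eqP]; rewrite oner_eq0. Qed.

Definition cpt (y : C * C) : cox := mkcox (xb_neq0 y.1) (nz1 (y.2 - shh F (xb p r y.1))).

Lemma inch_cpt y : inch (cpt y).
Proof. by rewrite /inch bs_mk fb_mk al_xb /= !oner_neq0. Qed.

Lemma fco_cpt y : fco (cpt y) = y.
Proof.
rewrite /fco bs_mk fb_mk al_xb be_xb divr1 expr1n mulr1 divr1 /= subrK.
by case: y.
Qed.

Lemma cpt_fco z : inch z -> @torus_orbit R d z (cpt (fco z)).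
Proof.
move=> [h1 h2]; apply/orbitE; exists (al (bs z))^-1, (fb z).1^-1; rewrite !invr_eq0; split=> //.
- rewrite bs_mk /= [in X in sc _ X](xb_al h1).
  by rewrite /sc /= !mulKf // -surjective_pairing.
- by rewrite fb_mk /= mulVf.
- rewrite fb_mk /= addrK.
  have ad : al (bs z) ^+ d != 0 by rewrite expf_neq0.
  by rewrite exprVn; field; rewrite ad h2.
Qed.

Lemma shh_c : continuous (fun b : C => shh F (xb p r b)).
Proof.
have -> : (fun b : C => shh F (xb p r b)) = (fun b => (shp F p r).[b]).
  by apply/funext => b; rewrite shp_horner.
exact: (cont_horner (@idC R)).
Qed.

Lemma al_c : continuous al.
Proof.
have c1 := @cont_fst C C; have c2 := @cont_snd C C; have kc := @constC R (C * C)%type.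
exact: (contM (contB (contM c1 (kc r.2)) (contM c2 (kc r.1))) (kc (dt p r)^-1)).
Qed.

Lemma be_c : continuous be.
Proof.
have c1 := @cont_fst C C; have c2 := @cont_snd C C; have kc := @constC R (C * C)%type.
exact: (contM (contB (contM (kc p.1) c2) (contM (kc p.2) c1)) (kc (dt p r)^-1)).
Qed.

Lemma near_inch z : inch z -> \forall w \near z, inch w.
Proof.
move=> [h1 h2].
have n1 := near_neq0 (cont_comp (@bs_c R) al_c) h1.
have n2 := near_neq0 (cont_comp (@fb_c R) (@cont_fst C C)) h2.
exact: nearI n1 n2.
Qed.

Lemma fco_c z : inch z -> {for z, continuous fco}.
Proof.
move=> [h1 h2].
have ac := cont_comp (@bs_c R) al_c; have bc := cont_comp (@bs_c R) be_c.
have uc := cont_comp (@fb_c R) (@cont_fst C C); have vc := cont_comp (@fb_c R) (@cont_snd C C).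
have bac := @at_div R _ _ _ z bc ac h1.
have sc' : {for z, continuous (fun z : cox => shh F (xb p r (be (bs z) / al (bs z))))} :=
  at_comp bac (@shh_c _).
have den := contM uc (contX (n := d) ac).
have d0 : (fb z).1 * al (bs z) ^+ d != 0 by rewrite mulf_neq0 // expf_neq0.
have q' := @at_div R _ _ _ z vc den d0.
have wc := atD q' sc'.
exact: (cvg_pair bac wc).
Qed.

(** ** Coordinates on the complement *)

Local Notation X := (@curve_complement R d (@zero_locus R d F)).
Variable x0 : X.

Definition vX (y : X) : hirz := \val (y : set_type (@cplx R d F)).

Lemma vX_c : continuous vX.
Proof. exact: initial_continuous. Qed.

Definition phi (y : C * C) : X := insubd (x0 : set_type (@cplx R d F)) (prh (cpt y)).

Definition chX (y : X) : Prop := inch (repr (vX y)).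

Definition psX (y : X) : C * C := fco (repr (vX y)).

Lemma Om_cplx y : Om y <-> @cplx R d F (prh (cpt y)).
Proof.
rewrite cplxE // bs_mk fb_mk /= (ev_cub hF c30) /Om /cub Pp_horner qp_horner mulf_eq0 (negbTE c30) /=.
by rewrite oner_neq0; split=> [->|[->]].
Qed.

Lemma phi_val y : Om y -> vX (phi y) = prh (cpt y).
Proof. by move=> /Om_cplx h; rewrite /phi /vX insubdK // inE. Qed.

Lemma chX_phi y : Om y -> chX (phi y).
Proof.
move=> O; rewrite /chX phi_val //.
apply: inch_orbit (inch_cpt y); exact: torus_orbit_symP (repr_orbit _).
Qed.

Lemma psX_phi y : Om y -> psX (phi y) = y.
Proof.
move=> O; rewrite /psX phi_val // -[RHS](fco_cpt y).
apply: fco_orbit (inch_cpt y); exact: torus_orbit_symP (repr_orbit _).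
Qed.

Lemma prh_psX (y : X) : chX y -> prh (cpt (psX y)) = vX y.
Proof.
by move=> c; rewrite -[RHS]prh_repr; apply/pi_orbit/torus_orbit_symP/cpt_fco.
Qed.

Lemma Om_psX (y : X) : chX y -> Om (psX y).
Proof. by move=> c; apply/Om_cplx; rewrite prh_psX //; have := valP y; rewrite inE. Qed.

Lemma phi_psX (y : X) : chX y -> phi (psX y) = y.
Proof.
move=> c; have h : vX (phi (psX y)) = vX y by rewrite phi_val ?prh_psX //; exact: Om_psX.
exact: (val_inj h).
Qed.

Lemma near_chX (y : X) : chX y -> \forall y' \near y, chX y'.
Proof.
move=> c; have vc := vX_c.
have o : open [set h : hirz | inch (repr h)].
  apply: open_prh => z /= h; have hz := inch_orbit (repr_orbit z) h.
  apply: nearS (near_inch hz) => w hw.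
  apply: inch_orbit hw; exact: torus_orbit_symP (repr_orbit _).
have N : nbhs (vX y) [set h : hirz | inch (repr h)] by apply: open_nbhs_nbhs; split.
exact: (vc y _ N).
Qed.

Lemma open_fco (V : set (C * C)) : open V -> open [set h : hirz | inch (repr h) /\ V (fco (repr h))].
Proof.
move=> oV; apply: open_prh => z /= [h hU]; have hz := inch_orbit (repr_orbit z) h.
have E := fco_orbit (repr_orbit z) h.
have n1 := near_inch hz.
have N : \forall y \near fco z, V y.
  apply: open_nbhs_nbhs; split=> //; by rewrite E.
have n2 : \forall w \near z, V (fco w) := near_cont (fco_c hz) N.
apply: nearS (nearI n1 n2) => w [hw hw'].
have so : @torus_orbit R d w (repr (prh w)) := torus_orbit_symP (repr_orbit w).
by split; [exact: inch_orbit so hw|rewrite (fco_orbit so hw)].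
Qed.

Lemma psX_c (y : X) : chX y -> {for y, continuous psX}.
Proof.
move=> c U nU.
have [V [oV Vy VU]] : exists V : set (C * C), [/\ open V, V (psX y) & V `<=` U].
  by exists (interior U); split; [exact: open_interior|exact: nU|exact: interior_subset].
have N : \forall h \near vX y, inch (repr h) /\ V (fco (repr h)).
  by apply: open_nbhs_nbhs; split; [exact: open_fco|].
have := near_cont (@vX_c y) N.
by apply: nearS => y' [_]; exact: VU.
Qed.

Lemma phi_c (T : topologicalType) (K : T -> C * C) : continuous K ->
  (forall t, Om (K t)) -> continuous (fun t => phi (K t)).
Proof.
move=> Kc KO; apply: (@continuous_comp_initial (set_type (@cplx R d F)) T hirz set_val).
have -> : (@set_val _ (@cplx R d F) \o (fun t => phi (K t))) = (fun t => prh (cpt (K t))).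
  by apply/funext => t; rewrite /= -phi_val.
apply: (cont_comp _ (@prh_c R d)).
apply: continuous_comp_initial => t.
have c1 := cont_comp Kc (@cont_fst C C); have c2 := cont_comp Kc (@cont_snd C C).
have kc := @constC R T.
have xc := cont_pair (contD (kc p.1) (contM c1 (kc r.1))) (contD (kc p.2) (contM c1 (kc r.2))).
have yc := cont_pair (kc 1) (contB c2 (cont_comp c1 shh_c)).
exact: (cvg_pair (rowv_c (xc t)) (rowv_c (yc t))).
Qed.

End Chart.

(** * Generation by two open sets *)

Section TwoOpens.
Context {R : realType} {X : topologicalType} (x : X) (G : groupType).
Variable f : {multiplicative pi1 R x -> G}.
Hypothesis fsurj : forall g, exists a, f a = g.
Hypothesis conn : forall y, exists a : R -> X, pth a x y.
Implicit Types (a b : R -> X) (y z : X) (A B : X -> Prop).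
Local Notation tau := (tau f conn).

Definition piece a (t u : R) : R -> X := fun s => a (t + s * (u - t)).

Lemma piece_c a t u : continuous a -> continuous (piece a t u).
Proof.
move=> ac; apply: (cont_comp _ ac) => s; apply: cvgD; first exact: cvg_cst.
by apply: cvgM; [exact: cvg_id|exact: cvg_cst].
Qed.

Lemma tau_piece a t u : continuous a ->
  (tau (piece a 0 t) * tau (piece a t u) = tau (piece a 0 u))%g.
Proof.
move=> ac; pose K (z : R * R) := a (z.1 * (t + z.2 * (u - t))).
have Kc : continuous K.
  apply: (cont_comp _ ac) => z; apply: cvgM; first exact: cvg_fst.
  by apply: cvgD; [exact: cvg_cst|apply: cvgM; [exact: cvg_snd|exact: cvg_cst]].
have := tau_square f conn Kc; rewrite /K /=.
have -> : (fun s => a (s * (t + 0 * (u - t)))) = piece a 0 t.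
  by apply/funext => s; rewrite /piece; congr a; ring.
have -> : (fun s => a (1 * (t + s * (u - t)))) = piece a t u.
  by apply/funext => s; rewrite /piece; congr a; ring.
have -> : (fun s => a (0 * (t + s * (u - t)))) = (fun=> a 0).
  by apply/funext => s; congr a; ring.
have -> : (fun s => a (s * (t + 1 * (u - t)))) = piece a 0 u.
  by apply/funext => s; rewrite /piece; congr a; ring.
by rewrite tau_cst mul1g.
Qed.

Lemma piece01 a : piece a 0 1 = a.
Proof. by apply/funext => s; rewrite /piece; congr a; ring. Qed.

Lemma piece10 a : piece a 1 0 = prev a.
Proof. by apply/funext => s; rewrite /piece /prev; congr a; ring. Qed.

Lemma tau_prev a : continuous a -> tau (prev a) = (tau a)^-1%g.
Proof.
move=> ac; apply: (@mulgI _ (tau a)); rewrite mulgV -piece10 -{1}[a]piece01 tau_piece //.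
rewrite -(tau_cst f conn (a 0)); congr tau; apply/funext => s; rewrite /piece; congr a; ring.
Qed.

Definition pin A a y z := pth a y z /\ forall t, 0 <= t <= 1 -> A (a t).

Lemma pin_cat A a b y z w : pin A a y z -> pin A b z w -> pin A (pcat a b) y w.
Proof.
move=> [pa ia] [pb ib]; split; first exact: pcat_pth pa pb.
move=> t /andP[t0 t1]; rewrite /pcat; case: (leP t 2^-1) => h.
  by apply: ia; apply/andP; split; lra.
by apply: ib; apply/andP; split; lra.
Qed.

Lemma pin_prev A a y z : pin A a y z -> pin A (prev a) z y.
Proof.
move=> [pa ia]; split; first exact: prev_pth.
by move=> t /andP[t0 t1]; apply: ia; apply/andP; split; lra.
Qed.

Lemma tau_pin_cat A B a b y z w : pin A a y z -> pin B b z w ->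
  tau (pcat a b) = (tau a * tau b)%g.
Proof. by move=> [[ac _ a1] _] [[bc b0 _] _]; apply: tau_cat => //; rewrite a1 b0. Qed.

(** A path from [x0] to a point of one open set is closed up inside that set; the class of the result
    modulo [H] is locally constant along the path, by connectedness of the intersection. *)
Theorem two_opens (x0 : X) (A : bool -> X -> Prop) (H : G -> Prop) :
  (forall y, exists i, A i y) -> (forall i y, A i y -> \forall z \near y, A i z) ->
  (forall i, A i x0) ->
  (forall i y, A i y -> exists a, pin (A i) a y x0) ->
  (forall y, A true y -> A false y -> exists a, pin (fun z => A true z /\ A false z) a y x0) ->
  subg H -> (forall i a, pin (A i) a x0 x0 -> H (tau a)) ->
  forall a, pth a x0 x0 -> H (tau a).
Proof.
move=> cov opn A0 cA cI [H1 HM HV] gen a [ac a0 a1].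
have same i y b b' k : pin (A i) b y x0 -> pin (A i) b' y x0 -> H (k * tau b)%g -> H (k * tau b')%g.
  move=> pb pb' h; have pr := pin_prev pb.
  have := gen i _ (pin_cat pr pb'); rewrite (tau_pin_cat pr pb') tau_prev; last by case: pb => -[].
  by move=> h'; have := HM _ _ h h'; rewrite !mulgA mulgK.
have any i j y b b' k : pin (A i) b y x0 -> pin (A j) b' y x0 -> H (k * tau b)%g -> H (k * tau b')%g.
  move=> pb pb' h; have [Ei Ej] : A i y /\ A j y.
    have [[_ b0 _] ib] := pb; have [[_ b0' _] ib'] := pb'.
    by split; [rewrite -b0; apply: ib|rewrite -b0'; apply: ib']; rewrite lexx ler01.
  have [e|ij] := eqVneq i j; first by subst j; exact: same pb pb' h.
  have [c [pc ic]] : exists c, pin (fun z => A i z /\ A j z) c y x0.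
    case: i j ij Ei Ej {pb pb'} => -[] // _ Ei Ej; first exact: cI.
    by have [c [pc ic]] := cI y Ej Ei; exists c; split=> // t /ic[].
  have pi : pin (A i) c y x0 by split=> // t /ic[].
  have pj : pin (A j) c y x0 by split=> // t /ic[].
  exact: same pj pb' (same _ _ _ _ _ pb pi h).
pose S (t : R) := forall i b, pin (A i) b (a t) x0 -> H (tau (piece a 0 t) * tau b)%g.
have step t u i : (forall s, 0 <= s <= 1 -> A i (a (t + s * (u - t)))) -> S t -> S u.
  move=> ins St j b pb.
  have At : A i (a t) by have := ins 0; rewrite mul0r addr0 lexx ler01; apply.
  have [c pc] := cA i _ At.
  have pp : pin (A i) (piece a u t) (a u) (a t).
    split; first split; [exact: piece_c|by rewrite /piece mul0r addr0|by rewrite /piece mul1r addrC subrK|].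
    move=> s /andP[s0 s1]; have := ins (1 - s) ltac:(apply/andP; split; lra).
    by rewrite /piece; congr (A i (a _)); ring.
  apply: any (pin_cat pp pc) pb _.
  rewrite (tau_pin_cat pp pc) mulgA tau_piece //; exact: St pc.
have lc (t : R) : 0 <= t <= 1 -> \forall u \near t, 0 <= u <= 1 -> `[< S u >] = `[< S t >].
  move=> _; have [i Ai] := cov (a t).
  have : \forall u \near t, A i (a u) by exact: near_cont (ac t) (opn i _ Ai).
  move=> /nbhs_ballP[e /= e0 he]; apply/nbhs_ballP; exists e => //= u hu _.
  have hs s : 0 <= s <= 1 -> A i (a (t + s * (u - t))).
    move=> /andP[s0 s1]; apply: he; rewrite /ball /= opprD addrA subrr sub0r normrN normrM (ger0_norm s0).
    by apply: le_lt_trans hu; rewrite distrC ler_piMl.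
  apply/asboolP/asboolP; last exact: step hs.
  apply: (step _ _ i) => s /andP[s0 s1].
  by have := hs (1 - s) ltac:(apply/andP; split; lra); congr (A i (a _)); ring.
have S0 : S 0.
  move=> i b pb; have -> : piece a 0 0 = (fun=> a 0) by apply/funext => s; rewrite /piece; congr a; ring.
  by rewrite tau_cst mul1g; apply: (gen i); rewrite -[X in pin _ _ X]a0.
have S1 : S 1 by apply/asboolP; rewrite (lconst01 lc); exact/asboolP.
have := S1 true (fun=> x0); rewrite piece01 tau_cst mulg1; apply; split=> [|t _]; last exact: A0.
by rewrite a1; exact: cst_pth.
Qed.

End TwoOpens.

(** * Connectedness over an affine chart *)

Section Joined.
Context {R : realType}.
Local Notation C := R[i].
Variables (P q : {poly C}).
Local Notation Om := (Om P q).
Local Notation roots3 := (roots3 P q).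

Lemma roots3_exist b : exists e1 e2 e3 : C, roots3 b e1 e2 e3.
Proof.
have [m s] := @fibpoly_monic R P q b.
have [l lE] := closed_field_poly_normal (fibpoly P q b).
move: lE; rewrite (monicP m) scale1r => lE.
have : size l = 3 by apply/eqP; have := congr1 (fun f : {poly C} => size f) lE; rewrite s size_prod_XsubC => -[] /eqP; rewrite eq_sym.
case: l lE => [|e1 [|e2 [|e3 [|]]]] //= lE _; exists e1, e2, e3 => v.
by rewrite -(@fibpolyE R P q) lE !big_cons big_nil !hornerM hornerC mulr1 !hornerXsubC !mulrA.
Qed.

Definition disc : {poly C} := - 4%:P * P ^+ 3 - 27%:P * q ^+ 2.

Lemma discE b : disc.[b] = - 4 * P.[b] ^+ 3 - 27 * q.[b] ^+ 2.
Proof. by rewrite /disc !(hornerD, hornerN, hornerM, horner_exp, hornerC). Qed.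

Lemma disc_roots b e1 e2 e3 : roots3 b e1 e2 e3 ->
  disc.[b] = ((e1 - e2) * (e1 - e3) * (e2 - e3)) ^+ 2.
Proof.
move=> /vieta[s3 p c].
by rewrite discE p c s3; ring.
Qed.

Lemma disc_dist b e1 e2 e3 : roots3 b e1 e2 e3 -> disc.[b] != 0 <-> dist3 e1 e2 e3.
Proof.
move=> /disc_roots ->; rewrite expf_eq0 /= !mulf_eq0 !negb_or !subr_eq0.
by split=> [/andP[/andP[]]|[-> ->]].
Qed.

Lemma disc_valid b : disc.[b] != 0 -> exists e1 e2 e3 z : C, roots3 b e1 e2 e3 /\ valid z e1 e2 e3.
Proof.
move=> d0; have [e1 [e2 [e3 r]]] := roots3_exist b.
have [z v] := valid_exists (proj1 (disc_dist r) d0).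
by exists e1, e2, e3, z.
Qed.

Lemma valid_disc b z e1 e2 e3 : roots3 b e1 e2 e3 -> valid z e1 e2 e3 -> disc.[b] != 0.
Proof. by move=> r v; apply/(disc_dist r); exact: valid_neq v. Qed.

Lemma valid_Om b z e1 e2 e3 : roots3 b e1 e2 e3 -> valid z e1 e2 e3 -> Om (b, z).
Proof.
move=> rb [zf1 zf2 zf3 _].
apply: contrapT => /(rootP _ rb)[] E; [move: zf1|move: zf2|move: zf3]; by rewrite E eqxx.
Qed.

Lemma trivial_flat : flat Om (fun=> 1%g : dihedral int).
Proof. by split=> *; rewrite ?mulg1. Qed.

(** Push both points to a common constant section over a disc, and join the projections off [Lx]. *)
Lemma joined (Lx : seq C) (b w b0 w0 : C) : Om (b, w) -> Om (b0, w0) -> b \notin Lx -> b0 \notin Lx ->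
  exists a : R -> C * C, pin (fun y => Om y /\ y.1 \notin Lx) a (b, w) (b0, w0).
Proof.
move=> O O0 bL b0L.
pose La := \prod_(x <- Lx) ('X - x%:P).
have LaE c : (c \notin Lx) = (La.[c] != 0) by rewrite -root_prod_XsubC.
have N : \forall c \near b, forall t : R, 0 <= t <= 1 -> lin c b t \notin Lx.
  apply: (@near_seg R C b (fun t c => lin c b t \notin Lx)) => t _.
  have c : continuous (fun z : R * C => La.[lin z.2 b z.1]).
    apply: cont_horner; apply: lin_cont; [exact: cont_snd|exact: cont_cst|exact: cont_fst].
  have := @near_neq0 R _ _ (t, b) c; rewrite /= -LaE /lin subrr mulr0 addr0 => /(_ bL).
  by apply: nearS => z; rewrite -LaE.
have [c hc1 hc2] := avoid_segment b0L N.
pose rho : C := `|b| + `|b0| + `|c| + 1.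
have rho0 : 0 < rho by rewrite ltr_wpDl ?ltr01 // !addr_ge0.
have cD := @disc_convex R 0 rho rho0.
have D (z : C) : `|z| <= rho - 1 -> `|0 - z| < rho.
  by move=> h; rewrite sub0r normrN (le_lt_trans h) // ltrBlDr ltrDl ltr01.
have Db : `|0 - b| < rho by apply: D; rewrite /rho addrK -addrA lerDl addr_ge0.
have Db0 : `|0 - b0| < rho by apply: D; rewrite /rho addrK [`|b| + _]addrC -addrA lerDl addr_ge0.
have Dc : `|0 - c| < rho by apply: D; rewrite /rho addrK lerDr addr_ge0.
have [m1 m10 hP] := poly_bound P (ltW rho0); have [m2 m20 hq] := poly_bound q (ltW rho0).
pose m : C := m1 + m2 + 1.
have Om_m (z : C) : `|0 - z| < rho -> Om (z, m).
  by rewrite sub0r normrN => /ltW Dz; apply: far_Om; rewrite /m lerD2r lerD ?hP ?hq.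
have [c1 [[c1c e1 f1] i1]] := fib_conn trivial_flat O (Om_m _ Db).
have [c2 [[c2c e2 f2] i2]] := fib_conn trivial_flat O0 (Om_m _ Db0).
pose S := (fun y : C * C => Om y /\ y.1 \notin Lx).
have p1 : pin S (fp b c1) (b, w) (b, m).
  by split; [split; [exact: (fp_c c1c)|rewrite /fp e1; reflexivity|rewrite /fp f1; reflexivity]
    |move=> t t01; split; [exact: i1|exact: bL]].
have p2 : pin S (fp b0 c2) (b0, w0) (b0, m).
  by split; [split; [exact: (fp_c c2c)|rewrite /fp e2; reflexivity|rewrite /fp f2; reflexivity]
    |move=> t t01; split; [exact: i2|exact: b0L]].
have seg (x y : C) : `|0 - x| < rho -> `|0 - y| < rho -> (forall t : R, 0 <= t <= 1 -> lin x y t \notin Lx) ->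
    pin S (fun t => (lin x y t, m)) (x, m) (y, m).
  move=> Dx Dy h; split; last by move=> t t01; split; [apply: Om_m; exact: cD|exact: h].
  split; [|rewrite lin0; reflexivity|rewrite lin1; reflexivity].
  by apply: cont_pair; [exact: lin_c|exact: cont_cst].
have p3 := seg b0 c Db0 Dc hc2; have p4 := seg c b Dc Db hc1.
by eexists; exact: (pin_cat p1 (pin_prev (pin_cat p2 (pin_cat p3 p4)))).
Qed.

End Joined.

(** * The fibre meridians generate *)

Section Scaling.
Context {R : realType} {G : groupType}.
Local Notation C := R[i].
Variables (P q P' q' : {poly C}) (g g' : (R -> C * C) -> G) (b b' k : C).
Hypothesis gflat : flat (Om P q) g.
Hypothesis gflat' : flat (Om P' q') g'.
Hypothesis k0 : k != 0.
Hypothesis OmE : forall w, Om P' q' (b', k * w) <-> Om P q (b, w).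
Hypothesis gE : forall z w, sin (Om P q) b z w -> g' (sg b' (k * z) (k * w)) = g (sg b z w).

Lemma ratio_sc (x y : C) : k * x / (k * y) = x / y.
Proof. by rewrite -mulf_div mulfV // mul1r. Qed.

Lemma pt_sc z e u : pt (k * z) (k * e) u = k * pt z e u.
Proof. by rewrite /pt; ring. Qed.

Lemma valid_sc z e1 e2 e3 : valid z e1 e2 e3 -> valid (k * z) (k * e1) (k * e2) (k * e3).
Proof.
have n (x y : C) : (k * x != k * y) = (x != y) by rewrite (inj_eq (mulfI k0)).
by move=> [z1 z2 z3 [n1 n2 n3]]; rewrite /valid !n -!mulrBr !ratio_sc.
Qed.

Lemma good_sc z e h : good (Om P q) b z e h -> good (Om P' q') b' (k * z) (k * e) h.
Proof.
move=> [h0 ze l]; split=> //; first by rewrite (inj_eq (mulfI k0)).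
move=> f nO fe; rewrite -[f](mulVKf k0) -!mulrBr ratio_sc; apply: l.
  by move=> /OmE; rewrite mulVKf.
by apply: contra_neq fe => <-; rewrite mulVKf.
Qed.

(** The change of charts is a homothety on each fibre, which preserves visibility and triangles. *)
Lemma mer_sc z e h : good (Om P q) b z e h ->
  mer (Om P' q') g' b' (k * z) (k * e) = mer (Om P q) g b z e.
Proof.
move=> gh; rewrite (merE gflat gh) (merE gflat' (good_sc gh)) /stri /tri !pt_sc.
by have [s1 s2 s3] := tin_good gh; rewrite !gE.
Qed.

End Scaling.

Section Transition.
Context {R : realType} {d : nat}.
Local Notation C := R[i].
Variable F : mpoly 4 C.
Hypothesis hF : @has_class R d 3 (3 * d) F.
Hypothesis c30 : c3 F != 0.
Variables (p r : C * C).
Hypothesis dt0 : dt p r != 0.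
Local Notation P := (Pp F p r).
Local Notation q := (qp F p r).
Local Notation P' := (Pp F r p).
Local Notation q' := (qp F r p).

Lemma dt_swap : dt r p != 0.
Proof. by rewrite -oppr_eq0 /dt opprB mulrC [r.1 * _]mulrC. Qed.

Lemma cub_swap b w : b != 0 -> cub P' q' (b^-1, b^-1 ^+ d * w) = b^-1 ^+ (3 * d) * cub P q (b, w).
Proof.
move=> b0; have bi : b^-1 != 0 by rewrite invr_eq0.
rewrite /cub /= !Pp_horner !qp_horner xb_swap // (Phh_sc hF) // (qhh_sc hF) //.
have -> : (3 * d = 2 * d + d)%N by rewrite -mulSnr.
have -> : (2 * d = d + d)%N by rewrite mul2n addnn.
by rewrite !exprD; ring.
Qed.

Lemma Om_swap b w : b != 0 -> Om P' q' (b^-1, b^-1 ^+ d * w) <-> Om P q (b, w).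
Proof.
move=> b0; rewrite /Om cub_swap // mulf_eq0 expf_eq0 invr_eq0 (negbTE b0) andbF /=.
by [].
Qed.

Lemma roots3_sc b e1 e2 e3 : b != 0 -> roots3 P q b e1 e2 e3 ->
  roots3 P' q' b^-1 (b^-1 ^+ d * e1) (b^-1 ^+ d * e2) (b^-1 ^+ d * e3).
Proof.
move=> b0 h v; have k0 : b^-1 ^+ d != 0 by rewrite expf_neq0 // invr_eq0.
rewrite -[v](mulVKf k0) cub_swap // h mulnC exprM; ring.
Qed.

Lemma disc_swap b : b != 0 -> (disc P' q').[b^-1] = b^-1 ^+ (6 * d) * (disc P q).[b].
Proof.
move=> b0; have bi : b^-1 != 0 by rewrite invr_eq0.
rewrite !discE !Pp_horner !qp_horner xb_swap //.
rewrite (Phh_sc hF) // (qhh_sc hF) // !exprMn -!exprM.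
have -> : (2 * d * 3 = 6 * d)%N by rewrite mulnAC.
have -> : (3 * d * 2 = 6 * d)%N by rewrite mulnAC.
ring.
Qed.

Lemma disc_swap_neq0 : disc P q != 0 -> disc P' q' != 0.
Proof.
move=> d0; have [b _ [db b0]] : exists2 b : C, True & (disc P q).[b] != 0 /\ b != 0.
  have X0 : ('X : {poly C}) != 0 by rewrite -size_poly_eq0 size_polyX.
  have c := cof_and (cof_poly d0) (cof_poly X0).
  have N : nbhs (0 : C) (fun=> True) by exact: (@near_all C 0 (fun=> True) (fun=> I)).
  by have [b _ [h1 h2]] := cof_open c N; exists b => //; rewrite hornerX in h2.
apply: (@neq_poly _ _ b^-1); rewrite disc_swap // mulf_neq0 // expf_neq0 // invr_eq0 //.
Qed.

Local Notation X := (@curve_complement R d (@zero_locus R d F)).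
Variable x0 : X.
Local Notation ph := (@phi R d F p r dt0 x0).
Local Notation ph' := (@phi R d F r p dt_swap x0).

Lemma phi_swap b w : b != 0 -> ph' (b^-1, b^-1 ^+ d * w) = ph (b, w).
Proof.
move=> b0; rewrite /phi; congr insubd; apply/pi_orbit/orbitE.
have bi : b^-1 != 0 by rewrite invr_eq0.
exists b, 1; rewrite oner_neq0 !bs_mk !fb_mk /= xb_swap //; split=> //.
- by rewrite /sc /= !mulVKf // -surjective_pairing.
- by rewrite mulr1.
- rewrite (shh_sc hF) // mulr1 -mulrBr mulrA -exprMn mulfV // expr1n mul1r //.
Qed.

End Transition.

Definition cl {R : realType} (t : R) : R := ival (clamp t).

Lemma cl_c {R : realType} : continuous (@cl R).
Proof. exact: cont_comp (@clamp_continuous R) (@ival_continuous R). Qed.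

Lemma cl01 {R : realType} (t : R) : 0 <= cl t <= 1.
Proof. exact: ival01. Qed.

Lemma clE {R : realType} (t : R) : 0 <= t <= 1 -> cl t = t.
Proof. by move=> /andP[t0 t1]; rewrite /cl ival_clamp min_l // max_r. Qed.

Lemma pcat_c {R : realType} (X : topologicalType) (a b : R -> X) :
  continuous a -> continuous b -> a 1 = b 0 -> continuous (pcat a b).
Proof.
move=> ac bc e.
by have [c _ _] := pcat_pth (And3 ac (erefl (a 0)) (erefl (a 1))) (And3 bc (esym e) (erefl (b 1))).
Qed.

Section OneChart.
Context {R : realType} {d : nat}.
Local Notation C := R[i].
Variable F : mpoly 4 C.
Hypothesis hF : @has_class R d 3 (3 * d) F.
Hypothesis c30 : c3 F != 0.
Variables (p r : C * C).
Hypothesis dt0 : dt p r != 0.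
Local Notation P := (Pp F p r).
Local Notation q := (qp F p r).
Local Notation X := (@curve_complement R d (@zero_locus R d F)).
Variable x0 : X.
Local Notation ph := (phi dt0 x0).
Local Notation ch := (@chX R d F p r).
Local Notation ps := (@psX R d F p r).

Lemma ch_join (Lx : seq C) (y : X) (b0 w0 : C) : ch y -> (ps y).1 \notin Lx -> Om P q (b0, w0) -> b0 \notin Lx ->
  exists a : R -> X, pin (fun z => ch z /\ (ps z).1 \notin Lx) a y (ph (b0, w0)).
Proof.
move=> cy yL O0 b0L; have Oy := Om_psX hF c30 dt0 cy.
have [a [[ac a0 a1] ia]] := @joined R P q Lx (ps y).1 (ps y).2 b0 w0 Oy O0 yL b0L.
exists (fun t => ph (a (cl t))); split; first split.
- have Kc := cont_comp (@cl_c R) ac; have KO (t : R) : Om P q (a (cl t)) by have [] := ia _ (cl01 t).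
  exact: (phi_c hF c30 (K := fun t => a (cl t)) Kc KO).
- by rewrite clE ?a0 ?lexx ?ler01 // -surjective_pairing phi_psX.
- by rewrite clE ?a1 ?lexx ?ler01.
- move=> t _; have [O L] := ia _ (cl01 t).
  by split; [exact: chX_phi|rewrite psX_phi].
Qed.

Variables (x : X) (G : groupType) (f : {multiplicative pi1 R x -> G}).
Hypothesis fsurj : forall g, exists a, f a = g.
Hypothesis conn : forall y, exists a : R -> X, pth a x y.
Local Notation tau := (tau f conn).

(** Precomposition with the retraction onto [0, 1] is needed since a path is only controlled there. *)
Definition gch (a : R -> C * C) : G := tau (fun t => ph (a (cl t))).

Lemma gch_c (a : R -> C * C) : continuous a -> inside (Om P q) a -> continuous (fun t => ph (a (cl t))).
Proof.
move=> ac ia; have Kc := cont_comp (@cl_c R) ac; have KO (t : R) : Om P q (a (cl t)) := ia _ (cl01 t).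
exact: (phi_c hF c30 (K := fun t => a (cl t)) Kc KO).
Qed.

Lemma gch_flat : flat (Om P q) gch.
Proof.
have cl0 : cl 0 = 0 :> R by rewrite clE // lexx ler01.
have cl1 : cl 1 = 1 :> R by rewrite clE // lexx ler01.
split.
- move=> K Kc KO.
  have Kc' : continuous (fun z : R * R => ph (K (cl z.1, cl z.2))).
    have pc := cont_pair (cont_comp (@cont_fst R R) (@cl_c R)) (cont_comp (@cont_snd R R) (@cl_c R)).
    have Kc' := cont_comp pc Kc.
    have KO' (z : R * R) : Om P q (K (cl z.1, cl z.2)) by apply: KO; exact: cl01.
    exact: (phi_c hF c30 (K := fun z : R * R => K (cl z.1, cl z.2)) Kc' KO').
  by have := tau_square f conn Kc'; rewrite /= cl0 cl1.
- move=> a a' ac ac' e ia ia'; rewrite /gch -tau_cat; first last.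
  + by rewrite cl0 cl1 e.
  + exact: gch_c.
  + exact: gch_c.
  have pc := pcat_c ac ac' e.
  have io : inside (Om P q) (pcat a a').
    move=> t /andP[t0 t1]; rewrite /pcat; case: (leP t 2^-1) => h.
      by apply: ia; apply/andP; split; lra.
    by apply: ia'; apply/andP; split; lra.
  have e' : ph (a (cl 1)) = ph (a' (cl 0)) by rewrite cl0 cl1 e.
  apply: (tau_ext f conn (gch_c pc io) (pcat_c (gch_c ac ia) (gch_c ac' ia') e')).
  move=> t t01; rewrite clE //; move/andP: t01 => [t0 t1]; rewrite /pcat; case: (leP t 2^-1) => h.
    by rewrite clE //; apply/andP; split; lra.
  by rewrite clE //; apply/andP; split; lra.
- by move=> y _; exact: tau_cst.
- move=> a a' _ _ _ e; congr tau; apply/funext => t; congr ph; apply: e; exact: cl01.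
Qed.

Lemma ch_gen b0 z0 e1 e2 e3 (H : G -> Prop) : disc P q != 0 -> roots3 P q b0 e1 e2 e3 ->
  valid z0 e1 e2 e3 -> subg H ->
  H (mer (Om P q) gch b0 z0 e1) -> H (mer (Om P q) gch b0 z0 e2) -> H (mer (Om P q) gch b0 z0 e3) ->
  forall a, pin ch a (ph (b0, z0)) (ph (b0, z0)) -> H (tau a).
Proof.
move=> D0 r0 v0 sH h1 h2 h3 a [[ac a0 a1] ia].
have O0 := valid_Om r0 v0.
pose y t := ps (a (cl t)).
have chy t : ch (a (cl t)) by apply: ia; exact: cl01.
have acl : continuous (fun t => a (cl t)) := cont_comp (@cl_c R) ac.
have yc : continuous y.
  by move=> t; have pc := psX_c (chy t); exact: (at_comp (acl t) pc).
have iy : inside (Om P q) y by move=> t _; exact: Om_psX.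
have cl0 : cl 0 = 0 :> R by rewrite clE // lexx ler01.
have cl1 : cl 1 = 1 :> R by rewrite clE // lexx ler01.
have py : pth y (b0, z0) (b0, z0) by split=> //; rewrite /y ?cl0 ?cl1 ?a0 ?a1 psX_phi.
have -> : tau a = gch y.
  rewrite /gch; apply: (tau_ext f conn ac (gch_c yc iy)).
  by move=> t t01; rewrite /y phi_psX ?clE // -[in ch _](clE t01).
apply: (aff_gen gch_flat (Ls := proots (disc P q)) _ _ r0 v0 sH h1 h2 h3 py iy).
  by move=> b; rewrite mem_proots // => /disc_valid.
rewrite mem_proots //; exact: valid_disc r0 v0.
Qed.

End OneChart.

Lemma pin_sub {R : realType} (X : topologicalType) (A B : X -> Prop) (a : R -> X) y z :
  (forall w, A w -> B w) -> pin A a y z -> pin B a y z.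
Proof. by move=> AB [pa ia]; split; [exact: pa|move=> t t01; exact: AB (ia t t01)]. Qed.

Section Generation.
Context {R : realType} {d : nat}.
Local Notation C := R[i].
Variable F : mpoly 4 C.
Hypothesis hF : @has_class R d 3 (3 * d) F.
Hypothesis c30 : c3 F != 0.
Variables (p r : C * C).
Hypothesis dt0 : dt p r != 0.
Local Notation P := (Pp F p r).
Local Notation q := (qp F p r).
Local Notation P' := (Pp F r p).
Local Notation q' := (qp F r p).
Local Notation X := (@curve_complement R d (@zero_locus R d F)).
Local Notation ch := (@chX R d F p r).
Local Notation ch' := (@chX R d F r p).
Hypothesis D0 : disc P q != 0.

Lemma al_swap (y : C * C) : al r p y = be p r y.
Proof.
have N (u v : C * C) : dt u v = - dt v u by rewrite /dt; ring.
by rewrite /al /be [dt r p]N [dt y p]N invrN mulrNN.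
Qed.

Lemma chX_or (y : X) : ch y \/ ch' y.
Proof.
have hy : @cplx R d F (vX y) by have := valP (y : set_type (@cplx R d F)); rewrite inE.
rewrite -[vX y]prh_repr in hy; have [_ u0] := proj1 (cplxE _ hF) hy.
have [a0|a0] := eqVneq (al p r (bs (repr (vX y)))) 0; last by left.
right; split=> //; rewrite al_swap; apply: contraTneq (bs_neq0 (repr (vX y))) => b0.
by rewrite negbK (al_be dt0 (bs _)) a0 b0 !mul0r !addr0.
Qed.

Lemma chX_both (y : X) : ch y -> ch' y <-> (psX p r y).1 \notin [:: 0].
Proof.
move=> [a0 u0]; rewrite inE /psX /fco /= mulf_eq0 invr_eq0 (negbTE a0) orbF -al_swap.
by split=> [[]|].
Qed.

Lemma base_exists : exists b0 z0 e1 e2 e3 : C, [/\ b0 != 0, roots3 P q b0 e1 e2 e3 & valid z0 e1 e2 e3].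
Proof.
have X0 : ('X : {poly C}) != 0 by rewrite -size_poly_eq0 size_polyX.
have c := cof_and (cof_poly D0) (cof_poly X0).
have N : nbhs (0 : C) (fun=> True) by exact: (@near_all C 0 (fun=> True) (fun=> I)).
have [b _ [h1 h2]] := cof_open c N; rewrite hornerX in h2.
have [e1 [e2 [e3 [z [rb v]]]]] := disc_valid h1.
by exists b, z, e1, e2, e3.
Qed.

Lemma X_join (x0 : X) b0 w0 (y : X) : b0 != 0 -> Om P q (b0, w0) ->
  exists a : R -> X, pth a y (phi dt0 x0 (b0, w0)).
Proof.
move=> b00 O0; have [cy|cy] := chX_or y.
  by have [a [pa _]] := ch_join hF c30 dt0 x0 (Lx := [::]) cy isT O0 isT; exists a.
have O0' : Om P' q' (b0^-1, b0^-1 ^+ d * w0) by apply/(Om_swap hF).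
have [a [pa _]] := ch_join hF c30 (dt_swap dt0) x0 (Lx := [::]) cy isT O0' isT; exists a.
by rewrite -(phi_swap hF dt0).
Qed.

Lemma X_conn (x y : X) : exists a : R -> X, pth a x y.
Proof.
have [b0 [z0 [e1 [e2 [e3 [b00 r0 v0]]]]]] := base_exists.
have O0 := valid_Om r0 v0.
have [a pa] := X_join x x b00 O0; have [a' pa'] := X_join x y b00 O0.
by exists (pcat a (prev a')); exact: pcat_pth pa (prev_pth pa').
Qed.

Variables (x : X) (G : groupType) (f : {multiplicative pi1 R x -> G}).
Hypothesis fsurj : forall g, exists a, f a = g.

Definition gc : (R -> C * C) -> G := gch dt0 x f (X_conn x).

Lemma gc_flat : flat (Om P q) gc.
Proof. exact: gch_flat. Qed.

(** The two charts have a connected intersection [b != 0], and over a fibre in the intersection the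
    meridians computed in the two charts are the same by [mer_sc]. *)
Lemma gen_nonzero b0 z0 e1 e2 e3 (H : G -> Prop) : b0 != 0 -> roots3 P q b0 e1 e2 e3 ->
  valid z0 e1 e2 e3 -> subg H ->
  H (mer (Om P q) gc b0 z0 e1) -> H (mer (Om P q) gc b0 z0 e2) -> H (mer (Om P q) gc b0 z0 e3) ->
  forall h, H h.
Proof.
move=> b00 r0 v0 sH h1 h2 h3 h.
have O0 := valid_Om r0 v0.
have [x0 x0E] : exists x0, x0 = phi dt0 x (b0, z0) by eexists.
have [a [pa <-]] := tau_surj fsurj (X_conn x) x0 h.
have [n12 n13 n23] := valid_neq v0.
pose k := b0^-1 ^+ d.
have k0 : k != 0 by rewrite expf_neq0 // invr_eq0.
pose gc' := gch (dt_swap dt0) x f (X_conn x).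
have gf' : flat (Om P' q') gc' by exact: gch_flat.
have OmE w : Om P' q' (b0^-1, k * w) <-> Om P q (b0, w) by exact: Om_swap.
have xE : x0 = phi (dt_swap dt0) x (b0^-1, k * z0) by rewrite x0E phi_swap.
have gE z w : sin (Om P q) b0 z w -> gc' (sg b0^-1 (k * z) (k * w)) = gc (sg b0 z w).
  move=> _; rewrite /gc' /gc /gch; congr tau; apply/funext => t.
  by rewrite /sg -(phi_swap hF dt0) //; congr (phi _ _ (_, _)); rewrite /lin /k; ring.
have [h' [g1 g2 g3]] := valid_good r0 v0.
have m1 := mer_sc gc_flat gf' k0 OmE gE g1.
have m2 := mer_sc gc_flat gf' k0 OmE gE g2.
have m3 := mer_sc gc_flat gf' k0 OmE gE g3.
have v0' := valid_sc k0 v0; have r0' := roots3_sc hF b00 r0.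
have D0' := disc_swap_neq0 hF D0.
apply: (@two_opens _ _ _ _ f (X_conn x) x0 (fun i => if i then ch else ch') H _ _ _ _ _ sH _ a pa).
- by move=> y; have [c|c] := chX_or y; [exists true|exists false].
- by case=> y; exact: near_chX.
- by case; [rewrite x0E; exact: (chX_phi hF c30)|rewrite xE; apply: (chX_phi hF c30); apply/OmE].
- case=> y cy.
    have [c pc] := ch_join hF c30 dt0 x (Lx := [::]) cy isT O0 isT.
    exists c; rewrite x0E; apply: pin_sub pc => w [cw _]; exact: cw.
  have [c pc] := ch_join hF c30 (dt_swap dt0) x (Lx := [::]) cy isT (proj2 (OmE z0) O0) isT.
  exists c; rewrite xE; apply: pin_sub pc => w [cw _]; exact: cw.
- move=> y cy cy'.
  have b0L : b0 \notin [:: 0] by rewrite inE.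
  have [c pc] := ch_join hF c30 dt0 x cy (proj1 (chX_both cy) cy') O0 b0L.
  exists c; rewrite x0E; apply: pin_sub pc => w [cw lw]; split; first exact: cw.
  exact: (proj2 (chX_both cw) lw).
- case=> c pc; first by rewrite x0E in pc; exact: (ch_gen hF c30 D0 r0 v0 sH h1 h2 h3 pc).
  rewrite xE in pc.
  apply: (ch_gen hF c30 D0' r0' v0' sH _ _ _ pc); [rewrite m1|rewrite m2|rewrite m3]; assumption.
Qed.

(** The meridians of the fibre over [b] are, up to simultaneous conjugation, those of a neighbouring fibre,
    which can be chosen with [b != 0] and in which [gen_nonzero] applies. *)
Theorem meridians_generate b z e1 e2 e3 (H : G -> Prop) : roots3 P q b e1 e2 e3 ->
  valid z e1 e2 e3 -> subg H ->
  H (mer (Om P q) gc b z e1) -> H (mer (Om P q) gc b z e2) -> H (mer (Om P q) gc b z e3) ->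
  forall h, H h.
Proof.
move=> rb v sH h1 h2 h3 h.
pose T : topologicalType := (C * (C * (C * C)))%type.
have c0 : continuous (fun x : T => x.1) by exact: cont_fst.
have c1 : continuous (fun x : T => x.2.1) by exact: cont_comp (@cont_snd _ _) (@cont_fst _ _).
have c22 : continuous (fun x : T => x.2.2) by exact: cont_comp (@cont_snd _ _) (@cont_snd _ _).
have c2 : continuous (fun x : T => x.2.2.1) by exact: cont_comp c22 (@cont_fst _ _).
have c3' : continuous (fun x : T => x.2.2.2) by exact: cont_comp c22 (@cont_snd _ _).
pose t0 : T := (b, (e1, (e2, e3))).
have zc := @constC R T z.
have H1 := @near_valid R T _ _ _ _ t0 zc c1 c2 c3' v.
have H2 := @mers_near _ _ _ _ _ gc_flat T _ _ _ _ _ t0 c0 zc c1 c2 c3' rb v.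
have N := roots3_near rb (nearI H1 H2).
have X0 : ('X : {poly C}) != 0 by rewrite -size_poly_eq0 size_polyX.
have [b' [f1 [f2 [f3 [[/= v' m] r']]]] b0] := cof_open (cof_poly X0) N; rewrite hornerX in b0.
have [k /= [E1 E2 E3]] := m r'.
have sH' := subg_conj k sH.
have := @gen_nonzero _ _ _ _ _ _ b0 r' v' sH'.
rewrite E1 E2 E3 /cj !mulgA !mulgV !mul1g !mulgK => /(_ h1 h2 h3 (k^-1 * h * k)%g).
by rewrite !mulgA mulgV mul1g mulgK.
Qed.

End Generation.

(** * Irreducibility *)

Section Classes.
Context {R : realType} {d : nat}.
Local Notation C := R[i].
Local Notation coxpoly := (mpoly 4 C).
Local Notation has_class := (@has_class R d).
Implicit Types (G H : coxpoly) (x : C * C).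

Lemma class_add a b G H : has_class a b G -> has_class a b H -> has_class a b (G + H).
Proof. by move=> hG hH m /msuppD_le; rewrite mem_cat => /orP[/hG|/hH]. Qed.

Lemma class_scale a b (k : C) G : has_class a b G -> has_class a b (k *: G).
Proof. by move=> hG m /msuppZ_le /hG. Qed.

Lemma class_mul a b a' b' G H : has_class a b G -> has_class a' b' H ->
  has_class (a + a') (b + b') (G * H).
Proof.
move=> hG hH m /msuppM_le /allpairsP[[m1 m2] /= [/hG[h1 h2] /hH[h1' h2'] ->]].
by rewrite !mnmDE -h1 -h2 -h1' -h2' mulnDr; split; ring.
Qed.

Lemma class_one : has_class 0 0 1.
Proof.
move=> m; rewrite -mpolyC1 msuppC oner_eq0 inE => /eqP ->.
by rewrite !mnm0E muln0.
Qed.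

Lemma class_exp a b n G : has_class a b G -> has_class (n * a) (n * b) (G ^+ n).
Proof.
move=> hG; elim: n => [|n IH]; first by rewrite expr0; exact: class_one.
by rewrite exprS !mulSn; exact: class_mul.
Qed.

Lemma class_sum a b n (T : 'I_n -> coxpoly) : (forall i, has_class a b (T i)) ->
  has_class a b (\sum_i T i).
Proof.
move=> h; elim/big_ind: _ => // [m|]; last exact: class_add.
by rewrite msupp0.
Qed.

Definition V (i : nat) : coxpoly := mpolyX C (mnm1 (inord i)).

Lemma class_V :
  [/\ has_class 0 1 (V 0), has_class 0 1 (V 1), has_class 1 0 (V 2) & has_class 1 d (V 3)].
Proof.
by split=> m; rewrite msuppX inE => /eqP ->; rewrite !mnm1E -!val_eqE /= !inordK //= ?muln0 ?muln1.
Qed.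

Lemma ev_V i x u v : (i < 4)%N -> ev (V i) x u v = [:: x.1; x.2; u; v]`_i.
Proof. by move=> i4; rewrite /ev /V mevalXU /vec4 inordK. Qed.

Lemma ev_add G H x u v : ev (G + H) x u v = ev G x u v + ev H x u v.
Proof. exact: mevalD. Qed.
Lemma ev_mul G H x u v : ev (G * H) x u v = ev G x u v * ev H x u v.
Proof. exact: mevalM. Qed.
Lemma ev_opp G x u v : ev (- G) x u v = - ev G x u v.
Proof. exact: mevalN. Qed.
Lemma ev_scale (k : C) G x u v : ev (k *: G) x u v = k * ev G x u v.
Proof. exact: mevalZ. Qed.
Lemma ev_exp G n x u v : ev (G ^+ n) x u v = ev G x u v ^+ n.
Proof. by elim: n => [|n IH]; rewrite ?expr0 ?exprS ?ev_mul ?IH //; exact: meval1. Qed.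

Lemma class_opp a b G : has_class a b G -> has_class a b (- G).
Proof. by move=> hG; rewrite -scaleN1r; exact: class_scale. Qed.

Lemma locus_closed a b G : has_class a b G -> zariski_closed (@zero_locus R d G).
Proof. by move=> hG; exists [set G]; split=> [_ ->|]; [exists a, b|rewrite bigcap_set1]. Qed.

(** ** Homogenization *)

Variables (p r : C * C).

Definition alM : coxpoly := (r.2 / dt p r) *: V 0 - (r.1 / dt p r) *: V 1.
Definition beM : coxpoly := (p.1 / dt p r) *: V 1 - (p.2 / dt p r) *: V 0.

(** The form of degree [n] with dehomogenization [f] in the frame. *)
Definition hom (n : nat) (f : {poly C}) : coxpoly :=
  \sum_(i < n.+1) f`_i *: (alM ^+ (n - i) * beM ^+ i).

Lemma class_alM : has_class 0 1 alM.
Proof. by have [v0 v1 _ _] := class_V; apply: class_add; [|apply: class_opp]; exact: class_scale. Qed.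

Lemma class_beM : has_class 0 1 beM.
Proof. by have [v0 v1 _ _] := class_V; apply: class_add; [|apply: class_opp]; exact: class_scale. Qed.

Lemma class_hom n f : has_class 0 n (hom n f).
Proof.
apply: class_sum => i; apply: class_scale.
have := class_mul (class_exp (n := (n - i)%N) class_alM) (class_exp (n := i) class_beM).
by rewrite !muln0 !muln1 subnK // -ltnS.
Qed.

Lemma ev_alM x u v : ev alM x u v = al p r x.
Proof. by rewrite /alM ev_add ev_opp !ev_scale !ev_V //= /al [dt x r]/dt; ring. Qed.

Lemma ev_beM x u v : ev beM x u v = be p r x.
Proof. by rewrite /beM ev_add ev_opp !ev_scale !ev_V //= /be [dt p x]/dt; ring. Qed.

Hypothesis dt0 : dt p r != 0.

Lemma ev_hom n (f : {poly C}) b u v : (size f <= n.+1)%N -> ev (hom n f) (xb p r b) u v = f.[b].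
Proof.
move=> sf; rewrite (horner_coef_wide _ sf) /hom.
have -> : ev (\sum_(i < n.+1) f`_i *: (alM ^+ (n - i) * beM ^+ i)) (xb p r b) u v =
    \sum_(i < n.+1) ev (f`_i *: (alM ^+ (n - i) * beM ^+ i)) (xb p r b) u v.
  exact: raddf_sum.
apply: eq_bigr => i _; rewrite ev_scale ev_mul !ev_exp ev_alM ev_beM al_xb // be_xb //.
by rewrite expr1n mul1r.
Qed.

End Classes.

Section Irreducible.
Context {R : realType} {d : nat}.
Local Notation C := R[i].
Local Notation coxpoly := (mpoly 4 C).
Variable F : coxpoly.
Hypothesis hF : @has_class R d 3 (3 * d) F.
Hypothesis c30 : c3 F != 0.
Variables (p r : C * C).
Hypothesis dt0 : dt p r != 0.
Local Notation P := (Pp F p r).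
Local Notation q := (qp F p r).
Local Notation locus := (@zero_locus R d).

Lemma locus_cpt a b (G : coxpoly) y : @has_class R d a b G ->
  locus G (prh (cpt F dt0 y)) <-> ev G (xb p r y.1) 1 (y.2 - (shp F p r).[y.1]) = 0.
Proof. by move=> hG; rewrite shp_horner (zero_locus_pi _ hG) evE bs_mk fb_mk. Qed.

Lemma curve_cpt y : locus F (prh (cpt F dt0 y)) <-> cub P q y = 0.
Proof.
rewrite (locus_cpt _ hF) shp_horner (ev_cub hF c30) /cub Pp_horner qp_horner.
by split=> [/eqP|->]; rewrite ?mulr0 // mulf_eq0 (negbTE c30) /= => /eqP.
Qed.

(** The curve is contained in the union of the section [v = E] and of the residual bisection; it is
    contained in neither unless [3 E ^ 2 + P] vanishes, since the two meet only over its zeros. *)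
Theorem irr_no_section (E : {poly C}) : irreducible_set (locus F) ->
  (size E <= d.+1)%N -> cubp P q E = 0 -> 3%:P * E ^+ 2 + P = 0.
Proof.
move=> [_ irr] sE cE; apply/eqP; apply: contraT => n0.
pose Vh : coxpoly := V 3 + V 2 * hom p r d (shp F p r).
pose Eh := hom p r d E.
pose G1 : coxpoly := Vh - V 2 * Eh.
pose G2 : coxpoly := Vh ^+ 2 + V 2 * Eh * Vh + V 2 ^+ 2 * (Eh ^+ 2 + hom p r (2 * d) P).
have [v0 v1 v2 v3] := @class_V R d.
have cl_h n f := @class_hom R d p r n f.
have clVh : @has_class R d 1 d Vh.
  by apply: class_add => //; have := class_mul v2 (cl_h d (shp F p r)).
have clVE : @has_class R d 1 d (V 2 * Eh) by have := class_mul v2 (cl_h d E).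
have cl1 : @has_class R d 1 d G1 by apply: class_add => //; exact: class_opp.
have cl2 : @has_class R d 2 (2 * d) G2.
  apply: class_add; last first.
    have cE2 : @has_class R d 0 (2 * d) (Eh ^+ 2) by have := class_exp (n := 2) (cl_h d E); rewrite muln0.
    by have := class_mul (class_exp (n := 2) v2) (class_add cE2 (cl_h (2 * d)%N P)); rewrite muln1 muln0.
  apply: class_add; first by have := class_exp (n := 2) clVh; rewrite muln1.
  by rewrite mul2n -addnn; exact: (class_mul clVE clVh).
have cl2' : @has_class R d 2 (2 * d).+1 (alM p r * G2) by have := class_mul (@class_alM R d p r) cl2.
have eVh b w : ev Vh (xb p r b) 1 (w - (shp F p r).[b]) = w.
  by rewrite /Vh ev_add ev_mul !ev_V //= ev_hom ?size_shp // mul1r subrK.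
have eE b w : ev Eh (xb p r b) 1 w = E.[b] by rewrite ev_hom.
have {}eVh := eVh; clearbody Vh Eh.
have e1 (y : C * C) : ev G1 (xb p r y.1) 1 (y.2 - (shp F p r).[y.1]) = y.2 - E.[y.1].
  by rewrite /G1 ev_add ev_opp ev_mul eVh ev_V //= eE mul1r.
have e2 (y : C * C) : ev (alM p r * G2) (xb p r y.1) 1 (y.2 - (shp F p r).[y.1]) =
    y.2 ^+ 2 + E.[y.1] * y.2 + (E.[y.1] ^+ 2 + P.[y.1]).
  rewrite ev_mul ev_alM al_xb // mul1r /G2 !(ev_add, ev_mul, ev_exp) !ev_V //= eVh eE.
  by rewrite ev_hom ?(size_Pp hF) // expr1n !mul1r.
have cubE y : cub P q y = (y.2 - E.[y.1]) * (y.2 ^+ 2 + E.[y.1] * y.2 + (E.[y.1] ^+ 2 + P.[y.1])).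
  have := cubpE P q E y.1; rewrite cE horner0 /cub /= => /esym e0.
  by rewrite -[LHS]subr0 -e0; ring.
have [] := irr (locus G1) (locus (alM p r * G2)) (locus_closed cl1) (locus_closed cl2').
- move=> y Fy; rewrite -[y]prh_repr; set z := repr y.
  have Fz : ev F (bs z) (fb z).1 (fb z).2 = 0 by rewrite -evE.
  have u0 : (fb z).1 != 0.
    apply/eqP => u0; move: Fz; rewrite (ev_expand hF) u0 !expr0n /= !mulr0 !mul0r !add0r.
    move/eqP; rewrite mulf_eq0 (Ah3_cst hF _ (0, 0)) -/(c3 F) (negbTE c30) expf_eq0 /= => /eqP v00.
    move/negP: (fb_neq0 z); apply; apply/eqP; rewrite [fb z]surjective_pairing u0.
    by congr (_, _).
  have [a0|a0] := eqVneq (al p r (bs z)) 0.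
    by right; apply/(zero_locus_pi _ cl2'); rewrite evE ev_mul ev_alM a0 mul0r.
  have iz : inch p r z by [].
  have zE : @prh R d z = prh (cpt F dt0 (fco (d := d) F p r z)).
    by apply/pi_orbit; exact: cpt_fco.
  have : locus F (prh z) by rewrite prh_repr.
  rewrite zE => /curve_cpt; rewrite cubE => /eqP; rewrite mulf_eq0 => /orP[] /eqP h; [left|right].
    by apply/(locus_cpt _ cl1); rewrite e1.
  by apply/(locus_cpt _ cl2'); rewrite e2.
- move=> sub.
  have [b hb] : exists b, (3%:P * E ^+ 2 + P).[b] != 0.
    by apply: contrapT => /forallNP h; move/eqP: n0; apply; apply: (@eq_cof_poly _ _ [::]) => b _; apply/eqP; apply: contraT => /h.
  pose dd := sqrtC (E.[b] ^+ 2 - 4 * (E.[b] ^+ 2 + P.[b])).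
  pose w := (- E.[b] + dd) / 2.
  have n2 : (2 : C) != 0 by rewrite pnatr_eq0.
  have ww : w ^+ 2 + E.[b] * w + (E.[b] ^+ 2 + P.[b]) = 0.
    have dE : dd ^+ 2 = E.[b] ^+ 2 - 4 * (E.[b] ^+ 2 + P.[b]) := sqrtCK _.
    have -> : w ^+ 2 + E.[b] * w + (E.[b] ^+ 2 + P.[b]) =
       (dd ^+ 2 - E.[b] ^+ 2 + 4 * (E.[b] ^+ 2 + P.[b])) / 4 by rewrite /w; field.
    by rewrite dE; ring.
  clearbody w; have : locus F (prh (cpt F dt0 (b, w))) by apply/curve_cpt; rewrite cubE /= ww mulr0.
  move=> /sub /(locus_cpt _ cl1); rewrite e1 /= => /eqP; rewrite subr_eq0 => /eqP wE.
  move: hb; rewrite hornerD hornerM hornerC horner_exp.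
  have -> : 3 * E.[b] ^+ 2 + P.[b] = 0 by rewrite -[RHS]ww wE; ring.
  by rewrite eqxx.
- move=> sub.
  have [b hb] : exists b, (3%:P * E ^+ 2 + P).[b] != 0.
    by apply: contrapT => /forallNP h; move/eqP: n0; apply; apply: (@eq_cof_poly _ _ [::]) => b _; apply/eqP; apply: contraT => /h.
  have : locus F (prh (cpt F dt0 (b, E.[b]))) by apply/curve_cpt; rewrite cubE /= subrr mul0r.
  move=> /sub /(locus_cpt _ cl2'); rewrite e2 /= => h.
  move: hb; rewrite hornerD hornerM hornerC horner_exp -h => /eqP; case; ring.
Qed.

(** ** Degenerate equations *)

Hypothesis irr : irreducible_set (locus F).

Lemma no_section (E : {poly C}) : cubp P q E = 0 -> 3%:P * E ^+ 2 + P = 0.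
Proof.
move=> cE; apply: irr_no_section => //.
exact: (poly_root_size (size_Pp hF p r) (size_qp hF p r) cE).
Qed.

(** If [q = 0], then [v = 0] is a component. *)
Lemma q_zero : q = 0 -> P = 0.
Proof.
move=> q0; have := @no_section 0; rewrite /cubp q0 !expr0n /= !mulr0 !addr0 add0r.
exact.
Qed.

Lemma simple_slope (k : C) : k != 0 -> exists2 g : C, g ^+ 3 + k * g + k = 0 & 3 * g ^+ 2 + k != 0.
Proof.
move=> k0; have [e1 [e2 [e3 r3]]] := @roots3_exist R k%:P k%:P 0.
have rt v : v ^+ 3 + k * v + k = (v - e1) * (v - e2) * (v - e3).
  by have := r3 v; rewrite /cub /= !hornerC.
have [s3 kE _] := vieta r3; rewrite hornerC in kE.
have key (a b c : C) : (forall v, v ^+ 3 + k * v + k = (v - a) * (v - b) * (v - c)) ->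
    k = a * b + a * c + b * c -> c = - (a + b) -> a != b -> a != c ->
    exists2 g : C, g ^+ 3 + k * g + k = 0 & 3 * g ^+ 2 + k != 0.
  move=> h kk cc n1 n2; exists a; first by rewrite h subrr !mul0r.
  have -> : 3 * a ^+ 2 + k = (a - b) * (a - c) by rewrite kk cc; ring.
  by rewrite mulf_neq0 // subr_eq0.
have [e12|n12] := eqVneq e1 e2; last first.
  have [e13|n13] := eqVneq e1 e3; last exact: (key e1 e2 e3).
  have n21 : e2 != e1 by rewrite eq_sym.
  apply: (key e2 e1 e3) => //; [by move=> v; rewrite rt; ring|by rewrite kE; ring|by rewrite s3; ring|].
  by rewrite -e13 eq_sym.
have [e13|n13] := eqVneq e1 e3.
  have z1 : e1 = 0.
    have n3 : (3 : C) != 0 by rewrite pnatr_eq0.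
    apply: (mulfI n3); rewrite mulr0.
    have -> : 3 * e1 = e1 + e2 + e3 by rewrite -e12 -e13; ring.
    by rewrite s3; ring.
  by move: k0; rewrite kE -e12 -e13 z1 !mul0r !addr0 eqxx.
apply: (key e3 e1 e2) => //.
- by move=> v; rewrite rt; ring.
- by rewrite kE; ring.
- by rewrite s3; ring.
- by rewrite eq_sym.
- by rewrite -e12 eq_sym.
Qed.

(** If [P ^ 3 = k q ^ 2], then [P = k s ^ 2] and [q = k s ^ 3], and [g s] is a polynomial
    solution for each root [g] of [X ^ 3 + k X + k]. *)
Lemma not_proportional (k : C) : P != 0 -> k != 0 -> P ^+ 3 != k%:P * q ^+ 2.
Proof.
move=> P0 k0; apply/eqP => PE.
have Pq : P %| q.
  rewrite -(@dvdp_pexp2r _ P q 2) // -(dvdpZr _ _ k0) -mul_polyC -PE.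
  by rewrite dvdp_exp2l.
have [s qE] := dvdpP _ _ Pq.
have s2 : P = k%:P * s ^+ 2.
  have P2 : P ^+ 2 != 0 by rewrite expf_neq0.
  by apply: (mulIf P2); rewrite -exprS PE qE; ring.
have s0 : s != 0 by apply: contraNneq P0 => s0; rewrite s2 s0 expr0n mulr0.
have [g g3 g2] := simple_slope k0.
have := @no_section (g%:P * s); rewrite /cubp.
have -> : (g%:P * s) ^+ 3 + P * (g%:P * s) + q = (g ^+ 3 + k * g + k)%:P * s ^+ 3.
  by rewrite qE s2 !(polyCD, polyCM, polyC_exp); ring.
have -> : 3%:P * (g%:P * s) ^+ 2 + P = (3 * g ^+ 2 + k)%:P * s ^+ 2.
  by rewrite s2 !(polyCD, polyCM, polyC_exp); ring.
rewrite g3 mul0r => /(_ erefl) /eqP.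
by rewrite mulf_eq0 polyC_eq0 (negbTE g2) expf_eq0 (negbTE s0).
Qed.

End Irreducible.

Section Squarefree.
Context {R : realType} {d : nat}.
Local Notation C := R[i].
Local Notation coxpoly := (mpoly 4 C).
Implicit Types (F G : coxpoly).

Lemma Ah_coef0 F (m : multinom 4) : @has_class R d 3 (3 * d) F -> (m (inord 2) + m (inord 3) = 3)%N ->
  (m (inord 0) + m (inord 1) = (3 - m (inord 3)) * d)%N ->
  (Ap F (1, 0) (0, 1) (m (inord 3)))`_(m (inord 1)) = mcoeff m F.
Proof.
move=> hF d1 d2; have [mF|mF] := boolP (m \in msupp F); first exact: (Ah_coef hF mF).
rewrite (memN_msupp_eq0 mF) /Ap coef_sum big_seq_cond big1 // => m' /andP[m'F /eqP e3].
rewrite scale0r addr0 expr1n mul1r add0r scale1r coefZ coefXn; case: eqP => [e1|_]; last by rewrite mulr0.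
case/negP: mF; suff -> : m = m' by [].
have [b1 b2] := class_deg hF m'F; rewrite e3 -e1 in b1 b2.
apply/mnmP => i; rewrite -(inord_val i); case: i => -[|[|[|[|//]]]] /= _.
- by apply: (@addIn (m (inord 1))); rewrite d2 b2.
- by rewrite -e1.
- by apply: (@addIn (m (inord 3))); rewrite d1 b1.
- by rewrite e3.
Qed.

(** The equation is recovered from its values on one chart, coefficient by coefficient. *)
Lemma class_eq F G : @has_class R d 3 (3 * d) F -> @has_class R d 3 (3 * d) G ->
  (forall b v, ev F (xb (1, 0) (0, 1) b) 1 v = ev G (xb (1, 0) (0, 1) b) 1 v) -> F = G.
Proof.
move=> hF hG e.
have A j b : Ah F j (xb (1, 0) (0, 1) b) = Ah G j (xb (1, 0) (0, 1) b) \/ (3 < j)%N.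
  case: (ltnP 3 j) => [|j3]; [by right|left].
  pose f H : {poly C} := \poly_(i < 4) Ah H i (xb (1, 0) (0, 1) b).
  have fE H v : @has_class R d 3 (3 * d) H -> (f H).[v] = ev H (xb (1, 0) (0, 1) b) 1 v.
    move=> hH; rewrite (ev_expand hH) horner_poly !big_ord_recl big_ord0 /= /bump /=; ring.
  have : f F = f G.
    apply/eqP; rewrite -subr_eq0; apply/eqP; apply: (@eq_cof_poly _ _ [::]) => v _.
    by rewrite hornerD hornerN !fE // e subrr.
  by move/(congr1 (fun h : {poly C} => h`_j)); rewrite !coef_poly ltnS j3.
have Ape j : (j <= 3)%N -> Ap F (1, 0) (0, 1) j = Ap G (1, 0) (0, 1) j.
  move=> j3; apply/eqP; rewrite -subr_eq0; apply/eqP; apply: (@eq_cof_poly _ _ [::]) => b _.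
  rewrite hornerD hornerN !Ap_horner; case: (A j b) => [->|]; first exact: subrr.
  by rewrite ltnNge j3.
have mk (m : multinom 4) : (m (inord 2) + m (inord 3) = 3)%N ->
    (m (inord 0) + m (inord 1) = (3 - m (inord 3)) * d)%N -> mcoeff m F = mcoeff m G.
  move=> d1 d2; rewrite -(Ah_coef0 hF d1 d2) -(Ah_coef0 hG d1 d2) Ape //.
  have le3 (a b : nat) : (a + b = 3)%N -> (b <= 3)%N by clear; lia.
  exact: le3 d1.
apply/mpolyP => m; have [mF|mF] := boolP (m \in msupp F).
  by have [d1 d2] := class_deg hF mF; exact: mk.
have [mG|mG] := boolP (m \in msupp G); first by have [d1 d2] := class_deg hG mG; exact: mk.
by rewrite !memN_msupp_eq0.
Qed.

(** Otherwise the equation is a constant multiple of the cube of [v + shp u]. *)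
Lemma squarefree_nonzero F : @has_class R d 3 (3 * d) F -> c3 F != 0 -> squarefree F ->
  ~ (Pp F (1, 0) (0, 1) = 0 /\ qp F (1, 0) (0, 1) = 0).
Proof.
move=> hF c30 sF [P0 q0].
have dt0 : dt ((1, 0) : C * C) (0, 1) != 0 by rewrite /dt /= mulr1 mul0r subr0 oner_eq0.
have [v0 v1 v2 v3] := @class_V R d.
pose G : coxpoly := V 3 + V 2 * hom (1, 0) (0, 1) d (shp F (1, 0) (0, 1)).
have clG : @has_class R d 1 d G.
  by apply: class_add => //; have := class_mul v2 (@class_hom R d (1, 0) (0, 1) d (shp F (1, 0) (0, 1))).
have eG b v : ev G (xb (1, 0) (0, 1) b) 1 v = v + (shp F (1, 0) (0, 1)).[b].
  by rewrite /G ev_add ev_mul !ev_V //= ev_hom ?(size_shp hF) // mul1r.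
have FE : F = G ^+ 2 * (c3 F *: G).
  apply: class_eq => //.
    have := class_mul (class_exp (n := 2) clG) (class_scale (k := c3 F) clG).
    by rewrite muln1 -mulSnr.
  move=> b v; rewrite ev_mul ev_exp ev_scale eG.
  rewrite -[v in LHS](addrK (shp F (1, 0) (0, 1)).[b]) {2}shp_horner (ev_cub hF c30).
  by rewrite -Pp_horner -qp_horner P0 q0 !horner0 mul0r !addr0; ring.
have uG := sF _ _ FE.
have := eG 0 (- (shp F (1, 0) (0, 1)).[0]); rewrite addNr => eG0.
have := ev_mul G G^-1 (xb (1, 0) (0, 1) 0) 1 (- (shp F (1, 0) (0, 1)).[0]).
rewrite mulrV // eG0 mul0r /ev meval1 => /eqP; by rewrite oner_eq0.
Qed.

End Squarefree.

(** * Abelian groups with two generators *)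

Lemma kill_mul (B : zmodType) (w : B) (n : nat) (l : int) : w *+ n = 0 -> w *~ (l * n) = 0.
Proof. by move=> h; rewrite mulrC mulrzA -[w *~ n]/(w *+ n) h mul0rz. Qed.

Lemma kill_mod (B : zmodType) (w : B) (n : nat) (k : int) : w *+ n = 0 -> w *~ (k %% n)%Z = w *~ k.
Proof. by move=> h; rewrite [in RHS](divz_eq k n) [RHS]mulrzDr kill_mul // add0r. Qed.

Section TwoGenerators.
Variable Q : zmodType.
Implicit Types (x y u : Q).

Definition spans (d : Q * Q) := forall u, exists i j : int, u = d.1 *~ i + d.2 *~ j.

Lemma spans_swap x y : spans (x, y) -> spans (y, x).
Proof. by move=> s u; have [i [j ->]] := s u; exists j, i; rewrite addrC. Qed.

Lemma spans_add x y (k : int) : spans (x, y) -> spans (y, x + y *~ k).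
Proof.
move=> s u; have [i [j ->]] := s u; exists (j - k * i), i => /=.
by rewrite mulrzBr mulrzDl -!mulrzA; rewrite addrCA [k * i]mulrC subrK.
Qed.

(** Take generators with a relation whose first coefficient [d1] is the smallest positive one among all
    relations of all pairs of generators. By division with remainder [d1] divides every coefficient, and
    the pair can be changed so that [d1] kills the first generator. *)
Theorem smith2 x y : spans (x, y) -> exists x' y' (d1 d2 : nat), [/\ spans (x', y'), (d1 %| d2)%N &
  forall i j : int, x' *~ i + y' *~ j = 0 <-> (d1%:Z %| i)%Z /\ (d2%:Z %| j)%Z].
Proof.
move=> sxy.
pose rel n := (0 < n)%N /\ exists x y (j : int), spans (x, y) /\ x *+ n + y *~ j = 0.
have [[n0 rn]|nr] := pselect (exists n, rel n); last first.
  have key a b (i j : int) : spans (a, b) -> a *~ i + b *~ j = 0 -> i = 0.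
    move=> s h; apply/eqP; apply: contraT => i0; case: nr; exists `|i|%N; split; first by rewrite absz_gt0.
    exists a, b; case: (intP i) i0 h => // n _ h; first by exists j.
    by exists (- j); split=> //; apply: oppr_inj; rewrite oppr0 -h opprD mulrNz opprK mulrNz.
  exists x, y, 0%N, 0%N; split=> // i j; rewrite !dvd0z; split.
    move=> h; have i0 := key _ _ _ _ sxy h; rewrite i0 eqxx; split=> //.
    apply/eqP; apply: (key y x j i (spans_swap sxy)); by rewrite addrC.
  by move=> [/eqP -> /eqP ->]; rewrite !mulr0z addr0.
have ex : exists n, `[< rel n >] by exists n0; exact/asboolP.
case: (ex_minnP ex) => d1 /asboolP[d10 [a [b [j [sab jE]]]]] dmin.
have d1z : d1%:Z != 0 by rewrite eqz_nat -lt0n.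
have d1p : 0 < d1%:Z by rewrite ltz_nat.
(* a relation whose first coefficient is less than [d1] *)
have small a' b' (i j' : int) : spans (a', b') -> 0 <= i -> i < d1%:Z -> a' *~ i + b' *~ j' = 0 -> i = 0.
  case: i => // n s _; rewrite ltz_nat => nd h; congr Posz; apply/eqP; apply: contraT; rewrite -lt0n => n0'.
  have : (d1 <= n)%N by apply: dmin; apply/asboolP; split=> //; exists a', b', j'.
  by rewrite leqNgt nd.
pose x' := a + b *~ (j %/ d1)%Z.
have sx : spans (b, x') by exact: spans_add.
have jE' := divz_eq j d1.
have r0 : (j %% d1)%Z = 0.
  apply: (small b x' _ d1%:Z sx (modz_ge0 _ d1z) (ltz_pmod _ d1p)).
  have h : a *+ d1 + b *~ ((j %/ d1)%Z * d1 + (j %% d1)%Z) = 0 by rewrite -jE'.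
  rewrite mulrzDr mulrzA addrA [LHS]addrC in h; rewrite /x' mulrzDl; exact: h.
have dx : x' *+ d1 = 0.
  by rewrite -[RHS]jE [in RHS]jE' r0 addr0 /x' mulrnDl mulrzA.
have sxb := spans_swap sx.
have first i k : x' *~ i + b *~ k = 0 -> (d1%:Z %| i)%Z.
  move=> h; apply/dvdz_mod0P; apply: (small x' b _ k sxb (modz_ge0 _ d1z) (ltz_pmod _ d1p)).
  by rewrite kill_mod.
have kill i : (d1%:Z %| i)%Z -> x' *~ i = 0.
  by move=> /dvdzP[k ->]; rewrite kill_mul.
have [[n1 [n10 bn]]|nb] := pselect (exists n, (0 < n)%N /\ b *+ n = 0); last first.
  have key k : b *~ k = 0 -> k = 0.
    move=> h; apply/eqP; apply: contraT => k0; case: nb; exists `|k|%N; split; first by rewrite absz_gt0.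
    by case: (intP k) k0 h => // n _ h; apply: oppr_inj; rewrite oppr0 -h mulrNz.
  exists x', b, d1, 0%N; split=> // i k; rewrite dvd0z; split.
    move=> h; have fi := first _ _ h; split=> //; apply/eqP/key.
    by rewrite kill // add0r in h.
  by move=> [/kill -> /eqP ->]; rewrite mulr0z addr0.
have exb : exists n, (0 < n)%N && (b *+ n == 0) by exists n1; rewrite n10 bn eqxx.
case: (ex_minnP exb) => d2 /andP[d20 /eqP bd] bmin.
have d2z : d2%:Z != 0 by rewrite eqz_nat -lt0n.
have d2p : 0 < d2%:Z by rewrite ltz_nat.
exists x', b, d1, d2; split=> //.
  rewrite -[(d1 %| d2)%N]/(d1%:Z %| d2%:Z)%Z; apply/dvdz_mod0P.
  apply: (small b (x' + b *~ (d2 %/ d1)%Z) _ d1%:Z (spans_add _ sxb) (modz_ge0 _ d1z) (ltz_pmod _ d1p)).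
  rewrite mulrzDl -mulrzA -[X in _ + (X + _)]/(x' *+ d1) dx add0r -mulrzDr addrC -divz_eq; exact: bd.
move=> i k; split.
  move=> h; have fi := first _ _ h; split=> //; rewrite kill // add0r in h.
  apply/dvdz_mod0P; have := modz_ge0 k d2z; have := ltz_pmod k d2p.
  have : b *~ (k %% d2)%Z = 0.
    by rewrite kill_mod.
  case: (k %% d2)%Z => // n bn'; rewrite ltz_nat => nd _; congr Posz; apply/eqP.
  apply: contraT; rewrite -lt0n => n0'; have : (d2 <= n)%N by apply: bmin; rewrite n0'; apply/eqP.
  by rewrite leqNgt nd.
by move=> [/kill -> /dvdzP[m ->]]; rewrite kill_mul // addr0.
Qed.

(** The coordinates of an element are determined modulo [d1] and [d2], which kill [u] and [v]. *)
Lemma hom_out x y (d1 d2 : nat) (B : zmodType) (u v : B) : spans (x, y) ->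
  (forall i j : int, x *~ i + y *~ j = 0 <-> (d1%:Z %| i)%Z /\ (d2%:Z %| j)%Z) ->
  u *+ d1 = 0 -> v *+ d2 = 0 ->
  exists f : {additive Q -> B}, forall i j : int, f (x *~ i + y *~ j) = u *~ i + v *~ j.
Proof.
move=> sxy rel u0 v0.
have ex z : exists c : int * int, z = x *~ c.1 + y *~ c.2.
  by have [i [j ->]] := sxy z; exists (i, j).
pose c z := projT1 (cid (ex z)).
have cE z : z = x *~ (c z).1 + y *~ (c z).2 := projT2 (cid (ex z)).
pose f z : B := u *~ (c z).1 + v *~ (c z).2.
have fE i j : f (x *~ i + y *~ j) = u *~ i + v *~ j.
  have h := cE (x *~ i + y *~ j); rewrite /f; move: (c _) h => [k l] /= h.
  have : x *~ (i - k) + y *~ (j - l) = 0.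
    by rewrite !mulrzBr addrACA h -opprD subrr.
  move=> /rel[/dvdzP[m iE] /dvdzP[m' jE]].
  have -> : i = k + m * d1 by rewrite -iE addrC subrK.
  have -> : j = l + m' * d2 by rewrite -jE addrC subrK.
  by rewrite !mulrzDr !kill_mul // !addr0.
have fD : zmod_morphism f.
  move=> z w; rewrite {1}(cE z) {1}(cE w) opprD addrACA -!mulrzBr fE !mulrzBr.
  by rewrite /f opprD addrACA.
pose fa := GRing.isZmodMorphism.Build _ _ f fD.
by exists (HB.pack_for {additive Q -> B} f fa).
Qed.

End TwoGenerators.

(** ** Generalized dihedral groups: weights and words *)

Section Words.
Variable Q : zmodType.
Implicit Types (d : Q * Q).

(* up to sign, [tT] is the map (x, y) -> (x - y, y) *)
Definition tT : seq bool := [:: false; true; true].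

Lemma act_cat l l' d : act (l ++ l') d = act l (act l' d).
Proof. by rewrite /act foldr_cat. Qed.

Definition tpow (k : nat) : seq bool := flatten (nseq k tT).

Lemma act_tpow k d : act (tpow k) d = iter k (@shear Q) d.
Proof. by elim: k => // k IH; rewrite /tpow /= -/(tpow k) -[LHS]/(shear (act (tpow k) d)) IH. Qed.

Lemma act_tpow2 k d : pm (d.1 - d.2 *+ k, d.2) (act (tpow k) d).
Proof. by rewrite act_tpow; exact: shear_iter. Qed.

(* the word whose second component is, up to sign, [d.1 - d.2 *+ k] *)
Definition wrow (k : nat) : seq bool := false :: tpow k.

Lemma wrow_act k d : (act (wrow k) d).2 = d.1 - d.2 *+ k \/ (act (wrow k) d).2 = - (d.1 - d.2 *+ k).
Proof.
have -> : act (wrow k) d = quard (act (tpow k) d) by [].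
by case: (act_tpow2 k d) => -> /=; [left|right].
Qed.

(* the word whose second component is, up to sign, [d.1 *+ m + d.2 *+ (1 - m * k)] *)
Definition wrow2 (m k : nat) : seq bool := false :: tpow m ++ wrow k.

Lemma wrow2_act m k d : let y := (d.1 - d.2 *+ k) *+ m + d.2 in
  (act (wrow2 m k) d).2 = y \/ (act (wrow2 m k) d).2 = - y.
Proof.
move=> y.
have -> : act (wrow2 m k) d = quard (act (tpow m) (act (wrow k) d)) by rewrite -act_cat.
set e := act (wrow k) d.
have [E|E] : pm (- d.2, d.1 - d.2 *+ k) e.
  have -> : e = quard (act (tpow k) d) by [].
  by have /pm_quard := act_tpow2 k d.
- clearbody e; case: (act_tpow2 m e) => -> /=; rewrite E /= ?opprK; [right|left].
    by rewrite /y opprD addrC.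
  by rewrite /y opprB opprK.
- clearbody e; case: (act_tpow2 m e) => -> /=; rewrite E /= ?opprK; [left|right].
    by rewrite /y mulNrn opprK addrC.
  by rewrite /y mulNrn opprK addrC.
Qed.

End Words.

(** * Groups that are not groups of translations *)

Section Exponent.
Variables (Q : zmodType) (n : nat).
Hypothesis (n0 : (0 < n)%N) (kill : forall y : Q, y *+ n = 0).
Implicit Types (y : Q).

Lemma ord_ex y : exists m, (0 < m)%N && (y *+ m == 0).
Proof. by exists n; rewrite n0 kill eqxx. Qed.

Definition ordz y : nat := ex_minn (ord_ex y).

Lemma ordzP y : [/\ (0 < ordz y)%N, y *+ ordz y = 0 & forall j, (0 < j < ordz y)%N -> y *+ j != 0].
Proof.
rewrite /ordz; case: ex_minnP => m /andP[m0 /eqP ym] mmin; split=> // j /andP[j0 jm].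
apply: contraL jm => yj; rewrite -leqNgt; apply: mmin; by rewrite j0.
Qed.

Lemma ordz_dvd y k : y *+ k = 0 -> (ordz y %| k)%N.
Proof.
have [o0 oy omin] := ordzP y; move=> yk.
have : y *+ (k %% ordz y) = 0.
  by have := yk; rewrite {1}(divn_eq k (ordz y)) mulrnDr mulnC mulrnA oy mul0rn add0r.
have := ltn_pmod k o0; rewrite /dvdn; case: (k %% ordz y)%N => // m lt e.
by have := omin m.+1 lt; rewrite e eqxx.
Qed.

(** The order of [y] is the width of the cusp of a pair [(x, y)], the length of the orbit in [cusp_count]. *)
Definition wt y : nat := (n %/ ordz y)%N.

Lemma wt_ord y : (n = ordz y * wt y)%N.
Proof. by rewrite mulnC /wt divnK // ordz_dvd. Qed.

Lemma wt_le y t : (forall m, (0 < m)%N -> y *+ m = 0 -> (n <= t * m)%N) -> (wt y <= t)%N.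
Proof.
move=> h; have [o0 oy _] := ordzP y; have := h _ o0 oy.
by rewrite {1}[n](wt_ord y) mulnC leq_pmul2r.
Qed.

Lemma wtN y : wt (- y) = wt y.
Proof.
rewrite /wt; congr (_ %/ _)%N; apply/eqP; rewrite eqn_dvd.
have [_ oy _] := ordzP y; have [_ oy' _] := ordzP (- y).
by rewrite !ordz_dvd ?mulNrn ?oy ?oppr0 //; apply: oppr_inj; rewrite -mulNrn oy' oppr0.
Qed.

Lemma wt_cusp y : exists2 m, (n <= m * wt y)%N & forall j, (0 < j < m)%N -> y *+ j != 0.
Proof. by exists (ordz y); [rewrite -wt_ord|have [] := ordzP y]. Qed.

Lemma odd_no2 y : odd n -> y + y = 0 -> y = 0.
Proof.
move=> on; rewrite -mulr2n => y2; have := kill y.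
by rewrite -(odd_double_half n) on mulrnDr mulr1n -mul2n mulrnA y2 mul0rn addr0.
Qed.

End Exponent.

Section Generating.
Variable Q : zmodType.

Lemma mulrz_mulrn (w : Q) (i : int) k : w *~ i *+ k = (w *+ k) *~ i.
Proof. by rewrite pmulrn [in RHS]pmulrn -!mulrzA mulrC. Qed.

Lemma nofix_rotd (u : Q) : u *+ 3 != 0 -> nofix (@spans Q) (@rotd Q).
Proof.
move=> u3 [x y] s h; case/eqP: u3; have [i [j ->]] := s u.
case: h => -[/= h1 h2].
  have y2 : y = - x by rewrite -h2.
  have x3 : x *+ 3 = 0.
    by rewrite mulrS mulr2n -{1}h1 y2 -opprD addNr.
  by rewrite mulrnDl !mulrz_mulrn /= y2 mulNrn x3 oppr0 !mul0rz addr0.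
have y0 : y = 0 by apply: (addIr (- x)); rewrite h1 add0r.
have x0 : x = 0 by apply: oppr_inj; rewrite h2 y0 !oppr0.
by rewrite x0 y0 !mul0rz addr0 mul0rn.
Qed.

Lemma nofix_quard (u : Q) : u + u != 0 -> nofix (@spans Q) (@quard Q).
Proof.
move=> u2 [x y] s h; case/eqP: u2; have [i [j ->]] := s u.
have [yx x2] : y = x /\ x + x = 0.
  case: h => -[/= h1 h2]; first by split; [rewrite h2|rewrite -{1}h1 h2 addNr].
  have yx : y = x by apply: oppr_inj.
  by split=> //; rewrite {1}h2 yx addNr.
by rewrite /= yx addrACA -!mulrzDl x2 !mul0rz addr0.
Qed.

End Generating.

(** The numerical conditions under which [contradiction] applies. The words are coset representatives of
    the stabilizer of a cusp, enough of them to bring the average of the weight down to [n / 6]. *)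
Definition bad (Q : zmodType) := exists (n : nat) (w : Q -> nat) (words : seq (seq bool)),
  [/\ forall y, w (- y) = w y,
      forall y, exists2 m, (n <= m * w y)%N & forall j, (0 < j < m)%N -> y *+ j != 0,
      forall y : Q, y + y = 0 -> y = 0,
      nofix (@spans Q) (@rotd Q) /\ nofix (@spans Q) (@quard Q) &
      [/\ (0 < n)%N, (0 < size words)%N &
        forall d, spans d -> (6 * \sum_(l <- words) w (act l d).2 <= n * size words)%N]].

Lemma bad_exponent (Q : zmodType) (n : nat) (u : Q) (words : seq (seq bool)) (n0 : (0 < n)%N)
    (kill : forall y : Q, y *+ n = 0) : odd n -> u *+ 3 != 0 -> (0 < size words)%N ->
  (forall d, spans d -> (6 * \sum_(l <- words) wt n0 kill (act l d).2 <= n * size words)%N) -> bad Q.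
Proof.
move=> on u3 w0 h; exists n, (wt n0 kill), words; split.
- exact: wtN.
- exact: wt_cusp.
- by move=> y; exact: (@odd_no2 Q n (kill) y on).
- split; first exact: nofix_rotd u3.
  apply: (nofix_quard (u := u)); apply: contra_neq u3 => u2.
  by rewrite (@odd_no2 Q n (kill) u on u2) mul0rn.
- by [].
Qed.

Section Cyclic.
Variable n' : nat.
Local Notation n := n'.+2.
Local Notation Zn := 'Z_n.

Lemma Zn_kill (y : Zn) : y *+ n = 0.
Proof. by rewrite -mulr_natr pchar_Zp // mulr0. Qed.

Lemma natZ (z : Zn) : z = (nat_of_ord z)%:R.
Proof. by rewrite natr_Zp. Qed.

Lemma natZ0 k : (k%:R == 0 :> Zn) = (n %| k)%N.
Proof. by rewrite -val_eqE /= Zp_nat /= /dvdn. Qed.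

Lemma wt_Zn (k : nat) : (wt (isT : (0 < n)%N) Zn_kill k%:R <= gcdn n k)%N.
Proof.
apply: wt_le => m m0 /eqP; rewrite -mulrnA natZ0 => h.
apply: dvdn_leq; first by rewrite muln_gt0 m0 gcdn_gt0.
by rewrite muln_gcdl dvdn_gcd dvdn_mulr.
Qed.

Lemma spans_coprime (x y : nat) : spans (x%:R : Zn, y%:R : Zn) -> coprime n (gcdn x y).
Proof.
move=> s; rewrite /coprime; set g := gcdn n _.
have g0 : (0 < g)%N by rewrite gcdn_gt0.
have gn : (g %| n)%N by exact: dvdn_gcdl.
have gx : (g %| x)%N by apply: dvdn_trans (dvdn_gcdr _ _) (dvdn_gcdl _ _).
have gy : (g %| y)%N by apply: dvdn_trans (dvdn_gcdr _ _) (dvdn_gcdr _ _).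
have kz z : (g %| z)%N -> (z%:R : Zn) *+ (n %/ g) = 0.
  move=> gz; apply/eqP; rewrite -mulrnA natZ0 -(divnK gz) mulnAC -mulnA divnK //.
  by rewrite dvdn_mull.
have [i [j /= h]] := s 1.
have : (1 : Zn) *+ (n %/ g) == 0 by rewrite h mulrnDl !mulrz_mulrn !kz // !mul0rz addr0.
rewrite -[1]/(1%:R) -mulrnA mul1n natZ0 => h1.
have q0 : (0 < n %/ g)%N by rewrite divn_gt0 // dvdn_leq.
have := dvdn_leq q0 h1; rewrite -{1}[n](divnK gn); case: (g) g0 q0 => [|[|k]] // _.
by move: (n %/ _)%N => a a0; rewrite leqNgt -{1}[a]muln1 ltn_pmul2l.
Qed.

(* the weights for the words [wrow k], with [n - y] in the role of [- y] *)
Definition rows1 (m x y : nat) : nat :=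
  gcdn n y + \sum_(k <- iota 0 m) gcdn n (x + (n - y) * k).

(** The words [wrow k] and the empty one represent the points [(1, - k)] and [(0, 1)] of the projective line
    over [Z_n]; some of them suffice for the orders below, except for [n = 15]. *)
Lemma bad_cyclic m : odd n -> ~~ (n %| 3)%N ->
  (forall x y : nat, (x < n)%N -> (y < n)%N -> coprime n (gcdn x y) -> (6 * rows1 m x y <= n * m.+1)%N) ->
  bad Zn.
Proof.
move=> on n3 h; pose words := [::] :: [seq wrow k | k <- iota 0 m].
have sw : size words = m.+1 by rewrite /= size_map size_iota.
apply: (@bad_exponent _ n 1 words isT Zn_kill on).
- by rewrite -[1]/(1%:R) -mulrnA mul1n natZ0.
- by rewrite sw.
move=> [x y] s; rewrite sw.
have cxy : coprime n (gcdn x y) by apply: spans_coprime; rewrite !natr_Zp.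
apply: leq_trans (h x y (ltn_ord x) (ltn_ord y) cxy).
rewrite leq_pmul2l // big_cons big_map /rows1; apply: leq_add.
  by rewrite /= {1}[y]natZ wt_Zn.
apply: leq_sum => k _.
have E : x - y *+ k = (nat_of_ord x + (n - nat_of_ord y) * k)%:R :> Zn.
  rewrite natrD natrM natrB; last exact/ltnW/ltn_ord.
  by rewrite pchar_Zp // sub0r -!natZ mulNr mulr_natr.
case: (wrow_act k (x, y)) => -> /=; rewrite ?wtN E; exact: wt_Zn.
Qed.

Definition rows2 (y : nat) (x : nat) (m k : nat) := gcdn n ((x + (n - y) * k) * m + y).

(** For a composite [n] the projective line has further points, represented by the words [wrow2]. *)
Lemma bad_cyclic2 m (mk : seq (nat * nat)) : odd n -> ~~ (n %| 3)%N ->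
  (forall x y : nat, (x < n)%N -> (y < n)%N -> coprime n (gcdn x y) ->
    (6 * (rows1 m x y + \sum_(i <- mk) rows2 y x i.1 i.2) <= n * (m.+1 + size mk))%N) ->
  bad Zn.
Proof.
move=> on n3 h; pose words := ([::] :: [seq wrow k | k <- iota 0 m]) ++ [seq wrow2 i.1 i.2 | i <- mk].
have sw : size words = (m.+1 + size mk)%N by rewrite size_cat /= !size_map size_iota.
apply: (@bad_exponent _ n 1 words isT Zn_kill on).
- by rewrite -[1]/(1%:R) -mulrnA mul1n natZ0.
- by rewrite sw.
move=> [x y] s; rewrite sw.
have cxy : coprime n (gcdn x y) by apply: spans_coprime; rewrite !natr_Zp.
apply: leq_trans (h x y (ltn_ord x) (ltn_ord y) cxy).
have E k : x - y *+ k = (nat_of_ord x + (n - nat_of_ord y) * k)%:R :> Zn.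
  rewrite natrD natrM natrB; last exact/ltnW/ltn_ord.
  by rewrite pchar_Zp // sub0r -!natZ mulNr mulr_natr.
rewrite leq_pmul2l // big_cat big_cons !big_map /rows1; apply: leq_add; first apply: leq_add.
- by rewrite /= {1}[y]natZ wt_Zn.
- by apply: leq_sum => k _; case: (wrow_act k (x, y)) => -> /=; rewrite ?wtN E; exact: wt_Zn.
apply: leq_sum => -[u k] _ /=.
have E2 : (x - y *+ k) *+ u + y = ((nat_of_ord x + (n - nat_of_ord y) * k) * u + nat_of_ord y)%:R :> Zn.
  by rewrite natrD natrM E mulr_natr -natZ.
case: (wrow2_act u k (x, y)) => /= ->; rewrite ?wtN E2; exact: wt_Zn.
Qed.

End Cyclic.

Definition check1 (n m : nat) : bool :=
  all (fun x => all (fun y => coprime n (gcdn x y) ==>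
    (6 * (gcdn n y + foldr (fun k s => gcdn n (x + (n - y) * k) + s) 0 (iota 0 m)) <= n * m.+1)%N)
      (iota 0 n)) (iota 0 n).

Lemma check1P n' m : odd n'.+2 -> ~~ (n'.+2 %| 3)%N -> check1 n'.+2 m -> bad 'Z_n'.+2.
Proof.
move=> on n3 /allP h; apply: (bad_cyclic (m := m) on n3) => x y xn yn c.
have := h x; rewrite mem_iota => /(_ xn)/allP/(_ y); rewrite mem_iota => /(_ yn); rewrite c /=.
by rewrite /rows1 unlock.
Qed.

Lemma bad_21 : bad 'Z_21. Proof. by apply: (@check1P 19 14 isT isT); vm_compute. Qed.
Lemma bad_35 : bad 'Z_35. Proof. by apply: (@check1P 33 7 isT isT); vm_compute. Qed.
Lemma bad_25 : bad 'Z_25. Proof. by apply: (@check1P 23 10 isT isT); vm_compute. Qed.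
Lemma bad_27 : bad 'Z_27. Proof. by apply: (@check1P 25 9 isT isT); vm_compute. Qed.
Lemma bad_49 : bad 'Z_49. Proof. by apply: (@check1P 47 7 isT isT); vm_compute. Qed.

Definition mk15 : seq (nat * nat) := [seq (3, m) | m <- iota 0 5] ++ [seq (5, m) | m <- iota 0 3].

Definition check15 : bool :=
  all (fun x => all (fun y => coprime 15 (gcdn x y) ==>
    (6 * (gcdn 15 y + foldr (fun k s => gcdn 15 (x + (15 - y) * k) + s) 0 (iota 0 15) +
      foldr (fun i s => gcdn 15 ((x + (15 - y) * i.2) * i.1 + y) + s) 0 mk15) <= 15 * 24)%N)
      (iota 0 15)) (iota 0 15).

Lemma bad_15 : bad 'Z_15.
Proof.
have /allP h : check15 by vm_compute.
apply: (@bad_cyclic2 13 15 mk15) => // x y xn yn c.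
have := h x; rewrite mem_iota => /(_ xn)/allP/(_ y); rewrite mem_iota => /(_ yn); rewrite c /=.
by rewrite /rows1 /rows2 !unlock.
Qed.

(** The sum of the weights is [n] for one of the [n + 1] points and [1] for the other ones, and
    [6 (n + n) <= n (n + 1)] for [n >= 11]. *)
Lemma bad_prime p : prime p -> (10 < p)%N -> bad 'Z_p.
Proof.
case: p => [|[|n']] // pp p10; have on : odd n'.+2.
  by case: (even_prime pp) => // p2; rewrite p2 in p10.
apply: (bad_cyclic (m := n'.+2) on) => [|x y xn yn c].
  by rewrite gtnNdvd // (leq_trans _ p10).
set p := n'.+2 in pp p10 on xn yn c *.
have gcdp z : gcdn p z = if (p %| z)%N then p else 1%N.
  case: ifP => [/gcdn_idPl|/negbT h] //; apply/eqP; by rewrite -/(coprime p z) prime_coprime.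
have few : (\sum_(k <- iota 0 p) gcdn p (x + (p - y) * k) + gcdn p y <= 2 * p)%N.
  have [py|py] := boolP (p %| y)%N.
    have y0 : y = 0%N by apply/eqP; rewrite -leqn0 leqNgt; apply/negP => y0; move: (dvdn_leq y0 py); rewrite leqNgt yn.
    have cx : gcdn p x = 1%N by move: c; rewrite y0 gcdn0 => /eqP.
    rewrite y0 subn0 gcdn0 mul2n -addnn leq_add2r.
    apply: leq_trans (_ : (\sum_(k <- iota 0 p) 1 <= _)%N); last by rewrite big_const_seq count_predT size_iota iter_addn_0 mul1n.
    by apply: leq_sum => k _; rewrite addnC mulnC gcdnMDl cx.
  have E2 : (2 * p = p.-1 + p + 1)%N by rewrite /p /=; clear; lia.
  rewrite (gcdp y) (negbTE py) E2 leq_add2r.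
  apply: leq_trans (_ : (\sum_(k <- iota 0 p) (1 + if (p %| x + (p - y) * k)%N then p.-1 else 0) <= _)%N).
    by apply: leq_sum => k _; rewrite gcdp; case: ifP.
  have S1 : (\sum_(k <- iota 0 p) 1)%N = p by rewrite big_const_seq count_predT size_iota iter_addn_0 mul1n.
  have -> : (\sum_(k <- iota 0 p) (1 + if (p %| x + (p - y) * k)%N then p.-1 else 0) =
      \sum_(k <- iota 0 p) (if (p %| x + (p - y) * k)%N then p.-1 else 0) + p)%N.
    by rewrite big_split S1 addnC.
  rewrite leq_add2r.
  apply: sum_excl; first exact: iota_uniq.
  move=> i j; rewrite !mem_iota !add0n => /andP[_ ip] /andP[_ jp].
  have wl a b : (a <= b)%N -> (b < p)%N -> (p %| x + (p - y) * a)%N -> (p %| x + (p - y) * b)%N -> a = b.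
    move=> ab bp ha hb; have : (p %| (p - y) * (b - a))%N.
      by rewrite mulnBr -(subnDl x) dvdn_sub.
    rewrite Euclid_dvdM // => /orP[] h.
      by case/negP: py; rewrite -(subKn (ltnW yn)) dvdn_sub.
    apply/eqP; rewrite eqn_leq ab leqNgt; apply/negP => lt; have d0 : (0 < b - a)%N by rewrite subn_gt0.
    by have := dvdn_leq d0 h; rewrite leqNgt (leq_ltn_trans (leq_subr _ _)).
  move=> hi hj; case: (leqP i j) => [|/ltnW] le; first exact: wl.
  by apply/esym; exact: wl.
rewrite addnC in few; apply: leq_trans (_ : (6 * (2 * p) <= _)%N); first by rewrite leq_pmul2l.
by rewrite mulnA mulnC leq_pmul2l.
Qed.

(** ** Two noncyclic groups *)

Section Pairs.
Variables (m n : nat).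
Local Notation B := ('Z_m * 'Z_n)%type.

Lemma pair_mulrn (x : B) k : x *+ k = (x.1 *+ k, x.2 *+ k).
Proof. by elim: k => [|k IH]; rewrite ?mulr0n ?mulrS ?IH. Qed.

Lemma pair_mulrz (x : B) (i : int) : x *~ i = (x.1 *~ i, x.2 *~ i).
Proof.
case: i => k; first exact: pair_mulrn.
by rewrite NegzE !mulrNz -!pmulrn pair_mulrn.
Qed.

Lemma spans_pair (x y : B) : spans (x, y) -> exists i j k l : int,
  [/\ x.1 *~ i + y.1 *~ j = 1, x.2 *~ i + y.2 *~ j = 0,
      x.1 *~ k + y.1 *~ l = 0 & x.2 *~ k + y.2 *~ l = 1].
Proof.
move=> s; have [i [j e]] := s (1, 0); have [k [l e']] := s (0, 1).
rewrite /= !pair_mulrz in e; rewrite /= !pair_mulrz in e'.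
exists i, j, k, l; split.
- exact: esym (congr1 fst e).
- exact: esym (congr1 snd e).
- exact: esym (congr1 fst e').
- exact: esym (congr1 snd e').
Qed.

End Pairs.

(** A pair of generators has an invertible determinant. *)
Lemma det_absurd (A : comNzRingType) (a b a' b' : A) (i j k l : int) :
  a *~ i + a' *~ j = 1 -> b *~ i + b' *~ j = 0 -> a *~ k + a' *~ l = 0 -> b *~ k + b' *~ l = 1 ->
  a * b' - a' * b != 0.
Proof.
have E (x : A) n : x *~ n = n%:~R * x by rewrite mulrzl.
rewrite (E a i) (E a' j) (E b i) (E b' j) (E a k) (E a' l) (E b k) (E b' l).
move: (i%:~R) (j%:~R) (k%:~R) (l%:~R) => i' j' k' l' h1 h2 h3 h4.
apply/eqP => dt; have : (i' * a + j' * a') * (k' * b + l' * b') - (i' * b + j' * b') * (k' * a + l' * a') =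
     (a * b' - a' * b) * (i' * l' - j' * k') by ring.
by rewrite h1 h2 h3 h4 dt !mul0r subr0 mulr1 => /eqP; rewrite oner_eq0.
Qed.

Lemma lin_int (A : nzRingType) (x y : nat) (u v c : int) :
  (x%:R : A) *~ u + y%:R *~ v - c%:~R = (x%:Z * u + y%:Z * v - c)%:~R.
Proof. by rewrite mulrzBr mulrzDr !mulrzA. Qed.

Lemma bad_7_7 : bad ('Z_7 * 'Z_7)%type.
Proof.
have kill (y : 'Z_7 * 'Z_7) : y *+ 7 = 0 by rewrite pair_mulrn !Zn_kill.
apply: (@bad_exponent _ 7 (1, 0) [:: [::]] isT kill isT) => //.
move=> [x y] s; rewrite big_seq1 /= muln1.
suff h : (wt (isT : (0 < 7)%N) kill y <= 1)%N by apply: leq_trans (_ : (6 * 1 <= _)%N); rewrite ?leq_pmul2l.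
apply: wt_le => m m0; rewrite mul1n pair_mulrn => -[e1 e2].
rewrite leqNgt; apply/negP => m7.
have key (z : 'Z_7) : z *+ m = 0 -> z = 0.
  rewrite {1}[z]natZ -mulrnA => /eqP; rewrite natZ0 (@Euclid_dvdM _ _ 7) // => /orP[h|h].
    by apply/eqP; rewrite [z]natZ natZ0.
  by have := dvdn_leq m0 h; rewrite leqNgt m7.
have [i [j [k [l]]]] := spans_pair s.
move=> [h1 h2 h3 h4]; have /eqP := @det_absurd 'Z_7 _ _ _ _ _ _ _ _ h1 h2 h3 h4; apply.
by rewrite (key _ e1) (key _ e2) mulr0 mul0r subr0.
Qed.

Lemma int_Zn n' (N : int) : (N%:~R == 0 :> 'Z_n'.+2) = (n'.+2 %| N)%Z.
Proof.
have k1 : (1 : 'Z_n'.+2) *+ n'.+2 = 0 := Zn_kill 1.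
rewrite -(kill_mod N k1); have m0 := @modz_ge0 N n'.+2 isT; have mn := @ltz_pmod N n'.+2 isT.
apply/idP/idP => [|/dvdz_mod0P ->]; last by rewrite mulr0z.
move: m0 mn; case E : (N %% n'.+2)%Z => [r|//] _; rewrite ltz_nat => rn.
rewrite -[1 *~ r]/(r%:R) natZ0 => h; apply/dvdz_mod0P; rewrite E; congr Posz.
by apply/eqP; rewrite -leqn0 leqNgt; apply/negP => r0; have := dvdn_leq r0 h; rewrite leqNgt rn.
Qed.

(* an upper bound for the weight of (a, b) in Z_3 x Z_9 *)
Definition w39 (a b : nat) : nat := if (9 %| b)%N && (3 %| a)%N then 9 else if (3 %| b)%N then 3 else 1.

Definition check39 : bool :=
  all (fun a => all (fun b => all (fun a' => all (fun b' => ~~ (3 %| a * b' + 2 * (a' * b))%N ==>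
    (6 * (foldr (fun k s => w39 (a + (3 - a') * k) (b + (9 - b') * k) + s) 0 (iota 0 9) +
          foldr (fun m s => w39 (a * (3 * m) + a') (b * (3 * m) + b') + s) 0 (iota 0 3)) <= 9 * 12)%N)
  (iota 0 9)) (iota 0 3)) (iota 0 9)) (iota 0 3).

Lemma check39_true : check39. Proof. by vm_compute. Qed.

Lemma bad_3_9 : bad ('Z_3 * 'Z_9)%type.
Proof.
have kill (y : 'Z_3 * 'Z_9) : y *+ 9 = 0.
  have k1 (z : 'Z_3) : z *+ (3 * 3) = 0 by rewrite mulrnA Zn_kill.
  by rewrite pair_mulrn k1 Zn_kill.
pose words := [seq wrow k | k <- iota 0 9] ++ [seq wrow2 (3 * m) 0 | m <- iota 0 3].
have wle (a b : nat) : (wt (isT : (0 < 9)%N) kill (a%:R, b%:R) <= w39 a b)%N.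
  apply: wt_le => m m0; rewrite pair_mulrn -!mulrnA => -[/eqP e1 /eqP e2].
  rewrite natZ0 in e1; rewrite natZ0 in e2; rewrite /w39.
  have three (c : nat) : ~~ (3 %| c)%N -> (3 %| c * m)%N -> (3 %| m)%N.
    by move=> c3; rewrite (@Euclid_dvdM _ _ 3) // (negbTE c3).
  case: ifP => [_|n1]; first by rewrite -[X in (X <= _)%N]muln1 leq_mul2l m0 orbT.
  case: ifP => [b3|/negbT b3].
    suff : (3 %| m)%N by move=> /(dvdn_leq m0) h; rewrite -[9%N]/(3 * 3)%N leq_mul2l.
    move/negbT: n1; rewrite negb_and => /orP[b9|a3]; last exact: three e1.
    have [c bE] := dvdnP b3; move: e2 b9; rewrite bE mulnAC -[9%N]/(3 * 3)%N !dvdn_pmul2r //.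
    by move=> h1 h2; exact: three h1.
  rewrite mul1n; apply: dvdn_leq => //; rewrite -(@Gauss_dvdr 9 b) //.
  by rewrite -[9%N]/(3 ^ 2)%N coprime_pexpl // prime_coprime.
apply: (@bad_exponent _ 9 (0, 1) words isT kill isT) => //.
move=> [[a b] [a' b']] s.
have [i [j [k [l [/= h1 h2 h3 h4]]]]] := spans_pair s.
have det : ~~ (3 %| nat_of_ord a * nat_of_ord b' + 2 * (nat_of_ord a' * nat_of_ord b))%N.
  apply/negP => d3.
  pose A : 'Z_3 := (nat_of_ord a)%:R; pose A' : 'Z_3 := (nat_of_ord a')%:R.
  pose B : 'Z_3 := (nat_of_ord b)%:R; pose B' : 'Z_3 := (nat_of_ord b')%:R.
  have down (u v : int) (c : int) : b *~ u + b' *~ v = c%:~R -> B *~ u + B' *~ v = c%:~R.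
    move=> h.
    have : (((nat_of_ord b)%:Z * u + (nat_of_ord b')%:Z * v - c)%:~R : 'Z_9) == 0.
      by rewrite -lin_int -!natZ h subrr.
    rewrite int_Zn => h9; apply/eqP; rewrite -subr_eq0 lin_int int_Zn; apply: dvdz_trans h9 => //.
  have g1 : A *~ i + A' *~ j = 1 by rewrite /A /A' -!natZ.
  have g3 : A *~ k + A' *~ l = 0 by rewrite /A /A' -!natZ.
  have g2 := down i j 0 h2; have g4 := down k l 1 h4.
  have dt : A * B' - A' * B = 0.
    have : ((nat_of_ord a * nat_of_ord b' + 2 * (nat_of_ord a' * nat_of_ord b))%:R : 'Z_3) == 0 by rewrite natZ0.
    rewrite natrD !natrM -/A -/A' -/B -/B' => /eqP h.
    have t3 : (3%:R : 'Z_3) = 0 by apply/eqP; rewrite natZ0.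
    have -> : A * B' - A' * B = A * B' + 2%:R * (A' * B) - 3%:R * (A' * B) by ring.
    by rewrite h t3 mul0r subr0.
  by have := det_absurd g1 g2 g3 g4; rewrite dt eqxx.
have m3 (c : 'Z_3) : nat_of_ord c \in iota 0 3 by rewrite mem_iota; exact: (ltn_ord c).
have m9 (c : 'Z_9) : nat_of_ord c \in iota 0 9 by rewrite mem_iota; exact: (ltn_ord c).
clear i j k l h1 h2 h3 h4.
have row (u u' : 'Z_3) k : u - u' *+ k = (nat_of_ord u + (3 - nat_of_ord u') * k)%:R.
  rewrite natrD natrM natrB; last exact/ltnW/ltn_ord.
  by rewrite pchar_Zp // sub0r -!natZ mulNr mulr_natr.
have row' (u u' : 'Z_9) k : u - u' *+ k = (nat_of_ord u + (9 - nat_of_ord u') * k)%:R.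
  rewrite natrD natrM natrB; last exact/ltnW/ltn_ord.
  by rewrite pchar_Zp // sub0r -!natZ mulNr mulr_natr.
have := allP (allP (allP (allP check39_true _ (m3 a)) _ (m9 b)) _ (m3 a')) _ (m9 b').
rewrite det => h; apply: leq_trans h; rewrite leq_pmul2l // big_cat !big_map.
have fE (f : nat -> nat) l : foldr (fun k s => f k + s)%N 0 l = \sum_(k <- l) f k.
  by elim: l => [|k l' IH]; rewrite ?big_nil ?big_cons //= IH.
rewrite !fE; apply: leq_add; apply: leq_sum => k _.
  have E : (a, b) - (a', b') *+ k = ((nat_of_ord a + (3 - nat_of_ord a') * k)%:R,
      (nat_of_ord b + (9 - nat_of_ord b') * k)%:R) :> 'Z_3 * 'Z_9.
    by rewrite pair_mulrn -row -row'.
  case: (wrow_act k ((a, b), (a', b'))) => -> /=; rewrite ?wtN E; exact: wle.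
have E : (a, b) *+ (3 * k) + (a', b') = ((nat_of_ord a * (3 * k) + nat_of_ord a')%:R,
    (nat_of_ord b * (3 * k) + nat_of_ord b')%:R) :> 'Z_3 * 'Z_9.
  have c3' (u u' : 'Z_3) q : u *+ q + u' = (nat_of_ord u * q + nat_of_ord u')%:R.
    by rewrite natrD natrM -!natZ mulr_natr.
  have c9' (u u' : 'Z_9) q : u *+ q + u' = (nat_of_ord u * q + nat_of_ord u')%:R.
    by rewrite natrD natrM -!natZ mulr_natr.
  by rewrite pair_mulrn -c3' -c9'.
have := @wrow2_act _ (3 * k) 0 ((a, b), (a', b')); rewrite /= mulr0n subr0 E.
by case=> ->; rewrite ?wtN; exact: wle.
Qed.

(** * The structure of dihedral coverings *)

Section Structure.
Context {R : realType} {Q : zmodType} {d : nat}.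
Local Notation C := R[i].
Local Notation G := (dihedral Q).
Variables (P q : {poly C}).
Local Notation Om := (Om P q).
Local Notation roots3 := (roots3 P q).
Variable g : (R -> C * C) -> G.
Hypothesis gflat : flat Om g.
Local Notation mer := (mer Om g).
Local Notation mers := (mers P q g).
Hypothesis (sP : (size P <= (2 * d).+1)%N) (sq : (size q <= (3 * d).+1)%N).
Hypothesis nosec : forall E, cubp P q E = 0 -> 3%:P * E ^+ 2 + P = 0.
Hypothesis D0 : disc P q != 0.
Hypothesis gen : forall b z e1 e2 e3 (H : G -> Prop), roots3 b e1 e2 e3 -> valid z e1 e2 e3 -> subg H ->
  H (mer b z e1) -> H (mer b z e2) -> H (mer b z e3) -> forall h, H h.

Lemma one_colour (chi : G -> bool) : (forall x y, chi (x * y)%g = chi x (+) chi y) ->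
  forall b z e1 e2 e3, roots3 b e1 e2 e3 -> valid z e1 e2 e3 ->
    chi (mer b z e2) = chi (mer b z e1) /\ chi (mer b z e3) = chi (mer b z e1).
Proof.
move=> chiM b z e1 e2 e3 r v.
have nsing (b' : C) : b' \notin proots (disc P q) -> exists e1 e2 e3 z : C, roots3 b' e1 e2 e3 /\ valid z e1 e2 e3.
  by rewrite mem_proots // => /disc_valid.
have [[E [_ cE]]|h] := colour_split gflat chiM sP sq nsing; first by rewrite nosec ?eqxx.
have bL : b \notin proots (disc P q) by rewrite mem_proots //; exact: (valid_disc r v).
exact: (h _ _ _ _ _ bL r v).
Qed.

Lemma dihM (x y : G) : (x * y)%g = (x.1 + dih_act x.2 y.1, x.2 (+) y.2).
Proof. by []. Qed.

Lemma dihV (x : G) : (x^-1)%g = (- dih_act x.2 x.1, x.2).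
Proof. by []. Qed.

(** By [one_colour] either all three meridians are reflections or all three are translations, and in the
    latter case they do not generate the group. *)
Lemma meridians_refl b z e1 e2 e3 : roots3 b e1 e2 e3 -> valid z e1 e2 e3 -> refl3 (mers b z e1 e2 e3).
Proof.
move=> r v; have chiM (x y : G) : (x * y)%g.2 = x.2 (+) y.2 by [].
have [h2 h3] := @one_colour (fun x : G => x.2) chiM _ _ _ _ _ r v.
suff h1 : (mer b z e1).2 = true by split; [exact: h1|exact: etrans h2 h1|exact: etrans h3 h1].
have [//|h1] : (mer b z e1).2 = true \/ (mer b z e1).2 = false by case: ((mer b z e1).2); [left|right].
have sH : subg (fun x : G => x.2 = false).
  by split=> [|x y hx hy|x hx]; rewrite ?dihM ?dihV /= ?hx ?hy.
by have := gen r v sH h1 (etrans h2 h1) (etrans h3 h1) (0, true).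
Qed.

Lemma disc_fibre : exists b z e1 e2 e3 : C, roots3 b e1 e2 e3 /\ valid z e1 e2 e3.
Proof.
have N : nbhs (0 : C) (fun=> True) by exact: (@near_all C 0 (fun=> True) (fun=> I)).
have [b _ h1] := cof_open (cof_poly D0) N.
by have [e1 [e2 [e3 [z [r v]]]]] := disc_valid h1; exists b, z, e1, e2, e3.
Qed.

(** With [phi] applied to the translation part, [one_colour] gives a common value [c] on the three
    reflections. The elements on which the value is [c] for reflections and trivial for translations form a
    subgroup, which contains the meridians and hence everything. *)
Lemma no_hom2 (phi : Q -> bool) : (forall x y, phi (x + y) = phi x (+) phi y) -> forall x, phi x = false.
Proof.
move=> phiD x; have [b [z [e1 [e2 [e3 [r v]]]]]] := disc_fibre.
have phi0 : phi 0 = false by have := phiD 0 0; rewrite addr0; case: (phi 0).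
have phiN y : phi (- y) = phi y by have := phiD (- y) y; rewrite addNr phi0; case: (phi y); case: (phi (- y)).
have chiM (u w : G) : phi (u * w)%g.1 = phi u.1 (+) phi w.1.
  by rewrite dihM phiD; case: u.2; rewrite /= ?phiN.
have [h2 h3] := @one_colour (fun u : G => phi u.1) chiM _ _ _ _ _ r v.
have [r1 r2 r3] := meridians_refl r v.
pose c := phi (mer b z e1).1.
have sH : subg (fun u : G => phi u.1 = c && u.2).
  split=> [|u w hu hw|u hu]; first by rewrite phi0 andbF.
    by rewrite chiM hu hw dihM /=; case: (c); case: u.2; case: w.2.
  by rewrite dihV /= phiN -hu; case: u.2; rewrite /= ?phiN.
have k1 : phi (mer b z e1).1 = c && (mer b z e1).2 by rewrite r1 andbT.
have k2 : phi (mer b z e2).1 = c && (mer b z e2).2 by rewrite r2 andbT h2.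
have k3 : phi (mer b z e3).1 = c && (mer b z e3).2 by rewrite r3 andbT h3.
by have := gen r v sH k1 k2 k3 (x, false); rewrite /= andbF.
Qed.

(** The combinations of the two differences, together with their translates by the first meridian, form a
    subgroup, which contains the three meridians. *)
Lemma fibre_spans b z e1 e2 e3 : roots3 b e1 e2 e3 -> valid z e1 e2 e3 -> spans (dat (mers b z e1 e2 e3)).
Proof.
move=> r v u; have [r1 r2 r3] := meridians_refl r v.
set dd := dat _; pose a := (mer b z e1).1.
pose S y := exists i j : int, y = dd.1 *~ i + dd.2 *~ j.
have S0 : S 0 by exists 0, 0; rewrite !mulr0z addr0.
have SD x y : S x -> S y -> S (x + y).
  by move=> [i [j ->]] [k [l ->]]; exists (i + k), (j + l); rewrite !mulrzDr addrACA.
have SN x : S x -> S (- x).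
  by move=> [i [j ->]]; exists (- i), (- j); rewrite !mulrNz opprD.
have sH : subg (fun x : G => S (if x.2 then x.1 - a else x.1)).
  split=> [|[x s] [y t]|[x s]]; first exact: S0.
    rewrite dihM /=; case: s; case: t => /= hx hy.
    - have -> : x - y = (x - a) - (y - a) by rewrite opprB addrA subrK.
      exact: (SD _ _ hx (SN _ hy)).
    - have -> : x - y - a = (x - a) - y by rewrite addrAC.
      exact: (SD _ _ hx (SN _ hy)).
    - have -> : x + y - a = x + (y - a) by rewrite addrA.
      exact: (SD _ _ hx hy).
    - exact: (SD _ _ hx hy).
  by rewrite dihV; case: s => /= hx; [rewrite opprK|exact: SN].
have h1 : S (if (mer b z e1).2 then (mer b z e1).1 - a else (mer b z e1).1) by rewrite r1 subrr.
have h2 : S (if (mer b z e2).2 then (mer b z e2).1 - a else (mer b z e2).1).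
  by rewrite r2; exists (-1), 0; rewrite mulrN1z mulr0z addr0 opprB.
have h3 : S (if (mer b z e3).2 then (mer b z e3).1 - a else (mer b z e3).1).
  by rewrite r3; exists 0, (-1); rewrite mulrN1z mulr0z add0r opprB.
exact: (gen r v sH h1 h2 h3 (u, false)).
Qed.

(** ** The nonisotrivial case *)

(** The frame is chosen with a generic fibre at infinity, so that [a], [c] and [a - c] have the same degree:
    [contradiction] applies to the reduced fraction of [- 4 P ^ 3] and the discriminant. *)
Theorem not_bad : (forall k : C, k != 0 -> P ^+ 3 != k%:P * q ^+ 2) -> P != 0 -> q != 0 ->
  P`_(2 * d) != 0 -> q`_(3 * d) != 0 -> (disc P q)`_(6 * d) != 0 -> ~ bad Q.
Proof.
move=> npr P0 q0 lP lq lD [n [w [words [wN cusp no2 [nR nS] [n0 w0 ineq]]]]].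
have sz (f : {poly C}) m : (size f <= m.+1)%N -> f`_m != 0 -> size f = m.+1.
  move=> sf fm; apply/eqP; rewrite eqn_leq sf ltnNge /=; apply: contra_neqN fm => h.
  exact: (leq_sizeP _ _ h).
have sX (f : {poly C}) m k : size f = m.+1 -> size (f ^+ k) = (m * k).+1.
  move=> sf; have f0 : f != 0 by rewrite -size_poly_gt0 sf.
  have := size_exp f k; rewrite sf /= => <-; rewrite prednK // size_poly_gt0 expf_neq0 //.
have P3 : size (P ^+ 3) = (6 * d).+1 by rewrite (sX _ _ _ (sz _ _ sP lP)) mulnAC.
have q2 : size (q ^+ 2) = (6 * d).+1 by rewrite (sX _ _ _ (sz _ _ sq lq)) mulnAC.
have n4 : (- 4 : C) != 0 by rewrite oppr_eq0 pnatr_eq0.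
have n27 : (27 : C) != 0 by rewrite pnatr_eq0.
have N4 : - 4%:P = (- 4)%:P :> {poly C} by rewrite polyCN.
pose N := - 4%:P * P ^+ 3; pose M := disc P q.
have sN : size N = (6 * d).+1 by rewrite /N N4 mul_polyC size_scale.
have NM : N - M = 27%:P * q ^+ 2 by rewrite /N /M /disc opprB addrC subrK.
have sNM : size (N - M) = (6 * d).+1 by rewrite NM mul_polyC size_scale.
have sM : size M = (6 * d).+1.
  apply: sz lD; rewrite /M /disc -/N (leq_trans (size_polyD _ _)) // geq_max sN size_polyN mul_polyC size_scale // q2.
  by rewrite leqnn.
have nN : N != 0 by rewrite -size_poly_gt0 sN.
have nM : M != 0 by rewrite -size_poly_gt0 sM.
pose k := gcdp N M; pose a := N %/ k; pose c := M %/ k.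
have aE : N = k * a by rewrite /a mulrC divpK // dvdp_gcdl.
have cE : M = k * c by rewrite /c mulrC divpK // dvdp_gcdr.
have k0 : k != 0 by rewrite gcdp_eq0 negb_and nN.
have a0 : a != 0 by apply: contraNneq nN => h; rewrite aE h mulr0.
have c0 : c != 0 by apply: contraNneq nM => h; rewrite cE h mulr0.
have acE : N - M = k * (a - c) by rewrite aE cE mulrBr.
have ac0 : a - c != 0 by apply/eqP => h; move: sNM; rewrite acE h mulr0 size_poly0.
have size_quot (f f' : {poly C}) : f' != 0 -> size f = (6 * d).+1 -> f = k * f' ->
    size f' = ((6 * d).+1 - (size k).-1)%N.
  move=> f0 sf fE; have := sf; rewrite fE size_mul //.
  have := k0; rewrite -size_poly_gt0; case: (size k) => // m _; rewrite addSn /= => <-.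
  by rewrite addKn.
have sa := size_quot _ _ a0 sN aE; have sc := size_quot _ _ c0 sM cE.
have sac := size_quot _ _ ac0 sNM acE.
have [D DE] : exists D, ((6 * d).+1 - (size k).-1)%N = D.+1.
  by have := a0; rewrite -size_poly_gt0 sa; case: (_ - _)%N => // D _; exists D.
rewrite DE in sa sc sac.
have cop : coprimep a c.
  by rewrite /a /c coprimep_div_gcd // nN.
have Dp : (0 < D)%N.
  rewrite lt0n; apply/eqP => D00; rewrite D00 in sa sc sac.
  have cst (f : {poly C}) : size f = 1 -> exists2 u : C, u != 0 & f = u%:P.
    by move=> /eqP/size_poly1P.
  have [u u0 aU] := cst a sa; have [v v0 cV] := cst c sc; have [t t0 tE] := cst _ sac.
  have tuv : t = u - v by apply: polyC_inj; rewrite -tE aU cV polyCB.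
  have PQ : (4 * t)%:P * P ^+ 3 = - (27 * u)%:P * q ^+ 2.
    have h1 : N * v%:P = M * u%:P by rewrite aE cE aU cV; ring.
    have h2 : M = N - 27%:P * q ^+ 2 by [].
    have : N * (u%:P - v%:P) = 27%:P * q ^+ 2 * u%:P.
      by rewrite mulrBr h1 h2; ring.
    rewrite -polyCB -tuv /N !polyCM => h3; apply: oppr_inj.
    have -> : - (4%:P * t%:P * P ^+ 3) = - 4%:P * P ^+ 3 * t%:P by ring.
    by rewrite h3; ring.
  have k' : - (27 * u) / (4 * t) != 0.
    by rewrite mulf_neq0 ?invr_eq0 ?oppr_eq0 ?mulf_neq0 // pnatr_eq0.
  case/eqP: (npr _ k'); have t4 : 4 * t != 0 by rewrite mulf_neq0 // pnatr_eq0.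
  have E : (4 * t)%:P * (- (27 * u) / (4 * t))%:P = - (27 * u)%:P :> {poly C}.
    by rewrite -polyCM mulrC divfK // polyCN.
  have t4' : (4 * t)%:P != 0 :> {poly C} by rewrite polyC_eq0.
  by apply: (mulfI t4'); rewrite PQ -E -mulrA.
apply: (contradiction gflat meridians_refl aE cE sa sc cop P0 q0 _ wN cusp no2 Dp sac n0 w0 nR nS ineq).
by move=> b dl s lb i; apply: fibre_spans; [exact: lab_roots3|apply: lab_valid => //; have [] := lb].
Qed.

End Structure.

(** ** The isotrivial case *)

Section Isotrivial.
Context {R : realType} {Q : zmodType} {d : nat}.
Local Notation C := R[i].
Local Notation G := (dihedral Q).
Variables (P q : {poly C}).
Local Notation Om := (Om P q).
Local Notation roots3 := (roots3 P q).
Variable g : (R -> C * C) -> G.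
Hypothesis gflat : flat Om g.
Local Notation mer := (mer Om g).
Local Notation mers := (mers P q g).
Hypothesis (sP : (size P <= (2 * d).+1)%N) (sq : (size q <= (3 * d).+1)%N).
Hypothesis nosec : forall E, cubp P q E = 0 -> 3%:P * E ^+ 2 + P = 0.
Hypothesis D0 : disc P q != 0.
Hypothesis gen : forall b z e1 e2 e3 (H : G -> Prop), roots3 b e1 e2 e3 -> valid z e1 e2 e3 -> subg H ->
  H (mer b z e1) -> H (mer b z e2) -> H (mer b z e3) -> forall h, H h.
Hypothesis P0 : P = 0.

Variable w : C.
Hypothesis (w1 : w ^+ 2 + w + 1 = 0) (wi : im w != 0).

Let w3 : w ^+ 3 = 1.
Proof.
have h : w ^+ 3 - 1 = (w - 1) * (w ^+ 2 + w + 1) by ring.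
by apply/eqP; rewrite -subr_eq0 h w1 mulr0.
Qed.

Definition cbrt (b v : C) := v != 0 /\ v ^+ 3 = - q.[b].

Lemma cbrt_roots b v : cbrt b v -> roots3 b v (w * v) (w ^+ 2 * v).
Proof.
move=> [_ v3] x; rewrite /cub /= P0 horner0 mul0r addr0.
have -> : q.[b] = - v ^+ 3 by rewrite v3 opprK.
apply/eqP; rewrite -subr_eq0.
have -> : x ^+ 3 - v ^+ 3 - (x - v) * (x - w * v) * (x - w ^+ 2 * v) =
  (w ^+ 2 + w + 1) * (x ^+ 2 * v - x * v ^+ 2 * w) + (w ^+ 3 - 1) * v ^+ 3 by ring.
by rewrite w1 w3 subrr !mul0r addr0.
Qed.

Lemma cbrt_valid b v : cbrt b v -> valid 0 v (w * v) (w ^+ 2 * v).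
Proof.
move=> [v0 _]; have w0 : w != 0 by apply: contraNneq wi => ->.
have w2i : im (w ^+ 2) != 0.
  have -> : w ^+ 2 = - w - 1 by apply/eqP; rewrite -subr_eq0 -w1; apply/eqP; ring.
  by move: wi; case: (w) => a b' /=; rewrite /im /= subr0 oppr_eq0.
rewrite /valid !subr0 ![0 == _]eq_sym !mulf_neq0 ?expf_neq0 //; split=> //; split.
- by rewrite mulfK //; exact: nonray_im.
- by rewrite mulfK //; exact: nonray_im.
- by rewrite (_ : _ / _ = w); [exact: nonray_im|field; rewrite w0 v0].
Qed.

Lemma cbrt_rot (b v : C) : cbrt b v -> cbrt b (w * v).
Proof.
move=> [v0 v3]; split; last by rewrite exprMn w3 mul1r.
by rewrite mulf_neq0 //; apply: contraNneq wi => ->.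
Qed.

Lemma cbrt_all (b v v' : C) : cbrt b v -> cbrt b v' -> [\/ v' = v, v' = w * v | v' = w ^+ 2 * v].
Proof.
move=> c [_ v3]; apply/(rootP _ (cbrt_roots c)).
by rewrite /Om /cub /= P0 horner0 mul0r addr0 v3 addNr eqxx.
Qed.

Definition cdat (b v : C) := dat (mers b 0 v (w * v) (w ^+ 2 * v)).

Lemma cdat_rot (b v : C) : cdat b (w * v) = rotd (cdat b v).
Proof. by rewrite /cdat -dat_rot mulrA -expr2 mulrA -exprSr w3 mul1r. Qed.

Lemma cdat_near (b v : C) (N : C -> Prop) : cbrt b v -> (\forall v' \near v, N v') ->
  \forall b' \near b, exists v', [/\ N v', cbrt b' v' & pm (cdat b v) (cdat b' v')].
Proof.
move=> c nN; have r := cbrt_roots c; have vl := cbrt_valid c.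
pose pr (x : C * (C * (C * C))) : C * C := (x.1, x.2.1).
have prc : continuous pr.
  exact: (cont_pair cont_fst (cont_comp cont_snd cont_fst)).
have bc : continuous (fun x : C * C => x.1) := cont_fst.
have vc : continuous (fun x : C * C => x.2) := cont_snd.
have M := @mers_near _ _ _ _ _ gflat (C * C)%type (fun x => x.1) (fun=> 0) (fun x => x.2) (fun x => w * x.2) (fun x => w ^+ 2 * x.2)
  (b, v) bc (@constc _ _ 0) vc (contM (@constc _ _ w) vc) (contM (@constc _ _ (w ^+ 2)) vc) r vl.
have N1 : \forall x \near (b, v), N x.2 by exact: (near_cont (@vc (b, v)) nN).
have N2 : \forall x \near (b, v), x.2 != 0 by apply: (near_neq0 vc); exact: (proj1 c).
have N3 := near_cont (@prc (b, (v, (w * v, w ^+ 2 * v)))) (nearI N1 (nearI N2 M)).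
apply: nearS (roots3_near r N3) => b' [f1 [f2 [f3 [[/= n1 [n2 n3]] r']]]].
have cf : cbrt b' f1.
  split=> //; apply/eqP; have := r' f1; rewrite /cub /= P0 horner0 mul0r addr0 subrr !mul0r => /eqP.
  by rewrite addr_eq0.
have [_ h] := csim_dat (meridians_refl gflat sP sq nosec D0 gen r vl) (n3 (cbrt_roots cf)).
by exists f1.
Qed.

(** If some translation is not killed by three, the data up to sign distinguishes the three points of each
    fibre: those with the data of a given one form a section, and [liouville] makes it a polynomial. *)
Theorem isotrivial (u : Q) : u *+ 3 = 0.
Proof.
apply/eqP; apply: contraT => u3; exfalso.
have nf := nofix_rotd u3.
have q0 : q != 0.
  by apply: contraNneq D0 => h; rewrite /disc P0 h !expr0n /= !mulr0 subr0.
pose Ls := proots q.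
have LsP (b : C) : b \notin Ls -> exists v, cbrt b v.
  rewrite mem_proots // => qb; have [v [e2 [e3 r]]] := roots3_exist P q b.
  have := r v; rewrite /cub /= P0 horner0 mul0r addr0 subrr !mul0r => /eqP; rewrite addr_eq0 => /eqP v3.
  exists v; split=> //; apply: contraNneq qb => v0.
  by rewrite /root -oppr_eq0 -v3 v0 expr0n.
have [l0 [_ sl0 hl0]] := many_points Ls 1.
case: l0 sl0 hl0 => // b0 [|//] _ hl0; have b0L := hl0 b0 (mem_head _ _).
have [v0 c0] := LsP _ b0L; pose d0 := cdat b0 v0.
pose good b v := cbrt b v /\ pm d0 (cdat b v).
have uniq b v v' : good b v -> good b v' -> v' = v.
  move=> [c p] [c' p']; have s : spans (cdat b v).
    exact: (fibre_spans gflat sP sq nosec D0 gen (cbrt_roots c) (cbrt_valid c)).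
  have nfv := nf _ s; have := pm_trans (pm_sym p) p'.
  case: (cbrt_all c c') => [-> //|->|->] h; exfalso; apply: nfv.
    by rewrite -cdat_rot.
  move: h; rewrite expr2 -mulrA !cdat_rot => h; apply: pm_sym.
  by have := pm_rotd h; rewrite rotd3.
pose h b := `[< exists v, good b v >].
have lc b : b \notin Ls -> \forall b' \near b, h b' = h b.
  move=> bL; case: (asboolP (exists v, good b v)) => [[v [c p]]|ng].
    have hb : h b by apply/asboolP; exists v.
    apply: nearS (cdat_near c (@near_all C _ (fun=> True) (fun=> I))) => b' [v' [_ c' p']].
    by rewrite hb; apply/asboolP; exists v'; split; [exact: c'|exact: pm_trans p p'].
  have [v c] := LsP _ bL.
  apply: nearS (cdat_near c (@near_all C _ (fun=> True) (fun=> I))) => b' [v' [_ c' p']].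
  rewrite (_ : h b = false); last by apply/negP => /asboolP.
  apply/negP => /asboolP[x [cx px]]; apply: ng.
  have cw := cbrt_rot c; have cw2 := cbrt_rot cw.
  case: (cbrt_all c' cx) px => ->.
  - by move=> px; exists v; split; [exact: c|exact: pm_trans px (pm_sym p')].
  - rewrite cdat_rot => px; exists (w * v); split=> //; rewrite cdat_rot.
    exact: pm_trans px (pm_sym (pm_rotd p')).
  - rewrite expr2 -mulrA !cdat_rot => px; exists (w * (w * v)); split=> //; rewrite !cdat_rot.
    exact: pm_trans px (pm_sym (pm_rotd (pm_rotd p'))).
have hall b : b \notin Ls -> exists v, good b v.
  move=> bL; apply/asboolP; change (h b).
  have cT : convexC ([set: C]) by [].
  rewrite (@lconst_avoid R _ h setT Ls cT openT _ b b0) //; last by move=> s _ sL; exact: lc.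
  by apply/asboolP; exists v0; split=> //; left.
pose e b := xget 0 [set v | good b v].
have eP b : b \notin Ls -> good b (e b).
  by move=> /hall[x m]; exact: (@xgetPex _ 0 [set v | good b v] (ex_intro _ x m)).
have [||E [_ cE]] := @liouville R P q d Ls e sP sq; last by rewrite nosec ?eqxx.
  move=> b /eP[c _]; exists (w * e b), (w ^+ 2 * e b); split; first exact: cbrt_roots.
  exact: valid_dist (cbrt_valid c).
move=> b bL N /= nN; have [c p] := eP b bL.
have nL : \forall b' \near b, b' \notin Ls.
  have := @near_neq0 R C (fun b => q.[b]) b (cont_horner (@idC R)).
  by rewrite -rootE -mem_proots // => /(_ bL); apply: nearS => b'; rewrite -rootE -mem_proots.
apply: nearS (nearI nL (cdat_near c nN)) => b' [bL' [v' [Nv c' p']]].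
have gv : good b' v' by split; [exact: c'|exact: pm_trans p p'].
change (N (e b')); rewrite (uniq b' _ _ gv (eP b' bL')); exact: Nv.
Qed.

End Isotrivial.

Lemma cube_root_of_unity (R : realType) : exists2 w : R[i], w ^+ 2 + w + 1 = 0 & im w != 0.
Proof.
pose s : R := Num.sqrt 3; have s2 : s ^+ 2 = 3 by rewrite sqr_sqrtr // ler0n.
have s0 : 0 < s by rewrite sqrtr_gt0 ltr0n.
exists (rc (- 2^-1) + 'i * rc (s / 2)); last first.
  by rewrite !reimE mul0r add0r mul1r gt_eqF // add0r divr_gt0 // ltr0n.
apply: eqC; rewrite expr2 !reimE /=; last by field.
have h : s * s = 3 by rewrite -expr2.
have E (x y : R) : x + x = 1 -> y * y = x * (x * (1 + 1 + 1)) ->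
    (- x + (0 * y - 1 * 0)) * (- x + (0 * y - 1 * 0)) - (0 + (0 * 0 + 1 * y)) * (0 + (0 * 0 + 1 * y)) +
    (- x + (0 * y - 1 * 0)) + 1 = 0.
  move=> h1 h2; transitivity (x * x - y * y - x + 1); first by ring.
  rewrite h2; transitivity ((1 - (x + x)) * (1 + x)); first by ring.
  by rewrite h1 subrr mul0r.
by apply: E; [field|rewrite mulrACA h; field].
Qed.

(** * The translations of a dihedral covering *)

Section Covering.
Context {R : realType} {d : nat}.
Local Notation C := R[i].
Local Notation hirz := (hirzebruch R d).

(** The coefficient of [v ^ 3] is the value of the equation on the exceptional section. *)
Lemma c3_neq0 (F : mpoly 4 C) : @has_class R d 3 (3 * d) F ->
  @zero_locus R d F `&` @exceptional_section R d = set0 -> c3 F != 0.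
Proof.
move=> hF CE; apply/eqP => c0.
have x0 : ((1, 0) : C * C) != 0 by rewrite xpair_eqE oner_eq0.
have y0 : ((0, 1) : C * C) != 0 by rewrite xpair_eqE oner_eq0 andbF.
pose z := mkcox x0 y0.
have : (@zero_locus R d F `&` @exceptional_section R d) (prh z).
  split; last by apply/exceptionalE; rewrite fb_mk.
  apply/(zero_locus_pi _ hF); rewrite evE bs_mk fb_mk (ev_expand hF) (Ah3_cst hF _ (0, 0)) -/(c3 F) c0.
  by rewrite !expr0n /= !mulr0 !mul0r !addr0.
by rewrite CE.
Qed.

Lemma admits_quotient (Z : set hirz) (Q B : zmodType) (h : {additive Q -> B}) :
  (forall y, exists x, h x = y) -> admits_dihedral_covering Z Q -> admits_dihedral_covering Z B.
Proof.
move=> hs [x [f fs]]; exists x.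
pose k (u : dihedral Q) : dihedral B := (h u.1, u.2).
have kM u v : k (u * v)%g = (k u * k v)%g.
  rewrite /k !dihM /=; congr (_, _); rewrite raddfD; congr (_ + _).
  by case: u.2 => //=; rewrite raddfN.
have fM : {morph (fun a : pi1_proj x => k (f a)) : a b / (a * b)%g}.
  by move=> a b; rewrite gmulfM kM.
pose fm := isMultiplicative.Build _ _ (fun a : pi1_proj x => k (f a)) fM.
exists (HB.pack_for {multiplicative (pi1_proj x) -> dihedral B} (fun a : pi1_proj x => k (f a)) fm).
move=> [b s]; have [q qb] := hs b; have [a fa] := fs (q, s); exists a => /=.
by rewrite /k fa qb.
Qed.

End Covering.

Lemma coef_top (A : nzRingType) (g : {poly A}) n k : (size g <= n.+1)%N -> (g ^+ k)`_(n * k) = g`_n ^+ k.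
Proof.
move=> sg; have sk j : (size (g ^+ j) <= (n * j).+1)%N.
  by rewrite (leq_trans (size_poly_exp_leq _ _)) // ltnS leq_mul2r; case: (size g) sg => [|m] sg; rewrite ?leq0n ?[(m.+1.-1 <= n)%N]sg orbT.
elim: k => [|k IH]; first by rewrite muln0 coef1.
rewrite exprS mulnS coefM (bigD1 (inord n)) //= big1 ?addr0 => [|i].
  by rewrite inordK ?ltnS ?leq_addr // addKn IH exprS.
rewrite -val_eqE /= inordK ?ltnS ?leq_addr // neq_ltn => /orP[lt|lt].
  rewrite [X in _ * X]nth_default ?mulr0 //; apply: leq_trans (sk _) _.
  move: (nat_of_ord i) lt => j lt.
  by rewrite addnC -addnBA ?(ltnW lt) // -[X in (X < _)%N]addn0 ltn_add2l subn_gt0.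
by rewrite nth_default ?mul0r // (leq_trans sg).
Qed.

Section Frames.
Context {R : realType} {d : nat} {Q : zmodType}.
Local Notation C := R[i].
Variable F : mpoly 4 C.
Hypothesis hF : @has_class R d 3 (3 * d) F.
Hypothesis c30 : c3 F != 0.
Hypothesis sF : squarefree F.
Hypothesis irr : irreducible_set (@zero_locus R d F).
Hypothesis cov : admits_dihedral_covering (@zero_locus R d F) Q.

Lemma disc_neq0 p r : dt p r != 0 -> Pp F p r != 0 \/ qp F p r != 0 -> disc (Pp F p r) (qp F p r) != 0.
Proof.
move=> dt0 h; have [P0|P0] := eqVneq (Pp F p r) 0.
  rewrite /disc P0 expr0n mulr0 sub0r oppr_eq0 mulf_neq0 ?polyC_eq0 ?pnatr_eq0 // expf_neq0 //.
  by case: h => //; rewrite P0 eqxx.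
have n4 : (4 : C) != 0 by rewrite pnatr_eq0.
have k0 : - (27 / 4) != 0 :> C by rewrite oppr_eq0 mulf_neq0 ?invr_eq0 ?pnatr_eq0.
apply: contraNneq (not_proportional hF c30 dt0 irr P0 k0) => D0.
have N4 : 4%:P != 0 :> {poly C} by rewrite polyC_eq0.
have E : 4%:P * (- (27 / 4))%:P = - 27%:P :> {poly C}.
  by rewrite -polyCM mulrN mulrCA divff // mulr1 polyCN.
apply/eqP; apply: (mulfI N4); rewrite [RHS]mulrA E.
by apply/eqP; rewrite -subr_eq0 -oppr_eq0 -D0 /disc; apply/eqP; ring.
Qed.

(** In this frame the fibre at infinity is the one above [b]. *)
Lemma frame_at (b : C) : dt ((0, 1) : C * C) (1, b) != 0 /\
  (Pp F (0, 1) (1, b))`_(2 * d) = (Pp F (1, 0) (0, 1)).[b] /\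
  (qp F (0, 1) (1, b))`_(3 * d) = (qp F (1, 0) (0, 1)).[b].
Proof.
split; first by rewrite /dt /= mul0r sub0r mulr1 oppr_eq0 oner_eq0.
rewrite (Pp_lead hF) (qp_lead hF) Pp_horner qp_horner.
by have -> : xb (1, 0) (0, 1) b = (1, b) by rewrite /xb /= mulr0 addr0 add0r mulr1.
Qed.

(** The first two properties hold in any frame. For the last one the frame is moved so that none of [P],
    [q] and the discriminant vanishes at infinity. *)
Theorem translations : [/\ exists dd : Q * Q, spans dd,
  forall phi : Q -> bool, (forall x y, phi (x + y) = phi x (+) phi y) -> forall x, phi x = false &
  (forall u : Q, u *+ 3 = 0) \/ ~ bad Q].
Proof.
have [x [f fs]] := cov.
pose P := Pp F (1, 0) (0, 1); pose q := qp F (1, 0) (0, 1).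
have dt0 : dt ((1, 0) : C * C) (0, 1) != 0 by rewrite /dt /= mulr1 mul0r subr0 oner_eq0.
have PQ0 : P != 0 \/ q != 0.
  have := squarefree_nonzero hF c30 sF; rewrite -/P -/q.
  by have [->|] := eqVneq P 0; [have [->|] := eqVneq q 0; [case|right]|left].
have D0 := disc_neq0 dt0 PQ0.
have nos := @no_section R d F hF c30 _ _ dt0 irr.
have gfl := gc_flat hF c30 dt0 D0 f.
have sP := size_Pp hF (1, 0) (0, 1); have sq := size_qp hF (1, 0) (0, 1).
have gen := @meridians_generate R d F hF c30 _ _ dt0 D0 x _ f fs.
split.
- have [b [z [e1 [e2 [e3 [r v]]]]]] := disc_fibre D0.
  by exists (dat (mers P q (gc hF c30 dt0 D0 f) b z e1 e2 e3)); exact: (fibre_spans gfl sP sq nos D0 gen r v).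
- exact: (no_hom2 gfl sP sq nos D0 gen).
have [P0|P0] := eqVneq P 0.
  have [w w1 wi] := cube_root_of_unity R; left.
  exact: (isotrivial gfl sP sq nos D0 gen P0 w1 wi).
right; have q0 : q != 0 by apply: contraNneq P0 => h; apply/eqP; exact: (q_zero hF c30 dt0 irr h).
have [b _] := cof_open (cof_poly (mulf_neq0 (mulf_neq0 P0 q0) D0)) (@near_all C 0 (fun=> True) (fun=> I)).
rewrite !hornerM !mulf_eq0 !negb_or discE => /andP[/andP[Pb qb] Db].
have [dt1 [lP lq]] := frame_at b.
have c1 : (Pp F (0, 1) (1, b))`_(2 * d) != 0 by rewrite lP.
have c2 : (qp F (0, 1) (1, b))`_(3 * d) != 0 by rewrite lq.
have n1 : Pp F (0, 1) (1, b) != 0 by apply: contraNneq c1 => ->; rewrite coef0.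
have n2 : qp F (0, 1) (1, b) != 0 by apply: contraNneq c2 => ->; rewrite coef0.
have D1 := disc_neq0 dt1 (or_introl n1).
have gfl1 := gc_flat hF c30 dt1 D1 f.
have npr k : k != 0 -> Pp F (0, 1) (1, b) ^+ 3 != k%:P * qp F (0, 1) (1, b) ^+ 2.
  exact: (not_proportional hF c30 dt1 irr n1).
apply: (not_bad gfl1 (size_Pp hF _ _) (size_qp hF _ _) (@no_section R d F hF c30 _ _ dt1 irr) D1
  (@meridians_generate R d F hF c30 _ _ dt1 D1 x _ f fs) npr n1 n2 c1 c2).
have E6 (m k : nat) : (m * k = 6)%N -> (6 * d = m * d * k)%N by move=> <-; rewrite mulnAC.
have N4 : - 4%:P = (- 4)%:P :> {poly C} by rewrite polyCN.
rewrite /disc N4 coefB !coefCM {1}(E6 2 3 erefl) (E6 3 2 erefl) !coef_top ?size_Pp ?size_qp // lP lq.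
exact: Db.
Qed.

End Frames.

(** * Classification of the groups of translations *)

Section Quotients.
Variable Q : zmodType.
Implicit Types x y u : Q.

Lemma Zp_addrn u n (a b : 'Z_n) : (1 < n)%N -> u *+ n = 0 -> u *+ (a + b)%R = u *+ a + u *+ b.
Proof.
move=> n1 un; rewrite -mulrnDr /=; move: (nat_of_ord a + nat_of_ord b)%N => m.
rewrite Zp_cast // [in RHS](divn_eq m n) mulrnDr.
by rewrite mulnC mulrnA un mul0rn add0r.
Qed.

Lemma Zp_mulrz u n (k : int) : (1 < n)%N -> u *+ n = 0 -> exists a : 'Z_n, u *+ a = u *~ k.
Proof.
move=> n1 un; have n0 : n%:Z != 0 by case: (n) n1.
exists (inZp `|(k %% n)%Z|); rewrite /= Zp_cast // -(kill_mod k un).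
have := modz_ge0 k n0; have : (k %% n < n)%Z by rewrite ltz_pmod // ltz_nat ltnW.
by case: (k %% n)%Z => // m; rewrite ltz_nat /= => mn _; rewrite modn_small.
Qed.

Lemma quotient_cyclic y n : (1 < n)%N -> (forall u, exists j : int, u = y *~ j) -> y *+ n = 0 ->
  quotient_of 'Z_n Q.
Proof.
move=> n1 s yn; pose f (a : 'Z_n) := y *+ a.
have fN : zmod_morphism f.
  move=> a b; apply/eqP; rewrite -subr_eq0 opprB addrA subr_eq0 /f -Zp_addrn //.
  by rewrite subrK.
exists (HB.pack_for {additive 'Z_n -> Q} f (GRing.isZmodMorphism.Build _ _ f fN)) => u.
by have [j ->] := s u; have [a <-] := Zp_mulrz j n1 yn; exists a.
Qed.

Lemma quotient_square x y n : (1 < n)%N -> spans (x, y) -> x *+ n = 0 -> y *+ n = 0 ->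
  quotient_of ('Z_n * 'Z_n)%type Q.
Proof.
move=> n1 s xn yn; pose f (a : 'Z_n * 'Z_n) := x *+ a.1 + y *+ a.2.
have fN : zmod_morphism f.
  move=> a b; apply/eqP; rewrite -subr_eq0 opprB addrA subr_eq0 /f addrACA -!Zp_addrn //.
  by rewrite -[(a - b).1 + b.1]/(a - b + b).1 -[(a - b).2 + b.2]/(a - b + b).2 subrK.
exists (HB.pack_for {additive ('Z_n * 'Z_n)%type -> Q} f (GRing.isZmodMorphism.Build _ _ f fN)) => u.
have [i [j ->]] := s u; have [a ha] := Zp_mulrz i n1 xn; have [b hb] := Zp_mulrz j n1 yn.
by exists (a, b); rewrite -ha -hb.
Qed.

End Quotients.

(** A prime divisor is 3, 5 or 7, and the only product of two of them that is allowed is 9. *)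
Lemma allowed_orders n : (forall m, m %| n -> m \notin [:: 2; 15; 21; 35; 25; 27; 49])%N ->
  (forall p, prime p -> p %| n -> p <= 10)%N -> n \in [:: 1; 3; 9; 5; 7]%N.
Proof.
move=> h hp; have n0 : (0 < n)%N by rewrite lt0n; apply/eqP => n0; have := h 2; rewrite n0 => /(_ isT).
have small p : prime p -> (p %| n)%N -> p \in [:: 3; 5; 7]%N.
  move=> pp pn; have := hp _ pp pn; have := h _ pn.
  by do 11! [case: p pp pn => [|p] pp pn //].
have step m : (m %| n)%N -> n = m \/ exists2 p, p \in [:: 3; 5; 7]%N & (m * p %| n)%N.
  move=> /dvdnP[k nE]; have [k1|k1] := ltnP 1 k.
    right; exists (pdiv k); last by rewrite nE mulnC dvdn_mul // pdiv_dvd.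
    by apply: small; [exact: pdiv_prime|rewrite nE dvdn_mulr // pdiv_dvd].
  by left; case: k nE k1 n0 => [->//|[|//]]; rewrite mul1n.
have H m (mn : (m %| n)%N) := h m mn.
case: (step 1%N (dvd1n n)) => [->//|[p]]; rewrite mul1n !inE => /or3P[] /eqP -> d1.
- case: (step _ d1) => [->//|[q]]; rewrite !inE => /or3P[] /eqP -> d2; try by have := H _ d2.
  case: (step _ d2) => [->//|[r]]; rewrite !inE => /or3P[] /eqP -> d3; first by have := H _ d3.
    by have := H 15 (dvdn_trans (isT : 15 %| 45)%N d3).
  by have := H 21 (dvdn_trans (isT : 21 %| 63)%N d3).
- by case: (step _ d1) => [->//|[q]]; rewrite !inE => /or3P[] /eqP -> d2; have := H _ d2.
- by case: (step _ d1) => [->//|[q]]; rewrite !inE => /or3P[] /eqP -> d2; have := H _ d2.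
Qed.

Section Classification.
Context {R : realType} {d : nat} (Z : set (hirzebruch R d)).
Hypothesis tri : trigonal_curve Z.
Hypothesis irr : irreducible_set Z.

Lemma covering_translations (Q : zmodType) : admits_dihedral_covering Z Q ->
  [/\ exists dd : Q * Q, spans dd,
  forall phi : Q -> bool, (forall x y, phi (x + y) = phi x (+) phi y) -> forall x, phi x = false &
  (forall u : Q, u *+ 3 = 0) \/ ~ bad Q].
Proof.
have [F [hF sF ZE CE]] := tri; move: irr CE; rewrite ZE => irrF CE.
exact: (translations hF (c3_neq0 hF CE) sF irrF).
Qed.

Lemma not_covered (B : zmodType) (u : B) : bad B -> u *+ 3 != 0 -> ~ admits_dihedral_covering Z B.
Proof. by move=> bB u3 /covering_translations[_ _ [h|//]]; rewrite h eqxx in u3. Qed.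

Lemma not_covered_Z n : (3 < n)%N -> bad 'Z_n -> ~ admits_dihedral_covering Z 'Z_n.
Proof.
case: n => [|[|n]] // n3 b; apply: (not_covered (u := 1) b).
by rewrite natZ0 gtnNdvd.
Qed.

(** The cyclic quotients leave [d2] among 1, 3, 5, 7, 9, and the quotients [Z_3 * Z_9] and [Z_7 * Z_7] force
    [d1 = 1] if [d2] is 9 or 7. *)
Theorem classification (Q : zmodType) : admits_dihedral_covering Z Q ->
  [\/ quotient_of ('Z_3 * 'Z_3)%type Q, quotient_of 'Z_9 Q,
      quotient_of ('Z_5 * 'Z_5)%type Q | quotient_of 'Z_7 Q].
Proof.
move=> cov; have [[[x0 y0] s0] no2 _] := covering_translations cov.
have [x [y [d1 [d2 [s dv rel]]]]] := smith2 s0.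
have x1 : x *+ d1 = 0.
  have := (rel d1 0).2 (conj (dvdzz _) (dvdz0 _)).
  by rewrite mulr0z addr0.
have y2 : y *+ d2 = 0.
  have := (rel 0 d2).2 (conj (dvdz0 _) (dvdzz _)).
  by rewrite mulr0z add0r.
have quo (B : zmodType) (u v : B) : spans (u, v) -> u *+ d1 = 0 -> v *+ d2 = 0 -> admits_dihedral_covering Z B.
  move=> suv u1 v2; have [f fE] := hom_out s rel u1 v2; apply: (admits_quotient (h := f)) cov.
  by move=> b; have [i [j ->]] := suv b; exists (x *~ i + y *~ j); rewrite fE.
have quoZ n : (1 < n)%N -> (n %| d2)%N -> admits_dihedral_covering Z 'Z_n.
  case: n => [|[|n]] // _ nd; apply: (quo _ 0 1); last by apply/eqP; rewrite natZ0.
    by move=> b; exists 0, (nat_of_ord b : int); rewrite mulr0z add0r /= -pmulrn natr_Zp.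
  by rewrite mul0rn.
have quoZ2 m n : (1 < m)%N -> (1 < n)%N -> (m %| d1)%N -> (n %| d2)%N ->
    admits_dihedral_covering Z ('Z_m * 'Z_n)%type.
  case: m n => [|[|m]] // [|[|n]] // _ _ md nd; apply: (quo _ (1, 0) (0, 1)).
  - move=> [a b]; exists (nat_of_ord a : int), (nat_of_ord b : int); rewrite !pair_mulrz /= !mul0rz.
    by congr (_, _); rewrite ?addr0 ?add0r /= -pmulrn natr_Zp.
  - by rewrite pair_mulrn mul0rn; congr (_, _); apply/eqP; rewrite natZ0.
  - by rewrite pair_mulrn mul0rn; congr (_, _); apply/eqP; rewrite natZ0.
have no n : (3 < n)%N -> bad 'Z_n -> ~~ (n %| d2)%N.
  move=> n3 b; apply/negP => nd; apply: (not_covered_Z n3 b); apply: quoZ => //.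
  exact: ltn_trans n3.
have d2E : d2 \in [:: 1; 3; 9; 5; 7]%N.
  apply: allowed_orders => [m md|p pp pd]; last first.
    by rewrite leqNgt; apply/negP => p10; move: pd; apply/negP/no; [exact: ltn_trans p10|exact: bad_prime].
  apply/negP; rewrite !inE => /or4P[/eqP mE|/eqP mE|/eqP mE|/or4P[] /eqP mE]; rewrite mE in md; last first.
  - by move: md; apply/negP/no => //; exact: bad_49.
  - by move: md; apply/negP/no => //; exact: bad_27.
  - by move: md; apply/negP/no => //; exact: bad_25.
  - by move: md; apply/negP/no => //; exact: bad_35.
  - by move: md; apply/negP/no => //; exact: bad_21.
  - by move: md; apply/negP/no => //; exact: bad_15.
  have [_ no2' _] := covering_translations (quoZ 2 isT md).
  have := no2' (fun z : 'Z_2 => z != 0) _ 1; rewrite oner_eq0 => h; have : true = false by apply: h => -[[|[|//]] ?] [[|[|//]] ?].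
  by [].
have cyc : (forall j : int, x *~ j = 0) -> forall u, exists j : int, u = y *~ j.
  by move=> h u; have [i [j ->]] := s u; exists j; rewrite h add0r.
have x0' : d1 = 1%N -> forall j : int, x *~ j = 0.
  by move=> d11 j; move: x1; rewrite d11 mulr1n => ->; rewrite mul0rz.
move: d2E; rewrite !inE => /orP[|/or4P[]] /eqP d2E; rewrite d2E in dv y2.
- constructor 4; apply: (quotient_cyclic (y := y)) => //; last by rewrite (mulrnA y 1 7) y2 mul0rn.
  by apply: cyc; apply: x0'; apply/eqP; rewrite -dvdn1.
- constructor 1; apply: (quotient_square (x := x) (y := y)) => //.
  by have /dvdnP[k ->] := dv; rewrite mulnC mulrnA x1 mul0rn.
- constructor 2; apply: (quotient_cyclic (y := y)) => //; apply: cyc; apply: x0'.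
  have n3 : ~~ (3 %| d1)%N.
    apply/negP => d13; apply: (not_covered (u := (0, 1)) bad_3_9); last by apply: quoZ2 => //; rewrite d2E.
    by rewrite pair_mulrn xpair_eqE [X in _ && X]natZ0 andbF.
  have : (d1 \in divisors 9) by rewrite -dvdn_divisors.
  by rewrite !inE => /or3P[] /eqP dE //; rewrite dE in n3.
- constructor 3; apply: (quotient_square (x := x) (y := y)) => //.
  by have /dvdnP[k ->] := dv; rewrite mulnC mulrnA x1 mul0rn.
- constructor 4; apply: (quotient_cyclic (y := y)) => //; apply: cyc; apply: x0'.
  have n7 : ~~ (7 %| d1)%N.
    apply/negP => d17; apply: (not_covered (u := (0, 1)) bad_7_7); last by apply: quoZ2 => //; rewrite d2E.
    by rewrite pair_mulrn xpair_eqE [X in _ && X]natZ0 andbF.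
  have : (d1 \in divisors 7) by rewrite -dvdn_divisors.
  by rewrite !inE => /orP[] /eqP dE //; rewrite dE in n7.
Qed.

End Classification.

Theorem corollary1p2p4 (R : realType) (d : nat) (C : set (hirzebruch R d))
    (Q : zmodType) :
  trigonal_curve C -> irreducible_set C -> admits_dihedral_covering C Q ->
  [\/ quotient_of ('Z_3 * 'Z_3)%type Q, quotient_of 'Z_9 Q,
      quotient_of ('Z_5 * 'Z_5)%type Q | quotient_of 'Z_7 Q].
Proof. by move=> tri irr cov; exact: (classification tri irr cov). Qed.
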